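(* Let $f:X\to Y$ be a globular subdivision of multipointed $d$-spaces. Then the underlying homotopy types of the flows $\mathrm{cat}(X)$ and $\mathrm{cat}(Y)$ are equal.
   Context: **Multipointed $d$-spaces.** $\mathbf{Top}$ denotes either the category of $\Delta$-generated spaces or that of $\Delta$-Hausdorff $\Delta$-generated spaces (either choice); it is bicomplete and cartesian closed with internal hom $\mathbf{TOP}(-,-)$, and $\Delta$-kelleyfication is the right adjoint of the inclusion of $\Delta$-generated spaces into topological spaces. $\mathcal{M}$ is the set of nondecreasing surjective maps $[0,1]\to[0,1]$. The normalized composition $\gamma_1*_N\gamma_2$ of paths with $\gamma_1(1)=\gamma_2(0)$ is $\gamma_1(2t)$ for $t\le 1/2$ and $\gamma_2(2t-1)$ for $t\ge 1/2$. A multipointed $d$-space is a triple $X=(|X|,X^0,\mathbb{P}^{top}X)$ with $|X|$ a space (the underlying space), $X^0\subset|X|$ a set (the states) and $\mathbb{P}^{top}X$ a set of continuous maps $[0,1]\to|X|$ (the execution paths) such that $\gamma(0),\gamma(1)\in X^0$ for every execution path $\gamma$, and $\mathbb{P}^{top}X$ is closed under $\gamma\mapsto\gamma\phi$ for $\phi\in\mathcal{M}$ and under normalized composition. A map $f:X\to Y$ is a continuous map $|X|\to|Y|$ taking $X^0$ to $Y^0$ and execution paths to execution paths. $\mathbb{P}^{top}_{\alpha,\beta}X$ is the set of execution paths from $\alpha$ to $\beta$ with the $\Delta$-kelleyfication of the topology induced by $\mathbf{TOP}([0,1],|X|)$. A set $S$ is viewed as $(S,S,\varnothing)$. The topological globe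 $\mathrm{Glob}^{top}(Z)$ of a space $Z$ has underlying space the quotient of $\{0,1\}\sqcup(Z\times[0,1])$ by $(z,0)=0$, $(z,1)=1$ for all $z$, states $\{0,1\}$, and execution paths $t\mapsto(z,\phi(t))$ with $z\in Z$, $\phi\in\mathcal{M}$. $\mathbf{D}^n$ is the closed unit disk of $\mathbb{R}^n$, $\mathbf{S}^{n-1}$ its boundary sphere, $\mathbf{D}^0=\{0\}$, $\mathbf{S}^{-1}=\varnothing$. The q-model structure of multipointed $d$-spaces is the combinatorial model structure with generating cofibrations $I^{gl,top}\cup\{C,R\}$, where $I^{gl,top}=\{\mathrm{Glob}^{top}(\mathbf{S}^{n-1})\subset\mathrm{Glob}^{top}(\mathbf{D}^n)\mid n\ge0\}$, $C:\varnothing\to\{0\}$, $R:\{0,1\}\to\{0\}$; weak equivalences are the maps bijective on states and inducing weak homotopy equivalences $\mathbb{P}^{top}_{\alpha,\beta}X\to\mathbb{P}^{top}_{f(\alpha),f(\beta)}Y$ for all states $\alpha,\beta$; fibrations are the maps inducing Serre fibrations (q-fibrations) on all these spaces. For a class $\mathcal{K}$ of maps, $\mathrm{cell}(\mathcal{K})$ is the class of transfinite compositions of pushouts of elements of $\mathcal{K}$. A multipointed $d$-space $X$ is cellular if $\varnothing\to X$ is in $\mathrm{cell}(I^{gl,top}\cup\{C,R\})$. **Flows.** A flow is a small semicategory (category without required identities) enriched over $\mathbf{Top}$: a set of states $X^0$, spaces of execution paths $\mathbb{P}_{\alpha,\beta}X$, and a continuous strictly associative composition. Maps of flows are enriched semifunctors.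 $\mathrm{Glob}(Z)$ is the flow with states $0,1$ whose only possibly nonempty path space is $\mathbb{P}_{0,1}=Z$. The q-model structure of flows is the combinatorial model structure with generating cofibrations $\{\mathrm{Glob}(\mathbf{S}^{n-1})\subset\mathrm{Glob}(\mathbf{D}^n)\mid n\ge0\}\cup\{\varnothing\to\{0\},\{0,1\}\to\{0\}\}$ (sets being flows with empty path spaces); weak equivalences are the maps bijective on states and inducing weak homotopy equivalences on all path spaces; fibrations are the maps inducing q-fibrations on all path spaces. **The functor $\mathrm{cat}$.** $\mathrm{cat}$ takes a multipointed $d$-space $X$ to the flow with states $X^0$, with $\mathbb{P}_{\alpha,\beta}\mathrm{cat}(X)$ the quotient of $\mathbb{P}^{top}_{\alpha,\beta}X$ by the equivalence relation generated by reparametrization by $\mathcal{M}$, and with composition induced by normalized composition. It is known that $\mathrm{cat}$ takes weak equivalences between q-cofibrant multipointed $d$-spaces to weak equivalences between q-cofibrant flows and that its left derived functor $\mathbf{L}\mathrm{cat}$ is an equivalence between the homotopy categories of the q-model structures. **Globular subdivision.** A map of multipointed $d$-spaces $f:X\to Y$ is a globular subdivision if $X$ and $Y$ are cellular and $f$ induces a homeomorphism $|X|\cong|Y|$. **Underlying homotopy type.** The underlying homotopy type of a flow $X$ is the homotopy type of the space $|(\mathbf{L}\mathrm{cat})^{-1}(X)|$, where $(\mathbf{L}\mathrm{cat})^{-1}(X)$ is a q-cofibrant multipointed $d$-space, unique up to weak equivalence, whose image by $\mathbf{L}\mathrm{cat}$ is isomorphic to $X$ in the homotopy category of flows (this homotopy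 type is well defined). *)

(* Defs.v *)
From HB Require Import structures.
From mathcomp Require Import all_boot all_order all_algebra generic_quotient.
From mathcomp Require Import all_classical all_reals.
From mathcomp Require Import topology normedtype.
From mathcomp Require Import lra.
From mathcomp Require wochoice.

Set Implicit Arguments.
Unset Strict Implicit.
Unset Printing Implicit Defensive.

Import Order.TTheory GRing.Theory Num.Theory.
Import numFieldNormedType.Exports.

Local Open Scope classical_set_scope.
Local Open Scope ring_scope.
Local Open Scope quotient_scope.

Section BasicSpaces.
Variable R : realType.

Definition unit_interval : topologicalType :=
  set_type (`[0, 1]%classic : set R).

Definition simplex (n : nat) : topologicalType := set_type
  [set x : 'rV[R]_n.+1 | (forall i, 0 <= x 0 i) /\ \sum_i x 0 i = 1].

Definition cube (n : nat) : topologicalType := set_type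
  [set x : 'rV[R]_n | forall i, 0 <= x 0 i <= 1].

Definition disk (n : nat) : topologicalType := set_type
  [set x : 'rV[R]_n | \sum_i x 0 i ^+ 2 <= 1].

(* [sphere n] has dimension [n - 1]; it is empty for [n = 0]. *)
Definition sphere (n : nat) : topologicalType := set_type
  [set x : 'rV[R]_n | \sum_i x 0 i ^+ 2 = 1].

Lemma sphere_sub_disk n (x : sphere n) :
  [set x : 'rV[R]_n | \sum_i x 0 i ^+ 2 <= 1] (set_val x).
Proof. by have /= -> := set_valP x. Qed.

Definition sphere_disk n (x : sphere n) : disk n :=
  SigSub (mem_set (sphere_sub_disk x)).

Lemma proj_unit_subproof (x : R) :
  `[0, 1]%classic (Order.max 0 (Order.min 1 x)).
Proof.
rewrite /= in_itv /= le_max lexx /= ge_max ler01 /=.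
by rewrite ge_min lexx.
Qed.

Definition proj_unit (x : R) : unit_interval :=
  SigSub (mem_set (proj_unit_subproof x)).

Definition i0 : unit_interval := proj_unit 0.
Definition i1 : unit_interval := proj_unit 1.

End BasicSpaces.
Arguments i0 {R}.
Arguments i1 {R}.

Section Kelleyfication.
Variables (R : realType) (T : topologicalType).

Definition delta_open (A : set T) :=
  forall n (u : simplex R n -> T), continuous u -> open (u @^-1` A).

Definition delta_generated := forall A : set T, delta_open A -> open A.

Lemma delta_openT : delta_open [set: T].
Proof. by move=> n u cu; rewrite preimage_setT; exact: openT. Qed.

Lemma delta_openI : setI_closed delta_open.
Proof.
by move=> A B dA dB n u cu; rewrite preimage_setI; apply: openI; [exact: dA|exact: dB].
Qed.

Lemma delta_open_bigU (J : Type) (g : J -> set T) :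
  (forall i, delta_open (g i)) -> delta_open (\bigcup_i g i).
Proof.
move=> dg n u cu; rewrite preimage_bigcup.
by apply: bigcup_open => i _; exact: dg.
Qed.

End Kelleyfication.
Arguments delta_generated : clear implicits.

Definition kelley_type (R : realType) (T : Type) : Type := T.

HB.instance Definition _ (R : realType) (T : topologicalType) :=
  Choice.on (kelley_type R T).
HB.instance Definition _ (R : realType) (T : topologicalType) :=
  isOpenTopological.Build (kelley_type R T)
    (@delta_openT R T) (@delta_openI R T) (@delta_open_bigU R T).

Definition kelley (R : realType) (T : topologicalType) : topologicalType :=
  kelley_type R T.

Definition kprod (R : realType) (T U : topologicalType) : topologicalType :=
  kelley R (T * U)%type.

(* The diagonal is closed in the product taken in Delta-generated spaces, by
   analogy with k-Hausdorff spaces. *)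
Definition delta_hausdorff (R : realType) (T : topologicalType) :=
  closed ([set x | x.1 = x.2] : set (kprod R T T)).

(* Top is the category of Delta-generated spaces for [h = false], and of
   Delta-Hausdorff Delta-generated spaces for [h = true]. *)
Definition in_Top (R : realType) (h : bool) (T : topologicalType) :=
  delta_generated R T /\ (h -> delta_hausdorff R T).

Record space (R : realType) (h : bool) := Space {
  carrier :> topologicalType;
  carrierP : in_Top R h carrier
}.

Lemma comp_continuous (S T U : topologicalType) (f : S -> T) (g : T -> U) :
  continuous f -> continuous g -> continuous (g \o f).
Proof. by move=> cf cg x; apply: continuous_comp; [exact: cf|exact: cg]. Qed.

Section KelleyTheory.
Variable R : realType.
Implicit Types T U : topologicalType.

Lemma kelley_open T (A : set (kelley R T)) : open A = delta_open R (A : set T).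
Proof. by []. Qed.

Lemma kelley_id_continuous T : continuous (id : kelley R T -> T).
Proof.
apply/continuousP => A oA; rewrite kelley_open => n u /continuousP cu.
exact: cu.
Qed.

Lemma simplex_kelley T n (u : simplex R n -> T) :
  continuous u -> continuous (u : simplex R n -> kelley R T).
Proof. by move=> cu; apply/continuousP => A; rewrite kelley_open; apply. Qed.

Lemma delta_gen_continuous T U (f : T -> U) : delta_generated R T ->
  (forall n (u : simplex R n -> T), continuous u -> continuous (f \o u)) ->
  continuous f.
Proof.
move=> dT cf; apply/continuousP => A oA; apply: dT => n u cu.
by have /continuousP := cf _ _ cu; apply.
Qed.

Lemma kelley_delta T : delta_generated R (kelley R T).
Proof.
move=> A dA; rewrite kelley_open => n u cu; apply: dA.
exact: simplex_kelley.
Qed.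

Lemma continuous_kelley T U (f : T -> U) : delta_generated R T ->
  continuous f -> continuous (f : T -> kelley R U).
Proof.
move=> dT cf; apply: (delta_gen_continuous dT) => n u cu.
by apply: simplex_kelley => x; apply: continuous_comp; [exact: cu|exact: cf].
Qed.

Lemma continuous_from_kelley T U (f : kelley R T -> U) :
  (forall n (u : simplex R n -> T), continuous u -> continuous (f \o u)) ->
  continuous f.
Proof.
move=> cf; apply: (delta_gen_continuous (@kelley_delta T)) => n u cu.
by apply: cf; exact: (comp_continuous cu (@kelley_id_continuous T)).
Qed.

Lemma delta_retract T U (s : T -> U) (r : U -> T) : delta_generated R U ->
  continuous s -> continuous r -> cancel s r -> delta_generated R T.
Proof.
move=> dU cs cr srK A dA.
have -> : A = s @^-1` (r @^-1` A) by apply/seteqP; split => x /=; rewrite srK.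
move/continuousP : cs; apply; apply: dU => n u cu; rewrite -comp_preimage.
by apply: dA => x; apply: continuous_comp; [exact: cu|exact: cr].
Qed.

Lemma simplex_delta n : delta_generated R (simplex R n).
Proof. by move=> A /(_ n id); apply => x; exact: cvg_id. Qed.

End KelleyTheory.

Section SimplexTopology.
Variable R : realType.

Lemma continuous_to_sub (S T : topologicalType) (A : set T)
    (f : S -> (set_type A : topologicalType)) :
  continuous (set_val \o f : S -> T) -> continuous f.
Proof. by move=> cf; apply: continuous_comp_initial. Qed.

Lemma set_val_continuous (T : topologicalType) (A : set T) :
  continuous (set_val : (set_type A : topologicalType) -> T).
Proof. exact: initial_continuous. Qed.

Lemma continuous_to_rV (S : topologicalType) n (f : S -> 'rV[R]_n) :
  (forall j, continuous (fun x => f x 0 j : R)) -> continuous f.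
Proof.
move=> cf x A [P nP PA]; apply: (@filterS _ _ _ [set y | forall j, P 0 j (f y 0 j)]).
  move=> y Py; apply: PA => i j; rewrite (ord1 i); exact: Py.
apply: filter_forall => j; exact: (cf j x _ (nP 0 j)).
Qed.

Lemma proj_unit_continuous : continuous (@proj_unit R).
Proof.
apply: continuous_to_sub => x.
apply: (@continuous_max _ _ (fun=> 0 : R^o) (fun x : R => Order.min 1 x : R^o)).
  exact: cst_continuous.
apply: (@continuous_min _ _ (fun=> 1 : R^o) (fun x : R => x : R^o)).
  exact: cst_continuous.
exact: cvg_id.
Qed.

Lemma proj_unitK (x : R) : 0 <= x <= 1 -> set_val (proj_unit x) = x.
Proof.
by move=> /andP[x0 x1]; rewrite /= /set_val /= (min_idPr x1) (max_idPr x0).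
Qed.

Lemma set_valK01 (t : unit_interval R) : proj_unit (set_val t) = t.
Proof.
apply: val_inj; rewrite -!set_valE proj_unitK //.
by have := set_valP t; rewrite /= in_itv.
Qed.

Lemma itv01P (t : unit_interval R) : 0 <= set_val t <= 1.
Proof. by have := set_valP t; rewrite /= in_itv. Qed.

Lemma set_val_i0 : set_val (i0 : unit_interval R) = 0.
Proof. by rewrite proj_unitK // lexx ler01. Qed.

Lemma set_val_i1 : set_val (i1 : unit_interval R) = 1.
Proof. by rewrite proj_unitK // lexx ler01. Qed.

Lemma unit_interval_delta : delta_generated R (unit_interval R).
Proof.
pose sv (t : unit_interval R) : 'rV[R]_2 :=
  \row_j (if j == 0 then set_val t else 1 - set_val t).
have svP t : (forall i, 0 <= sv t 0 i) /\ \sum_i sv t 0 i = 1.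
  have /andP[t0 t1] := itv01P t; split.
    by move=> i; rewrite mxE; case: ifP => _ //; rewrite subr_ge0.
  by rewrite 2!big_ord_recl big_ord0 !mxE /= addr0 addrC subrK.
pose s (t : unit_interval R) : simplex R 1 := SigSub (mem_set (svP t)).
pose r (x : simplex R 1) : unit_interval R := proj_unit (set_val x 0 0).
apply: (@delta_retract R _ _ s r (@simplex_delta R 1)).
- apply: continuous_to_sub; apply: continuous_to_rV => j.
  have -> : (fun x => sv x 0 j) =
      (fun x => if j == 0 then set_val x else 1 - set_val x).
    by apply/funext => x; rewrite mxE.
  case: (j == 0); first exact: set_val_continuous.
  move=> x; apply: (@continuousB _ R^o _ (fun=> 1) set_val).
    exact: cst_continuous.
  exact: set_val_continuous.
- apply: (@comp_continuous _ _ _ (fun x : simplex R 1 => set_val x 0 0 : R));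
    last exact: proj_unit_continuous.
  apply: (@comp_continuous _ _ _ set_val (fun x : 'rV[R]_2 => x 0 0)).
    exact: set_val_continuous.
  exact: coord_continuous.
- by move=> t; rewrite /r /s {1}/set_val /= mxE eqxx set_valK01.
Qed.

Lemma simplex_bound n (x : simplex R n) i : 0 <= set_val x 0 i <= 1.
Proof.
have /= [x0 x1] := set_valP x; rewrite x0 /=; apply: le_trans (_ : _ <= \sum_i set_val x 0 i) _; last by rewrite x1.
by rewrite (bigD1 i) //= lerDl; apply: sumr_ge0 => j _.
Qed.

Lemma set_type_compact (T : topologicalType) (A : set T) :
  compact A -> compact [set: (set_type A : topologicalType)].
Proof.
move=> cA F FF _.
have [|p [Ap clp]] := cA (set_val @ F) _.
  by apply: (@filterS _ F _ setT) => [x _|]; [exact: set_valP|exact: filterT].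
exists (SigSub (mem_set Ap)); split=> // B C FB [_ [[D oD <-] Dp DC]].
have [] := clp (set_val @` B) D; last first.
- move=> _ [[x Bx <-] Dx]; exists x; split => //; exact: DC.
- exact: open_nbhs_nbhs.
- by apply: (@filterS _ F _ B _ _ FB) => x Bx; exists x.
Qed.

Lemma coord_sum_continuous (S : topologicalType) n (f : 'I_n -> S -> R) :
  (forall i, continuous (f i)) -> continuous (fun x => \sum_i f i x).
Proof.
move=> cf x; elim: n f cf => [|n IHn] f cf.
  have -> : (fun x => \sum_i f i x) = (fun=> 0).
    by apply/funext => y; rewrite big_ord0.
  exact: cst_continuous.
have -> : (fun x => \sum_i f i x) =
    (fun x => f ord0 x + \sum_i f (lift ord0 i) x).
  by apply/funext => y; rewrite big_ord_recl.
apply: (@continuousD _ R^o); first exact: cf.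
by apply: (IHn (fun i => f (lift ord0 i))).
Qed.

Lemma simplex_compact n : compact [set: simplex R n].
Proof.
apply: set_type_compact; apply: bounded_closed_compact.
    exists (1 : R); split; first exact: num_real.
  move=> M M1 x [x0 x1]; apply: ltW; apply: le_lt_trans M1.
  rewrite /Num.norm /= mx_normrE; apply/bigmax_leP; split => // -[i j] _ /=.
  rewrite (ord1 i) ger0_norm // -x1 (bigD1 j) //= lerDl.
  by apply: sumr_ge0 => k _.
have -> : [set x : 'rV[R]_n.+1 | (forall i, 0 <= x 0 i) /\ \sum_i x 0 i = 1] =
  \bigcap_i ((fun x : 'rV[R]_n.+1 => x 0 i : R) @^-1` [set r | 0 <= r]) `&`
  (fun x : 'rV[R]_n.+1 => \sum_i x 0 i) @^-1` [set 1].
  apply/seteqP; split => x /= [x0 x1]; split => // i; first by move=> _; exact: x0.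
  exact: (x0 i).
apply: closedI.
  apply: closed_bigI => i _; apply: closed_comp => [x _|]; last exact: closed_ge.
  exact: coord_continuous.
apply: closed_comp => [x _|]; last exact: closed_eq.
by apply: coord_sum_continuous => i; exact: coord_continuous.
Qed.

Lemma simplex_regular n : regular_space (simplex R n).
Proof.
exact: (@uniform_regular (set_type
  [set x : 'rV[R]_n.+1 | (forall i, 0 <= x 0 i) /\ \sum_i x 0 i = 1])).
Qed.

End SimplexTopology.

Lemma pair_continuous (S T U : topologicalType) (f : S -> T) (g : S -> U) :
  continuous f -> continuous g -> continuous (fun x => (f x, g x)).
Proof. by move=> cf cg x; apply: cvg_pair; [exact: cf|exact: cg]. Qed.

Section SimplexProduct.
Variables (R : realType) (m n : nat).

Let N := (m + n.+1)%N.

Let lsum (k : nat) (x : 'rV[R]_k) : R := \sum_i x 0 i.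

Let resc k (x : 'rV[R]_k.+1) : 'rV[R]_k.+1 :=
  \row_j ((x 0 j + (if j == 0 then Order.max 0 (2^-1 - lsum x) else 0)) /
          Order.max 2^-1 (lsum x)).

Let maxP (a : R) : Order.max 2^-1 a != 0.
Proof. by apply: lt0r_neq0; rewrite lt_max invr_gt0 ltr0n. Qed.

Let rescP k (x : 'rV[R]_k.+1) : (forall i, 0 <= x 0 i) ->
  (forall i, 0 <= resc x 0 i) /\ \sum_i resc x 0 i = 1.
Proof.
move=> x0; split=> [i|].
  rewrite mxE divr_ge0 //; first by rewrite addr_ge0 //; case: ifP; rewrite // le_max lexx.
  by rewrite le_max invr_ge0 ler0n.
under eq_bigr do rewrite mxE.
rewrite -mulr_suml big_split /= -big_mkcond big_pred1_eq -/(lsum x).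
suff -> : lsum x + Order.max 0 (2^-1 - lsum x) = Order.max 2^-1 (lsum x).
  by rewrite divff.
by case: (leP (lsum x) 2^-1) => h; [rewrite max_r ?subr_ge0 // addrC subrK|
  rewrite max_l ?addr0 // subr_le0 ltW].
Qed.

Let resc_continuous (S : topologicalType) k (f : S -> 'rV[R]_k.+1) :
  continuous f -> continuous (fun x => resc (f x)).
Proof.
move=> cf; have cc j : continuous (fun x => f x 0 j : R).
  exact: (comp_continuous cf (@coord_continuous _ _ _ _ _)).
have cs : continuous (fun x => lsum (f x)) by exact: coord_sum_continuous.
apply: continuous_to_rV => j; rewrite (_ : (fun x => _) = (fun x =>
    ((f x 0 j + (if j == 0 then Order.max 0 (2^-1 - lsum (f x)) else 0)) *
          (Order.max 2^-1 (lsum (f x)))^-1))); last first.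
  by apply/funext => x; rewrite mxE.
move=> x; apply: (@continuousM R S).
  apply: (@continuousD R R^o S); first exact: cc.
  case: (j == 0); last exact: cst_continuous.
  apply: (@continuous_max R S (fun=> 0) (fun x => 2^-1 - lsum (f x))).
    exact: cst_continuous.
  apply: (@continuousB R R^o S (fun=> 2^-1)); first exact: cst_continuous.
  exact: cs.
apply: (@continuousV R S); first exact: maxP.
apply: (@continuous_max R S (fun=> 2^-1)); first exact: cst_continuous.
exact: cs.
Qed.

Let resc_half k (x : 'rV[R]_k.+1) :
  \sum_i x 0 i = 1 -> resc (2^-1 *: x) = x.
Proof.
move=> x1; apply/rowP => j; rewrite mxE.
have -> : lsum (2^-1 *: x) = 2^-1.
  by rewrite /lsum; under eq_bigr do rewrite mxE; rewrite -mulr_sumr x1 mulr1.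
rewrite subrr max_l // max_l // if_same addr0 mxE.
by rewrite invrK mulrC mulrA divff ?mul1r // pnatr_eq0.
Qed.

Lemma simplex_prod_delta :
  delta_generated R (simplex R m * simplex R n)%type.
Proof.
pose sv (z : simplex R m * simplex R n) : 'rV[R]_N.+1 :=
  row_mx (2^-1 *: set_val z.1 : 'rV[R]_m.+1) (2^-1 *: set_val z.2).
have svP z : (forall i, 0 <= sv z 0 i) /\ \sum_i sv z 0 i = 1.
  have /= [x0 x1] := set_valP z.1; have /= [y0 y1] := set_valP z.2.
  split=> [i|].
    rewrite mxE; case: splitP => j _; rewrite mxE mulr_ge0 // invr_ge0 //.
  rewrite (@big_split_ord _ _ _ m.+1 n.+1) /=.
  under eq_bigr do rewrite (row_mxEl (2^-1 *: set_val z.1)) mxE.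
  under [X in _ + X]eq_bigr do rewrite (row_mxEr (2^-1 *: set_val z.1)) mxE.
  by rewrite -!mulr_sumr x1 y1 mulr1; lra.
pose s z : simplex R N := SigSub (mem_set (svP z)).
have r1P (w : simplex R N) : (forall i, 0 <= resc (lsubmx (set_val w : 'rV_(m.+1 + n.+1))) 0 i)
    /\ \sum_i resc (lsubmx (set_val w : 'rV_(m.+1 + n.+1))) 0 i = 1.
  by apply: rescP => i; rewrite mxE; have [+ _] := set_valP w; apply.
have r2P (w : simplex R N) : (forall i, 0 <= resc (rsubmx (set_val w : 'rV_(m.+1 + n.+1))) 0 i)
    /\ \sum_i resc (rsubmx (set_val w : 'rV_(m.+1 + n.+1))) 0 i = 1.
  by apply: rescP => i; rewrite mxE; have [+ _] := set_valP w; apply.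
pose r1 w : simplex R m := SigSub (mem_set (r1P w)).
pose r2 w : simplex R n := SigSub (mem_set (r2P w)).
pose r w := (r1 w, r2 w).
have cw (i : 'I_N.+1) : continuous (fun w : simplex R N => set_val w 0 i : R).
  apply: (@comp_continuous _ _ _ set_val (fun x : 'rV[R]_N.+1 => x 0 i)).
    exact: set_val_continuous.
  exact: coord_continuous.
have half k (S : topologicalType) (f : S -> simplex R k) j : continuous f ->
    continuous (fun x => 2^-1 * set_val (f x) 0 j : R).
  move=> cf x; apply: (@continuousM R S (fun=> 2^-1)); first exact: cst_continuous.
  apply: (@comp_continuous _ _ _ f (fun y : simplex R k => set_val y 0 j) cf).
  apply: (@comp_continuous _ _ _ set_val (fun x : 'rV[R]_k.+1 => x 0 j)).
    exact: set_val_continuous.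
  exact: coord_continuous.
apply: (@delta_retract R _ _ s r (@simplex_delta R N)).
- apply: continuous_to_sub; apply: continuous_to_rV => i.
  have -> : i = unsplit (fintype.split (i : 'I_(m.+1 + n.+1))) by rewrite splitK.
  case: (fintype.split _) => j /=.
    have -> : (fun z => sv z 0 (@unsplit m.+1 n.+1 (inl j))) =
        (fun z => 2^-1 * set_val z.1 0 j).
      by apply/funext => z; rewrite /sv (row_mxEl (2^-1 *: set_val z.1)) mxE.
    by apply: half => z; exact: cvg_fst.
  have -> : (fun z => sv z 0 (@unsplit m.+1 n.+1 (inr j))) =
      (fun z => 2^-1 * set_val z.2 0 j).
    by apply/funext => z; rewrite /sv (row_mxEr (2^-1 *: set_val z.1)) mxE.
  by apply: half => z; exact: cvg_snd.
- by apply: (pair_continuous (f := r1) (g := r2)); apply: continuous_to_sub;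
    apply: resc_continuous; apply: continuous_to_rV => j;
    under eq_fun do rewrite mxE; exact: cw.
- move=> [x y]; congr pair; apply: val_inj => /=.
    by rewrite {1}/set_val/= row_mxKl resc_half //; have /= [] := set_valP x.
  by rewrite {1}/set_val/= row_mxKr resc_half //; have /= [] := set_valP y.
Qed.

End SimplexProduct.

Section Products.
Variable R : realType.
Implicit Types S T U : topologicalType.

Lemma fst_continuous S T : continuous (fst : S * T -> S).
Proof. by move=> x; exact: cvg_fst. Qed.

Lemma snd_continuous S T : continuous (snd : S * T -> T).
Proof. by move=> x; exact: cvg_snd. Qed.

Lemma kpair_continuous S T U (f : S -> T) (g : S -> U) : delta_generated R S ->
  continuous f -> continuous g -> continuous (fun x => (f x, g x) : kprod R T U).
Proof. by move=> dS cf cg; apply: continuous_kelley => //; exact: pair_continuous. Qed.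

Lemma kfst_continuous S T : continuous (fst : kprod R S T -> S).
Proof.
exact: (comp_continuous (@kelley_id_continuous R (S * T)%type) (@fst_continuous S T)).
Qed.

Lemma ksnd_continuous S T : continuous (snd : kprod R S T -> T).
Proof.
exact: (comp_continuous (@kelley_id_continuous R (S * T)%type) (@snd_continuous S T)).
Qed.

Lemma kprod_continuous S T U (f : kprod R S T -> U) :
  (forall n (u : simplex R n -> S) (v : simplex R n -> T),
    continuous u -> continuous v -> continuous (fun x => f (u x, v x))) ->
  continuous f.
Proof.
move=> cf; apply: continuous_from_kelley => n u cu.
rewrite (_ : _ \o _ = fun x => f ((u x).1, (u x).2)); last first.
  by apply/funext => x /=; case: (u x).
apply: cf; first exact: (comp_continuous cu (@fst_continuous _ _)).
exact: (comp_continuous cu (@snd_continuous _ _)).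
Qed.

Lemma kswap_continuous S T :
  continuous (fun x : kprod R S T => (x.2, x.1) : kprod R T S).
Proof.
apply: kpair_continuous; first exact: kelley_delta.
  exact: ksnd_continuous.
exact: kfst_continuous.
Qed.

(* A quotient map stays a quotient map after multiplication by an identity. *)
Lemma quotient_prod_continuous (P Q Y Z : topologicalType) (q : P -> Q)
    (F : Q -> Y -> Z) :
  delta_generated R P -> (forall x, exists p, q p = x) ->
  (forall A : set Q, open (q @^-1` A) -> open A) ->
  continuous (fun x : kprod R P Y => F (q x.1) x.2) ->
  continuous (fun x : kprod R Q Y => F x.1 x.2).
Proof.
move=> dP qsurj qopen cF; apply: kprod_continuous => n a b ca cb.
apply/continuousP => U oU; rewrite openE => t0 /= Ft0; rewrite /interior.
have [p0 qp0] := qsurj (a t0).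
have cp0 : continuous (fun t => F (q p0) (b t)).
  apply: (@comp_continuous _ (kprod R P Y) _ (fun t => (p0, b t))
    (fun x => F (q x.1) x.2)) => //.
  apply: kpair_continuous => //; first exact: simplex_delta.
  exact: cst_continuous.
have nK : nbhs t0 [set t | U (F (q p0) (b t))].
  apply: open_nbhs_nbhs; split; first by move/continuousP : cp0; apply.
  by rewrite /= qp0.
have [K0 nK0 K0U] := simplex_regular nK.
pose K := closure K0.
have cK : compact K.
  apply: (@subclosed_compact _ _ setT) => //; first exact: closed_closure.
  exact: simplex_compact.
pose W := [set x : Q | forall t, K t -> U (F x (b t))].
have oW : open W.
  apply: qopen; apply: dP => m c cc; rewrite openE => s0 /= Ws0; rewrite /interior.
  have cG : continuous (fun st : simplex R m * simplex R n => F (q (c st.1)) (b st.2)).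
    apply: (@comp_continuous _ (kprod R P Y) _
      (fun st : simplex R m * simplex R n => (c st.1, b st.2))
      (fun x => F (q x.1) x.2)) => //.
    apply: kpair_continuous; first exact: simplex_prod_delta.
      exact: (comp_continuous (@fst_continuous _ _) cc).
    exact: (comp_continuous (@snd_continuous _ _) cb).
  move/compact_near_coveringP : cK => /(_ _ (nbhs s0)
    (fun s t => U (F (q (c s)) (b t))) _); apply => t Kt.
  have nU : nbhs (s0, t) [set st | U (F (q (c st.1)) (b st.2))].
    apply: open_nbhs_nbhs; split; first by move/continuousP : cG; apply.
    exact: Ws0.
  have [[A B] /= [nA nB] AB] := nU; exists (B, A) => //= -[t' s'] /= [Bt' As'].
  exact: (AB (s', t')).
have nW : nbhs t0 (a @^-1` W).
  apply: open_nbhs_nbhs; split; first by move/continuousP : ca; apply.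
  by move=> t Kt /=; rewrite -qp0; exact: K0U.
apply: filterS (filterI nW nK0) => t [/= Wt K0t]; apply: Wt.
exact: subset_closure.
Qed.

End Products.

Section Coequalizer.
Variables (R : realType) (h : bool) (T : topologicalType).
Variable r : T -> T -> Prop.

(* The quotient in Top: for [h = false] this is the equivalence relation
   generated by [r]; for [h = true] it is the finest equivalence relation
   containing [r] whose quotient is Delta-Hausdorff, as colimits of
   Delta-Hausdorff spaces are reflections of those of Delta-generated spaces. *)
Definition topquot_rel : rel T := fun x y =>
  `[< forall e : equiv_rel T, (forall x y, r x y -> e x y) ->
        (h -> delta_hausdorff R (quotient_topology {eq_quot e})) -> e x y >].

Lemma topquot_refl : reflexive topquot_rel.
Proof. by move=> x; apply/asboolP => e _ _; exact: equiv_refl. Qed.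

Lemma topquot_sym : symmetric topquot_rel.
Proof.
move=> x y; apply/asboolP/asboolP => xy e re he; rewrite equiv_sym; exact: xy.
Qed.

Lemma topquot_trans : transitive topquot_rel.
Proof.
move=> y x z /asboolP xy /asboolP yz; apply/asboolP => e re he.
by apply: (equiv_trans (xy e re he)); exact: yz.
Qed.

Definition topquot_equiv : equiv_rel T :=
  EquivRel topquot_rel topquot_refl topquot_sym topquot_trans.

Definition topquot : topologicalType := quotient_topology {eq_quot topquot_equiv}.

Definition topquot_pi (x : T) : topquot :=
  \pi_(quotient_topology {eq_quot topquot_equiv}) x.

Definition topquot_repr (x : topquot) : T :=
  repr (x : quotient_topology {eq_quot topquot_equiv}).

Lemma topquot_reprK : cancel topquot_repr topquot_pi.
Proof. by move=> x; rewrite /topquot_pi /topquot_repr reprK. Qed.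

Lemma topquot_piP x y : topquot_pi x = topquot_pi y <-> topquot_rel x y.
Proof.
split=> [xy|xy]; first by apply/(@eqmodP T topquot_equiv).
by apply/(@eqmodP T topquot_equiv).
Qed.

Lemma topquot_pi_eq x y : r x y -> topquot_pi x = topquot_pi y.
Proof. by move=> rxy; apply/topquot_piP/asboolP => e + _; apply. Qed.

Lemma topquot_pi_continuous : continuous topquot_pi.
Proof. exact: pi_continuous. Qed.

Lemma topquot_open (A : set topquot) : open (topquot_pi @^-1` A) -> open A.
Proof. by []. Qed.

Lemma topquot_continuous (U : topologicalType) (f : topquot -> U) :
  continuous (f \o topquot_pi) -> continuous f.
Proof. by move=> cf; apply/quotient_continuous. Qed.

Lemma topquot_factor (U : topologicalType) (f : T -> U) : in_Top R h U ->
  continuous f -> (forall x y, r x y -> f x = f y) ->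
  forall x y, topquot_pi x = topquot_pi y -> f x = f y.
Proof.
move=> [dU hU] cf rf x y /topquot_piP/asboolP.
pose k : rel T := fun x y => f x == f y.
have kr : reflexive k by move=> ?; rewrite /k.
have ks : symmetric k by move=> ? ?; rewrite /k eq_sym.
have kt : transitive k by move=> ? ? ?; rewrite /k => /eqP -> /eqP ->.
pose ke := EquivRel k kr ks kt => /(_ ke) xy; apply/eqP; apply: xy => [a b rab|hh].
  by apply/eqP; exact: rf.
pose Q : topologicalType := quotient_topology {eq_quot ke}.
pose g (z : Q) := f (repr (z : {eq_quot ke})).
have gE z : g (\pi_(quotient_topology {eq_quot ke}) z) = f z.
  apply/eqP; apply/(@eqmodP T ke); by rewrite reprK.
have cg : continuous g.
  apply/quotient_continuous.
  by rewrite (_ : _ \o _ = f) //; apply/funext => z; exact: gE.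
have gI a b : g a = g b -> a = b.
  move=> gab; have /(@eqmodP T ke) : k (repr (a : {eq_quot ke})) (repr (b : {eq_quot ke})).
    exact/eqP.
  by rewrite !reprK.
have cgg : continuous (fun z : kprod R Q Q => (g z.1, g z.2) : kprod R U U).
  apply: kpair_continuous; first exact: kelley_delta.
    exact: (comp_continuous (@kfst_continuous _ _ _) cg).
  exact: (comp_continuous (@ksnd_continuous _ _ _) cg).
rewrite /delta_hausdorff (_ : [set _ | _] =
    (fun z : kprod R Q Q => (g z.1, g z.2) : kprod R U U) @^-1` [set x | x.1 = x.2]).
  by apply: closed_comp => [z _|]; [exact: cgg|exact: hU].
by apply/seteqP; split => -[a b] /= => [->|/gI].
Qed.

Lemma topquot_in_Top : delta_generated R T -> in_Top R h topquot.
Proof.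
move=> dT; split=> [A dA|hh].
  apply: topquot_open; apply: dT => n u cu; rewrite -comp_preimage.
  by apply: dA; apply: comp_continuous cu _; exact: topquot_pi_continuous.
pose adm := [set e : equiv_rel T | (forall x y, r x y -> e x y) /\
   (h -> delta_hausdorff R (quotient_topology {eq_quot e}))].
pose Q (e : equiv_rel T) : topologicalType := quotient_topology {eq_quot e}.
pose g (e : equiv_rel T) (z : topquot) : Q e :=
  \pi_(quotient_topology {eq_quot e}) (topquot_repr z).
have gE e x : adm e -> g e (topquot_pi x) = \pi_(quotient_topology {eq_quot e}) x.
  move=> [re he]; apply/(@eqmodP T e).
  by have /topquot_piP/asboolP := topquot_reprK (topquot_pi x); apply.
have cg e : adm e -> continuous (g e).
  move=> ae; apply: topquot_continuous; rewrite (_ : _ \o _ = \pi_(quotient_topology {eq_quot e})).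
    exact: pi_continuous.
  by apply/funext => x; exact: gE.
have cgg e : adm e -> continuous (fun z : kprod R topquot topquot =>
    (g e z.1, g e z.2) : kprod R (Q e) (Q e)).
  move=> ae; apply: kpair_continuous; first exact: kelley_delta.
    exact: (comp_continuous (@kfst_continuous _ _ _) (cg _ ae)).
  exact: (comp_continuous (@ksnd_continuous _ _ _) (cg _ ae)).
rewrite /delta_hausdorff (_ : [set _ | _] =
    \bigcap_(e in adm) ((fun z : kprod R topquot topquot =>
      (g e z.1, g e z.2) : kprod R (Q e) (Q e)) @^-1` [set x | x.1 = x.2])).
  apply: closed_bigI => e ae; apply: closed_comp => [z _|]; first exact: cgg.
  exact: ae.2.
apply/seteqP; split => -[a b] /= => [-> //|ab].
rewrite -(topquot_reprK a) -(topquot_reprK b); apply/topquot_piP/asboolP => e re he.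
by have := ab e (conj re he); rewrite /= /g => /(@eqmodP T e).
Qed.

End Coequalizer.

Section PathAlgebra.
Variable R : realType.
Local Notation I := (unit_interval R).

Definition reparametrization (phi : I -> I) :=
  (forall s t, set_val s <= set_val t -> set_val (phi s) <= set_val (phi t)) /\
  (forall t, exists s, phi s = t).

Definition ncomp (T : Type) (g1 g2 : I -> T) : I -> T := fun t =>
  if set_val t <= 2^-1 then g1 (proj_unit (2 * set_val t))
  else g2 (proj_unit (2 * set_val t - 1)).

Lemma unit_eq (s t : I) : set_val s = set_val t -> s = t.
Proof. exact: val_inj. Qed.

Lemma reparam0 phi : reparametrization phi -> phi i0 = i0.
Proof.
move=> [mphi sphi]; have [s s0] := sphi i0.
apply/unit_eq/eqP; rewrite eq_le; apply/andP; split.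
  by rewrite -{2}s0; apply: mphi; rewrite set_val_i0; have /andP[] := itv01P s.
by rewrite set_val_i0; have /andP[] := itv01P (phi i0).
Qed.

Lemma reparam1 phi : reparametrization phi -> phi i1 = i1.
Proof.
move=> [mphi sphi]; have [s s1] := sphi i1.
apply/unit_eq/eqP; rewrite eq_le; apply/andP; split.
  by rewrite set_val_i1; have /andP[] := itv01P (phi i1).
by rewrite -{1}s1; apply: mphi; rewrite set_val_i1; have /andP[] := itv01P s.
Qed.

Section Ncomp.
Variables (T : Type) (g1 g2 : I -> T).

Lemma ncompl t : set_val t <= 2^-1 ->
  ncomp g1 g2 t = g1 (proj_unit (2 * set_val t)).
Proof. by rewrite /ncomp => ->. Qed.

Lemma ncompr t : g1 i1 = g2 i0 -> 2^-1 <= set_val t ->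
  ncomp g1 g2 t = g2 (proj_unit (2 * set_val t - 1)).
Proof.
move=> g12; rewrite /ncomp; case: ifPn => // h1 h2.
have -> : set_val t = 2^-1 by apply/eqP; rewrite eq_le h1.
by rewrite mulfV ?pnatr_eq0 // subrr.
Qed.

Lemma ncomp0 : ncomp g1 g2 i0 = g1 i0.
Proof.
rewrite ncompl set_val_i0 ?invr_ge0 ?ler0n // mulr0; by [].
Qed.

Lemma ncomp1 : ncomp g1 g2 i1 = g2 i1.
Proof.
rewrite /ncomp set_val_i1 ifF; first by congr (g2 (proj_unit _)); lra.
by apply/negbTE; rewrite -ltNge; lra.
Qed.

End Ncomp.

Lemma unit_le (t : I) : 0 <= set_val t /\ set_val t <= 1.
Proof. by have /andP[] := itv01P t. Qed.

Lemma ncomp_reparaml (T : Type) (g1 g2 : I -> T) phi :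
  reparametrization phi -> g1 i1 = g2 i0 ->
  exists2 psi, reparametrization psi &
    ncomp (g1 \o phi) g2 = ncomp g1 g2 \o psi.
Proof.
move=> [mphi sphi] g12.
pose psi (t : I) : I := if set_val t <= 2^-1 then
  proj_unit (set_val (phi (proj_unit (2 * set_val t))) / 2) else t.
have psiE t : set_val t <= 2^-1 ->
    set_val (psi t) = set_val (phi (proj_unit (2 * set_val t))) / 2.
  move=> ht; rewrite /psi ht proj_unitK //.
  by have [] := unit_le (phi (proj_unit (2 * set_val t))) => ? ?; lra.
have psiE' t : 2^-1 < set_val t -> psi t = t by rewrite /psi ltNge => /negbTE ->.
exists psi; first split.
- move=> s t st; have [hs|hs] := leP (set_val s) 2^-1; last first.
    by rewrite !psiE' //; lra.
  have [ht|ht] := leP (set_val t) 2^-1.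
    rewrite !psiE // ler_pM2r ?invr_gt0 ?ltr0n //; apply: mphi.
    by have := unit_le s; have := unit_le t => ? ?; rewrite !proj_unitK; lra.
  rewrite psiE // psiE' //.
  by have := unit_le (phi (proj_unit (2 * set_val s))) => ?; lra.
- move=> t; have := unit_le t => t01; have [ht|ht] := leP (set_val t) 2^-1; last first.
    by exists t; rewrite psiE'.
  have [s ps] := sphi (proj_unit (2 * set_val t)); have := unit_le s => s01.
  have hs : set_val (proj_unit (set_val s / 2) : I) = set_val s / 2.
    by rewrite proj_unitK //; lra.
  exists (proj_unit (set_val s / 2)); apply: unit_eq; rewrite psiE hs; last lra.
  have -> : 2 * (set_val s / 2) = set_val s by lra.
  by rewrite set_valK01 ps proj_unitK; lra.
apply/funext => t /=; have := unit_le t => t01.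
have [ht|ht] := leP (set_val t) 2^-1.
  have := unit_le (phi (proj_unit (2 * set_val t))) => p01.
  rewrite !ncompl ?psiE //=; last lra.
  congr g1; apply: unit_eq; rewrite proj_unitK; lra.
by rewrite psiE' // /ncomp leNgt ht.
Qed.

Lemma ncomp_reparamr (T : Type) (g1 g2 : I -> T) phi :
  reparametrization phi -> g1 i1 = g2 i0 ->
  exists2 psi, reparametrization psi &
    ncomp g1 (g2 \o phi) = ncomp g1 g2 \o psi.
Proof.
move=> rphi g12; have [mphi sphi] := rphi.
pose psi (t : I) : I := if set_val t <= 2^-1 then t else
  proj_unit ((set_val (phi (proj_unit (2 * set_val t - 1))) + 1) / 2).
have psiE t : 2^-1 < set_val t ->
    set_val (psi t) = (set_val (phi (proj_unit (2 * set_val t - 1))) + 1) / 2.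
  move=> ht; rewrite /psi leNgt ht /= proj_unitK //.
  by have [] := unit_le (phi (proj_unit (2 * set_val t - 1))) => ? ?; lra.
have psiE' t : set_val t <= 2^-1 -> psi t = t by rewrite /psi => ->.
exists psi; first split.
- move=> s t st; have [ht|ht] := leP (set_val t) 2^-1.
    by rewrite !psiE' //; lra.
  have [hs|hs] := leP (set_val s) 2^-1; last first.
    rewrite !psiE // ler_pM2r ?invr_gt0 ?ltr0n // lerD2r; apply: mphi.
    by have := unit_le s; have := unit_le t => ? ?; rewrite !proj_unitK; lra.
  rewrite (psiE t) // (psiE' s) //.
  by have := unit_le (phi (proj_unit (2 * set_val t - 1))) => ?; lra.
- move=> t; have := unit_le t => t01; have [ht|ht] := leP (set_val t) 2^-1.
    by exists t; rewrite psiE'.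
  have [s ps] := sphi (proj_unit (2 * set_val t - 1)); have := unit_le s => s01.
  have hs : set_val (proj_unit ((set_val s + 1) / 2) : I) = (set_val s + 1) / 2.
    by rewrite proj_unitK //; lra.
  have s0 : 0 < set_val s.
    rewrite lt_neqAle s01.1 andbT; apply/eqP => s0.
    have s0' : s = i0 by apply: unit_eq; rewrite set_val_i0.
    move: ps; rewrite s0' reparam0 // => /(congr1 set_val).
    by rewrite set_val_i0 proj_unitK; lra.
  exists (proj_unit ((set_val s + 1) / 2)); apply: unit_eq; rewrite psiE hs; last lra.
  have -> : 2 * ((set_val s + 1) / 2) - 1 = set_val s by lra.
  by rewrite set_valK01 ps proj_unitK; lra.
apply/funext => t /=; have := unit_le t => t01.
have [ht|ht] := leP (set_val t) 2^-1.
  by rewrite psiE' // !ncompl.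
have := unit_le (phi (proj_unit (2 * set_val t - 1))) => p01.
rewrite !ncompr ?psiE //=; [| lra | by rewrite reparam0 | lra].
congr g2; apply: unit_eq; rewrite proj_unitK; lra.
Qed.

Lemma ncomp_assoc (T : Type) (g1 g2 g3 : I -> T) :
  g1 i1 = g2 i0 -> g2 i1 = g3 i0 ->
  exists2 psi, reparametrization psi &
    ncomp (ncomp g1 g2) g3 = ncomp g1 (ncomp g2 g3) \o psi.
Proof.
move=> g12 g23.
pose f (t : R) : R := if t <= 4^-1 then 2 * t else if t <= 2^-1 then t + 4^-1
  else t / 2 + 2^-1.
pose psi (t : I) : I := proj_unit (f (set_val t)).
have psiE t : set_val (psi t) = f (set_val t).
  have t01 := unit_le t; rewrite proj_unitK // /f.
  by have [?|?] := leP (set_val t) 4^-1; [lra|case: (leP (set_val t) 2^-1) => ?; lra].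
exists psi; first split.
- move=> s t st; rewrite !psiE /f; have s01 := unit_le s; have t01 := unit_le t.
  by case: (leP (set_val s) 4^-1) => ?; case: (leP (set_val t) 4^-1) => ?;
     case: (leP (set_val s) 2^-1) => ?; case: (leP (set_val t) 2^-1) => ?; lra.
- move=> t; have := unit_le t => t01.
  have [h1|h1] := leP (set_val t) 2^-1.
    exists (proj_unit (set_val t / 2)); apply: unit_eq; rewrite psiE proj_unitK; last lra.
    by rewrite /f ifT; lra.
  have [h2|h2] := leP (set_val t) (3 / 4).
    exists (proj_unit (set_val t - 4^-1)); apply: unit_eq; rewrite psiE proj_unitK; last lra.
    by rewrite /f ifF ?ifT; [lra|lra|apply/negbTE; rewrite -ltNge; lra].
  exists (proj_unit (2 * set_val t - 1)); apply: unit_eq; rewrite psiE proj_unitK; last lra.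
  by rewrite /f !ifF; [lra|apply/negbTE; rewrite -ltNge; lra..].
apply/funext => t /=; have := unit_le t => t01.
have g123 : g1 i1 = ncomp g2 g3 i0 by rewrite ncomp0.
have g123' : ncomp g1 g2 i1 = g3 i0 by rewrite ncomp1.
have [h1|h1] := leP (set_val t) 2^-1; last first.
  have pE : set_val (psi t) = set_val t / 2 + 2^-1.
    by rewrite psiE /f !ifF //; apply/negbTE; rewrite -ltNge; lra.
  rewrite (ncompr g123') ?(ltW h1) // (ncompr g123) pE; last lra.
  have p2 : set_val (proj_unit (2 * (set_val t / 2 + 2^-1) - 1) : I) = set_val t.
    by rewrite proj_unitK; lra.
  by rewrite (ncompr g23) p2 // ltW.
rewrite (@ncompl _ _ _ t) //.
have v2 : set_val (proj_unit (2 * set_val t) : I) = 2 * set_val t.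
  by rewrite proj_unitK; lra.
have [h2|h2] := leP (set_val t) 4^-1.
  have pE : set_val (psi t) = 2 * set_val t by rewrite psiE /f ifT.
  by rewrite !ncompl ?pE ?v2 //; lra.
have pE : set_val (psi t) = set_val t + 4^-1.
  by rewrite psiE /f h1 ifF //; apply/negbTE; rewrite -ltNge; lra.
rewrite (ncompr g12) ?v2; last lra.
rewrite (ncompr g123) ?pE; last lra.
have v3 : set_val (proj_unit (2 * (set_val t + 4^-1) - 1) : I) = 2 * set_val t - 2^-1.
  by rewrite proj_unitK; lra.
rewrite ncompl v3; last lra.
by congr (g2 (proj_unit _)); lra.
Qed.

Lemma reparam_continuous phi : reparametrization phi -> continuous phi.
Proof.
move=> rphi; have [mphi sphi] := rphi.
suff cf : continuous (fun t : I => set_val (phi t) : R).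
  exact: (@continuous_to_sub I R `[0, 1]%classic phi cf).
move=> t0 A /nbhs_ballP[e /= e0 eA]; change (nbhs t0 [set t | A (set_val (phi t))]).
have t01 := unit_le (phi t0).
have up : nbhs t0 [set t | set_val (phi t) < set_val (phi t0) + e].
  have [h|h] := ltP 1 (set_val (phi t0) + e).
    apply: (@filterS _ _ (nbhs_filter t0) setT _ _ filterT) => t _ /=.
    by have := unit_le (phi t) => ?; lra.
  have [s ps] := sphi (proj_unit (set_val (phi t0) + e / 2)).
  have vs : set_val (phi s) = set_val (phi t0) + e / 2 by rewrite ps proj_unitK; lra.
  have ts : set_val t0 < set_val s.
    by rewrite ltNge; apply/negP => /mphi; lra.
  have : nbhs t0 [set t | set_val t < set_val s].
    apply: (@set_val_continuous R `[0, 1]%classic t0 [set x | x < set_val s]).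
    exact: lt_nbhsl.
  by apply: (@filterS _ _ (nbhs_filter t0)) => t /= /ltW /mphi; lra.
have dn : nbhs t0 [set t | set_val (phi t0) - e < set_val (phi t)].
  have [h|h] := ltP (set_val (phi t0) - e) 0.
    apply: (@filterS _ _ (nbhs_filter t0) setT _ _ filterT) => t _ /=.
    by have := unit_le (phi t) => ?; lra.
  have [s ps] := sphi (proj_unit (set_val (phi t0) - e / 2)).
  have vs : set_val (phi s) = set_val (phi t0) - e / 2 by rewrite ps proj_unitK; lra.
  have ts : set_val s < set_val t0.
    by rewrite ltNge; apply/negP => /mphi; lra.
  have : nbhs t0 [set t | set_val s < set_val t].
    apply: (@set_val_continuous R `[0, 1]%classic t0 [set x | set_val s < x]).
    by apply: open_nbhs_nbhs; split => //; exact: open_gt.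
  by apply: (@filterS _ _ (nbhs_filter t0)) => t /= /ltW /mphi; lra.
have := @filterI _ _ (nbhs_filter t0) _ _ up dn.
apply: (@filterS _ _ (nbhs_filter t0)) => t [/= upt dnt].
apply: eA; rewrite /ball /= ltr_distlC; apply/andP; split; lra.
Qed.

End PathAlgebra.

Record mdspace (R : realType) (h : bool) := MdSpace {
  underlying : space R h;
  states : set underlying;
  execution : set (unit_interval R -> underlying);
  execution_continuous : forall g, execution g -> continuous g;
  execution_start : forall g, execution g -> states (g i0);
  execution_end : forall g, execution g -> states (g i1);
  execution_reparam : forall g phi, execution g -> reparametrization phi ->
    execution (g \o phi);
  execution_ncomp : forall g1 g2, execution g1 -> execution g2 ->
    g1 i1 = g2 i0 -> execution (ncomp g1 g2)
}.

Record flow (R : realType) (h : bool) := Flow {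
  fstate : Type;
  fpath : fstate -> fstate -> space R h;
  fcomp : forall a b c, fpath a b -> fpath b c -> fpath a c;
  fcomp_continuous : forall a b c, continuous
    (fun x : kprod R (fpath a b) (fpath b c) => fcomp x.1 x.2);
  fcomp_assoc : forall a b c d
    (x : fpath a b) (y : fpath b c) (z : fpath c d),
    fcomp (fcomp x y) z = fcomp x (fcomp y z)
}.

Section PathSpace.
Variable R : realType.
Local Notation I := (unit_interval R).

(* The internal hom from [0, 1]. *)
Definition TOP01 (T : topologicalType) : topologicalType :=
  kelley R (set_type [set g : {compact-open, I -> T} | continuous (g : I -> T)]).

Definition TOP01_fun (T : topologicalType) (g : TOP01 T) : I -> T :=
  set_val (g : set_type [set g : {compact-open, I -> T} | continuous (g : I -> T)]).

Variables (h : bool) (X : mdspace R h).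

Definition exec_path (a b : underlying X) : set (TOP01 (underlying X)) :=
  [set g | [/\ execution (TOP01_fun g), TOP01_fun g i0 = a & TOP01_fun g i1 = b]].

Definition path_space (a b : underlying X) : topologicalType :=
  kelley R (set_type (exec_path a b)).

Section Ends.
Variables a b : underlying X.

Definition path_fun (g : path_space a b) : I -> underlying X :=
  TOP01_fun (set_val (g : set_type (exec_path a b))).

Lemma path_funP (g : path_space a b) :
  [/\ execution (path_fun g), path_fun g i0 = a & path_fun g i1 = b].
Proof. exact: (set_valP (g : set_type (exec_path a b))). Qed.

Definition mk_TOP01 (T : topologicalType) (g : I -> T) (cg : continuous g) :
  TOP01 T := SigSub (mem_set cg).

Lemma mk_path_subproof (g : I -> underlying X) (eg : execution g) :
  g i0 = a -> g i1 = b -> exec_path a b (mk_TOP01 (execution_continuous eg)).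
Proof. by move=> ga gb; split. Qed.

Definition mk_path (g : I -> underlying X) (eg : execution g)
    (ga : g i0 = a) (gb : g i1 = b) : path_space a b :=
  SigSub (mem_set (mk_path_subproof eg ga gb)).

Lemma mk_pathK g eg ga gb : path_fun (@mk_path g eg ga gb) = g.
Proof. by []. Qed.

Lemma path_fun_inj : injective path_fun.
Proof. by move=> f g fg; apply/val_inj/val_inj. Qed.

Lemma path_fun_continuous :
  continuous (path_fun : path_space a b -> {compact-open, I -> underlying X}).
Proof.
pose C := [set g : {compact-open, I -> underlying X} |
  continuous (g : I -> underlying X)].
have c1 := @kelley_id_continuous R (set_type (exec_path a b)).
have c2 := @set_val_continuous _ (exec_path a b).
have c3 := @kelley_id_continuous R (set_type C).
have c4 := @set_val_continuous _ C.
exact: (comp_continuous (comp_continuous (comp_continuous c1 c2) c3) c4).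
Qed.

Lemma path_space_continuous (S : topologicalType) (f : S -> path_space a b) :
  delta_generated R S ->
  continuous (path_fun \o f : S -> {compact-open, I -> underlying X}) ->
  continuous f.
Proof.
move=> dS cf; apply: continuous_kelley => //.
apply: continuous_to_sub; apply: continuous_kelley => //.
by apply: continuous_to_sub.
Qed.

Definition reparam_rel (g g' : path_space a b) :=
  exists2 phi, reparametrization phi & path_fun g' = path_fun g \o phi.

Lemma cat_path_in_Top : in_Top R h (topquot R h reparam_rel).
Proof. by apply: topquot_in_Top; exact: kelley_delta. Qed.

Definition cat_path : space R h := Space cat_path_in_Top.

Definition cat_pi : path_space a b -> cat_path := @topquot_pi R h _ reparam_rel.

Definition cat_repr : cat_path -> path_space a b :=
  @topquot_repr R h _ reparam_rel.

Lemma cat_reprK : cancel cat_repr cat_pi.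
Proof. exact: topquot_reprK. Qed.

End Ends.

Section Comp.
Variables a b c : underlying X.

Lemma path_comp_subproof (x : path_space a b) (y : path_space b c) :
  [/\ execution (ncomp (path_fun x) (path_fun y)),
      ncomp (path_fun x) (path_fun y) i0 = a &
      ncomp (path_fun x) (path_fun y) i1 = c].
Proof.
have [ex xa xb] := path_funP x; have [ey yb yc] := path_funP y.
by rewrite ncomp0 ncomp1; split => //; apply: execution_ncomp => //; rewrite xb.
Qed.

Definition path_comp (x : path_space a b) (y : path_space b c) :
    path_space a c :=
  let: And3 e1 e2 e3 := path_comp_subproof x y in mk_path e1 e2 e3.

Lemma path_compE x y : path_fun (path_comp x y) = ncomp (path_fun x) (path_fun y).
Proof. by rewrite /path_comp; case: path_comp_subproof. Qed.

Lemma path_matching (x : path_space a b) (y : path_space b c) :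
  path_fun x i1 = path_fun y i0.
Proof. by have [_ _ ->] := path_funP x; have [_ ->] := path_funP y. Qed.

Lemma path_comp_continuous :
  continuous (fun z : kprod R (path_space a b) (path_space b c) =>
    path_comp z.1 z.2).
Proof.
apply: path_space_continuous; first exact: kelley_delta.
move=> z0; apply/(@compact_open_cvgP _ _ _ _ (@fmap_filter _ _ _ (nbhs z0) (nbhs_filter z0))) => K O cK oO /= KO.
pose d1 (t : I) : I := proj_unit (2 * set_val t).
pose d2 (t : I) : I := proj_unit (2 * set_val t - 1).
have cv : continuous (fun t : I => set_val t : R).
  exact: (@set_val_continuous R `[0, 1]%classic).
have c2v : continuous (fun t : I => 2 * set_val t : R).
  move=> t; apply: (@continuousM R I (fun=> 2)); first exact: cst_continuous.
  exact: cv.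
have cd1 : continuous d1 by exact: (comp_continuous c2v (@proj_unit_continuous R)).
have cd2 : continuous d2.
  apply: (@comp_continuous _ _ _ (fun t : I => 2 * set_val t - 1 : R) _ _
    (@proj_unit_continuous R)) => t.
  apply: (@continuousB R R^o I _ (fun=> 1)); first exact: c2v.
  exact: cst_continuous.
pose K1 := d1 @` (K `&` [set t | set_val t <= 2^-1]).
pose K2 := d2 @` (K `&` [set t | 2^-1 <= set_val t]).
have cK1 : compact K1.
  apply: continuous_compact; first exact: continuous_subspaceT.
  apply: compact_closedI => //; apply: (@closed_comp I R _ [set x | x <= 2^-1]).
    by move=> t _; exact: cv.
  exact: closed_le.
have cK2 : compact K2.
  apply: continuous_compact; first exact: continuous_subspaceT.
  apply: compact_closedI => //; apply: (@closed_comp I R _ [set x | 2^-1 <= x]).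
    by move=> t _; exact: cv.
  exact: closed_ge.
have compP (z : kprod R (path_space a b) (path_space b c)) :
    (path_fun (path_comp z.1 z.2) @` K `<=` O) <->
    (path_fun z.1 @` K1 `<=` O /\ path_fun z.2 @` K2 `<=` O).
  rewrite path_compE; split.
    move=> H; split=> _ [_ [t [Kt ht] <-] <-]; apply: H; exists t => //.
      by rewrite ncompl.
    by rewrite ncompr //; exact: path_matching.
  move=> [H1 H2] _ [t Kt <-].
  have [ht|ht] := leP (set_val t) 2^-1.
    by rewrite ncompl //; apply: H1; exists (d1 t) => //; exists t.
  rewrite ncompr ?(ltW ht) //; last exact: path_matching.
  by apply: H2; exists (d2 t) => //; exists t => //; split => //=; exact: ltW.
have [KO1 KO2] := (compP z0).1 KO.
have n1 := comp_continuous (@kfst_continuous R _ (path_space b c)) (@path_fun_continuous a b).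
have n2 := comp_continuous (@ksnd_continuous R (path_space a b) _) (@path_fun_continuous b c).
have o1 := compact_open_open cK1 oO; have o2 := compact_open_open cK2 oO.
have nn : nbhs z0 [set z : kprod R (path_space a b) (path_space b c) |
    path_fun z.1 @` K1 `<=` O /\ path_fun z.2 @` K2 `<=` O].
  apply: open_nbhs_nbhs; split => //.
  have O1 := (continuousP _).1 n1 _ o1.
  have O2 := (continuousP _).1 n2 _ o2.
  exact: (openI O1 O2).
by apply: (@filterS _ _ (nbhs_filter z0) _ _ _ nn) => z /compP.
Qed.

Lemma cat_compl_eq (x x' : path_space a b) (y : path_space b c) :
  cat_pi x = cat_pi x' -> cat_pi (path_comp x y) = cat_pi (path_comp x' y).
Proof.
apply: (@topquot_factor R h _ _ _ (fun x => cat_pi (path_comp x y))).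
- exact: cat_path_in_Top.
- apply: (@comp_continuous _ _ _ _ _ _ (@topquot_pi_continuous _ _ _ _)).
  apply: (@comp_continuous _ (kprod R (path_space a b) (path_space b c)) _
    (fun x => (x, y)) _ _ path_comp_continuous).
  apply: kpair_continuous; [exact: kelley_delta|by move=> ?; exact: cvg_id|].
  exact: cst_continuous.
- move=> u v [phi rphi vE]; apply: topquot_pi_eq.
  have [psi rpsi psiE] := ncomp_reparaml rphi (path_matching u y).
  by exists psi => //; rewrite !path_compE vE.
Qed.

Lemma cat_compr_eq (x : path_space a b) (y y' : path_space b c) :
  cat_pi y = cat_pi y' -> cat_pi (path_comp x y) = cat_pi (path_comp x y').
Proof.
apply: (@topquot_factor R h _ _ _ (fun y => cat_pi (path_comp x y))).
- exact: cat_path_in_Top.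
- apply: (@comp_continuous _ _ _ _ _ _ (@topquot_pi_continuous _ _ _ _)).
  apply: (@comp_continuous _ (kprod R (path_space a b) (path_space b c)) _
    (fun y => (x, y)) _ _ path_comp_continuous).
  apply: kpair_continuous; [exact: kelley_delta|exact: cst_continuous|].
  by move=> ?; exact: cvg_id.
- move=> u v [phi rphi vE]; apply: topquot_pi_eq.
  have [psi rpsi psiE] := ncomp_reparamr rphi (path_matching x u).
  by exists psi => //; rewrite !path_compE vE.
Qed.

Definition cat_comp (x : cat_path a b) (y : cat_path b c) : cat_path a c :=
  cat_pi (path_comp (cat_repr x) (cat_repr y)).

Lemma cat_compE (x : path_space a b) (y : path_space b c) :
  cat_comp (cat_pi x) (cat_pi y) = cat_pi (path_comp x y).
Proof.
rewrite /cat_comp (@cat_compl_eq _ x) ?cat_reprK //.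
by rewrite (@cat_compr_eq _ _ y) ?cat_reprK.
Qed.

Lemma cat_comp_continuous :
  continuous (fun z : kprod R (cat_path a b) (cat_path b c) => cat_comp z.1 z.2).
Proof.
apply: (@quotient_prod_continuous R _ _ _ _ (@cat_pi a b) cat_comp).
- exact: kelley_delta.
- by move=> x; exists (cat_repr x); rewrite cat_reprK.
- by move=> A; exact: topquot_open.
rewrite (_ : (fun _ => _) = (fun z => cat_comp (cat_pi z.2) z.1) \o
  (fun z : kprod R (path_space a b) (cat_path b c) =>
     (z.2, z.1) : kprod R (cat_path b c) (path_space a b))) //.
apply: (comp_continuous (@kswap_continuous R _ _)).
apply: (@quotient_prod_continuous R _ _ _ _ (@cat_pi b c)
  (fun y x => cat_comp (cat_pi x) y)).
- exact: kelley_delta.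
- by move=> x; exists (cat_repr x); rewrite cat_reprK.
- by move=> A; exact: topquot_open.
rewrite (_ : (fun _ => _) = @cat_pi a c \o (fun z => path_comp z.1 z.2) \o
  (fun z : kprod R (path_space b c) (path_space a b) =>
     (z.2, z.1) : kprod R (path_space a b) (path_space b c))); last first.
  by apply/funext => z; rewrite /= cat_compE.
apply: (comp_continuous (@kswap_continuous R _ _)).
apply: (comp_continuous path_comp_continuous).
exact: topquot_pi_continuous.
Qed.

End Comp.

Lemma cat_comp_assoc a b c d
    (x : cat_path a b) (y : cat_path b c) (z : cat_path c d) :
  cat_comp (cat_comp x y) z = cat_comp x (cat_comp y z).
Proof.
rewrite -(cat_reprK x) -(cat_reprK y) -(cat_reprK z) !cat_compE.
apply/esym/topquot_pi_eq; set x' := cat_repr x.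
have [psi rpsi psiE] := ncomp_assoc
  (path_matching x' (cat_repr y)) (path_matching (cat_repr y) (cat_repr z)).
by exists psi => //; rewrite !path_compE.
Qed.

Definition cat_flow : flow R h := {|
  fstate := set_type (@states R h X);
  fpath := fun a b => cat_path (set_val a) (set_val b);
  fcomp := fun a b c => @cat_comp (set_val a) (set_val b) (set_val c);
  fcomp_continuous := fun a b c => @cat_comp_continuous _ _ _;
  fcomp_assoc := fun a b c d => @cat_comp_assoc _ _ _ _
|}.

End PathSpace.

Section MdMaps.
Variables (R : realType) (h : bool).

Record mdmap (X Y : mdspace R h) := MdMap {
  md_fun :> underlying X -> underlying Y;
  md_continuous : continuous md_fun;
  md_states : forall a, states a -> states (md_fun a);
  md_execution : forall g, execution g -> execution (md_fun \o g)
}.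

Lemma mdmap_eq X Y (f g : mdmap X Y) : md_fun f = md_fun g -> f = g.
Proof.
case: f g => f cf sf ef [g cg sg eg] /= fg; case: _ / fg cg sg eg => cg sg eg.
by congr MdMap; exact: Prop_irrelevance.
Qed.

Definition mdmap_id X : mdmap X X :=
  @MdMap X X idfun (fun x => cvg_id) (fun a sa => sa) (fun g eg => eg).

Definition mdmap_comp X Y Z (f : mdmap X Y) (g : mdmap Y Z) : mdmap X Z :=
  @MdMap X Z (g \o f) (comp_continuous (@md_continuous _ _ f) (@md_continuous _ _ g))
    (fun a sa => md_states g (md_states f sa))
    (fun p ep => md_execution g (md_execution f ep)).

End MdMaps.

Section FlowMaps.
Variables (R : realType) (h : bool).

Record flowmap (F G : flow R h) := FlowMap {
  fm_state : fstate F -> fstate G;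
  fm_path : forall a b, fpath a b -> fpath (fm_state a) (fm_state b);
  fm_continuous : forall a b, continuous (@fm_path a b);
  fm_comp : forall a b c (x : fpath a b) (y : fpath b c),
    fm_path (fcomp x y) = fcomp (fm_path x) (fm_path y)
}.

Definition flowmap_id F : flowmap F F :=
  @FlowMap F F idfun (fun a b => idfun) (fun a b x => cvg_id)
    (fun a b c x y => erefl).

Lemma flowmap_comp_subproof F G H (f : flowmap F G) (g : flowmap G H)
    a b c (x : fpath a b) (y : fpath b c) :
  fm_path g (fm_path f (fcomp x y)) =
  fcomp (fm_path g (fm_path f x)) (fm_path g (fm_path f y)).
Proof. by rewrite !fm_comp. Qed.

Definition flowmap_comp F G H (f : flowmap F G) (g : flowmap G H) :
    flowmap F H :=
  @FlowMap F H (fm_state g \o fm_state f)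
    (fun a b => @fm_path _ _ g _ _ \o @fm_path _ _ f a b)
    (fun a b => comp_continuous (@fm_continuous _ _ f a b)
                                (@fm_continuous _ _ g _ _))
    (@flowmap_comp_subproof F G H f g).

End FlowMaps.

Section Categories.

Record category := Category {
  ob :> Type;
  hom : ob -> ob -> Type;
  idm : forall A, hom A A;
  (* [compm f g] is f followed by g. *)
  compm : forall A B D, hom A B -> hom B D -> hom A D;
  comp_idl : forall A B (f : hom A B), compm (idm A) f = f;
  comp_idr : forall A B (f : hom A B), compm f (idm B) = f;
  comp_assoc : forall A B D E (f : hom A B) (g : hom B D) (k : hom D E),
    compm (compm f g) k = compm f (compm g k)
}.

Variable C : category.

Definition mor_class := forall A B : C, hom A B -> Prop.

Definition is_isom (A B : C) (f : hom A B) := exists g : hom B A,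
  compm f g = idm A /\ compm g f = idm B.

Definition is_pushout (A B X Y : C) (i : hom A B) (f : hom A X)
    (g : hom B Y) (j : hom X Y) :=
  compm f j = compm i g /\
  forall (Z : C) (u : hom B Z) (v : hom X Z), compm f v = compm i u ->
    exists! w : hom Y Z, compm g w = u /\ compm j w = v.

Definition pushout_of (K : mor_class) : mor_class := fun X Y j =>
  exists (A B : C) (i : hom A B) (f : hom A X) (g : hom B Y),
    K A B i /\ is_pushout i f g j.

(* Functors from the initial segment [P] of a preordered set [L], and their
   colimits. *)
Section Diagrams.
Variables (L : Type) (le : rel L) (D : L -> C).
Variable d : forall i j, le i j -> hom (D i) (D j).

Definition is_functor :=
  (forall i (lii : le i i), d lii = idm (D i)) /\
  (forall i j k (lij : le i j) (ljk : le j k) (lik : le i k),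
    compm (d lij) (d ljk) = d lik).

Definition is_cocone (P : L -> Prop) (Y : C)
    (c : forall i, P i -> hom (D i) Y) :=
  forall i j (lij : le i j) (Pi : P i) (Pj : P j), compm (d lij) (c j Pj) = c i Pi.

Definition is_colimit (P : L -> Prop) (Y : C)
    (c : forall i, P i -> hom (D i) Y) :=
  is_cocone c /\
  forall (Z : C) (e : forall i, P i -> hom (D i) Z), is_cocone e ->
    exists! w : hom Y Z, forall i (Pi : P i), compm (c i Pi) w = e i Pi.

End Diagrams.

Definition strictly (L : Type) (le : rel L) (i j : L) := le i j /\ i <> j.

Definition is_successor (L : Type) (le : rel L) (i j : L) :=
  strictly le i j /\ forall k, strictly le i k -> le j k.

Lemma strictlyW (L : Type) (le : rel L) (i j : L) : strictly le i j -> le i j.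
Proof. by case. Qed.

(* Transfinite compositions of pushouts of elements of [K]; ordinals are
   represented by well-ordered types with a least element [bot]. *)
Definition cell (K : mor_class) : mor_class := fun X Y f =>
  exists (L : Type) (le : rel L) (bot : L) (D : L -> C)
    (d : forall i j, le i j -> hom (D i) (D j))
    (c : forall i, True -> hom (D i) Y) (e : hom X (D bot)),
  [/\ wochoice.well_order le /\ (forall i, le bot i),
      is_functor d,
      (forall i j (lij : le i j), is_successor le i j -> pushout_of K (d i j lij)),
      (forall j, j <> bot -> (forall i, ~ is_successor le i j) ->
        is_colimit d (fun i (lij : strictly le i j) => d i j (strictlyW lij))) &
      is_colimit d c /\ is_isom e /\ compm e (c bot I) = f].

Definition has_lift (A B X Y : C) (i : hom A B) (p : hom X Y) :=
  forall (u : hom A X) (v : hom B Y), compm u p = compm i v ->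
    exists w : hom B X, compm i w = u /\ compm w p = v.

Definition inj (K : mor_class) : mor_class := fun X Y p =>
  forall (A B : C) (i : hom A B), K A B i -> has_lift i p.

(* The cofibrations of the model structure cofibrantly generated by [K]. *)
Definition cof (K : mor_class) : mor_class := fun A B i =>
  forall (X Y : C) (p : hom X Y), inj K p -> has_lift i p.

(* The localization C[W^-1] of Gabriel and Zisman: morphisms are zigzags
   modulo the congruence generated by the relations below. *)
Section Localization.
Variable W : mor_class.

Inductive zigzag : C -> C -> Type :=
| zz_nil (A : C) : zigzag A A
| zz_fwd (A B D : C) (f : hom A B) : zigzag B D -> zigzag A D
| zz_bwd (A B D : C) (w : hom B A) : W w -> zigzag B D -> zigzag A D.

Fixpoint zz_cat (A B D : C) (z : zigzag A B) : zigzag B D -> zigzag A D :=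
  match z with
  | zz_nil _ => fun z' => z'
  | zz_fwd _ _ _ f z => fun z' => zz_fwd f (zz_cat z z')
  | zz_bwd _ _ _ w Ww z => fun z' => zz_bwd Ww (zz_cat z z')
  end.

Inductive zz_eq : forall A B : C, zigzag A B -> zigzag A B -> Prop :=
| zz_refl (A B : C) (z : zigzag A B) : zz_eq z z
| zz_sym (A B : C) (z z' : zigzag A B) : zz_eq z z' -> zz_eq z' z
| zz_trans (A B : C) (z1 z2 z3 : zigzag A B) :
    zz_eq z1 z2 -> zz_eq z2 z3 -> zz_eq z1 z3
| zz_congr_fwd (A B D : C) (f : hom A B) (z z' : zigzag B D) :
    zz_eq z z' -> zz_eq (zz_fwd f z) (zz_fwd f z')
| zz_congr_bwd (A B D : C) (w : hom B A) (Ww : W w) (z z' : zigzag B D) :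
    zz_eq z z' -> zz_eq (zz_bwd Ww z) (zz_bwd Ww z')
| zz_id (A B : C) (z : zigzag A B) : zz_eq (zz_fwd (idm A) z) z
| zz_comp (A B D E : C) (f : hom A B) (g : hom B D) (z : zigzag D E) :
    zz_eq (zz_fwd f (zz_fwd g z)) (zz_fwd (compm f g) z)
| zz_fwd_bwd (A B D : C) (w : hom A B) (Ww : W w) (z : zigzag A D) :
    zz_eq (zz_fwd w (zz_bwd Ww z)) z
| zz_bwd_fwd (A B D : C) (w : hom B A) (Ww : W w) (z : zigzag A D) :
    zz_eq (zz_bwd Ww (zz_fwd w z)) z.

Definition localization_isomorphic (A B : C) :=
  exists (z : zigzag A B) (z' : zigzag B A),
    zz_eq (zz_cat z z') (zz_nil A) /\ zz_eq (zz_cat z' z) (zz_nil B).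

End Localization.
End Categories.

Definition MdTop (R : realType) (h : bool) : category.
Proof.
refine (@Category (mdspace R h) (@mdmap R h) (@mdmap_id R h) (@mdmap_comp R h) _ _ _).
- by move=> X Y f; exact: mdmap_eq.
- by move=> X Y f; exact: mdmap_eq.
- by move=> X Y Z T f g k; exact: mdmap_eq.
Defined.

Definition FlowCat (R : realType) (h : bool) : category.
Proof.
refine (@Category (flow R h) (@flowmap R h) (@flowmap_id R h) (@flowmap_comp R h) _ _ _).
- by move=> X Y [f fp cf mf]; congr FlowMap; exact: Prop_irrelevance.
- by move=> X Y [f fp cf mf]; congr FlowMap; exact: Prop_irrelevance.
- by move=> X Y Z T f g k; congr FlowMap; exact: Prop_irrelevance.
Defined.

Section Globes.
Variables (R : realType) (h : bool).
Local Notation I := (unit_interval R).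

Lemma discrete_in_Top (S : choiceType) :
  in_Top R h (discrete_topology S : topologicalType).
Proof.
split=> [A _|_]; first exact: discrete_open.
rewrite /delta_hausdorff -openC kelley_open => n u cu.
pose A x : set (discrete_topology S) := [set x].
rewrite (_ : _ @^-1` _ = \bigcup_(xy in [set xy : S * S | xy.1 <> xy.2])
    (u @^-1` ((fst @^-1` A xy.1) `&` (snd @^-1` A xy.2)))); last first.
  apply/seteqP; split => [t /= tne|t [[x y] /= xy [/= -> ->]]] //.
  by exists (u t) => //=; split.
apply: bigcup_open => -[x y] _; move/continuousP : cu; apply; apply: openI.
  by apply: open_comp => [z _|]; [exact: cvg_fst|exact: discrete_open].
by apply: open_comp => [z _|]; [exact: cvg_snd|exact: discrete_open].
Qed.

Definition discrete_space (S : choiceType) : space R h :=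
  Space (discrete_in_Top S).

Definition dset (S : choiceType) : mdspace R h.
Proof.
refine (@MdSpace R h (discrete_space S) setT set0 _ _ _ _ _) => //.
Defined.

Definition dset_map (S S' : choiceType) (f : S -> S') : mdmap (dset S) (dset S').
Proof.
refine (@MdMap R h (dset S) (dset S') f _ _ _) => //.
by apply/continuousP => A _; exact: discrete_open.
Defined.

Definition empty_map (X : mdspace R h) : mdmap (dset void) X.
Proof.
refine (@MdMap R h (dset void) X (fun x : void => match x with end) _ _ _) => //.
Defined.

Section Globe.
Variable Z : topologicalType.

Definition globe_part (b : bool) : topologicalType :=
  if b then kprod R Z I else discrete_topology bool.

Definition preglobe : topologicalType := {b : bool & globe_part b}.

(* The points 0 and 1 of the globe are [false] and [true]. *)
Definition pole (b : bool) : preglobe := existT globe_part false b.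
Definition inside (z : Z) (t : I) : preglobe := existT globe_part true (z, t).

Definition globe_rel (x y : preglobe) : Prop := exists z : Z,
  (x = inside z i0 /\ y = pole false) \/ (x = inside z i1 /\ y = pole true).

Lemma part_continuous b : continuous (existT globe_part b : _ -> preglobe).
Proof. exact: (@existT_continuous bool globe_part b). Qed.

Lemma preglobe_delta : delta_generated R preglobe.
Proof.
move=> A dA; apply/sigT_openP => -[].
  apply: (@kelley_delta R (Z * I)%type) => n u cu.
  apply: (dA n (fun x => existT globe_part true (u x) : preglobe)).
  exact: (comp_continuous cu (@part_continuous true)).
exact: discrete_open.
Qed.

Lemma globe_in_Top : in_Top R h (topquot R h globe_rel).
Proof. exact: (topquot_in_Top _ _ preglobe_delta). Qed.

Definition globe_space : space R h := Space globe_in_Top.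

Definition globe_pi : preglobe -> globe_space := @topquot_pi R h _ globe_rel.

Definition globe_path (z : Z) (phi : I -> I) : I -> globe_space :=
  fun t => globe_pi (inside z (phi t)).

Lemma globe_path0 z phi : reparametrization phi ->
  globe_path z phi i0 = globe_pi (pole false).
Proof.
move=> rphi; rewrite /globe_path reparam0 //; apply: topquot_pi_eq.
by exists z; left.
Qed.

Lemma globe_path1 z phi : reparametrization phi ->
  globe_path z phi i1 = globe_pi (pole true).
Proof.
move=> rphi; rewrite /globe_path reparam1 //; apply: topquot_pi_eq.
by exists z; right.
Qed.

Lemma globe_path_continuous z phi : reparametrization phi ->
  continuous (globe_path z phi).
Proof.
move=> /reparam_continuous cphi.
have c1 : continuous (fun t : I => (z, phi t) : kprod R Z I).
  apply: kpair_continuous => //; first exact: unit_interval_delta.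
  exact: cst_continuous.
have c2 := @part_continuous true.
have c3 := @topquot_pi_continuous R h _ globe_rel.
exact: (comp_continuous (comp_continuous c1 c2) c3).
Qed.

Lemma poles_neq : globe_pi (pole false) <> globe_pi (pole true).
Proof.
pose D : topologicalType := I.
have DT : in_Top R h D.
  split=> [|_]; first exact: unit_interval_delta.
  rewrite /delta_hausdorff (_ : [set _ | _] =
    (fun x : kprod R D D => set_val x.1 - set_val x.2 : R) @^-1` [set 0]).
    apply: closed_comp => [x _|]; last exact: closed_eq.
    apply: (@continuousB R R^o (kprod R D D)).
      apply: (comp_continuous (@kfst_continuous R D D)).
      exact: (@set_val_continuous R `[0, 1]%classic).
    apply: (comp_continuous (@ksnd_continuous R D D)).
    exact: (@set_val_continuous R `[0, 1]%classic).
  apply/seteqP; split => -[x y] /= => [->|/eqP]; first by rewrite subrr.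
  by rewrite subr_eq0 => /eqP; exact: val_inj.
pose f (x : preglobe) : D := match x with
  | existT b y => (if b return globe_part b -> D then fun y => y.2
                   else fun y => if y then i1 else i0) y end.
have cf : continuous f.
  apply/continuousP => A oA; apply/sigT_openP => -[]; last exact: discrete_open.
  exact: (continuousP _).1 (@ksnd_continuous R Z D) _ oA.
have rf x y : globe_rel x y -> f x = f y.
  by move=> [z [[-> ->]|[-> ->]]].
move=> /(topquot_factor DT cf rf) /(congr1 set_val) /=.
by rewrite set_val_i0 set_val_i1 => /esym/eqP; rewrite oner_eq0.
Qed.

Definition globe : mdspace R h.
Proof.
refine (@MdSpace R h globe_space (range (globe_pi \o pole))
  [set g | exists z phi, reparametrization phi /\ g = globe_path z phi]
  _ _ _ _ _).
- by move=> _ [z [phi [rphi ->]]]; exact: globe_path_continuous.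
- by move=> _ [z [phi [rphi ->]]]; exists false => //=; rewrite globe_path0.
- by move=> _ [z [phi [rphi ->]]]; exists true => //=; rewrite globe_path1.
- move=> _ psi [z [phi [[mphi sphi] ->]]] [mpsi spsi].
  exists z, (phi \o psi); split => //; split => [s t st|t] /=.
    exact/mphi/mpsi.
  by have [s <-] := sphi t; have [s' <-] := spsi s; exists s'.
- move=> _ _ [z [phi [rphi ->]]] [z' [phi' [rphi' ->]]].
  by rewrite globe_path1 // globe_path0 // => /esym/poles_neq.
Defined.

End Globe.

Section GlobeMap.
Variables (Z Z' : topologicalType) (f : Z -> Z') (cf : continuous f).

Definition preglobe_map (x : preglobe Z) : preglobe Z' :=
  match x with
  | existT b y => (if b return globe_part Z b -> preglobe Z'
                   then fun y => inside (f y.1) y.2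
                   else fun b => pole Z' b) y
  end.

Definition globe_map_fun (x : globe_space Z) : globe_space Z' :=
  globe_pi (preglobe_map (@topquot_repr R h _ (@globe_rel Z) x)).

Lemma preglobe_map_continuous :
  continuous (fun x => globe_pi (preglobe_map x)).
Proof.
apply: (@comp_continuous _ _ _ preglobe_map); last exact: topquot_pi_continuous.
apply/continuousP => A oA; apply/sigT_openP => -[]; last exact: discrete_open.
have c1 : continuous (fun y : kprod R Z I => (f y.1, y.2) : kprod R Z' I).
  apply: kpair_continuous; first exact: kelley_delta.
    exact: (comp_continuous (@kfst_continuous R Z I) cf).
  exact: ksnd_continuous.
have c2 := @part_continuous Z' true.
exact: ((continuousP _).1 (comp_continuous c1 c2) _ oA).
Qed.

Lemma globe_map_funE x :
  globe_map_fun (globe_pi x) = globe_pi (preglobe_map x).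
Proof.
have r_compat y y' : @globe_rel Z y y' ->
    globe_pi (preglobe_map y) = globe_pi (preglobe_map y').
  by move=> [z [[-> ->]|[-> ->]]]; apply: topquot_pi_eq; exists (f z); [left|right].
apply: (topquot_factor (globe_in_Top Z') preglobe_map_continuous r_compat).
exact: topquot_reprK.
Qed.

Lemma globe_map_continuous : continuous globe_map_fun.
Proof.
apply: (@topquot_continuous R h _ (@globe_rel Z)).
rewrite (_ : _ \o _ = fun x => globe_pi (preglobe_map x)).
  exact: preglobe_map_continuous.
by apply/funext => x; exact: globe_map_funE.
Qed.

Definition globe_map : mdmap (globe Z) (globe Z').
Proof.
refine (@MdMap R h (globe Z) (globe Z') globe_map_fun globe_map_continuous _ _).
- by move=> _ [b _ <-]; exists b => //=; rewrite globe_map_funE.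
- move=> _ [z [phi [rphi ->]]]; exists (f z), phi; split => //.
  by apply/funext => t /=; rewrite globe_map_funE.
Defined.

End GlobeMap.

Lemma sphere_disk_continuous n : continuous (@sphere_disk R n).
Proof.
exact: (@continuous_to_sub _ _ _ (@sphere_disk R n)
  (@set_val_continuous _ [set x : 'rV[R]_n | \sum_i x 0 i ^+ 2 = 1])).
Qed.

Inductive generating_cofibration : mor_class (MdTop R h) :=
| gen_globe n : @generating_cofibration (globe (sphere R n)) (globe (disk R n))
    (globe_map (@sphere_disk_continuous n))
| gen_C : @generating_cofibration (dset void) (dset unit)
    (dset_map (fun x : void => match x with end))
| gen_R : @generating_cofibration (dset bool) (dset unit)
    (dset_map (fun=> tt)).

Definition cellular (X : MdTop R h) :=
  @cell (MdTop R h) generating_cofibration (dset void) X (empty_map X).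

Definition qcofibrant (X : MdTop R h) :=
  @cof (MdTop R h) generating_cofibration (dset void) X (empty_map X).

Definition globular_subdivision (X Y : MdTop R h) (f : mdmap X Y) :=
  [/\ cellular X, cellular Y & exists g : underlying Y -> underlying X,
    [/\ continuous g, cancel f g & cancel g f]].

End Globes.

Section Homotopy.
Variable R : realType.
Local Notation I := (unit_interval R).
Implicit Types A B : topologicalType.

Definition homotopic A B (f g : A -> B) :=
  exists H : kprod R A I -> B, [/\ continuous H,
    forall a, H (a, i0) = f a & forall a, H (a, i1) = g a].

Definition homotopy_equivalent A B :=
  exists (f : A -> B) (g : B -> A), [/\ continuous f, continuous g,
    homotopic (g \o f) idfun & homotopic (f \o g) idfun].

Definition path_connected A (a b : A) :=
  exists g : I -> A, [/\ continuous g, g i0 = a & g i1 = b].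

Definition cube_boundary n (x : cube R n) :=
  exists i, set_val x 0 i = 0 \/ set_val x 0 i = 1.

(* Maps of pairs from (cube, boundary) to [(A, a)], and homotopies between them
   relative to the boundary: the elements of the homotopy groups of [(A, a)]. *)
Definition spheroid n A (a : A) (u : cube R n -> A) :=
  continuous u /\ forall x, cube_boundary x -> u x = a.

Definition homotopic_rel n A (u v : cube R n -> A) :=
  exists H : cube R n * I -> A, [/\ continuous H,
    forall x, H (x, i0) = u x, forall x, H (x, i1) = v x &
    forall x t, cube_boundary x -> H (x, t) = u x].

Definition weak_homotopy_equivalence A B (f : A -> B) :=
  [/\ continuous f,
    (forall b, exists a, path_connected (f a) b),
    (forall a a', path_connected (f a) (f a') -> path_connected a a') &
    forall n (a : A),
      (forall v, @spheroid n.+1 B (f a) v ->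
         exists2 u, spheroid a u & homotopic_rel (f \o u) v) /\
      (forall u u', @spheroid n.+1 A a u -> spheroid a u' ->
         homotopic_rel (f \o u) (f \o u') -> homotopic_rel u u')].

End Homotopy.

Section UnderlyingHomotopyType.
Variables (R : realType) (h : bool).

Definition flow_weak_equivalence : mor_class (FlowCat R h) :=
  fun F G (f : flowmap F G) => bijective (fm_state f) /\
    forall a b, weak_homotopy_equivalence R (@fm_path _ _ _ _ f a b).

(* Isomorphism in the homotopy category of flows. *)
Definition ho_isomorphic (F G : flow R h) :=
  @localization_isomorphic (FlowCat R h) flow_weak_equivalence F G.

(* The homotopy type of the spaces |Z|, for Z q-cofibrant with L cat (Z)
   isomorphic to [F], as a class of spaces modulo homotopy equivalence; the left
   derived functor of cat is cat itself on q-cofibrant objects. *)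
Definition underlying_homotopy_type (F : flow R h) : space R h -> Prop :=
  fun T => exists Z : mdspace R h,
    [/\ qcofibrant Z, ho_isomorphic (cat_flow Z) F &
        homotopy_equivalent R (underlying Z) T].

End UnderlyingHomotopyType.

(* Main.v *)
(* The idea is to recover a q-cofibrant multipointed d-space Z, up to homotopy, from the
   flow cat Z. To a flow H one associates a multipointed d-space E(H) whose execution paths
   deform continuously onto those of H; a point of E(H) remembers, for every level below
   its height, the piece of execution path around it that lies above this level. Weak
   equivalences of flows then induce weak equivalences of the spaces of execution paths of
   E, so that zigzags of flows act on the homotopy classes of maps W -> E(-) with W
   q-cofibrant. The space A(Z) of compatible pairs in Z * E(cat Z) projects to Z by a weak
   equivalence; hence Z is a retract up to homotopy of A(Z), which yields a natural
   parametrization of the execution paths of Z, the paths of Z deform onto those of cat Z,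
   and A(Z) also projects to E(cat Z) by a weak equivalence. Maps W -> Z are therefore the
   same, up to homotopy, as maps W -> E(cat Z), and by the Yoneda lemma an isomorphism
   between cat Z and cat Z' in the homotopy category comes from a homotopy equivalence
   between Z and Z'. As cellular objects are q-cofibrant, the underlying homotopy type of
   cat X is that of |X|, and |X| is homeomorphic to |Y|. *)
From HB Require Import structures.
From mathcomp Require Import all_boot all_order all_algebra.
From mathcomp Require Import all_classical all_reals.
From mathcomp Require Import topology normedtype realfun.
From mathcomp Require Import lra.
Require Import Defs.

Set Implicit Arguments.
Unset Strict Implicit.
Unset Printing Implicit Defensive.

Import Order.TTheory GRing.Theory Num.Theory.
Import numFieldNormedType.Exports.

Local Open Scope classical_set_scope.
Local Open Scope ring_scope.

(** * Continuity and test spaces *)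

Section TestSpaces.
Variable R : realType.
Implicit Types S T U : topologicalType.

(** The obstacle is that a flow keeps execution paths only modulo [reparametrization], whose
    elements may be constant on intervals, so that no continuous choice of representatives is at
    hand. The remedy is a clock that depends on points alone: the lengths in a reading say how long
    it runs on either side, and the paths of A(Z) are required to be divisible by it. Readings are
    indexed by levels because a concatenation must deform into a single path labelled by the
    composite: while the height at the junction rises from 0 to 1, the levels below it already read
    the composite and the levels above it still read the two factors. Labels and clock change at
    height 1 only, so stretches of smaller height may be cut off or attached freely. Weak
    equivalences enter through the relative lifting property [star], which is inherited along
    deformations, and cofibrancy enters as lifting against the generating cofibrations; the homotopy
    pullback [pull] turns a weak equivalence into a map with the matching right lifting property. *)

Lemma paste_at S T (g : S -> R) (r : R) (f1 f2 : S -> T) x : continuous_at x g ->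
  (g x <= r -> continuous_at x f1) -> (r <= g x -> continuous_at x f2) ->
  (g x = r -> f1 x = f2 x) ->
  continuous_at x (fun x => if g x <= r then f1 x else f2 x).
Proof.
move=> cg c1 c2 e12 A /= nA.
have N1 : g x <= r -> nbhs x [set y | A (f1 y)].
  by move=> gx; apply: (c1 gx A); move: nA; rewrite gx.
have N2 : r <= g x -> nbhs x [set y | A (f2 y)].
  move=> gx; apply: (c2 gx A); move: nA; case: ifP => // gx'.
  by rewrite e12 //; apply/eqP; rewrite eq_le gx gx'.
change (nbhs x [set y | A (if g y <= r then f1 y else f2 y)]).
have [gx|gx|gx] := ltgtP (g x) r.
- have lt : nbhs x [set y | g y < r].
    by apply: (cg [set v | v < r]); exact: lt_nbhsl.
  apply: filterS (filterI lt (N1 (ltW gx))) => y [/= gy].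
  by rewrite (ltW gy).
- have lt : nbhs x [set y | r < g y].
    by apply: (cg [set v | r < v]); apply: open_nbhs_nbhs; split => //; exact: open_gt.
  apply: filterS (filterI lt (N2 (ltW gx))) => y [/= gy].
  by rewrite leNgt gy.
- have gx1 : g x <= r by rewrite gx.
  have gx2 : r <= g x by rewrite gx.
  by apply: filterS (filterI (N1 gx1) (N2 gx2)) => y [/= ? ?]; case: ifP.
Qed.

Lemma paste S T (g : S -> R) (r : R) (f1 f2 : S -> T) : continuous g ->
  (forall x, g x <= r -> continuous_at x f1) ->
  (forall x, r <= g x -> continuous_at x f2) ->
  (forall x, g x = r -> f1 x = f2 x) ->
  continuous (fun x => if g x <= r then f1 x else f2 x).
Proof.
by move=> cg c1 c2 e12 x; apply: paste_at; [exact: cg|exact: c1|exact: c2|exact: e12].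
Qed.

Lemma comp_cont_at S T U (f : S -> T) (g : T -> U) x :
  continuous_at x f -> continuous_at (f x) g ->
  continuous_at x (fun y => g (f y)).
Proof. by move=> cf cg; apply: (@continuous_comp _ _ _ f g). Qed.

Lemma eq_near_continuous S T (f g : S -> T) x :
  (\forall y \near x, f y = g y) -> continuous_at x f ->
  continuous_at x g.
Proof.
move=> fg cf A /= nA; have fgx := nbhs_singleton fg.
rewrite -fgx in nA; change (nbhs x [set y | A (g y)]).
have nf : nbhs x [set y | A (f y)] by exact: cf.
by apply: filterS (filterI fg nf) => y [/= ->].
Qed.

Lemma eq_cont S T (g f : S -> T) : (forall x, f x = g x) ->
  continuous g -> continuous f.
Proof. by move=> /funext ->. Qed.

Section ContinuityRules.
Variables (T : topologicalType) (x : T).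

Lemma ct_cst U (c : U) : continuous_at x (fun _ : T => c).
Proof. exact: cst_continuous. Qed.
Lemma ct_id : continuous_at x (fun y : T => y).
Proof. exact: cvg_id. Qed.
Lemma ct_add (V : normedModType R) (f g : T -> V) : continuous_at x f ->
  continuous_at x g -> continuous_at x (fun y => f y + g y).
Proof. exact: continuousD. Qed.
Lemma ct_opp (V : normedModType R) (f : T -> V) : continuous_at x f ->
  continuous_at x (fun y => - f y).
Proof. exact: continuousN. Qed.
Lemma ct_scale (V : normedModType R) (f : T -> R) (g : T -> V) :
  continuous_at x f -> continuous_at x g ->
  continuous_at x (fun y => f y *: g y).
Proof. by move=> cf cg; apply: cvgZ. Qed.
Lemma ct_addR (f g : T -> R) : continuous_at x f ->
  continuous_at x g -> continuous_at x (fun y => f y + g y).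
Proof. exact: (@continuousD R R^o). Qed.
Lemma ct_oppR (f : T -> R) : continuous_at x f ->
  continuous_at x (fun y => - f y).
Proof. exact: (@continuousN R R^o). Qed.
Lemma ct_mulR (f g : T -> R) : continuous_at x f ->
  continuous_at x g -> continuous_at x (fun y => f y * g y).
Proof. exact: continuousM. Qed.
Lemma ct_invR (f : T -> R) : f x != 0 -> continuous_at x f ->
  continuous_at x (fun y => (f y)^-1).
Proof. exact: continuousV. Qed.
Lemma ct_max (f g : T -> R) : continuous_at x f ->
  continuous_at x g -> continuous_at x (fun y => Order.max (f y) (g y)).
Proof. exact: (@continuous_max R T f g). Qed.
Lemma ct_min (f g : T -> R) : continuous_at x f ->
  continuous_at x g -> continuous_at x (fun y => Order.min (f y) (g y)).
Proof. exact: (@continuous_min R T f g). Qed.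
Lemma ct_norm (V : normedModType R) (f : T -> V) : continuous_at x f ->
  continuous_at x (fun y => `|f y|).
Proof. by move=> cf; apply: (@continuous_comp _ _ _ f); last exact: norm_continuous. Qed.
Lemma ct_fst U1 U2 (f : T -> U1 * U2) : continuous_at x f ->
  continuous_at x (fun y => (f y).1).
Proof. by move=> cf; apply: (@continuous_comp _ _ _ f); last exact: fst_continuous. Qed.
Lemma ct_snd U1 U2 (f : T -> U1 * U2) : continuous_at x f ->
  continuous_at x (fun y => (f y).2).
Proof. by move=> cf; apply: (@continuous_comp _ _ _ f); last exact: snd_continuous. Qed.
Lemma ct_pair U1 U2 (f : T -> U1) (g : T -> U2) : continuous_at x f ->
  continuous_at x g -> continuous_at x (fun y => (f y, g y)).
Proof. by move=> cf cg; apply: cvg_pair. Qed.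
Lemma ct_coord n (f : T -> 'rV[R]_n) i : continuous_at x f ->
  continuous_at x (fun y => f y 0 i).
Proof.
by move=> cf; apply: (@continuous_comp _ _ _ f (fun z => z 0 i)); last exact: coord_continuous.
Qed.
Lemma ct_val U (A : set U) (f : T -> set_type A) : continuous_at x f ->
  continuous_at x (fun y => set_val (f y)).
Proof.
move=> cf; apply: (@continuous_comp _ (set_type A : topologicalType) _ f set_val x) => //.
exact: set_val_continuous.
Qed.
Lemma ct_proj_unit (f : T -> R) : continuous_at x f ->
  continuous_at x (fun y => proj_unit (f y)).
Proof.
by move=> cf; apply: (@continuous_comp _ _ _ f); last exact: proj_unit_continuous.
Qed.
Lemma ct_app U (V : topologicalType) (g : U -> V) (f : T -> U) : continuous g -> continuous_at x f ->
  continuous_at x (fun y => g (f y)).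
Proof. by move=> cg cf; apply: (@continuous_comp _ _ _ f g); last exact: cg. Qed.

End ContinuityRules.
End TestSpaces.

Ltac ct1 := lazymatch goal with
  | |- _ = _ -> _ => fail
  | |- forall _, _ => intro
  | |- continuous_at _ (fun _ => ?c) => exact: ct_cst
  | |- continuous_at _ (fun y => y) => exact: ct_id
  | |- continuous_at _ (fun y => @GRing.add _ (@?f y) (@?g y)) =>
      first [refine (@ct_addR _ _ _ f g _ _) | refine (@ct_add _ _ _ _ f g _ _)]
  | |- continuous_at _ (fun y => @GRing.opp _ (@?f y)) =>
      first [refine (@ct_oppR _ _ _ f _) | refine (@ct_opp _ _ _ _ f _)]
  | |- continuous_at _ (fun y => @GRing.mul _ (@?f y) (@?g y)) =>
      refine (@ct_mulR _ _ _ f g _ _)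
  | |- continuous_at _ (fun y => @GRing.scale _ _ (@?f y) (@?g y)) =>
      refine (@ct_scale _ _ _ _ f g _ _)
  | |- continuous_at _ (fun y => @GRing.inv _ (@?f y)) =>
      refine (@ct_invR _ _ _ f _ _)
  | |- continuous_at _ (fun y => @Order.max _ _ (@?f y) (@?g y)) =>
      refine (@ct_max _ _ _ f g _ _)
  | |- continuous_at _ (fun y => @Order.min _ _ (@?f y) (@?g y)) =>
      refine (@ct_min _ _ _ f g _ _)
  | |- continuous_at _ (fun y => Num.norm (@?f y)) =>
      first [refine (@ct_norm _ _ _ _ f _) | refine (@ct_norm _ _ _ _^o f _)]
  | |- continuous_at _ (fun y => fst (@?f y)) => refine (@ct_fst _ _ _ _ f _)
  | |- continuous_at _ (fun y => snd (@?f y)) => refine (@ct_snd _ _ _ _ f _)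
  | |- continuous_at _ fst => exact: fst_continuous
  | |- continuous_at _ snd => exact: snd_continuous
  | |- continuous_at _ (fun y => pair (@?f y) (@?g y)) =>
      refine (@ct_pair _ _ _ _ f g _ _)
  | |- continuous_at _ (fun y => fun_of_matrix (@?f y) _ ?i) =>
      refine (@ct_coord _ _ _ _ f i _)
  | |- continuous_at _ (fun y => set_val (@?f y)) =>
      refine (@ct_val _ _ _ _ f _)
  | |- continuous_at _ (fun y => proj_unit (@?f y)) =>
      refine (@ct_proj_unit _ _ _ f _)
  | H : continuous ?g |- continuous_at _ (fun y => ?g (@?f y)) =>
      refine (@ct_app _ _ _ _ g f H _)
  | H : continuous ?f |- continuous_at _ ?f => exact: H
  | H : forall x, continuous_at x ?f |- continuous_at _ ?f => exact: H
  | |- _ => assumption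
  end.
Ltac ct := repeat ct1.

Section TestSpaces2.
Variable R : realType.
Implicit Types S T U : topologicalType.

(** * Clamping to the unit ball and local retractions *)

Section Clamp.
Variable W : normedModType R.

Definition clamp (x : W) : W := (Order.max 1 `|x|)^-1 *: x.

Lemma max1_gt0 (r : R) : 0 < Order.max 1 r.
Proof. by rewrite lt_max ltr01. Qed.

Lemma norm_clamp_le x : `|clamp x| <= 1.
Proof.
rewrite normrZ gtr0_norm ?invr_gt0 ?max1_gt0 //.
by rewrite mulrC ler_pdivrMr ?max1_gt0 // mul1r le_max lexx orbT.
Qed.

Lemma clamp_id x : `|x| <= 1 -> clamp x = x.
Proof. by move=> x1; rewrite /clamp max_l // invr1 scale1r. Qed.

Lemma norm_clamp x : 1 <= `|x| -> `|clamp x| = 1.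
Proof.
move=> x1; rewrite normrZ gtr0_norm ?invr_gt0 ?max1_gt0 // max_r //.
by rewrite mulVf // gt_eqF // (lt_le_trans ltr01).
Qed.

Lemma clamp_continuous : continuous clamp.
Proof.
by move=> x; rewrite /clamp; ct; rewrite gt_eqF ?max1_gt0.
Qed.

Definition nrm (x : W) : W := `|x|^-1 *: x.

Lemma clamp_nrm x : 1 <= `|x| -> clamp x = nrm x.
Proof. by move=> x1; rewrite /clamp max_r. Qed.

Lemma norm_nrm x : x != 0 -> `|nrm x| = 1.
Proof. by move=> x0; rewrite normrZ normfV normr_id mulVf // normr_eq0. Qed.

Lemma nrm_id x : `|x| = 1 -> nrm x = x.
Proof. by rewrite /nrm => ->; rewrite invr1 scale1r. Qed.

Lemma nrm_scale (r : R) x : 0 < r -> nrm (r *: x) = nrm x.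
Proof.
move=> r0; rewrite /nrm normrZ gtr0_norm // scalerA invfM -mulrA mulrC -mulrA.
by rewrite mulfV ?mulr1 // gt_eqF.
Qed.

Lemma nrm_continuous x : x != 0 -> continuous_at x nrm.
Proof.
by move=> x0; rewrite /nrm; ct; rewrite normr_eq0.
Qed.

Lemma norm1_neq0 (x : W) : `|x| = 1 -> x != 0.
Proof. by move=> x1; rewrite -normr_eq0 x1 oner_eq0. Qed.

Lemma norm_ge_neq0 (r : R) (x : W) : 0 < r -> r <= `|x| -> x != 0.
Proof. by move=> r0 rx; rewrite -normr_gt0 (lt_le_trans r0). Qed.

(* A continuous self-map with values in a prescribed neighbourhood of [x0], equal to the
   identity near [x0]; it makes local constructions global. *)
Lemma local_retraction (x0 : W) (O : set W) : nbhs x0 O ->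
  exists rho : W -> W, [/\ continuous rho, forall x, O (rho x) &
    exists2 e : R, 0 < e & forall x, `|x - x0| <= e -> rho x = x].
Proof.
move=> /nbhs_ballP[e /= e0 eO].
have e2 : 0 < e / 2 by rewrite divr_gt0.
pose rho x := x0 + (e / 2) *: clamp ((e / 2)^-1 *: (x - x0)).
exists rho; split.
- by have cc := clamp_continuous; move=> z; rewrite /rho; ct.
- move=> x; apply: eO; rewrite -ball_normE /= /rho opprD addrA subrr sub0r normrN.
  rewrite normrZ gtr0_norm // (@le_lt_trans _ _ (e / 2)) //.
    by rewrite -[leRHS]mulr1 ler_pM2l // norm_clamp_le.
  by rewrite ltr_pdivrMr // ltr_pMr // ltr1n.
- exists (e / 2) => // x xe; rewrite /rho clamp_id.
    by rewrite scalerA mulfV ?scale1r ?gt_eqF // addrC subrK.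
  rewrite normrZ normfV gtr0_norm // mulrC ler_pdivrMr //.
  by rewrite mul1r.
Qed.

End Clamp.

Section SimplexRetraction.
Variable n : nat.

Let pos (x : 'rV[R]_n.+1) (i : 'I_n.+1) : R := Order.max 0 (x 0 i).
Let psum (x : 'rV[R]_n.+1) : R := \sum_i pos x i.
(** The positive part rescaled to sum 1. Mass missing below 1/2 is added at vertex 0, which keeps
    the denominator away from 0 without moving the points of the simplex. *)
Let ret (x : 'rV[R]_n.+1) : 'rV[R]_n.+1 :=
  \row_j ((pos x j + (if j == 0 then Order.max 0 (2^-1 - psum x) else 0)) /
          Order.max 2^-1 (psum x)).

Let retP x : (forall i, 0 <= ret x 0 i) /\ \sum_i ret x 0 i = 1.
Proof.
have m0 a : 0 < Order.max 2^-1 a :> R by rewrite lt_max invr_gt0 ltr0n.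
split=> [i|].
  rewrite mxE divr_ge0 ?(ltW (m0 _)) // addr_ge0 //; first by rewrite le_max lexx.
  by case: ifP => // _; rewrite le_max lexx.
under eq_bigr do rewrite mxE.
rewrite -mulr_suml big_split /= -(@big_mkcond _ _ _ _ _ (fun j => j == 0) (fun=> Order.max 0 (2^-1 - psum x))) big_pred1_eq -/(psum x).
suff -> : psum x + Order.max 0 (2^-1 - psum x) = Order.max 2^-1 (psum x).
  by rewrite divff // gt_eqF.
by case: (leP (psum x) 2^-1) => h; [rewrite max_r ?subr_ge0 // addrC subrK|
  rewrite max_l ?addr0 // subr_le0 ltW].
Qed.

Definition to_simplex (x : 'rV[R]_n.+1) : simplex R n :=
  SigSub (mem_set (retP x)).

Lemma to_simplex_id (x : 'rV[R]_n.+1) : (forall i, 0 <= x 0 i) ->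
  \sum_i x 0 i = 1 -> set_val (to_simplex x) = x.
Proof.
move=> x0 x1; have px i : pos x i = x 0 i by rewrite /pos max_r.
have ps : psum x = 1 by rewrite /psum; under eq_bigr do rewrite px.
have h : (2^-1 : R) <= 1 by lra.
apply/rowP => j; rewrite [LHS]mxE ps px (max_r h) divr1 max_l ?if_same ?addr0 //.
by rewrite subr_le0.
Qed.

Lemma to_simplexK (s : simplex R n) : to_simplex (set_val s) = s.
Proof.
by apply: val_inj; have [s0 s1] := set_valP s; exact: to_simplex_id.
Qed.

Lemma to_simplex_continuous : continuous to_simplex.
Proof.
apply: continuous_to_sub; apply: continuous_to_rV => j.
have cc i : continuous (fun x : 'rV[R]_n.+1 => pos x i).
  by rewrite /pos; ct.
have cs : continuous psum by exact: coord_sum_continuous.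
apply: (eq_cont (g := fun x =>
   ((pos x j + (if j == 0 then Order.max 0 (2^-1 - psum x) else 0)) *
          (Order.max 2^-1 (psum x))^-1))); first by move=> x; rewrite mxE.
by case: (j == 0); ct; rewrite ?gt_eqF // lt_max invr_gt0 ltr0n.
Qed.

End SimplexRetraction.

Lemma coord_le_norm n (x : 'rV[R]_n) i : `|x 0 i| <= `|x|.
Proof.
rewrite [leRHS]/Num.norm /= mx_normrE.
exact: (le_bigmax _ (fun i : 'I_1 * 'I_n => `|x i.1 i.2|) (0, i)).
Qed.

Lemma norm_le_coord n (x : 'rV[R]_n) r : 0 <= r ->
  (forall i, `|x 0 i| <= r) -> `|x| <= r.
Proof.
move=> r0 xr; rewrite /Num.norm /= mx_normrE; apply/bigmax_leP; split => // -[i j] _.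
by rewrite /= (ord1 i).
Qed.

(** The affine map [u] sends the barycentre of the simplex to [x0] and [v] inverts it; [to_simplex]
    makes the composite defined everywhere. On the ball of radius [n.+1%:R^-1] around [x0] all
    barycentric coordinates given by [v] are nonnegative, so [u] undoes [to_simplex \o v] there. *)
Lemma rV_delta n : delta_generated R 'rV[R]_n.
Proof.
move=> A dA; rewrite openE => x0 Ax0; rewrite /interior.
pose u (s : simplex R n) : 'rV[R]_n :=
  \row_i (x0 0 i + n.+1%:R * set_val s 0 (lift ord0 i) - 1).
pose v (y : 'rV[R]_n) : 'rV[R]_n.+1 := \row_j
  (if unlift ord0 j is Some i then (y 0 i - x0 0 i + 1) / n.+1%:R
   else 1 - \sum_i ((y 0 i - x0 0 i + 1) / n.+1%:R)).
have n0 : 0 < n.+1%:R :> R by rewrite ltr0n.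
have cu : continuous u.
  apply: continuous_to_rV => i.
  apply: (eq_cont (g := fun s : simplex R n => x0 0 i + n.+1%:R * set_val s 0 (lift ord0 i) - 1)).
    by move=> s; rewrite mxE.
  by ct.
have ce i : continuous (fun y : 'rV[R]_n => (y 0 i - x0 0 i + 1) / n.+1%:R).
  by ct.
have cv : continuous v.
  apply: continuous_to_rV => j; case: (unliftP ord0 j) => [i|] ->.
    apply: (eq_cont (g := fun y : 'rV[R]_n => (y 0 i - x0 0 i + 1) / n.+1%:R)) => //.
    by move=> y; rewrite mxE liftK.
  apply: (eq_cont (g := fun y : 'rV[R]_n =>
    1 - \sum_i ((y 0 i - x0 0 i + 1) / n.+1%:R))).
    by move=> y; rewrite mxE unlift_none.
  have cs := coord_sum_continuous ce; by ct.
have uv (y : 'rV[R]_n) : `|y - x0| <= n.+1%:R^-1 -> u (to_simplex (v y)) = y.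
  move=> yx; have yi i : `|y 0 i - x0 0 i| <= n.+1%:R^-1.
    by apply: le_trans yx; have := coord_le_norm (y - x0) i; rewrite !mxE.
  have n1 : n.+1%:R^-1 <= 1 :> R by rewrite invf_le1 // ler1n.
  have v0 i : 0 <= (y 0 i - x0 0 i + 1) / n.+1%:R.
    rewrite divr_ge0 ?(ltW n0) //; have := yi i.
    by rewrite ler_norml => /andP[h1 h2]; move: n1 h1 h2; set N := _^-1 : R; lra.
  have vi i : (y 0 i - x0 0 i + 1) / n.+1%:R <= n.+1%:R^-1 + n.+1%:R^-1 / n.+1%:R.
    rewrite mulrDl mul1r addrC lerD2l ler_pM2r ?invr_gt0 //.
    by have := yi i; rewrite ler_norml => /andP[].
  have vy0 j : 0 <= v y 0 j.
    rewrite mxE; case: (unliftP ord0 j) => [i|] _ //.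
    rewrite subr_ge0; apply: (@le_trans _ _ (\sum_(i < n) (n.+1%:R^-1 + n.+1%:R^-1 / n.+1%:R))).
      by apply: ler_sum => i _; exact: vi.
    rewrite sumr_const card_ord -(mulr_natl (_ + _) n).
    set N := n.+1%:R^-1 : R.
    have N0 : 0 < N by rewrite invr_gt0.
    have NN : n.+1%:R * N = 1 by rewrite mulfV ?gt_eqF.
    have nE : n%:R = n.+1%:R - 1 :> R by rewrite mulrSr addrK.
    rewrite nE mulrBl mul1r mulrDr mulrA NN mul1r.
    by have := mulr_gt0 N0 N0; lra.
  have vy1 : \sum_j v y 0 j = 1.
    have vl i : v y 0 (lift ord0 i) = (y 0 i - x0 0 i + 1) / n.+1%:R.
      by rewrite mxE liftK.
    by rewrite big_ord_recl (eq_bigr _ (fun i _ => vl i)) mxE unlift_none subrK.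
  rewrite /u to_simplex_id //; apply/rowP => i.
  by rewrite !mxE liftK mulrCA mulfV ?gt_eqF //; lra.
have oB : open ((@to_simplex n \o v) @^-1` (u @^-1` A)).
  apply: open_comp => [x _|]; last exact: dA.
  exact: (comp_continuous cv (@to_simplex_continuous n)).
have nB : nbhs x0 ((@to_simplex n \o v) @^-1` (u @^-1` A)).
  apply: open_nbhs_nbhs; split => //=; rewrite uv // subrr normr0.
  by rewrite invr_ge0 ltW.
have nE : nbhs x0 [set y | `|y - x0| <= n.+1%:R^-1].
  apply/nbhs_ballP; exists n.+1%:R^-1 => /=; first by rewrite invr_gt0.
  by move=> y; rewrite -ball_normE /= distrC => /ltW.
by apply: filterS (filterI nB nE) => y [/= + yE]; rewrite uv.
Qed.

(** A plot on a simplex extends to the ambient vector space along the retraction [to_simplex].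
    Testing on whole vector spaces spares all restrictions to subspaces later on. *)
Lemma rV_test T U (f : T -> U) : delta_generated R T ->
  (forall n (u : 'rV[R]_n -> T), continuous u -> continuous (f \o u)) ->
  continuous f.
Proof.
move=> dT cf; apply: (delta_gen_continuous dT) => n u cu.
have := cf _ _ (comp_continuous (@to_simplex_continuous n) cu) => c1.
rewrite (_ : f \o u = (f \o (u \o @to_simplex n)) \o set_val); last first.
  by apply/funext => s /=; rewrite to_simplexK.
exact: (comp_continuous (@set_val_continuous _ _) c1).
Qed.

Section Cons.
Variable n : nat.

Definition rVcons (z : 'rV[R]_n * R) : 'rV[R]_n.+1 :=
  \row_j (if unlift ord0 j is Some i then z.1 0 i else z.2).
Definition rVuncons (y : 'rV[R]_n.+1) : 'rV[R]_n * R :=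
  (\row_i y 0 (lift ord0 i), y 0 ord0).

Lemma rVcons_continuous : continuous rVcons.
Proof.
apply: continuous_to_rV => j; case: (unliftP ord0 j) => [i|] ->.
  apply: (eq_cont (g := fun z : 'rV[R]_n * R => z.1 0 i)); last by ct.
  by move=> y; rewrite mxE liftK.
apply: (eq_cont (g := fun z : 'rV[R]_n * R => z.2)); last by ct.
by move=> y; rewrite mxE unlift_none.
Qed.

Lemma rVuncons_continuous : continuous rVuncons.
Proof.
apply: pair_continuous; last exact: coord_continuous.
apply: continuous_to_rV => i.
apply: (eq_cont (g := fun y : 'rV[R]_n.+1 => y 0 (lift ord0 i))); last by ct.
by move=> y; rewrite mxE.
Qed.

Lemma rVconsK : cancel rVcons rVuncons.
Proof.
move=> [x t]; congr pair; last by rewrite /rVcons mxE unlift_none.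
by apply/rowP => i; rewrite !mxE liftK.
Qed.

Lemma rVunconsK : cancel rVuncons rVcons.
Proof.
move=> y; apply/rowP => j; rewrite mxE.
by case: (unliftP ord0 j) => [i|] -> //=; rewrite mxE.
Qed.

(** For the sup norm, the ball of dimension [n + 1] is a cylinder over the ball of dimension [n];
    the shifts of dimension below rest on this. *)
Lemma norm_uncons y : Order.max `|(rVuncons y).1| `|(rVuncons y).2| = `|y|.
Proof.
apply/eqP; rewrite eq_le; apply/andP; split.
  rewrite ge_max coord_le_norm andbT; apply: norm_le_coord => // i.
  by rewrite mxE coord_le_norm.
apply: norm_le_coord => [|j]; first by rewrite le_max normr_ge0.
rewrite le_max; case: (unliftP ord0 j) => [i|] ->; last by rewrite lexx orbT.
by have := coord_le_norm (rVuncons y).1 i; rewrite mxE => ->.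
Qed.

Lemma norm_cons z : `|rVcons z| = Order.max `|z.1| `|z.2|.
Proof. by rewrite -norm_uncons rVconsK. Qed.

Lemma rV_prod_delta : delta_generated R ('rV[R]_n * R)%type.
Proof.
apply: (delta_retract (@rV_delta _) rVcons_continuous rVuncons_continuous).
exact: rVconsK.
Qed.

End Cons.

End TestSpaces2.

(** * Weak homotopy equivalences as a relative lifting property *)

Definition rVnorm (R : realType) n (x : 'rV[R]_n) : R := `|x|.

(* [lra] on goals involving norms of row vectors, whose instances need not agree
   syntactically. *)
Ltac nlra := repeat match goal with
  | H : context [@Num.norm ?A ?B ?x] |- _ =>
      change (@Num.norm A B x) with (rVnorm x) in H
  | |- context [@Num.norm ?A ?B ?x] =>
      change (@Num.norm A B x) with (rVnorm x)
  end; lra.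

Section Star.
Variable R : realType.
Implicit Types A B : topologicalType.

Definition cl (t : R) : R := Order.max 0 (Order.min 1 t).

Lemma cl_id t : 0 <= t <= 1 -> cl t = t.
Proof. by case/andP=> t0 t1; rewrite /cl (min_idPr t1) (max_idPr t0). Qed.

Lemma cl_itv t : 0 <= cl t <= 1.
Proof. by rewrite /cl le_max lexx /= ge_max ler01 /= ge_min lexx. Qed.

Lemma cl_le0 t : t <= 0 -> cl t = 0.
Proof. by move=> t0; rewrite /cl max_l // ge_min t0 orbT. Qed.

Lemma cl_ge1 t : 1 <= t -> cl t = 1.
Proof. by move=> t1; rewrite /cl (min_idPl t1) max_r. Qed.

Lemma cl_continuous : continuous cl.
Proof. by rewrite /cl; ct. Qed.

(** Joint continuity of a homotopy, tested along plots, so that no topology on the product has to be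
    chosen. *)
Definition hcont A (K : R -> A -> A) := forall n (a : 'rV[R]_n -> A) (v : 'rV[R]_n -> R),
  continuous a -> continuous v -> continuous (fun x => K (v x) (a x)).

(** [local_retraction] replaces maps that are continuous on [O] only by globally continuous ones
    that agree with them near [x]. *)
Lemma hcont_at A (K : R -> A -> A) (W : normedModType R) (a : W -> A) (v : W -> R)
    (O : set W) x : hcont K -> delta_generated R W -> open O ->
  (forall y, O y -> continuous_at y a) -> (forall y, O y -> continuous_at y v) ->
  O x -> continuous_at x (fun y => K (v y) (a y)).
Proof.
move=> hK dW oO ca cv Ox.
have [|rho [crho rhoO [e e0 rhoE]]] := @local_retraction R W x O.
  exact: open_nbhs_nbhs.
have c1 : continuous (a \o rho).
  by move=> y; apply: (comp_cont_at (crho y)); exact: ca.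
have c2 : continuous (v \o rho).
  by move=> y; apply: (comp_cont_at (crho y)); exact: cv.
have c3 : continuous (fun y => K (v (rho y)) (a (rho y))).
  apply: (rV_test dW) => n u cu.
  apply: (hK n (a \o rho \o u) (v \o rho \o u)).
    exact: (comp_continuous cu c1).
  exact: (comp_continuous cu c2).
apply: (eq_near_continuous _ (c3 x)).
apply/nbhs_ballP; exists e => // y; rewrite -ball_normE /= distrC => /ltW.
by move=> /rhoE ->.
Qed.

(* [f] is a weak homotopy equivalence, in the form of a relative lifting property for the
   pairs (ball, sphere) of the sup norm. Maps from a ball are represented by maps from the
   whole space, and maps from a sphere by maps continuous away from the origin. *)
Definition star A B (f : A -> B) :=
  (forall b, exists a (g : R -> B), [/\ continuous g, g 0 = f a & g 1 = b]) /\
  forall n (a : 'rV[R]_n -> A) (b : 'rV[R]_n -> B),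
    (forall x : 'rV[R]_n, x != 0 -> continuous_at x a) -> continuous b ->
    (forall x : 'rV[R]_n, `|x| = 1 -> f (a x) = b x) ->
    exists (c : 'rV[R]_n -> A) (k : 'rV[R]_n * R -> B), [/\ continuous c,
      forall x : 'rV[R]_n, `|x| = 1 -> c x = a x, continuous k,
      forall x : 'rV[R]_n, `|x| <= 1 -> k (x, 0) = f (c x) /\ k (x, 1) = b x &
      forall (x : 'rV[R]_n) (t : R), `|x| = 1 -> 0 <= t <= 1 -> k (x, t) = b x].

Lemma neq0_open (W : normedModType R) : open [set x : W | x != 0].
Proof.
rewrite (_ : [set x : W | x != 0] = [set x : W | 0 < `|x|]); last first.
  by apply/seteqP; split => x /=; rewrite normr_gt0.
apply: (@open_comp _ _ (fun x : W => `|x|) [set r | 0 < r]); last exact: open_gt.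
by move=> x _; exact: norm_continuous.
Qed.

Lemma fst_neq0_open (W : normedModType R) : open [set z : W * R | z.1 != 0].
Proof.
apply: (@open_comp _ _ fst [set x : W | x != 0]); last exact: neq0_open.
by move=> x _; exact: cvg_fst.
Qed.

Section Deformation.
Variables (A B A0 B0 : topologicalType) (f : A -> B) (f0 : A0 -> B0).
Variables (pA : A -> A0) (pB : B -> B0) (sA : A0 -> A) (sB : B0 -> B).
Variables (KA : R -> A -> A) (KB : R -> B -> B).
Hypotheses (cpA : continuous pA) (cpB : continuous pB).
Hypotheses (csA : continuous sA) (csB : continuous sB).
Hypotheses (hKA : hcont KA) (hKB : hcont KB).
Hypotheses (KA0 : forall x, KA 0 x = x) (KA1 : forall x, KA 1 x = sA (pA x)).
Hypotheses (KB0 : forall x, KB 0 x = x) (KB1 : forall x, KB 1 x = sB (pB x)).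
Hypotheses (fs : forall x, f (sA x) = sB (f0 x)) (pf : forall x, pB (f x) = f0 (pA x)).
Hypothesis fK : forall t x, f (KA t x) = KB t (f x).

(** The problem projected to [f0] is solved on the ball of radius 1/2, and the shell between radii
    1/2 and 1 is filled by the deformations [KA] and [KB]. The homotopy to [b] has two halves: [h1]
    uses the homotopy found for [f0], and [h2] undoes [KB]. *)
Lemma star_deformation : star f0 -> star f.
Proof.
move=> [s0 s1]; split=> [b|n a b ca cb fab].
  have [a0 [g [cg g0 g1]]] := s0 (pB b).
  have cK : continuous (fun t : R => KB (2 - 2 * t) b).
    have dR : delta_generated R R^o.
      apply: (@delta_retract R R^o 'rV[R]_1 (fun t => \row_j t) (fun x => x 0 0)).
      - exact: rV_delta.
      - apply: continuous_to_rV => j; apply: (eq_cont (g := fun t : R^o => t : R)).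
          by move=> t; rewrite mxE.
        by ct.
      - by ct.
      - by move=> t; rewrite mxE.
    move=> t; apply: (@hcont_at _ _ R^o (fun=> b) (fun t => 2 - 2 * t) setT) => //.
    - exact: openT.
    - by move=> y _; ct.
    - by move=> y _; ct.
  exists (sA a0), (fun t => if t <= 2^-1 then sB (g (2 * t)) else KB (2 - 2 * t) b).
  split.
  - apply: (@paste R R B id 2^-1 (fun t => sB (g (2 * t)))) => /=; [by ct|by ct|by ct|].
    move=> t t2; have -> : 2 * t = 1 by rewrite t2; lra.
    by rewrite g1 -KB1; congr (KB _ _); lra.
  - by rewrite ifT ?invr_ge0 // mulr0 g0 fs.
  - rewrite ifF; last by apply/negbTE; rewrite -ltNge; lra.
    by rewrite -[RHS]KB0; congr (KB _ _); lra.
have [|||c0 [h0 [cc0 c0a ch0 h01 h0b]]] := s1 n (pA \o a) (pB \o b).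
- by move=> x x0; apply: comp_cont_at; [exact: ca|exact: cpA].
- exact: (comp_continuous cb cpB).
- by move=> x x1 /=; rewrite -pf fab.
have can (x : 'rV[R]_n) : x != 0 -> continuous_at x (fun x => a (nrm x)).
  move=> x0; apply: (comp_cont_at (nrm_continuous x0)); apply: ca.
  by apply: norm1_neq0; rewrite norm_nrm.
have n2 (x : 'rV[R]_n) : `|x| = 2^-1 -> 2 *: x = nrm x.
  by move=> x2; rewrite /nrm x2 invrK.
have nn (x : 'rV[R]_n) : `|2 *: x| = 2 * `|x| by rewrite normrZ ger0_norm.
pose c x := if `|x| <= 2^-1 then sA (c0 (2 *: x)) else KA (2 - 2 * `|x|) (a (nrm x)).
have half_neq0 (x : 'rV[R]_n) : 2^-1 <= `|x| -> x != 0.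
  by apply: norm_ge_neq0; rewrite invr_gt0.
have cc : continuous c.
  apply: (@paste R _ _ (fun x : 'rV[R]_n => `|x|) 2^-1 (fun x => sA (c0 (2 *: x)))).
  - by ct.
  - by ct.
  - move=> x /half_neq0 x0.
    apply: (hcont_at (O := [set x : 'rV[R]_n | x != 0]) hKA (@rV_delta R n) (@neq0_open _)) => //.
    by move=> y _; ct.
  - move=> x x2; have e : 2 - 2 * `|x| = 1 by rewrite x2; lra.
    by rewrite e KA1 n2 // c0a // norm_nrm // half_neq0 // x2.
have b_near (x : 'rV[R]_n) : `|x| = 1 -> KB 1 (b x) = sB (pB (b x)) by move=> _; exact: KB1.
have clm := @clamp_continuous R 'rV[R]_n.
have ccl := cl_continuous.
have cn (z : 'rV[R]_n * R) : z.1 != 0 -> continuous_at z (fun z => nrm z.1).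
  by move=> z0; apply: (comp_cont_at (f := fst)); [exact: cvg_fst|exact: nrm_continuous].
pose h1 (z : 'rV[R]_n * R) := if `|z.1| <= 2^-1 then sB (h0 (2 *: z.1, cl (2 * z.2)))
  else KB (2 - 2 * `|z.1|) (b (nrm z.1)).
have ch1 : continuous h1.
  apply: (@paste R _ _ (fun z : 'rV[R]_n * R => `|z.1|) 2^-1
     (fun z => sB (h0 (2 *: z.1, cl (2 * z.2))))).
  - by ct.
  - by ct.
  - move=> x /half_neq0 x0.
    apply: (hcont_at (O := [set z : 'rV[R]_n * R | z.1 != 0]) hKB (@rV_prod_delta R n) (@fst_neq0_open _)) => //.
      by move=> y y0; apply: (comp_cont_at (cn y y0)).
    by move=> y _; ct.
  - move=> z z2; have e : 2 - 2 * `|z.1| = 1 by rewrite z2; lra.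
    have z1 : `|2 *: z.1| = 1 by rewrite nn z2; lra.
    by rewrite e KB1 (h0b _ _ z1 (cl_itv _)) /= n2.
(* At its start [h2] applies [KB 1] on the inner ball and the shell deformation outside, as [h1]
   does at its end. Then the parameter of [KB] decreases to 0 while the argument of [b] moves along
   a segment from [clamp (2 *: x)] to [x]. *)
pose h2 (z : 'rV[R]_n * R) := KB ((1 - cl (2 * z.2 - 1)) * Order.min 1 (2 - 2 * `|z.1|))
  (b ((1 - cl (2 * z.2 - 1)) *: clamp (2 *: z.1) + cl (2 * z.2 - 1) *: z.1)).
have ch2 : continuous h2.
  move=> z; apply: (hcont_at (O := setT) hKB (@rV_prod_delta R n) openT) => // y _; ct.
exists c, (fun z => if z.2 <= 2^-1 then h1 z else h2 z); split => //.
- move=> x x1; rewrite /c x1 ifF; last by apply/negbTE; rewrite -ltNge; lra.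
  by rewrite nrm_id // mulr1 subrr KA0.
- apply: (@paste R _ _ (fun z : 'rV[R]_n * R => z.2) 2^-1 h1 h2); [by ct|by ct|by ct|].
  move=> [x t] /= z2; have e1 : 2 * t = 1 by rewrite z2; lra.
  rewrite /h1 /h2 /= e1 subrr (cl_le0 (lexx 0)) cl_id ?ler01 ?lexx //.
  rewrite subr0 mul1r scale1r scale0r addr0.
  case: ifPn => [zl|]; last first.
    rewrite -ltNge => zl; rewrite (min_idPr _); last by nlra.
    have x2 : 1 <= `|2 *: x| by rewrite nn; nlra.
    by rewrite clamp_nrm // nrm_scale.
  have z1 : `|2 *: x| <= 1 by rewrite nn; nlra.
  have m1 : 1 <= 2 - 2 * `|x| by nlra.
  have [_ ->] := h01 (2 *: x) z1.
  by rewrite (min_idPl m1) KB1 /= clamp_id.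
- move=> x x1 /=; split.
    rewrite ifT ?invr_ge0 // /h1 /c /= mulr0 (cl_le0 (lexx 0)).
    case: ifPn => [xl|]; last first.
      rewrite -ltNge => /ltW /half_neq0 x0.
      by rewrite -fab ?norm_nrm // -fK.
    have xl1 : `|2 *: x| <= 1 by rewrite nn; nlra.
    by have [-> _] := h01 (2 *: x) xl1; rewrite -fs.
  rewrite ifF; last by apply/negbTE; rewrite -ltNge; lra.
  have e1 : cl (2 * 1 - 1) = 1 by apply: cl_ge1; lra.
  by rewrite /h2 /= e1 subrr mul0r KB0 scale0r add0r scale1r.
- move=> x t x1 t01 /=; case: ifPn => tl.
    rewrite /h1 /= x1 ifF; last by apply/negbTE; rewrite -ltNge; lra.
    by rewrite nrm_id // mulr1 subrr KB0.
  rewrite /h2 /= x1 mulr1 subrr (min_idPr _) ?ler01 // mulr0 KB0.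
  have x2 : 1 <= `|2 *: x| by rewrite nn x1; lra.
  by rewrite clamp_nrm // nrm_scale // nrm_id // -scalerDl subrK scale1r.
Qed.

End Deformation.

End Star.

(** * Variants of the relative lifting property *)

Section StarConsequences.
Variables (R : realType) (A B : topologicalType) (f : A -> B).
Hypothesis sf : star R f.

(** The boundary condition holds only up to the homotopy [Om]. It becomes strict for [b'], which is
    [b] shrunk to radius 1/2 and surrounded by [Om] run backwards; the homotopy obtained for [b'] is
    then bent so that [Om] appears on its sides. *)
Lemma star_strict n (a : 'rV[R]_n -> A) (b : 'rV[R]_n -> B) (Om : 'rV[R]_n * R -> B) :
  (forall x : 'rV[R]_n, x != 0 -> continuous_at x a) -> continuous b ->
  (forall z : 'rV[R]_n * R, z.1 != 0 -> continuous_at z Om) ->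
  (forall x : 'rV[R]_n, `|x| = 1 -> Om (x, 0) = f (a x)) ->
  (forall x : 'rV[R]_n, `|x| = 1 -> Om (x, 1) = b x) ->
  exists (c : 'rV[R]_n -> A) (T : 'rV[R]_n * R -> B), [/\ continuous c,
    forall x : 'rV[R]_n, `|x| = 1 -> c x = a x, continuous T,
    forall x : 'rV[R]_n, `|x| <= 1 -> T (x, 0) = f (c x) /\ T (x, 1) = b x &
    forall (x : 'rV[R]_n) (t : R), `|x| = 1 -> 0 <= t <= 1 -> T (x, t) = Om (x, t)].
Proof.
move=> ca cb cOm Om0 Om1; have [_ s1] := sf.
have nn (x : 'rV[R]_n) : `|2 *: x| = 2 * `|x| by rewrite normrZ ger0_norm.
have half_neq0 (x : 'rV[R]_n) : 2^-1 <= `|x| -> x != 0.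
  by apply: norm_ge_neq0; rewrite invr_gt0.
pose b' (x : 'rV[R]_n) := if `|x| <= 2^-1 then b (2 *: x) else Om (nrm x, 2 - 2 * `|x|).
have cb' : continuous b'.
  apply: (@paste R _ _ (fun x : 'rV[R]_n => `|x|) 2^-1 (fun x => b (2 *: x))).
  - by ct.
  - by ct.
  - move=> x /half_neq0 x0.
    apply: (@comp_cont_at _ _ _ (fun x : 'rV[R]_n => (nrm x, 2 - 2 * `|x|)) Om).
      by ct; exact: nrm_continuous.
    by apply: cOm => /=; apply: norm1_neq0; rewrite norm_nrm.
  - move=> x x2; have x0 : x != 0 by apply: half_neq0; rewrite x2.
    have -> : 2 - 2 * `|x| = 1 by rewrite x2; lra.
    by rewrite Om1 ?norm_nrm // /nrm x2 invrK.
have b'1 (x : 'rV[R]_n) : `|x| = 1 -> f (a x) = b' x.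
  move=> x1; rewrite /b' x1 ifF; last by apply/negbTE; rewrite -ltNge; lra.
  by rewrite nrm_id // mulr1 subrr Om0.
have [c' [k [cc' c'a ck k01 kb]]] := s1 n a b' ca cb' b'1.
have clm := @clamp_continuous R 'rV[R]_n.
have ccl := @cl_continuous R.
(* On [|x| = 1] the point [y] has norm [1 - t / 2] and [v = 1], which yields [b'] there, that is
   [Om (x, t)]. At time 0 the parameter [v] leaves 0 only beyond radius 2/3, where [clamp] has
   already put [y] on the sphere and [k] does not depend on time. *)
pose y (z : 'rV[R]_n * R) := (1 - cl z.2) *: clamp ((3 / 2) *: z.1) + (cl z.2 / 2) *: z.1.
pose v (z : 'rV[R]_n * R) := Order.min 1 (Order.max (3 * cl z.2) (3 * `|z.1| - 2)).
have h32 : 0 < 3 / 2 :> R by rewrite divr_gt0.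
have n3 (x : 'rV[R]_n) : `|(3 / 2) *: x| = 3 / 2 * `|x| by rewrite normrZ ger0_norm ?divr_ge0.
exists (fun x => c' (clamp ((3 / 2) *: x))), (fun z => k (y z, v z)); split.
- by ct.
- move=> x x1; rewrite clamp_nrm; last by rewrite n3 x1; lra.
  by rewrite (nrm_scale _ h32) nrm_id // c'a.
- by rewrite /y /v; ct.
- move=> x x1; rewrite /y /v /= (cl_le0 (lexx 0)) (cl_ge1 (lexx 1)) subr0 scale1r.
  rewrite subrr scale0r add0r !mul0r scale0r addr0 mulr0 mulr1; split.
    have [h|h] := leP `|x| (2 / 3).
      rewrite (max_idPl _); last by nlra.
      rewrite (min_idPr _) ?ler01 //.
      by have [-> _] := k01 (clamp ((3 / 2) *: x)) (norm_clamp_le _).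
    have x3 : 1 <= `|(3 / 2) *: x| by rewrite n3; nlra.
    have e1 : `|clamp ((3 / 2) *: x)| = 1 by exact: norm_clamp.
    rewrite kb //; first by rewrite -b'1 // c'a.
    by rewrite ge_min le_min ler01 lexx /= andbT le_max lexx.
  rewrite (min_idPl _); last by rewrite le_max; apply/orP; left; lra.
  rewrite mul1r; have x2 : `|2^-1 *: x| <= 1.
    by rewrite normrZ ger0_norm ?invr_ge0 //; nlra.
  have [_ ->] := k01 _ x2; rewrite /b' ifT.
    by rewrite scalerA mulfV ?scale1r ?pnatr_eq0.
  by rewrite normrZ ger0_norm ?invr_ge0 //; nlra.
- move=> x t x1 t01; rewrite /y /v /= (cl_id t01) x1 (min_idPl _); last first.
    by rewrite le_max; apply/orP; right; lra.
  rewrite clamp_nrm; last by rewrite n3 x1; lra.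
  rewrite (nrm_scale _ h32) nrm_id // -scalerDl.
  have /andP[t0 t1] := t01; have r0 : 0 < 1 - t + t / 2 by lra.
  have ny : `|(1 - t + t / 2) *: x| = 1 - t + t / 2 by rewrite normrZ gtr0_norm // x1 mulr1.
  have ny1 : `|(1 - t + t / 2) *: x| <= 1 by rewrite ny; lra.
  have [_ ->] := k01 _ ny1.
  rewrite /b' ny; case: ifPn => [h|h].
    have -> : t = 1 by lra.
    by rewrite scalerA Om1 //; congr b; rewrite -[RHS]scale1r; congr (_ *: _); lra.
  by rewrite nrm_scale // nrm_id //; congr (Om (_, _)); lra.
Qed.

Lemma star_prod n (a : 'rV[R]_n * R -> A) (b : 'rV[R]_n * R -> B) :
  (forall z, (`|z.1| != 0) || (z.2 != 0) -> continuous_at z a) -> continuous b ->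
  (forall z, Order.max `|z.1| `|z.2| = 1 -> f (a z) = b z) ->
  exists (c : 'rV[R]_n * R -> A) (k : ('rV[R]_n * R) * R -> B), [/\ continuous c,
    forall z, Order.max `|z.1| `|z.2| = 1 -> c z = a z, continuous k,
    forall z, Order.max `|z.1| `|z.2| <= 1 -> k (z, 0) = f (c z) /\ k (z, 1) = b z &
    forall z t, Order.max `|z.1| `|z.2| = 1 -> 0 <= t <= 1 -> k (z, t) = b z].
Proof.
move=> ca cb fab; have [_ s1] := sf.
have cs := @rVcons_continuous R n; have cr := @rVuncons_continuous R n.
pose r := @rVuncons R n; pose s := @rVcons R n.
have sK z : r (s z) = z by exact: rVconsK.
have nr y : Order.max `|(r y).1| `|(r y).2| = `|y| by exact: norm_uncons.
have ns z : `|s z| = Order.max `|z.1| `|z.2| by exact: norm_cons.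
have [|||c [k [cc c_a ck k01 kb]]] := s1 _ (a \o r) (b \o r).
- move=> y y0; apply: comp_cont_at; [exact: cr|apply: ca].
  apply: contraNT y0; rewrite negb_or !negbK => /andP[/eqP e1 /eqP e2].
  by rewrite -normr_eq0 -nr e1 e2 normr0 maxxx.
- exact: (comp_continuous cr cb).
- by move=> y y1; rewrite /= fab // nr.
exists (c \o s), (fun w => k (s w.1, w.2)); split.
- exact: (comp_continuous cs cc).
- by move=> z z1; rewrite /= c_a ?ns //= sK.
- by rewrite /s; ct.
- by move=> z z1; have [|-> ->] := k01 (s z); rewrite ?ns //= sK.
- by move=> z t z1 t01; rewrite /= kb ?ns //= sK.
Qed.

(* The property in dimension [n + 1], for cylinders over the ball of dimension [n]. *)
Lemma star_shift n (b0 b1 : 'rV[R]_n -> A) (a : 'rV[R]_n * R -> A)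
    (be : 'rV[R]_n * R -> B) : continuous b0 -> continuous b1 ->
  (forall z : 'rV[R]_n * R, z.1 != 0 -> continuous_at z a) -> continuous be ->
  (forall x : 'rV[R]_n, `|x| <= 1 -> be (x, 0) = f (b0 x) /\ be (x, 1) = f (b1 x)) ->
  (forall (x : 'rV[R]_n) (u : R), `|x| = 1 -> 0 <= u <= 1 -> be (x, u) = f (a (x, u))) ->
  (forall x : 'rV[R]_n, `|x| = 1 -> a (x, 0) = b0 x /\ a (x, 1) = b1 x) ->
  exists (C : 'rV[R]_n * R -> A) (K : ('rV[R]_n * R) * R -> B), [/\ continuous C,
    continuous K,
    (forall x : 'rV[R]_n, `|x| <= 1 -> C (x, 0) = b0 x /\ C (x, 1) = b1 x) /\
    (forall (x : 'rV[R]_n) (u : R), `|x| = 1 -> 0 <= u <= 1 -> C (x, u) = a (x, u)),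
    forall (x : 'rV[R]_n) (u : R), `|x| <= 1 -> 0 <= u <= 1 ->
      K ((x, u), 0) = f (C (x, u)) /\ K ((x, u), 1) = be (x, u) &
    forall (x : 'rV[R]_n) (u t : R), `|x| <= 1 -> 0 <= u <= 1 -> 0 <= t <= 1 ->
      [\/ `|x| = 1, u = 0 | u = 1] -> K ((x, u), t) = be (x, u)].
Proof.
move=> cb0 cb1 ca cbe be01 bea a01.
(* The data on the sides and the two ends of the box [|x| <= 1], [|w| <= 1] are extended
   homogeneously along rays, hence continuously away from the origin; [w = 2 * u - 1] centres the
   interval. *)
pose a1 (z : 'rV[R]_n * R) := if `|z.2| - `|z.1| <= 0 then
   a (nrm z.1, (z.2 / `|z.1| + 1) / 2) else
   if z.2 <= 0 then b0 ((`|z.2|)^-1 *: z.1) else b1 ((`|z.2|)^-1 *: z.1).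
have cn (z : 'rV[R]_n * R) : z.1 != 0 -> continuous_at z (fun z => nrm z.1).
  by move=> z0; apply: (comp_cont_at (f := fst)); [exact: cvg_fst|exact: nrm_continuous].
have a1_eq (x : 'rV[R]_n) (w : R) : Order.max `|x| `|w| = 1 ->
    (`|x| = 1 -> a1 (x, w) = a (x, (w + 1) / 2)) /\
    (w = -1 -> a1 (x, w) = b0 x) /\ (w = 1 -> a1 (x, w) = b1 x).
  move=> m1; have w1 : `|w| <= 1 by rewrite -m1 le_max lexx orbT.
  have e1 : `|x| = 1 -> a1 (x, w) = a (x, (w + 1) / 2).
    by move=> x1; rewrite /a1 /= x1 subr_le0 w1 divr1 nrm_id.
  split=> //; split=> we.
    have [x1|x1] := eqVneq `|x| 1; first by rewrite e1 // we addNr mul0r (a01 x x1).1.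
    have x1' : `|x| <= 1 by rewrite -m1 le_max lexx.
    rewrite /a1 /= we normrN1 subr_le0 ifF; last by apply/negbTE; rewrite -ltNge lt_neqAle x1.
    by rewrite lerN10 invr1 scale1r.
  have [x1|x1] := eqVneq `|x| 1.
    rewrite e1 // we (_ : (1 + 1) / 2 = 1); first by rewrite (a01 x x1).2.
    by lra.
  have x1' : `|x| <= 1 by rewrite -m1 le_max lexx.
  rewrite /a1 /= we normr1 subr_le0 ifF; last by apply/negbTE; rewrite -ltNge lt_neqAle x1.
  by rewrite ler10 invr1 scale1r.
have ca1 z : (`|z.1| != 0) || (z.2 != 0) -> continuous_at z a1.
  move=> z0; rewrite /a1; apply: paste_at.
  - by ct.
  - rewrite subr_le0 => h; have z10 : z.1 != 0.
      apply: contraTneq z0 => e; move: h; rewrite e normr0 normr_le0 => /eqP ->.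
      by rewrite eqxx.
    apply: (@comp_cont_at _ _ _ (fun z : 'rV[R]_n * R => (nrm z.1, (z.2 / `|z.1| + 1) / 2)) a).
      by ct; [exact: cn|rewrite normr_eq0].
    by apply: ca => /=; apply: norm1_neq0; rewrite norm_nrm.
  - rewrite subr_ge0 => h; have z20 : z.2 != 0.
      apply: contraTneq z0 => e; move: h; rewrite e normr0 => h.
      by rewrite eqxx orbF negbK eq_le h normr_ge0.
    have n20 : `|z.2| != 0 by rewrite normr_eq0.
    apply: paste_at => [|_|_|e]; [ct|ct|ct|by move: z20; rewrite e eqxx].
  - move/eqP; rewrite subr_eq0 => /eqP h.
    have z10 : `|z.1| != 0.
      by apply: contraTneq z0 => e; rewrite e eqxx /= negbK -normr_eq0 h e.
    have z10' : z.1 != 0 by rewrite -normr_eq0.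
    have [z2|z2] := leP z.2 0.
      have -> : z.2 / `|z.1| = -1.
        by move: h; rewrite ler0_norm // => /(congr1 -%R); rewrite opprK => ->; rewrite mulNr mulfV.
      by rewrite addNr mul0r (a01 _ (norm_nrm z10')).1 h.
    have -> : z.2 / `|z.1| = 1 by rewrite -h gtr0_norm // mulfV // gt_eqF.
    rewrite (_ : (1 + 1) / 2 = 1); last by lra.
    by rewrite (a01 _ (norm_nrm z10')).2 h.
pose be1 (z : 'rV[R]_n * R) := be (z.1, (z.2 + 1) / 2).
have cbe1 : continuous be1 by rewrite /be1; ct.
have abe z : Order.max `|z.1| `|z.2| = 1 -> f (a1 z) = be1 z.
  case: z => x w m1; have [e1 [e2 e3]] := a1_eq x w m1.
  have [x1|x1] := eqVneq `|x| 1.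
    rewrite e1 // /be1 /= bea //.
    have : `|w| <= 1 by rewrite -m1 le_max lexx orbT.
    by rewrite ler_norml => /andP[? ?]; apply/andP; split; lra.
  have x1' : `|x| <= 1 by rewrite -m1 le_max lexx.
  have w1 : `|w| = 1.
    by move: m1; rewrite /Order.max; case: ifP => // _ e; rewrite e eqxx in x1.
  have [b0e b1e] := be01 x x1'; have [w0|w0] := leP w 0.
    have we : w = -1 by move: w1; rewrite ler0_norm //; lra.
    by rewrite e2 // /be1 /= we addNr mul0r b0e.
  have we : w = 1 by move: w1; rewrite gtr0_norm.
  by rewrite e3 // /be1 /= we (_ : (1 + 1) / 2 = 1) ?b1e //; lra.
have [C [K [cC Ca cK K01 Kb]]] := star_prod ca1 cbe1 abe.
have u_itv (u : R) : 0 <= u <= 1 -> `|2 * u - 1| <= 1.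
  by case/andP=> u0 u1; rewrite ler_norml; apply/andP; split; lra.
have m1 (x : 'rV[R]_n) (u : R) : `|x| <= 1 -> 0 <= u <= 1 ->
    [\/ `|x| = 1, u = 0 | u = 1] -> Order.max `|x| `|2 * u - 1| = 1.
  move=> x1 u01 h; apply/eqP; rewrite eq_le ge_max x1 u_itv //= le_max.
  case: h => [->|->|->]; first by rewrite lexx.
    by rewrite mulr0 sub0r normrN1 lexx orbT.
  by rewrite (_ : 2 * 1 - 1 = 1) ?normr1 ?lexx ?orbT //; lra.
have i0' : (0 <= (0 : R) <= 1) by rewrite lexx ler01.
have i1' : (0 <= (1 : R) <= 1) by rewrite lexx ler01.
have be1E (x : 'rV[R]_n) (u : R) : be1 (x, 2 * u - 1) = be (x, u).
  by rewrite /be1 /=; congr (be (_, _)); lra.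
exists (fun z => C (z.1, 2 * z.2 - 1)), (fun w => K ((w.1.1, 2 * w.1.2 - 1), w.2)).
split; [by ct|by ct| | |].
- split=> [x x1|x u x1 u01] /=.
    have M0 := m1 x 0 x1 i0' (Or32 _ _ (erefl 0)).
    have M1 := m1 x 1 x1 i1' (Or33 _ _ (erefl 1)).
    have [_ [e0 _]] := a1_eq _ _ M0; have [_ [_ e1]] := a1_eq _ _ M1.
    rewrite (Ca (x, 2 * 0 - 1) M0) (Ca (x, 2 * 1 - 1) M1).
    by split; [apply: e0; lra|apply: e1; lra].
  have x1' : `|x| <= 1 by rewrite x1.
  have M := m1 x u x1' u01 (Or31 _ _ x1).
  rewrite (Ca (x, 2 * u - 1) M); have [-> // _] := a1_eq _ _ M.
  by congr (a (_, _)); lra.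
- move=> x u x1 u01 /=; have [|-> ->] := K01 (x, 2 * u - 1).
    by rewrite /= ge_max x1 u_itv.
  by rewrite be1E.
- by move=> x u t x1 u01 t01 h /=; rewrite Kb ?be1E //=; exact: m1.
Qed.

End StarConsequences.

(** * From homotopy groups to the relative lifting property *)

Section HomotopyGroups.
Variable R : realType.
Local Notation I := (unit_interval R).
Implicit Types A B T : topologicalType.

Definition relhom T n (u v : 'rV[R]_n -> T) := exists K : 'rV[R]_n * R -> T,
  [/\ continuous K,
   forall x : 'rV[R]_n, `|x| <= 1 -> K (x, 0) = u x /\ K (x, 1) = v x &
   forall (x : 'rV[R]_n) (t : R), `|x| = 1 -> 0 <= t <= 1 -> K (x, t) = u x].

Lemma relhom_trans T n (u v w : 'rV[R]_n -> T) :
  relhom u v -> relhom v w -> relhom u w.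
Proof.
move=> [K [cK K01 Kb]] [L [cL L01 Lb]].
have clm := @clamp_continuous R 'rV[R]_n; have ccl := @cl_continuous R.
exists (fun z => if z.2 <= 2^-1 then K (clamp z.1, 2 * z.2)
  else L (clamp z.1, 2 * z.2 - 1)); split.
- apply: (@paste R _ _ (fun z : 'rV[R]_n * R => z.2) 2^-1
    (fun z => K (clamp z.1, 2 * z.2))); [by ct|by ct|by ct|].
  move=> [x t] /= ->; rewrite mulfV ?pnatr_eq0 // subrr.
  by rewrite (K01 _ (norm_clamp_le _)).2 (L01 _ (norm_clamp_le _)).1.
- move=> x x1; rewrite /= clamp_id // ifT ?invr_ge0 // mulr0 (K01 x x1).1; split=> //.
  rewrite ifF; last by apply/negbTE; rewrite -ltNge; lra.
  by rewrite (_ : 2 * 1 - 1 = 1) ?(L01 x x1).2 //; lra.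
- move=> x t x1 /andP[t0 t1]; have x1' : `|x| <= 1 by rewrite x1.
  rewrite /= clamp_id //; case: ifPn => h; first by rewrite Kb //; lra.
  rewrite Lb //; last by lra.
  by rewrite -(K01 x x1').2 Kb // ler01 lexx.
Qed.

Lemma relhom_sym T n (u v : 'rV[R]_n -> T) : relhom u v -> relhom v u.
Proof.
move=> [K [cK K01 Kb]]; exists (fun z => K (z.1, 1 - z.2)); split; first by ct.
  by move=> x /K01[e0 e1]; rewrite /= subr0 subrr.
move=> x t x1 t01; have x1' : `|x| <= 1 by rewrite x1.
rewrite /= Kb //; last by case/andP: t01 => ? ?; lra.
by rewrite -(K01 x x1').2 Kb // ler01 lexx.
Qed.

Lemma relhom_homotopy T n (v : 'rV[R]_n -> T) (p q : 'rV[R]_n -> 'rV[R]_n) :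
  continuous v -> continuous p -> continuous q ->
  (forall x : 'rV[R]_n, `|x| = 1 -> p x = q x) -> relhom (v \o p) (v \o q).
Proof.
move=> cv cp cq pq; exists (fun z => v ((1 - z.2) *: p z.1 + z.2 *: q z.1)); split.
- by ct.
- by move=> x _ /=; rewrite subr0 scale1r scale0r addr0 subrr scale0r add0r scale1r.
- by move=> x t x1 _ /=; rewrite pq // -scalerDl subrK scale1r.
Qed.

Section Collar.
Variables (T : topologicalType) (n : nat) (g : 'rV[R]_n -> T).
Hypothesis cg : continuous g.

(** Translates between boundary values. With [rho r = 2 - 2 * r] the shell contracts the boundary
    value [g] to the base point [g 0]; with [rho r = 2 * r - 1] it expands the constant [g 0] back
    to [g]. *)
Definition collar (rho : R -> R) (v : 'rV[R]_n -> T) (x : 'rV[R]_n) : T :=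
  if `|x| <= 2^-1 then v (2 *: x) else g (rho `|x| *: nrm x).

Let half_neq0 (x : 'rV[R]_n) : 2^-1 <= `|x| -> x != 0.
Proof. by apply: norm_ge_neq0; rewrite invr_gt0. Qed.

Let n2 (x : 'rV[R]_n) : `|x| = 2^-1 -> 2 *: x = nrm x.
Proof. by move=> x2; rewrite /nrm x2 invrK. Qed.

Let nn (x : 'rV[R]_n) : `|2 *: x| = 2 * `|x|.
Proof. by rewrite normrZ ger0_norm. Qed.

Lemma collar_continuous (rho : R -> R) (v : 'rV[R]_n -> T) : continuous rho -> continuous v ->
  (forall x : 'rV[R]_n, `|x| = 1 -> v x = g (rho 2^-1 *: x)) ->
  continuous (collar rho v).
Proof.
move=> cr cv vg.
apply: (@paste R _ _ (fun x : 'rV[R]_n => `|x|) 2^-1 (fun x => v (2 *: x))).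
- by ct.
- by ct.
- by move=> x /half_neq0 x0; have := nrm_continuous x0 => c1; ct.
- move=> x x2; have x0 : x != 0 by apply: half_neq0; rewrite x2.
  by rewrite x2 n2 // vg // norm_nrm.
Qed.

Lemma collar_relhom (rho : R -> R) (v w : 'rV[R]_n -> T) : continuous rho -> relhom v w ->
  (forall x : 'rV[R]_n, `|x| = 1 -> v x = g (rho 2^-1 *: x)) ->
  relhom (collar rho v) (collar rho w).
Proof.
move=> cr [K [cK K01 Kb]] vg; have ccl := @cl_continuous R.
exists (fun z => if `|z.1| <= 2^-1 then K (2 *: z.1, cl z.2)
  else g (rho `|z.1| *: nrm z.1)); split.
- apply: (@paste R _ _ (fun z : 'rV[R]_n * R => `|z.1|) 2^-1
     (fun z => K (2 *: z.1, cl z.2))).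
  + by ct.
  + by ct.
  + move=> z /half_neq0 x0.
    have c1 : continuous_at z (fun z => nrm z.1).
      by apply: (comp_cont_at (f := fst)); [exact: cvg_fst|exact: nrm_continuous].
    by ct.
  + move=> [x t] /= x2; have x0 : x != 0 by apply: half_neq0; rewrite x2.
    by rewrite Kb ?cl_itv ?n2 ?norm_nrm // x2 vg // norm_nrm.
- move=> x x1; rewrite /collar /= (cl_le0 (lexx 0)) (cl_ge1 (lexx 1)).
  by case: ifPn => // h; have [-> ->] := K01 (2 *: x) ltac:(rewrite nn; nlra).
- move=> x t x1 _; rewrite /collar /= x1.
  have hf : (1 <= 2^-1 :> R) = false by apply/negbTE; rewrite -ltNge; lra.
  by rewrite hf.
Qed.

(** Outside radius 1/4 the double collar follows each ray of [g] from radius 1 to 0 and back to 1.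
    This profile [m] is deformed linearly to the constant 1, after which a rescaling of [v]
    remains. *)
Lemma collar_collar v : continuous v -> (forall x : 'rV[R]_n, `|x| = 1 -> v x = g x) ->
  relhom (collar (fun r => 2 * r - 1) (collar (fun r => 2 - 2 * r) v)) v.
Proof.
move=> cv vg; have clm := @clamp_continuous R 'rV[R]_n.
have n4 (x : 'rV[R]_n) : `|4 *: x| = 4 * `|x| by rewrite normrZ ger0_norm.
have q0 (x : 'rV[R]_n) : 4^-1 <= `|x| -> x != 0.
  by apply: norm_ge_neq0; rewrite invr_gt0.
apply: (relhom_trans (v := v \o (fun x => clamp (4 *: x)))); last first.
  apply: (@relhom_homotopy _ _ v _ idfun) => //; [by ct|by move=> ?; exact: cvg_id|].
  move=> x x1 /=; rewrite clamp_nrm; last by rewrite n4 x1; lra.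
  by rewrite nrm_scale // nrm_id.
pose m (r : R) := Order.max (2 - 4 * r) (2 * r - 1).
apply: relhom_sym; exists (fun z => if `|z.1| <= 4^-1 then v (4 *: z.1)
  else g ((1 - z.2 * (1 - m `|z.1|)) *: nrm z.1)); split.
- apply: (@paste R _ _ (fun z : 'rV[R]_n * R => `|z.1|) 4^-1 (fun z => v (4 *: z.1))).
  + by ct.
  + by ct.
  + move=> z /q0 x0.
    have c1 : continuous_at z (fun z => nrm z.1).
      by apply: (comp_cont_at (f := fst)); [exact: cvg_fst|exact: nrm_continuous].
    by rewrite /m; ct.
  + move=> [x t] /= x4; rewrite /m x4 (max_idPl _); last by lra.
    rewrite (_ : 1 - (2 - 4 * 4^-1) = 0); last by lra.
    rewrite mulr0 subr0 scale1r -vg; last by rewrite norm_nrm // q0 // x4.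
    by rewrite /nrm x4 invrK.
- move=> x x1; rewrite /= mul0r subr0 scale1r mul1r opprB addrC subrK; split.
    case: ifPn => [h|]; first by rewrite clamp_id // n4; nlra.
    rewrite -ltNge => /ltW h; rewrite -vg ?norm_nrm ?q0 // clamp_nrm ?nrm_scale //.
    by rewrite n4; nlra.
  rewrite /collar nn; case: ifPn => [h|].
    rewrite !ifT; [|nlra|nlra].
    by rewrite scalerA; congr (v (_ *: _)); lra.
  rewrite -ltNge => h; case: ifPn => [h2|].
    rewrite ifF; last by apply/negbTE; rewrite -ltNge; nlra.
    rewrite nrm_scale // /m (max_idPl _); last by nlra.
    by congr (g (_ *: _)); lra.
  by rewrite -ltNge => h2; rewrite /m (max_idPr _) //; nlra.
- move=> x t x1 t01; rewrite /= x1 ifF; last by apply/negbTE; rewrite -ltNge; lra.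
  rewrite /m (max_idPr _); last by lra.
  rewrite (_ : 1 - t * (1 - (2 * 1 - 1)) = 1); last by lra.
  rewrite scale1r nrm_id // -vg // clamp_nrm; last by rewrite n4 x1; lra.
  by rewrite nrm_scale // nrm_id.
Qed.

End Collar.

Section FreeBoundary.
Variables (A B : topologicalType) (f : A -> B) (n : nat).
Hypothesis cf : continuous f.
Hypothesis sur : forall (a : A) (v : 'rV[R]_n -> B), continuous v ->
  (forall x : 'rV[R]_n, `|x| = 1 -> v x = f a) -> exists u : 'rV[R]_n -> A,
  [/\ continuous u, forall x : 'rV[R]_n, `|x| = 1 -> u x = a & relhom (f \o u) v].
Hypothesis inj : forall (a : A) (u v : 'rV[R]_n -> A), continuous u -> continuous v ->
  (forall x : 'rV[R]_n, `|x| = 1 -> u x = a) -> (forall x : 'rV[R]_n, `|x| = 1 -> v x = a) ->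
  relhom (f \o u) (f \o v) -> relhom u v.

Let comp_collar (g : 'rV[R]_n -> A) rho v : f \o collar g rho v = collar (f \o g) rho (f \o v).
Proof. by apply/funext => x; rewrite /= /collar; case: ifP. Qed.

Let cr1 : continuous (fun r : R => 2 * r - 1).
Proof. by ct. Qed.

Let cr2 : continuous (fun r : R => 2 - 2 * r).
Proof. by ct. Qed.

Let h1 : 2 * 2^-1 - 1 = 0 :> R. Proof. lra. Qed.
Let h2 : 2 - 2 * 2^-1 = 1 :> R. Proof. lra. Qed.

Let collar1 T (g : 'rV[R]_n -> T) rho v (x : 'rV[R]_n) : `|x| = 1 ->
  collar g rho v x = g (rho 1 *: x).
Proof.
move=> x1; rewrite /collar x1 ifF ?nrm_id //.
by apply/negbTE; rewrite -ltNge; lra.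
Qed.

(** The contracting collar makes the boundary value constant, [sur] applies, and the expanding
    collar restores the boundary value [g]. The same device proves [free_inj]. *)
Lemma free_sur (g : 'rV[R]_n -> A) (v : 'rV[R]_n -> B) : continuous g -> continuous v ->
  (forall x : 'rV[R]_n, `|x| = 1 -> v x = f (g x)) -> exists u : 'rV[R]_n -> A,
  [/\ continuous u, forall x : 'rV[R]_n, `|x| = 1 -> u x = g x & relhom (f \o u) v].
Proof.
move=> cg cv vg; have cfg := comp_continuous cg cf.
have [||u [cu ua fu]] := sur (a := g 0) (v := collar (f \o g) (fun r => 2 - 2 * r) v).
- apply: collar_continuous => // x x1; by rewrite h2 scale1r vg.
- by move=> x x1; rewrite collar1 // mulr1 subrr scale0r.
exists (collar g (fun r => 2 * r - 1) u); split.
- by apply: collar_continuous => // x x1; rewrite h1 scale0r ua.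
- by move=> x x1; rewrite collar1 // (_ : 2 * 1 - 1 = 1) ?scale1r //; lra.
rewrite comp_collar; apply: relhom_trans (collar_collar cfg cv vg).
by apply: collar_relhom => // x x1; rewrite h1 scale0r /= ua.
Qed.

Lemma free_inj (u v : 'rV[R]_n -> A) : continuous u -> continuous v ->
  (forall x : 'rV[R]_n, `|x| = 1 -> u x = v x) ->
  relhom (f \o u) (f \o v) -> relhom u v.
Proof.
move=> cu cv uv fuv; have cfu := comp_continuous cu cf.
have s w : (forall x : 'rV[R]_n, `|x| = 1 -> w x = u x) -> forall x : 'rV[R]_n, `|x| = 1 ->
    w x = u ((2 - 2 * 2^-1) *: x) by move=> wu x x1; rewrite h2 scale1r wu.
have vu (x : 'rV[R]_n) : `|x| = 1 -> v x = u x by move=> /uv.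
have b w (x : 'rV[R]_n) : `|x| = 1 -> collar u (fun r => 2 - 2 * r) w x = u 0.
  by move=> x1; rewrite collar1 // mulr1 subrr scale0r.
have uvs : relhom (collar u (fun r => 2 - 2 * r) u) (collar u (fun r => 2 - 2 * r) v).
  apply: (inj (a := u 0)) => //.
  - by apply: collar_continuous => // x x1; rewrite s.
  - by apply: collar_continuous => //; exact: s.
  - exact: b.
  - exact: b.
  rewrite !comp_collar; apply: collar_relhom => // x x1.
  by rewrite h2 scale1r.
apply: (relhom_trans (relhom_sym (collar_collar cu cu (fun x _ => erefl)))).
apply: relhom_trans (collar_collar cu cv vu).
by apply: collar_relhom => // x x1; rewrite h1 scale0r b.
Qed.

End FreeBoundary.

Section WeakEquivalence.
Variables (A B : topologicalType) (f : A -> B).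
Hypothesis wf : weak_homotopy_equivalence R f.

Let cf : continuous f. Proof. by case: wf. Qed.

Let tocube n (x : 'rV[R]_n) : 'rV[R]_n := \row_i cl ((x 0 i + 1) / 2).

Let tocubeP n (x : 'rV[R]_n) i : 0 <= tocube x 0 i <= 1.
Proof. by rewrite mxE cl_itv. Qed.

Let cubeof n (x : 'rV[R]_n) : cube R n := SigSub (mem_set (tocubeP x)).
Let ofcube n (y : cube R n) : 'rV[R]_n := \row_i (2 * set_val y 0 i - 1).

Let cubeof_continuous n : continuous (@cubeof n).
Proof.
apply: continuous_to_sub; apply: continuous_to_rV => i; have ccl := @cl_continuous R.
apply: (eq_cont (g := fun x : 'rV[R]_n => cl ((x 0 i + 1) / 2))); last by ct.
by move=> x; rewrite mxE.
Qed.

Let ofcube_continuous n : continuous (@ofcube n).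
Proof.
apply: continuous_to_rV => i.
apply: (eq_cont (g := fun y : cube R n => 2 * set_val y 0 i - 1)); last by ct.
by move=> x; rewrite mxE.
Qed.

Let cubeofE n (x : 'rV[R]_n) i : set_val (cubeof x) 0 i = cl ((x 0 i + 1) / 2).
Proof. by rewrite [LHS]mxE. Qed.

Let ofcubeK n (y : cube R n) : cubeof (ofcube y) = y.
Proof.
apply: val_inj; apply/rowP => i; rewrite [LHS]mxE mxE.
have h : (2 * set_val y 0 i - 1 + 1) / 2 = set_val y 0 i by lra.
by rewrite h cl_id //; exact: (set_valP y i).
Qed.

Let cubeofK n (x : 'rV[R]_n) : `|x| <= 1 -> ofcube (cubeof x) = x.
Proof.
move=> x1; apply/rowP => i; rewrite mxE cubeofE cl_id; last first.
  have := le_trans (coord_le_norm x i) x1; rewrite ler_norml => /andP[? ?].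
  by apply/andP; split; lra.
lra.
Qed.

Let ofcube_norm n (y : cube R n) : `|ofcube y| <= 1.
Proof.
apply: norm_le_coord => // i; rewrite mxE ler_norml.
by have /andP[? ?] := set_valP y i; apply/andP; split; lra.
Qed.

Let ofcube_boundary n (y : cube R n) : cube_boundary y -> `|ofcube y| = 1.
Proof.
move=> [i yi]; apply/eqP; rewrite eq_le ofcube_norm /=.
apply: le_trans (coord_le_norm _ i); rewrite mxE.
case: yi => ->; first by rewrite mulr0 sub0r normrN1.
by rewrite (_ : 2 * 1 - 1 = 1) ?normr1 //; lra.
Qed.

Let cubeof_boundary n (x : 'rV[R]_n) : `|x| = 1 -> cube_boundary (cubeof x).
Proof.
move=> x1; apply: contrapT => nb.
suff : `|x| < 1 by rewrite x1 ltxx.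
have lt1 i : `|x 0 i| < 1.
  rewrite lt_neqAle (le_trans (coord_le_norm x i)) ?x1 // andbT; apply/eqP => xi.
  apply: nb; exists i; rewrite cubeofE.
  have [x0|x0] := leP (x 0 i) 0.
    by left; move: xi; rewrite ler0_norm // => xi; rewrite cl_le0 //; lra.
  by right; move: xi; rewrite gtr0_norm // => ->; rewrite cl_ge1 //; lra.
rewrite /Num.norm /= mx_normrE; apply/bigmax_ltP; split => // -[i j] _ /=.
by rewrite (ord1 i).
Qed.

Let relhomP T n (u v : 'rV[R]_n -> T) :
  homotopic_rel (u \o @ofcube n) (v \o @ofcube n) -> relhom u v.
Proof.
move=> [H [cH H0 H1 Hb]]; have cc := @cubeof_continuous n.
exists (fun z => H (cubeof z.1, proj_unit z.2)); split.
- by ct.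
- by move=> x x1; rewrite H0 H1 /= !cubeofK.
- move=> x t x1 t01; rewrite Hb /=; last exact: cubeof_boundary.
  by rewrite cubeofK // x1.
Qed.

Let homotopic_relP T n (u v : 'rV[R]_n -> T) : relhom u v ->
  homotopic_rel (u \o @ofcube n) (v \o @ofcube n).
Proof.
move=> [K [cK K01 Kb]]; have cc := @ofcube_continuous n.
exists (fun z => K (ofcube z.1, set_val z.2)); split.
- by ct.
- by move=> y; rewrite /= set_val_i0 (K01 _ (ofcube_norm y)).1.
- by move=> y; rewrite /= set_val_i1 (K01 _ (ofcube_norm y)).2.
- by move=> y t yb; rewrite /= Kb //; [exact: ofcube_boundary|exact: itv01P].
Qed.

Let path_relhom T (u v : 'rV[R]_0 -> T) :
  path_connected R (u 0) (v 0) -> relhom u v.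
Proof.
have z0 (x : 'rV[R]_0) : x = 0 by apply/rowP => -[].
move=> [p [cp p0 p1]]; exists (fun z => p (proj_unit z.2)); split.
- by ct.
- by move=> x _; rewrite (z0 x) p0 p1.
- by move=> x t; rewrite (z0 x) normr0 => /esym/eqP; rewrite oner_eq0.
Qed.

Let sur n (a : A) (v : 'rV[R]_n.+1 -> B) : continuous v ->
  (forall x : 'rV[R]_n.+1, `|x| = 1 -> v x = f a) -> exists u : 'rV[R]_n.+1 -> A,
  [/\ continuous u, forall x : 'rV[R]_n.+1, `|x| = 1 -> u x = a & relhom (f \o u) v].
Proof.
move=> cv va; case: wf => _ _ _ /(_ n a)[sur _].
have [|u [cu ua] fu] := sur (v \o @ofcube _).
  split; first exact: (comp_continuous (@ofcube_continuous _) cv).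
  by move=> y yb; rewrite /= va // ofcube_boundary.
exists (u \o @cubeof _); split.
- exact: (comp_continuous (@cubeof_continuous _) cu).
- by move=> x x1; rewrite /= ua //; exact: cubeof_boundary.
apply: relhomP; rewrite (_ : _ \o _ = f \o u) //.
by apply/funext => y; rewrite /= ofcubeK.
Qed.

Let inj n (u v : 'rV[R]_n -> A) : continuous u -> continuous v ->
  (forall x : 'rV[R]_n, `|x| = 1 -> u x = v x) ->
  relhom (f \o u) (f \o v) -> relhom u v.
Proof.
case: n u v => [|n] u v cu cv uv.
  move=> [K [cK K01 _]]; apply: path_relhom; case: wf => _ _ + _; apply.
  exists (fun t => K (0, set_val t)); split; first by ct.
    by rewrite set_val_i0; have [|-> _] := K01 0; rewrite // normr0.
  by rewrite set_val_i1; have [|_ ->] := K01 0; rewrite // normr0.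
apply: (free_inj cf) => // a u' v' cu' cv' ua va fuv.
case: wf => _ _ _ /(_ n a)[_ inj].
have uK w : (w \o @cubeof n.+1) \o @ofcube n.+1 = w :> (cube R n.+1 -> A).
  by apply/funext => y; rewrite /= ofcubeK.
apply: relhomP; apply: inj.
- split; first exact: (comp_continuous (@ofcube_continuous _) cu').
  by move=> y yb; rewrite /= ua // ofcube_boundary.
- split; first exact: (comp_continuous (@ofcube_continuous _) cv').
  by move=> y yb; rewrite /= va // ofcube_boundary.
exact: (homotopic_relP fuv).
Qed.

(* The retraction of the cylinder [ball * [-1, 1]] onto its top and sides, by central
   projection from the point [(0, -2)]. *)
Let ret n (z : 'rV[R]_n * R) : 'rV[R]_n * R :=
  let s := (Order.max 3^-1 (Order.max `|z.1| ((z.2 + 2) / 3)))^-1 in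
  (s *: z.1, s * (z.2 + 2) - 2).

Let ret_continuous n : continuous (@ret n).
Proof.
move=> z; rewrite /ret; have : Order.max 3^-1 (Order.max `|z.1| ((z.2 + 2) / 3)) != 0.
  by rewrite gt_eqF // lt_max invr_gt0 ltr0n.
by move=> m0; ct.
Qed.

Let ret_norm n (z : 'rV[R]_n * R) : `|z.1| <= 1 -> -1 <= z.2 <= 1 ->
  Order.max `|(ret z).1| `|(ret z).2| = 1.
Proof.
case: z => x t /= x1 /andP[t0 t1].
have h3 : 3^-1 <= Order.max `|x| ((t + 2) / 3) by rewrite le_max; apply/orP; right; lra.
rewrite (max_idPr h3); set m := Order.max _ _ in h3 *.
have m0 : 0 < m by lra.
have mx : `|x| <= m by rewrite le_max lexx.
have mt : (t + 2) / 3 <= m by rewrite le_max lexx orbT.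
have m1 : m <= 1 by rewrite ge_max x1 /=; lra.
rewrite normrZ gtr0_norm ?invr_gt0 //.
have b1 : `|m^-1 * (t + 2) - 2| <= 1.
  rewrite ler_norml lerBrDr lerBlDr; apply/andP; split.
    by rewrite mulrC ler_pdivlMr //; lra.
  by rewrite mulrC ler_pdivrMr //; lra.
have : m = `|x| \/ m = (t + 2) / 3.
  by rewrite /m /Order.max; case: ifP => _; [right|left].
case=> me.
  rewrite -me mulVf ?gt_eqF //; exact/max_idPl.
rewrite (_ : m^-1 * (t + 2) - 2 = 1); last first.
  by rewrite (_ : t + 2 = m * 3) ?mulKf ?gt_eqF //; [lra|rewrite me; lra].
by rewrite normr1; apply/max_idPr; rewrite mulrC ler_pdivrMr // mul1r.
Qed.

Let ret_id n (z : 'rV[R]_n * R) : `|z.1| <= 1 -> -1 <= z.2 <= 1 ->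
  `|z.1| = 1 \/ z.2 = 1 -> ret z = z.
Proof.
case: z => x t /= x1 /andP[t0 t1] h.
have -> : ret (x, t) = (x, t + 2 - 2).
  rewrite /ret /= (_ : Order.max _ _ = 1) ?invr1 ?scale1r ?mul1r //.
  apply/eqP; rewrite eq_le !ge_max x1 !le_max /=; apply/andP; split; first lra.
  case: h => ->; first by rewrite lexx orbT.
  by apply/orP; right; apply/orP; right; lra.
by rewrite addrK.
Qed.

(** Dimension 0 is surjectivity on path components. In dimension [n + 1], injectivity in dimension
    [n] identifies the bottom face of [a] with the one obtained from the other faces, so that [a]
    extends over the ball as [at1]; surjectivity in dimension [n + 1], with free boundary, then
    corrects [at1] so that its image becomes homotopic to [b]. *)
Lemma star_weak_homotopy_equivalence : star R f.
Proof.
split=> [b|[|n] a b ca cb fab].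
- case: wf => _ + _ _ => /(_ b)[a [p [cp p0 p1]]].
  by exists a, (fun t => p (proj_unit t)); split => //; ct.
- have z0 (x : 'rV[R]_0) : x = 0 by apply/rowP => -[].
  have n1 (x : 'rV[R]_0) : `|x| = 1 -> False.
    by rewrite (z0 x) normr0 => /esym/eqP; rewrite oner_eq0.
  case: wf => _ + _ _ => /(_ (b 0))[a0 [p [cp p0 p1]]].
  exists (fun=> a0), (fun z => p (proj_unit z.2)); split.
  + by ct.
  + by move=> x /n1.
  + by ct.
  + by move=> x _; rewrite (z0 x).
  + by move=> x t /n1.
have cu := @rVuncons_continuous R n; have cc := @rVcons_continuous R n.
have clm := @clamp_continuous R 'rV[R]_n; have ccl := @cl_continuous R.
have cr := @ret_continuous n.
have nc := @norm_cons R n; have nu := @norm_uncons R n.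
pose w (z : 'rV[R]_n * R) := rVcons z.
pose cD (z : 'rV[R]_n * R) := (clamp z.1, Order.max (-1) (Order.min 1 z.2)).
have cDP z : `|(cD z).1| <= 1 /\ -1 <= (cD z).2 <= 1.
  rewrite norm_clamp_le; split => //=; rewrite le_max lexx /= ge_max ge_min lexx /=.
  by apply/andP; split => //; lra.
have cD_id z : `|z.1| <= 1 -> -1 <= z.2 <= 1 -> cD z = z.
  move=> z1 /andP[z2 z3]; case: z z1 z2 z3 => x t /= x1 t0 t1.
  by rewrite /cD /= clamp_id // (min_idPr t1) (max_idPr t0).
have cDc : continuous cD by rewrite /cD; ct.
(* [ar] extends [a] from the top and the sides of the cylinder. *)
pose ar z := a (rVcons (ret (cD z))).
have ar_norm z : `|rVcons (ret (cD z))| = 1.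
  by rewrite nc; have [] := cDP z; exact: ret_norm.
have car : continuous ar.
  move=> z; apply: (@comp_cont_at _ _ _ (fun z => rVcons (ret (cD z))) a); first by ct.
  by apply: ca; apply: norm1_neq0.
have bot_norm (x : 'rV[R]_n) : `|x| <= 1 -> `|rVcons (x, -1)| = 1.
  by move=> x1; rewrite nc /= normrN1; exact/max_idPr.
have m11 : -1 <= (-1 : R) <= 1 by apply/andP; split; lra.
pose g0 (x : 'rV[R]_n) := a (rVcons (clamp x, -1)).
have cg0 : continuous g0.
  move=> z; apply: (@comp_cont_at _ _ _ (fun z => rVcons (clamp z, -1)) a); first by ct.
  by apply: ca; apply: norm1_neq0; rewrite bot_norm ?norm_clamp_le.
(* After applying [f] the homotopy is explicit: [b] is evaluated on the segments joining the points
   of the bottom face to their images under [ret]. *)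
have [K [cK K01 Kb]] : relhom g0 (fun x => ar (x, -1)).
  apply: inj => //; first by ct.
    move=> x x1; have x1' : `|x| <= 1 by rewrite x1.
    by rewrite /g0 /ar cD_id // clamp_id // ret_id //; left.
  exists (fun z => b (rVcons ((1 - z.2) *: clamp z.1 + z.2 *: (ret (cD (z.1, -1))).1,
     -1 + z.2 * ((ret (cD (z.1, -1))).2 + 1)))); split.
  - by ct.
  - move=> x x1 /=; split.
      rewrite subr0 scale1r !scale0r addr0 mul0r addr0.
      exact/esym/fab/bot_norm/norm_clamp_le.
    rewrite subrr scale0r add0r scale1r mul1r.
    have aK (r : R) : -1 + (r + 1) = r by lra.
    by rewrite aK /ar (fab _ (ar_norm _)); congr (b (rVcons _)); case: (ret _).
  - move=> x t x1 t01; have x1' : `|x| <= 1 by rewrite x1.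
    have rE : ret (cD (x, -1)) = (x, -1) by rewrite cD_id // ret_id //; left.
    rewrite [fst (x, t)]/= [snd (x, t)]/= rE [fst _]/= [snd _]/=.
    rewrite clamp_id // -scalerDl subrK scale1r addNr mulr0 addr0.
    by rewrite /comp /g0 clamp_id // fab ?bot_norm.
pose gg (x : 'rV[R]_n.+1) := `|(rVuncons (nrm x)).1| + (rVuncons (nrm x)).2.
have nn (x : 'rV[R]_n.+1) : `|2 *: x| = 2 * `|x| by rewrite normrZ ger0_norm.
have half_neq0 (x : 'rV[R]_n.+1) : 2^-1 <= `|x| -> x != 0.
  by apply: norm_ge_neq0; rewrite invr_gt0.
have sph (y : 'rV[R]_n.+1) : `|y| = 1 -> [/\ `|(rVuncons y).1| <= 1,
    -1 <= (rVuncons y).2 <= 1 & `|(rVuncons y).1| = 1 \/ `|(rVuncons y).2| = 1].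
  move=> y1; have e : Order.max `|(rVuncons y).1| `|(rVuncons y).2| = 1 by rewrite nu.
  split; first by rewrite -e le_max lexx.
    by rewrite -ler_norml -e le_max lexx orbT.
  by move: e; rewrite /Order.max; case: ifP => _ ->; [right|left].
have low (y : 'rV[R]_n.+1) : `|y| = 1 -> `|(rVuncons y).1| + (rVuncons y).2 <= 0 ->
    y = rVcons ((rVuncons y).1, -1).
  move=> y1; have [s1 /andP[s2 s2'] s3] := sph y y1; have n0 := normr_ge0 (rVuncons y).1.
  move=> h; rewrite -[LHS](@rVunconsK R n); congr (rVcons _).
  rewrite [LHS]surjective_pairing; congr pair; case: s3 => e; first by move: h s2; rewrite e; lra.
  by move: e; rewrite ler0_norm; lra.
have high (y : 'rV[R]_n.+1) : `|y| = 1 -> 0 <= `|(rVuncons y).1| + (rVuncons y).2 ->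
    ret (rVuncons y) = rVuncons y.
  move=> y1; have [s1 s2 s3] := sph y y1; have n0 := normr_ge0 (rVuncons y).1 => h.
  apply: ret_id => //; case: s3 => e; [by left|].
  have [t0|t0] := leP (rVuncons y).2 0; last by right; rewrite -e gtr0_norm.
  by left; move: e; rewrite ler0_norm //; move: s1 h; lra.
(* On the unit sphere [gg <= 0] characterizes the bottom face. Over it [K] fills the shell between
   radii 1/2 and 1; over the other faces [a] is constant along rays. *)
pose col (x : 'rV[R]_n.+1) := if gg x <= 0
  then K ((rVuncons (nrm x)).1, cl (2 - 2 * `|x|)) else a (nrm x).
have ccol (x : 'rV[R]_n.+1) : x != 0 -> continuous_at x col.
  move=> x0; have cn := nrm_continuous x0; have y1 := norm_nrm x0.
  apply: paste_at.
  - by rewrite /gg; ct.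
  - by move=> _; ct.
  - by move=> _; apply: (comp_cont_at cn); apply: ca; exact: norm1_neq0.
  - move=> g0x; have g0x' : gg x <= 0 by rewrite g0x.
    have yE := low _ y1 g0x'.
    have y2 : (rVuncons (nrm x)).2 = -1 by rewrite yE rVconsK.
    have y3 : `|(rVuncons (nrm x)).1| = 1 by move: g0x; rewrite /gg y2; lra.
    by rewrite Kb ?cl_itv // /g0 clamp_id ?y3 // -yE.
pose at1 (x : 'rV[R]_n.+1) := if `|x| <= 2^-1 then ar (rVuncons (2 *: x)) else col x.
have cat1 : continuous at1.
  apply: (@paste R _ _ (fun x : 'rV[R]_n.+1 => `|x|) 2^-1 (fun x => ar (rVuncons (2 *: x)))).
  - by ct.
  - by ct.
  - by move=> x /half_neq0 /ccol.
  - move=> x x2; have x0 : x != 0 by apply: half_neq0; rewrite x2.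
    have y1 := norm_nrm x0; have -> : 2 *: x = nrm x by rewrite /nrm x2 invrK.
    have [s1 s2 _] := sph _ y1.
    rewrite /col; case: ifPn => [g0x|].
      have yE := low _ y1 g0x; have y2 : (rVuncons (nrm x)).2 = -1 by rewrite yE rVconsK.
      rewrite x2 cl_ge1; last by lra.
      by rewrite (K01 _ s1).2 -y2 -surjective_pairing.
    rewrite -ltNge => /ltW /(high _ y1) yE.
    by rewrite /ar cD_id // yE rVunconsK.
have at1a (x : 'rV[R]_n.+1) : `|x| = 1 -> at1 x = a x.
  move=> x1; rewrite /at1 x1 ifF; last by apply/negbTE; rewrite -ltNge; lra.
  have [s1 _ _] := sph x x1.
  rewrite /col /gg x1 nrm_id //; case: ifPn => // /(low x x1) xE.
  rewrite cl_le0; last by lra.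
  by rewrite (K01 _ s1).1 /g0 clamp_id // -xE.
have at1b (x : 'rV[R]_n.+1) : `|x| = 1 -> b x = f (at1 x).
  by move=> x1; rewrite at1a // fab.
have [u [cu' ub [L [cL L01 Lb]]]] := free_sur cf (@sur n) cat1 cb at1b.
exists u, L; split => //.
- by move=> x x1; rewrite ub // at1a.
- by move=> x t x1 t01; rewrite Lb //= ub // at1a // fab.
Qed.

End WeakEquivalence.

End HomotopyGroups.

(** * Path spaces *)

Section PathPlots.
Variable R : realType.
Local Notation I := (unit_interval R).
Implicit Types S T U : topologicalType.

Lemma unit_interval_compact : compact [set: I].
Proof. exact: set_type_compact (@segment_compact R 0 1). Qed.

Lemma unit_interval_regular : regular_space I.
Proof. exact: (@uniform_regular (set_type (`[0, 1]%classic : set R))). Qed.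

Lemma unit_interval_locally_compact : locally_compact [set: I].
Proof.
move=> x _; exists [set: I]; first exact: filterT.
by split => //; exact: unit_interval_compact.
Qed.

(** The exponential law for the locally compact regular space [I]; the Delta-kelleyfication of the
    mapping space only refines its topology. *)
Lemma TOP01_eval S T (u : S -> TOP01 R T) : continuous u ->
  continuous (fun z : S * I => TOP01_fun (u z.1) z.2).
Proof.
move=> cu; have c1 := comp_continuous cu (@kelley_id_continuous R _).
have c2 := comp_continuous c1 (@set_val_continuous _ _).
have c3 x : continuous (TOP01_fun (u x)).
  exact: (set_valP (u x : set_type [set g : {compact-open, I -> T} | continuous (g : I -> T)])).
have c4 := @continuous_uncurry_regular S I T (fun x => TOP01_fun (u x))
  unit_interval_locally_compact unit_interval_regular c2 c3.
by apply: eq_cont c4 => -[].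
Qed.

Lemma TOP01_curry S T (u : S -> TOP01 R T) : delta_generated R S ->
  continuous (fun z : S * I => TOP01_fun (u z.1) z.2) -> continuous u.
Proof.
move=> dS cu; apply: continuous_kelley => //; apply: continuous_to_sub.
exact: (continuous_curry_fun cu).
Qed.

Section PathSpace.
Variables (h : bool) (X : mdspace R h) (a b : underlying X).

Lemma path_eval S (u : S -> path_space a b) : continuous u ->
  continuous (fun z : S * I => path_fun (u z.1) z.2).
Proof.
move=> cu; have c1 := comp_continuous cu (@kelley_id_continuous R _).
have c2 := comp_continuous c1 (@set_val_continuous _ _).
exact: (TOP01_eval c2).
Qed.

Lemma path_curry S (u : S -> path_space a b) : delta_generated R S ->
  continuous (fun z : S * I => path_fun (u z.1) z.2) -> continuous u.
Proof.
by move=> dS cu; apply: path_space_continuous => //; exact: (continuous_curry_fun cu).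
Qed.

End PathSpace.

(** As the maps [f j] separate points, the diagonal is the intersection of the preimages of the
    closed diagonals of the [U j]. *)
Lemma in_Top_family h T (J : Type) (U : J -> topologicalType)
    (f : forall j, T -> U j) : delta_generated R T ->
  (forall j, in_Top R h (U j)) -> (forall j, continuous (f j)) ->
  (forall x y, (forall j, f j x = f j y) -> x = y) -> in_Top R h T.
Proof.
move=> dT hU cf fI; split=> // hh; rewrite /delta_hausdorff.
rewrite (_ : [set _ | _] = \bigcap_(j in [set: J]) ((fun z : kprod R T T =>
    (f j z.1, f j z.2) : kprod R (U j) (U j)) @^-1` [set x | x.1 = x.2])).
  apply: closed_bigI => j _; apply: closed_comp => [z _|]; last exact: (hU j).2.
  apply: kpair_continuous; first exact: kelley_delta.
    exact: (comp_continuous (@kfst_continuous _ _ _) (cf j)).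
  exact: (comp_continuous (@ksnd_continuous _ _ _) (cf j)).
by apply/seteqP; split => -[x y] /= => [->//|xy]; apply: fI => j; exact: xy.
Qed.

Lemma TOP01_at_continuous T t : continuous (fun g : TOP01 R T => TOP01_fun g t).
Proof.
have c1 : continuous (fun g : TOP01 R T => (g, t)).
  by move=> g; ct.
exact: (comp_continuous c1 (@TOP01_eval _ T id (fun=> cvg_id))).
Qed.

Lemma TOP01_funI T : injective (@TOP01_fun R T).
Proof. by move=> f g fg; exact: val_inj. Qed.

Lemma TOP01_in_Top h T : in_Top R h T -> in_Top R h (TOP01 R T).
Proof.
move=> hT; apply: (@in_Top_family h _ I (fun=> T) (fun t g => TOP01_fun g t)) => //.
- exact: kelley_delta.
- by move=> t; exact: TOP01_at_continuous.
- by move=> x y xy; apply: TOP01_funI; apply/funext.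
Qed.

Lemma path_at_continuous h (X : mdspace R h) (a b : underlying X) t :
  continuous (fun g : path_space a b => path_fun g t).
Proof.
have c1 : continuous (fun g : path_space a b => (g, t)).
  by move=> g; ct.
exact: (comp_continuous c1 (@path_eval _ X a b _ id (fun=> cvg_id))).
Qed.

Lemma path_space_in_Top h (X : mdspace R h) (a b : underlying X) :
  in_Top R h (path_space a b).
Proof.
apply: (@in_Top_family h _ I (fun=> underlying X) (fun t g => path_fun g t)).
- exact: kelley_delta.
- by move=> _; exact: carrierP.
- by move=> t; exact: path_at_continuous.
- by move=> x y xy; apply: path_fun_inj; apply/funext.
Qed.

Lemma kprod_in_Top h T U : in_Top R h T -> in_Top R h U -> in_Top R h (kprod R T U).
Proof.
move=> hT hU; apply: (@in_Top_family h _ bool (fun b => if b then T else U)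
  (fun b => if b as b return kprod R T U -> (if b then T else U) then fst else snd)).
- exact: kelley_delta.
- by case.
- by case; [exact: kfst_continuous|exact: ksnd_continuous].
- by move=> [x y] [x' y'] H; rewrite (H true : x = x') (H false : y = y').
Qed.

Lemma ncomp_comp T U (f : T -> U) (g1 g2 : I -> T) :
  f \o ncomp g1 g2 = ncomp (f \o g1) (f \o g2).
Proof. by apply/funext => t; rewrite /ncomp /=; case: ifP. Qed.

Lemma ncomp_continuous T (g1 g2 : I -> T) : continuous g1 -> continuous g2 ->
  g1 i1 = g2 i0 -> continuous (ncomp g1 g2).
Proof.
move=> c1 c2 e12.
apply: (@paste R I T (fun t : I => set_val t) 2^-1 (fun t => g1 (proj_unit (2 * set_val t)))
  (fun t => g2 (proj_unit (2 * set_val t - 1)))).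
- by ct.
- by ct.
- by ct.
- by move=> t th; rewrite th mulfV ?pnatr_eq0 // subrr.
Qed.

Lemma rV_I_delta n : delta_generated R ('rV[R]_n * I)%type.
Proof.
apply: (@delta_retract R _ ('rV[R]_n * R)%type (fun z => (z.1, set_val z.2))
  (fun z => (z.1, proj_unit z.2))).
- exact: rV_prod_delta.
- by ct.
- by ct.
- by move=> [x t] /=; rewrite set_valK01.
Qed.

End PathPlots.

(** * Homotopies and homotopy pullbacks *)

Section MdHomotopy.
Variables (R : realType) (h : bool).
Local Notation I := (unit_interval R).
Implicit Types W X Y : mdspace R h.

Definition homot W X (f g : underlying W -> underlying X) :=
  exists K : I -> underlying W -> underlying X, [/\
    continuous (fun z : underlying W * I => K z.2 z.1), K i0 = f, K i1 = g,
    forall u e, execution e -> execution (K u \o e) &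
    forall u a, states a -> K u a = f a].

Lemma homot_refl W X (f : mdmap W X) : homot f f.
Proof.
exists (fun=> f); split=> // [|u e ee]; last exact: md_execution.
exact: (comp_continuous (@fst_continuous _ _) (@md_continuous _ _ _ _ f)).
Qed.

Lemma homot_sym W X (f g : underlying W -> underlying X) : homot f g -> homot g f.
Proof.
move=> [K [cK K0 K1 eK sK]]; exists (fun u => K (proj_unit (1 - set_val u))).
split=> [||| u e ee|u a sa].
- have c2 : continuous (fun z : underlying W * I => (z.1, proj_unit (1 - set_val z.2) : I)).
    by ct.
  exact: (comp_continuous c2 cK).
- by rewrite set_val_i0 subr0.
- by rewrite set_val_i1 subrr.
- exact: eK.
- by rewrite sK // -K1 sK.
Qed.

Lemma homot_states W X (f g : underlying W -> underlying X) a :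
  homot f g -> states a -> f a = g a.
Proof. by move=> [K [_ _ <- _ sK]] sa; rewrite sK. Qed.

Lemma homot_trans W X (f g k : underlying W -> underlying X) :
  homot f g -> homot g k -> homot f k.
Proof.
move=> fg gk; have fga a := homot_states (a := a) fg.
case: fg gk => [K [cK K0 K1 eK sK]] [L [cL L0 L1 eL sL]].
exists (fun u => if set_val u <= 2^-1 then K (proj_unit (2 * set_val u))
  else L (proj_unit (2 * set_val u - 1))); split.
- have c1 : continuous (fun z : underlying W * I => (z.1, proj_unit (2 * set_val z.2) : I)) by ct.
  have c2 : continuous (fun z : underlying W * I => (z.1, proj_unit (2 * set_val z.2 - 1) : I)) by ct.
  apply: (eq_cont (g := fun z : underlying W * I => if set_val z.2 <= 2^-1 then
    K (proj_unit (2 * set_val z.2)) z.1 else L (proj_unit (2 * set_val z.2 - 1)) z.1)).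
    by move=> z; case: ifP.
  apply: paste.
  + by ct.
  + by move=> z _; exact: (comp_continuous c1 cK).
  + by move=> z _; exact: (comp_continuous c2 cL).
  + move=> z zh; rewrite zh mulfV ?pnatr_eq0 // subrr.
    by rewrite -/(@i0 R) -/(@i1 R) L0 K1.
- by rewrite set_val_i0 mulr0 ifT ?invr_ge0.
- rewrite set_val_i1 ifF; first by rewrite -L1; congr (L (proj_unit _)); lra.
  by apply/negbTE; rewrite -ltNge; lra.
- by move=> u e ee; case: ifP => _; [exact: eK|exact: eL].
- by move=> u a sa; case: ifP => _; [exact: sK|rewrite sL // fga].
Qed.

Lemma homot_precomp W' W X (f : mdmap W' W) (g g' : underlying W -> underlying X) :
  homot g g' -> homot (g \o f) (g' \o f).
Proof.
move=> [K [cK K0 K1 eK sK]]; exists (fun u => K u \o f); split=> [|||u e ee|u a sa].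
- have cf := @md_continuous _ _ _ _ f.
  have c1 : continuous (fun z : underlying W' * I => (f z.1, z.2)) by ct.
  exact: (comp_continuous c1 cK).
- by rewrite K0.
- by rewrite K1.
- by apply: (eK u (f \o e)); exact: md_execution.
- by apply: sK; exact: md_states.
Qed.

Lemma homot_postcomp W X X' (k : mdmap X X') (g g' : underlying W -> underlying X) :
  homot g g' -> homot (k \o g) (k \o g').
Proof.
move=> [K [cK K0 K1 eK sK]]; exists (fun u => k \o K u); split=> [|||u e ee|u a sa].
- exact: (comp_continuous cK (@md_continuous _ _ _ _ k)).
- by rewrite K0.
- by rewrite K1.
- by apply: (md_execution k (g := K u \o e)); exact: eK.
- by rewrite /= sK.
Qed.

Section PathObject.
Variables (Y0 Y1 X : mdspace R h) (k0 : mdmap Y0 X) (k1 : mdmap Y1 X).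

Definition pull_set : set ((underlying Y0 * TOP01 R (underlying X)) * underlying Y1) :=
  [set z | TOP01_fun z.1.2 i0 = k0 z.1.1 /\ TOP01_fun z.1.2 i1 = k1 z.2].

Definition pull_top : topologicalType := kelley R (set_type pull_set).

Definition pull0 (x : pull_top) : underlying Y0 := (set_val (x : set_type pull_set)).1.1.
Definition pullw (x : pull_top) : TOP01 R (underlying X) :=
  (set_val (x : set_type pull_set)).1.2.
Definition pull1 (x : pull_top) : underlying Y1 := (set_val (x : set_type pull_set)).2.

Let pull_val_continuous : continuous (fun x : pull_top => set_val (x : set_type pull_set)).
Proof.
apply: (@comp_continuous pull_top (set_type pull_set : topologicalType) _ id set_val).
  exact: kelley_id_continuous.
exact: set_val_continuous.
Qed.

Lemma pull0_continuous : continuous pull0.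
Proof. exact: (comp_continuous pull_val_continuous (comp_continuous (@fst_continuous _ _) (@fst_continuous _ _))). Qed.
Lemma pullw_continuous : continuous pullw.
Proof. exact: (comp_continuous pull_val_continuous (comp_continuous (@fst_continuous _ _) (@snd_continuous _ _))). Qed.
Lemma pull1_continuous : continuous pull1.
Proof. exact: (comp_continuous pull_val_continuous (@snd_continuous _ _)). Qed.

Lemma pull_continuous (S : topologicalType) (f : S -> pull_top) : delta_generated R S ->
  continuous (pull0 \o f) -> continuous (pullw \o f) -> continuous (pull1 \o f) ->
  continuous f.
Proof.
move=> dS c0 cw c1; apply: continuous_kelley => //; apply: continuous_to_sub.
apply: (eq_cont (g := fun x => ((pull0 (f x), pullw (f x)), pull1 (f x)))).
  by move=> x; rewrite /pull0 /pullw /pull1 /=; case: (set_val _) => -[].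
by apply: pair_continuous => //; apply: pair_continuous.
Qed.

Lemma pullP (x : pull_top) : TOP01_fun (pullw x) i0 = k0 (pull0 x) /\
  TOP01_fun (pullw x) i1 = k1 (pull1 x).
Proof. exact: (set_valP (x : set_type pull_set)). Qed.

Lemma pull_eq (x y : pull_top) : pull0 x = pull0 y -> pull1 x = pull1 y ->
  TOP01_fun (pullw x) = TOP01_fun (pullw y) -> x = y.
Proof.
move=> e0 e1 /TOP01_funI ew; apply: val_inj; move: e0 e1 ew.
rewrite /pull0 /pull1 /pullw /set_val /=.
by case: (val x) (val y) => [[a b] c] [[a' b'] c'] /= -> -> ->.
Qed.

Lemma pull_in_Top : in_Top R h pull_top.
Proof.
pose U (o : option bool) : topologicalType := if o is Some b then
  if b then underlying Y0 else underlying Y1 else TOP01 R (underlying X).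
pose f (o : option bool) : pull_top -> U o := match o with
  | Some true => pull0 | Some false => pull1 | None => pullw end.
apply: (@in_Top_family R h _ _ U f).
- exact: kelley_delta.
- by move=> [[]|]; [exact: carrierP|exact: carrierP|apply: TOP01_in_Top; exact: carrierP].
- by move=> [[]|]; [exact: pull0_continuous|exact: pull1_continuous|exact: pullw_continuous].
- move=> x y xy; apply: pull_eq.
  + exact: (xy (Some true)).
  + exact: (xy (Some false)).
  + by congr TOP01_fun; exact: (xy None).
Qed.

Definition pull_space : space R h := Space pull_in_Top.

Definition pull_slice (x : pull_top) (u : I) : underlying X := TOP01_fun (pullw x) u.

Lemma pull_slice0 x : pull_slice x i0 = k0 (pull0 x).
Proof. by have [] := pullP x. Qed.
Lemma pull_slice1 x : pull_slice x i1 = k1 (pull1 x).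
Proof. by have [] := pullP x. Qed.

(** Constancy of the connecting path at states is what makes the homotopy of [pull_homot] relative
    to the states. *)
Definition pull_states : set pull_space :=
  [set x | [/\ states (pull0 x), states (pull1 x) &
    forall u, pull_slice x u = k0 (pull0 x)]].

Definition pull_execution : set (I -> pull_space) :=
  [set g | [/\ continuous g, execution (pull0 \o g), execution (pull1 \o g),
    forall u, execution (fun t => pull_slice (g t) u) &
    forall u, pull_slice (g i0) u = k0 (pull0 (g i0)) /\ pull_slice (g i1) u = k0 (pull0 (g i1))]].

(* The homotopy pullback of [k0] and [k1]. *)
Definition pull : mdspace R h.
Proof.
refine (@MdSpace R h pull_space pull_states pull_execution _ _ _ _ _).
- by move=> g [].
- move=> g [_ e0 e1 _ sw]; split; [exact: (execution_start e0)|exact: (execution_start e1)|].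
  by move=> u; have [] := sw u.
- move=> g [_ e0 e1 _ sw]; split; [exact: (execution_end e0)|exact: (execution_end e1)|].
  by move=> u; have [] := sw u.
- move=> g phi [cg e0 e1 ew sw] rphi; split.
  + exact: (comp_continuous (reparam_continuous rphi) cg).
  + exact: (execution_reparam e0).
  + exact: (execution_reparam e1).
  + by move=> u; exact: (execution_reparam (ew u)).
  + by rewrite /= reparam0 // reparam1.
- move=> g g' [cg e0 e1 ew sw] [cg' e0' e1' ew' sw'] gg'; split.
  + exact: ncomp_continuous.
  + by rewrite ncomp_comp; apply: execution_ncomp => //=; rewrite gg'.
  + by rewrite ncomp_comp; apply: execution_ncomp => //=; rewrite gg'.
  + move=> u; rewrite (_ : (fun t => _) = (pull_slice^~ u) \o ncomp g g') // ncomp_comp.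
    by apply: execution_ncomp => //=; [exact: ew|exact: ew'|rewrite gg'].
  + move=> u; rewrite ncomp0 ncomp1; split; [exact: (sw u).1|exact: (sw' u).2].
Defined.

Definition pull_pr0 : mdmap pull Y0.
Proof.
refine (@MdMap R h pull Y0 pull0 pull0_continuous _ _).
- by move=> x [].
- by move=> g [].
Defined.

Definition pull_pr1 : mdmap pull Y1.
Proof.
refine (@MdMap R h pull Y1 pull1 pull1_continuous _ _).
- by move=> x [].
- by move=> g [].
Defined.

Lemma pull_homot W (f : mdmap W pull) : homot (k0 \o pull_pr0 \o f) (k1 \o pull_pr1 \o f).
Proof.
have cf : continuous (f : underlying W -> pull_top) by exact: (@md_continuous _ _ _ _ f).
exists (fun u y => pull_slice (f y) u); split.
- exact: (@TOP01_eval R _ _ (fun y => pullw (f y)) (comp_continuous cf pullw_continuous)).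
- by apply/funext => y; rewrite pull_slice0.
- by apply/funext => y; rewrite pull_slice1.
- by move=> u e ee; have [_ _ _ + _] := md_execution f ee; apply.
- by move=> u a sa; have [_ _ ->] := md_states f sa.
Qed.

Definition mk_pull (y0 : underlying Y0) (y1 : underlying Y1) (w : I -> underlying X)
    (cw : continuous w) (w0 : w i0 = k0 y0) (w1 : w i1 = k1 y1) : pull_top :=
  SigSub (mem_set (conj w0 w1 : pull_set ((y0, mk_TOP01 cw), y1))).

(** Converse of [pull_homot]: a homotopy relative to the states is the same thing as a map to the
    homotopy pullback. *)
Lemma pull_map W (f0 : mdmap W Y0) (f1 : mdmap W Y1) (K : I -> underlying W -> underlying X) :
  continuous (fun z : underlying W * I => K z.2 z.1) ->
  K i0 = k0 \o f0 -> K i1 = k1 \o f1 ->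
  (forall u e, execution e -> execution (K u \o e)) ->
  (forall u a, states a -> K u a = k0 (f0 a)) ->
  exists f : mdmap W pull, forall y : underlying W, [/\ pull0 (f y : pull_top) = f0 y,
    pull1 (f y : pull_top) = f1 y & forall u, pull_slice (f y : pull_top) u = K u y].
Proof.
move=> cK K0 K1 eK sK.
have cw y : continuous (K^~ y).
  have c1 : continuous (fun u : I => (y, u)) by ct.
  exact: (comp_continuous c1 cK).
have w0 y : K i0 y = k0 (f0 y) by rewrite K0.
have w1 y : K i1 y = k1 (f1 y) by rewrite K1.
pose f y := mk_pull (cw y) (w0 y) (w1 y).
have cf : continuous (f : underlying W -> pull_space).
  have [dW _] := carrierP (underlying W); apply: pull_continuous => //.
  - exact: (@md_continuous _ _ _ _ f0).
  - by apply: TOP01_curry.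
  - exact: (@md_continuous _ _ _ _ f1).
have sf a : states a -> pull_states (f a).
  move=> sa; split; [exact: (md_states f0 sa)|exact: (md_states f1 sa)|].
  by move=> u; rewrite [LHS](sK u a sa).
have ef e : execution e -> pull_execution (f \o e).
  move=> ee; split.
  - exact: (comp_continuous (execution_continuous ee) cf).
  - exact: (md_execution f0 ee).
  - exact: (md_execution f1 ee).
  - by move=> u; exact: (eK u e ee).
  - move=> u; split; first by exact: (sK u _ (execution_start ee)).
    by exact: (sK u _ (execution_end ee)).
by exists (@MdMap R h W pull f cf sf ef).
Qed.

End PathObject.
End MdHomotopy.

(** * Globes *)

Section Radial.
Variable R : realType.

Definition e2 n (x : 'rV[R]_n) : R := Num.sqrt (\sum_i x 0 i ^+ 2).

Lemma sqsum_ge0 n (x : 'rV[R]_n) : 0 <= \sum_i x 0 i ^+ 2.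
Proof. by apply: sumr_ge0 => i _; exact: sqr_ge0. Qed.

Lemma e2_continuous n : continuous (@e2 n).
Proof.
have c1 : continuous (fun x : 'rV[R]_n => \sum_i x 0 i ^+ 2).
  apply: coord_sum_continuous => i; apply: (eq_cont (g := fun x : 'rV[R]_n => x 0 i * x 0 i)).
    by move=> x; rewrite expr2.
  by ct.
exact: (comp_continuous c1 (@sqrt_continuous R)).
Qed.

Lemma norm_le_e2 n (x : 'rV[R]_n) : `|x| <= e2 x.
Proof.
apply: norm_le_coord => [|i]; first exact: sqrtr_ge0.
rewrite -sqrtr_sqr ler_wsqrtr // (bigD1 i) //= lerDl.
by apply: sumr_ge0 => j _; exact: sqr_ge0.
Qed.

Lemma e2Z n (r : R) (x : 'rV[R]_n) : e2 (r *: x) = `|r| * e2 x.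
Proof.
rewrite /e2; under eq_bigr do rewrite mxE exprMn.
by rewrite -mulr_sumr sqrtrM ?sqr_ge0 // sqrtr_sqr.
Qed.

Lemma e2_0 n : e2 (0 : 'rV[R]_n) = 0.
Proof. by rewrite -(scale0r 0) e2Z normr0 mul0r. Qed.

Lemma e2_gt0 n (x : 'rV[R]_n) : x != 0 -> 0 < e2 x.
Proof. by move=> x0; apply: lt_le_trans (norm_le_e2 x); rewrite normr_gt0. Qed.

Lemma e2_sq n (x : 'rV[R]_n) : e2 x ^+ 2 = \sum_i x 0 i ^+ 2.
Proof. by rewrite sqr_sqrtr // sqsum_ge0. Qed.

Lemma e2_ge0 n (x : 'rV[R]_n) : 0 <= e2 x. Proof. exact: sqrtr_ge0. Qed.

(** Away from 0 the quotient is continuous; at 0, where it may have no limit, the bound by [g] takes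
    over. *)
Lemma radial_continuous n (p q g : 'rV[R]_n -> R) : continuous p -> continuous q ->
  (forall x, x != 0 -> q x != 0) -> continuous g -> g 0 = 0 ->
  (forall x, `|(p x / q x) *: x| <= g x) ->
  continuous (fun x => (p x / q x) *: x).
Proof.
move=> cp cq q0 cg g0 le x; have [->|x0] := eqVneq x 0; last by ct; exact: q0.
move=> A; rewrite /= scaler0 => /nbhs_ballP[e /= e0 eA].
have N : nbhs (0 : 'rV[R]_n) [set y | g y < e].
  by apply: (cg 0 [set r | r < e]); rewrite g0; exact: lt_nbhsl.
apply: filterS N => y /= ge; apply: eA; rewrite -ball_normE /= sub0r normrN.
exact: le_lt_trans (le y) ge.
Qed.

(** [supn] and [eucl] are inverse radial homeomorphisms between the Euclidean ball, which defines
    globes, and the sup norm ball, in terms of which [star] is stated. *)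
Definition supn n (x : 'rV[R]_n) : 'rV[R]_n := (e2 x / `|x|) *: x.
Definition eucl n (x : 'rV[R]_n) : 'rV[R]_n := (`|x| / e2 x) *: x.

Lemma norm_supn n (x : 'rV[R]_n) : `|supn x| = e2 x.
Proof.
have [->|x0] := eqVneq x 0; first by rewrite /supn scaler0 normr0 e2_0.
rewrite normrZ ger0_norm ?divr_ge0 ?e2_ge0 // -mulrA mulVf ?mulr1 //.
by rewrite normr_eq0.
Qed.

Lemma e2_eucl n (x : 'rV[R]_n) : e2 (eucl x) = `|x|.
Proof.
have [->|x0] := eqVneq x 0; first by rewrite /eucl scaler0 e2_0 normr0.
rewrite e2Z ger0_norm ?divr_ge0 ?e2_ge0 // -mulrA mulVf ?mulr1 //.
by rewrite gt_eqF // e2_gt0.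
Qed.

Lemma supn_continuous n : continuous (@supn n).
Proof.
apply: (@radial_continuous n (@e2 n) (fun x => `|x|) (@e2 n)).
- exact: e2_continuous.
- by ct.
- by move=> x; rewrite normr_eq0.
- exact: e2_continuous.
- exact: e2_0.
- by move=> x; rewrite -/(supn x) norm_supn.
Qed.

Lemma eucl_continuous n : continuous (@eucl n).
Proof.
apply: (@radial_continuous n (fun x => `|x|) (@e2 n) (fun x => `|x|)).
- by ct.
- exact: e2_continuous.
- by move=> x x0; rewrite gt_eqF // e2_gt0.
- by ct.
- exact: normr0.
- by move=> x; rewrite -/(eucl x) (le_trans (norm_le_e2 _)) // e2_eucl.
Qed.

Lemma supnK n (x : 'rV[R]_n) : eucl (supn x) = x.
Proof.
have [->|x0] := eqVneq x 0; first by rewrite /eucl /supn !scaler0.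
have nx : `|x| != 0 by rewrite normr_eq0.
have ex : e2 x != 0 by rewrite gt_eqF // e2_gt0.
rewrite /eucl norm_supn /supn e2Z ger0_norm ?divr_ge0 ?e2_ge0 // scalerA.
have -> : e2 x / (e2 x / `|x| * e2 x) * (e2 x / `|x|) = 1; last by rewrite scale1r.
by rewrite invfM (mulrCA (e2 x) _ (e2 x)^-1) mulfV // mulr1 mulVf // mulf_neq0 ?invr_eq0.
Qed.

Lemma eucl_diskP n (x : 'rV[R]_n) :
  [set x : 'rV[R]_n | \sum_i x 0 i ^+ 2 <= 1] (eucl (clamp x)).
Proof.
by rewrite /= -e2_sq e2_eucl expr_le1 // norm_clamp_le.
Qed.

Definition eucl_disk n (x : 'rV[R]_n) : disk R n := SigSub (mem_set (eucl_diskP x)).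

Lemma eucl_disk_continuous n : continuous (@eucl_disk n).
Proof.
apply: continuous_to_sub; have c1 := @clamp_continuous R 'rV[R]_n.
exact: (comp_continuous c1 (@eucl_continuous n)).
Qed.

Lemma disk_norm n (d : disk R n) : `|supn (set_val d)| <= 1.
Proof.
rewrite norm_supn -(@expr_le1 _ 2) ?e2_ge0 // e2_sq; exact: (set_valP d).
Qed.

Lemma eucl_diskK n (d : disk R n) : eucl_disk (supn (set_val d)) = d.
Proof.
apply: val_inj; rewrite -!set_valE /= [LHS]/set_val /= clamp_id ?supnK //.
exact: disk_norm.
Qed.

Lemma sphere_norm n (s : sphere R n) : `|supn (set_val s)| = 1.
Proof. by rewrite norm_supn /e2 (set_valP s : _ = 1) sqrtr1. Qed.

Lemma eucl_sphereP n (x : 'rV[R]_n) : x != 0 ->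
  [set x : 'rV[R]_n | \sum_i x 0 i ^+ 2 = 1] ((e2 x)^-1 *: x).
Proof.
move=> x0; have ex := e2_gt0 x0.
by rewrite /= -e2_sq e2Z gtr0_norm ?invr_gt0 // mulVf ?expr1n // gt_eqF.
Qed.

Definition eucl_sphere n (x : 'rV[R]_n) (x0 : x != 0) : sphere R n :=
  SigSub (mem_set (eucl_sphereP x0)).

(** The default [d] is the value at the origin, where [star] asks for no continuity. *)
Definition sphere_ext n T (d : T) (g : sphere R n -> T) (x : 'rV[R]_n) : T :=
  if pselect (x != 0) is left p then g (eucl_sphere p) else d.

Lemma sphere_extE n T (d : T) (g : sphere R n -> T) (s : sphere R n) :
  sphere_ext d g (supn (set_val s)) = g s.
Proof.
rewrite /sphere_ext; case: pselect => [p|].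
  congr g; apply: val_inj; rewrite -!set_valE [LHS]/set_val /=.
  by rewrite -[RHS]supnK /eucl sphere_norm div1r.
by case; apply: norm1_neq0; exact: sphere_norm.
Qed.

Lemma sphere_ext_factor n (S : topologicalType) (rho : S -> 'rV[R]_n) :
  continuous rho -> (forall w, rho w != 0) -> exists2 s : S -> sphere R n, continuous s &
  forall T (d : T) g w, sphere_ext d g (rho w) = g (s w).
Proof.
move=> crho rho0; exists (fun w => eucl_sphere (rho0 w)); last first.
  move=> T d g w; rewrite /sphere_ext; case: pselect => [p|[]] //.
  by congr (g (eucl_sphere _)); exact: Prop_irrelevance.
apply: continuous_to_sub; have c1 := @e2_continuous n.
have c2 := comp_continuous crho c1.
have c3 : continuous (fun w => ((@e2 n \o rho) w)^-1 *: rho w).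
  by ct; rewrite /= gt_eqF // e2_gt0.
exact: c3.
Qed.

End Radial.

Section GlobeRec.
Variables (R : realType) (h : bool) (Z : topologicalType) (X : mdspace R h).
Local Notation I := (unit_interval R).

Lemma globe_rec (F : Z -> I -> underlying X) (a b : underlying X) :
  continuous (fun z : kprod R Z I => F z.1 z.2) ->
  (forall z, F z i0 = a) -> (forall z, F z i1 = b) -> states a -> states b ->
  (forall z, execution (F z)) ->
  exists m : mdmap (globe R h Z) X,
    (forall z t, m (globe_pi h (inside z t)) = F z t) /\
    forall c, m (globe_pi h (pole R Z c)) = if c then b else a.
Proof.
move=> cF F0 F1 sa sb eF.
pose f (x : preglobe R Z) : underlying X := match x with
  | existT c y => (if c return globe_part R Z c -> underlying X then fun y => F y.1 y.2
                   else fun y => if y then b else a) y end.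
have cf : continuous f.
  apply/continuousP => A oA; apply/sigT_openP => -[]; last exact: discrete_open.
  exact: (continuousP _).1 cF _ oA.
have rf x y : globe_rel x y -> f x = f y.
  by move=> [z [[-> ->]|[-> ->]]] /=; rewrite ?F0 ?F1.
pose m (x : globe_space R h Z) : underlying X := f (@topquot_repr R h _ (@globe_rel R Z) x).
have mE x : m (globe_pi h x) = f x.
  by apply: (topquot_factor (carrierP (underlying X)) cf rf); exact: topquot_reprK.
have cm : continuous m.
  apply: (@topquot_continuous R h _ (@globe_rel R Z)).
  by apply: eq_cont cf => x; exact: mE.
have sm x : @states R h (globe R h Z) x -> states (m x).
  by move=> [c _ <-]; rewrite /= mE /=; case: c.
have em g : @execution R h (globe R h Z) g -> execution (m \o g).
  move=> [z [phi [rphi ->]]].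
  rewrite (_ : _ \o _ = F z \o phi); first exact: execution_reparam.
  by apply/funext => t; rewrite /= /globe_path mE.
exists (@MdMap R h (globe R h Z) X m cm sm em); split=> [z t|c] /=; exact: mE.
Qed.

Lemma globe_cases (x : globe_space R h Z) :
  (exists z t, x = globe_pi h (inside z t)) \/ exists c, x = globe_pi h (pole R Z c).
Proof.
rewrite -(topquot_reprK x); case: (topquot_repr x) => -[] y; last by right; exists y.
by left; case: y => z t; exists z, t.
Qed.

Lemma globe_id_path (z : Z) : @execution R h (globe R h Z) (globe_path h z id).
Proof. by exists z, id; split => //; split => // t; exists t. Qed.

Lemma inside0 (z : Z) : globe_pi h (inside z i0) = globe_pi h (pole R Z false).
Proof. by apply: topquot_pi_eq; exists z; left. Qed.

Lemma inside1 (z : Z) : globe_pi h (inside z i1) = globe_pi h (pole R Z true).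
Proof. by apply: topquot_pi_eq; exists z; right. Qed.

Lemma inside_continuous : continuous (fun z : kprod R Z I => globe_pi h (inside z.1 z.2)).
Proof.
have c1 := comp_continuous (@part_continuous R Z true) (@topquot_pi_continuous R h _ (@globe_rel R Z)).
by apply: eq_cont c1 => -[].
Qed.

End GlobeRec.

(** * Homotopy classes of maps from q-cofibrant objects *)

Section Lifting.
Variables (R : realType) (h : bool).
Local Notation I := (unit_interval R).
Implicit Types W X Y : mdspace R h.

Lemma path_exec X (a b : underlying X) (g : path_space a b) : execution (path_fun g).
Proof. by have [] := path_funP g. Qed.
Lemma path_src X (a b : underlying X) (g : path_space a b) : path_fun g i0 = a.
Proof. by have [] := path_funP g. Qed.
Lemma path_tgt X (a b : underlying X) (g : path_space a b) : path_fun g i1 = b.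
Proof. by have [] := path_funP g. Qed.

Definition path_map Y X (k : mdmap Y X) (a b : underlying Y) (g : path_space a b) :
    path_space (k a) (k b) :=
  mk_path (md_execution k (path_exec g)) (congr1 k (path_src g)) (congr1 k (path_tgt g)).

(** The weak equivalences of the q-model structure, with [star] expressing the condition on spaces
    of execution paths. *)
Definition mdstar Y X (k : mdmap Y X) :=
  [/\ forall b, states b -> exists2 a, states a & k a = b,
      forall a a', states a -> states a' -> k a = k a' -> a = a' &
      forall a b, states a -> states b -> star R (@path_map Y X k a b)].

(** The condition on path components is the lifting property in dimension 0, where the sphere is
    empty; [inh] supplies the dummy map required on it. *)
Lemma star_intro (A B : topologicalType) (f : A -> B) : (B -> inhabited A) ->
  (forall n (a : 'rV[R]_n -> A) (b : 'rV[R]_n -> B),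
    (forall x : 'rV[R]_n, x != 0 -> continuous_at x a) -> continuous b ->
    (forall x : 'rV[R]_n, `|x| = 1 -> f (a x) = b x) ->
    exists (c : 'rV[R]_n -> A) (k : 'rV[R]_n * R -> B), [/\ continuous c,
      forall x : 'rV[R]_n, `|x| = 1 -> c x = a x, continuous k,
      forall x : 'rV[R]_n, `|x| <= 1 -> k (x, 0) = f (c x) /\ k (x, 1) = b x &
      forall (x : 'rV[R]_n) (t : R), `|x| = 1 -> 0 <= t <= 1 -> k (x, t) = b x]) ->
  star R f.
Proof.
move=> inh H; split=> // b; have [a0] := inh b.
have nx (x : 'rV[R]_0) : `|x| = 0.
  by apply/eqP; rewrite eq_le normr_ge0 andbT; apply: norm_le_coord => // -[].
have [|||c [k [_ _ ck k01 _]]] := H 0%N (fun=> a0) (fun=> b).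
- by move=> x _; ct.
- by move=> x; ct.
- by move=> x; rewrite nx => /esym/eqP; rewrite oner_eq0.
have n1 : `|0 : 'rV[R]_0| <= 1 by rewrite nx.
have [k0 k1] := k01 0 n1; exists (c 0), (fun t => k (0, t)); split => //.
have c1 : continuous (fun t : R => (0 : 'rV[R]_0, t)) by ct.
exact: (comp_continuous c1 ck).
Qed.

Lemma rV_R_I_delta n : delta_generated R (('rV[R]_n * R) * I)%type.
Proof.
have c1 := @rVcons_continuous R n; have c2 := @rVuncons_continuous R n.
apply: (@delta_retract R _ ('rV[R]_n.+1 * I)%type (fun z => (rVcons z.1, z.2))
  (fun z => (rVuncons z.1, z.2))).
- exact: rV_I_delta.
- by ct.
- by ct.
- by move=> [x t] /=; rewrite rVconsK.
Qed.

Lemma dset_rec (S : choiceType) X (f : S -> underlying X) : (forall s, states (f s)) ->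
  exists m : mdmap (dset R h S) X, forall s, m s = f s.
Proof.
move=> sf; have cf : continuous (f : discrete_topology S -> underlying X).
  by apply/continuousP => A _; exact: discrete_open.
by exists (@MdMap R h (dset R h S) X f cf (fun s _ => sf s) (fun g (e : False) => match e with end)).
Qed.

Section Extension.
Variables (T : topologicalType) (n : nat) (V : normedModType R).
Variables (p : V -> 'rV[R]_n) (d : T) (g : sphere R n -> V -> T).
Hypothesis cp : continuous p.

(* Continuity away from the zeros of [p] of a function of a vector [v] whose value
   depends on the point [p v / |p v|] of the sphere. *)
Lemma sphere_ext_continuous v :
  (forall (s : V -> sphere R n) (rho : V -> V), continuous s -> continuous rho ->
    continuous (fun w => g (s w) (rho w))) ->
  p v != 0 -> continuous_at v (fun v => sphere_ext d (g^~ v) (p v)).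
Proof.
move=> cg pv0; have oO : open [set v | p v != 0].
  apply: (@open_comp _ _ p [set x | x != 0]); last exact: neq0_open.
  by move=> x _; exact: cp.
have [|rho [crho rhoO [e e0 rhoE]]] := @local_retraction R V v [set v | p v != 0].
  exact: open_nbhs_nbhs.
have [s cs sE] := sphere_ext_factor (comp_continuous crho cp) rhoO.
apply: (eq_near_continuous _ (cg s rho cs crho v)).
apply/nbhs_ballP; exists e => // y; rewrite -ball_normE /= distrC => /ltW /rhoE yE.
by rewrite -(sE T d (g^~ (rho y))) /= yE.
Qed.

End Extension.

(** By adjunction, lifting against an inclusion of globes is a relative filling problem in path
    spaces: [aS] is a sphere of paths of [Y], [bD] a disk of paths of [X], and [oS] the connecting
    homotopies over the sphere. [star_strict] fills it without changing [oS], as a strict lift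
    demands. *)
Lemma pull_pr1_lift_globe Y X (k : mdmap Y X) n : mdstar k ->
  has_lift (C := MdTop R h) (globe_map R h (@sphere_disk_continuous R n))
    (pull_pr1 k (mdmap_id X)).
Proof.
move=> [_ _ sk] u v uv; pose P := pull k (mdmap_id X).
have uvE x : pull1 (u x : pull_top k (mdmap_id X)) = v (globe_map R h (@sphere_disk_continuous R n) x).
  exact: (congr1 (fun m : mdmap _ _ => md_fun m x) uv).
pose uu x : pull_top k (mdmap_id X) := u x.
pose pl c := globe_pi h (pole R (sphere R n) c).
have spl c : pull_states (uu (pl c)).
  by apply: (md_states u); exists c.
pose y c := pull0 (uu (pl c)).
have sy c : states (y c) by case: (spl c).
have slpl c t : pull_slice (uu (pl c)) t = k (y c) by case: (spl c).
have p1pl c : pull1 (uu (pl c)) = k (y c).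
  by have := pull_slice1 (uu (pl c)); rewrite slpl.
have vpl c : v (globe_pi h (pole R (disk R n) c)) = k (y c).
  by rewrite -p1pl [RHS]uvE /= (globe_map_funE h (@sphere_disk_continuous R n)).
have upath s := md_execution u (@globe_id_path R h (sphere R n) s).
have ea s : execution (fun t => pull0 (uu (globe_pi h (inside s t)))).
  by have [_ + _ _ _] := upath s.
have eo s t : execution (fun r => pull_slice (uu (globe_pi h (inside s r))) t).
  by have [_ _ _ + _] := upath s; apply.
have ev d : execution (fun t => v (globe_pi h (inside d t))).
  exact: (md_execution v (@globe_id_path R h (disk R n) d)).
have ea0 s : pull0 (uu (globe_pi h (inside s i0))) = y false by rewrite inside0.
have ea1 s : pull0 (uu (globe_pi h (inside s i1))) = y true by rewrite inside1.
have eo0 s t : pull_slice (uu (globe_pi h (inside s i0))) t = k (y false) by rewrite inside0 slpl.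
have eo1 s t : pull_slice (uu (globe_pi h (inside s i1))) t = k (y true) by rewrite inside1 slpl.
have ev0 d : v (globe_pi h (inside d i0)) = k (y false) by rewrite inside0 vpl.
have ev1 d : v (globe_pi h (inside d i1)) = k (y true) by rewrite inside1 vpl.
pose aS s : path_space (y false) (y true) := mk_path (ea s) (ea0 s) (ea1 s).
pose oS s t : path_space (k (y false)) (k (y true)) := mk_path (eo s t) (eo0 s t) (eo1 s t).
pose bD d : path_space (k (y false)) (k (y true)) := mk_path (ev d) (ev0 d) (ev1 d).
have cin (S : topologicalType) (Z : topologicalType) (s : S -> Z) (t : S -> I) :
    delta_generated R S -> continuous s -> continuous t ->
    continuous (fun x => globe_pi h (inside (s x) (t x))).
  move=> dS cs ct'; have c1 := kpair_continuous dS cs ct'.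
  exact: (comp_continuous c1 (@inside_continuous R h Z)).
have cu : continuous uu by exact: (@md_continuous _ _ _ _ u).
have cv : continuous v by exact: md_continuous.
have st := sk _ _ (sy false) (sy true).
pose pf := path_map k (a := y false) (b := y true).
have [a0 _] := st.1 (bD (eucl_disk 0)).
pose a (x : 'rV[R]_n) := sphere_ext a0 aS x.
pose Om (z : 'rV[R]_n * R) := sphere_ext (bD (eucl_disk 0)) (fun s => oS s (proj_unit z.2)) z.1.
pose b (x : 'rV[R]_n) := bD (eucl_disk x).
have ca (x : 'rV[R]_n) : x != 0 -> continuous_at x a.
  move=> x0; have cid : continuous (id : 'rV[R]_n -> 'rV[R]_n) by ct.
  apply: (@sphere_ext_continuous _ n _ id a0 (fun s _ => aS s) cid); last exact: x0.
  move=> s _ cs _; apply: path_curry; first exact: rV_delta.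
  apply: (comp_continuous _ (pull0_continuous (k0 := k) (k1 := mdmap_id X))).
  apply: (comp_continuous _ cu).
  by apply: (cin _ _ (fun z => s z.1) snd); [exact: rV_I_delta|ct|ct].
have cOm (z : 'rV[R]_n * R) : z.1 != 0 -> continuous_at z Om.
  move=> z0; have c1 : continuous (fst : 'rV[R]_n * R -> 'rV[R]_n) by ct.
  apply: (@sphere_ext_continuous _ n _ fst (bD (eucl_disk 0)) (fun s z => oS s (proj_unit z.2)) c1); last exact: z0.
  move=> s rho cs crho; apply: path_curry; first exact: rV_prod_delta.
  have c2 : continuous (fun z : ('rV[R]_n * R) * I =>
      (pullw (uu (globe_pi h (inside (s z.1) z.2))), proj_unit (rho z.1).2)).
    have c3 : continuous (fun z : ('rV[R]_n * R) * I => pullw (uu (globe_pi h (inside (s z.1) z.2)))).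
      apply: (comp_continuous _ (pullw_continuous (k0 := k) (k1 := mdmap_id X))).
      apply: (comp_continuous _ cu).
      by apply: (cin _ _ (fun z => s z.1) snd); [exact: rV_R_I_delta|ct|ct].
    by ct.
  exact: (comp_continuous c2 (@TOP01_eval R _ _ id (fun=> cvg_id))).
have cb : continuous b.
  apply: path_curry; first exact: rV_delta.
  apply: (comp_continuous _ cv); have ced := @eucl_disk_continuous R n.
  by apply: (cin _ _ (fun z => eucl_disk z.1) snd); [exact: rV_I_delta|ct|ct].
have Om0 (x : 'rV[R]_n) : `|x| = 1 -> Om (x, 0) = pf (a x).
  move=> /norm1_neq0 x0; rewrite /Om /a /sphere_ext /=; case: pselect => // p.
  apply: path_fun_inj; apply/funext => t; exact: pull_slice0.
have Om1 (x : 'rV[R]_n) : `|x| = 1 -> Om (x, 1) = b x.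
  move=> x1; have x0 := norm1_neq0 x1; rewrite /Om /b /sphere_ext /=; case: pselect => // p.
  apply: path_fun_inj; apply/funext => t; rewrite [LHS]pull_slice1.
  rewrite [LHS]uvE /= (globe_map_funE h (@sphere_disk_continuous R n)); congr (v (globe_pi h (inside _ t))).
  apply: val_inj; change ((e2 x)^-1 *: x = eucl (clamp x)).
  by rewrite clamp_id ?x1 // /eucl x1 div1r.
have [c [T [cc ca1 cT T01 TOm]]] := star_strict st ca cb cOm Om0 Om1.
pose sv (d : disk R n) : 'rV[R]_n := supn (set_val d).
have csv : continuous sv.
  exact: (comp_continuous (@set_val_continuous _ _) (@supn_continuous R n)).
have wc d t : continuous (fun r : I => path_fun (T (sv d, set_val r)) t).
  have c1 : continuous (fun r : I => T (sv d, set_val r)).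
    by apply: (comp_continuous _ cT); ct.
  exact: (comp_continuous c1 (@path_at_continuous R _ X (k (y false)) (k (y true)) t)).
have w0 d t : path_fun (T (sv d, set_val (i0 : I))) t = k (path_fun (c (sv d)) t).
  by rewrite set_val_i0 (T01 _ (disk_norm d)).1.
have w1 d t : path_fun (T (sv d, set_val (i1 : I))) t = mdmap_id X (v (globe_pi h (inside d t))).
  by rewrite set_val_i1 (T01 _ (disk_norm d)).2 /b eucl_diskK.
pose F d t : pull_top k (mdmap_id X) := mk_pull (wc d t) (w0 d t) (w1 d t).
have cF : continuous (fun z : kprod R (disk R n) I => F z.1 z.2).
  have ckf := @kfst_continuous R (disk R n) I; have cks := @ksnd_continuous R (disk R n) I.
  have cki := @kelley_id_continuous R (disk R n * I)%type.
  apply: pull_continuous; first exact: kelley_delta.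
  - exact: (comp_continuous cki (path_eval (comp_continuous csv cc))).
  - apply: TOP01_curry; first exact: kelley_delta.
    have c1 : continuous (fun z : disk R n * I => T (sv z.1, set_val z.2)).
      by apply: (comp_continuous _ cT); ct.
    have c2 : continuous (fun z : kprod R (disk R n) I * I => ((z.1.1, z.2), z.1.2)).
      apply: pair_continuous; first apply: pair_continuous.
      + exact: (comp_continuous (@fst_continuous _ _) ckf).
      + exact: snd_continuous.
      + exact: (comp_continuous (@fst_continuous _ _) cks).
    exact: (comp_continuous c2 (path_eval c1)).
  - exact: (comp_continuous (@inside_continuous R h (disk R n)) cv).
have F0 d : F d i0 = uu (pl false).
  apply: pull_eq.
  - by rewrite [LHS]path_src.
  - by rewrite p1pl; exact: ev0.
  - by apply/funext => t; rewrite [LHS]path_src; rewrite -(slpl false t).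
have F1 d : F d i1 = uu (pl true).
  apply: pull_eq.
  - by rewrite [LHS]path_tgt.
  - by rewrite p1pl; exact: ev1.
  - by apply/funext => t; rewrite [LHS]path_tgt; rewrite -(slpl true t).
have eF d : pull_execution (F d).
  split.
  - have c1 : continuous (fun t : I => (d, t) : kprod R (disk R n) I).
      by apply: kpair_continuous; [exact: unit_interval_delta|move=> t; ct|move=> t; ct].
    exact: (comp_continuous c1 cF).
  - exact: (path_exec (c (sv d))).
  - exact: ev.
  - by move=> t; exact: (path_exec (T (sv d, set_val t))).
  - by move=> t; rewrite F0 F1 !slpl.
have [m [mi mp]] := @globe_rec R h (disk R n) P F (uu (pl false)) (uu (pl true)) cF F0 F1 (spl false) (spl true) eF.
exists m; split; apply: mdmap_eq; apply/funext => x /=.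
  have [[s [t ->]]|[e ->]] := globe_cases x; rewrite (globe_map_funE h (@sphere_disk_continuous R n)) /=; last first.
    by rewrite mp; case: e.
  rewrite mi; apply: pull_eq.
  - by rewrite /F /pull0 /= /sv /= ca1 ?sphere_norm // /a sphere_extE.
  - by rewrite [RHS]uvE /= (globe_map_funE h (@sphere_disk_continuous R n)).
  - apply/funext => r; change (path_fun (T (sv (sphere_disk s), set_val r)) t = pull_slice (uu (globe_pi h (inside s t))) r).
    rewrite TOm ?sphere_norm ?itv01P // /Om /= (sphere_extE _ (fun s => oS s _)) /=.
    by rewrite set_valK01.
have [[s [t ->]]|[e ->]] := globe_cases x.
  by rewrite mi.
by rewrite mp vpl -p1pl; case: e.
Qed.

(** The globes are treated above; [gen_C] and [gen_R] express surjectivity and injectivity on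
    states. *)
Lemma pull_pr1_inj Y X (k : mdmap Y X) : mdstar k ->
  inj (@generating_cofibration R h) (pull_pr1 k (mdmap_id X) : hom (pull k (mdmap_id X) : MdTop R h) X).
Proof.
move=> hk A B i []; first by move=> n; exact: pull_pr1_lift_globe.
- move=> u v _; have [sur _ _] := hk; have [y sy ky] := sur (v tt) (md_states v Logic.I).
  have cw : continuous (fun _ : I => v tt) by move=> t; ct.
  pose q : pull_top k (mdmap_id X) := mk_pull cw (esym ky) (erefl : v tt = mdmap_id X (v tt)).
  have sq : pull_states q by split => //; exact: (md_states v).
  have [m mE] := @dset_rec unit (pull k (mdmap_id X)) (fun=> q) (fun=> sq).
  exists m; split; apply: mdmap_eq; apply/funext => -[].
  by rewrite /= mE.
- move=> u v uv; have uvE x : pull1 (u x : pull_top k (mdmap_id X)) = v tt.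
    exact: (congr1 (fun m : mdmap _ _ => md_fun m x) uv).
  have su x : pull_states (u x) by exact: (md_states u (Logic.I : [set: bool] x)).
  have k0 x : k (pull0 (u x : pull_top k (mdmap_id X))) = v tt.
    by have [_ _ E] := su x; rewrite -(E i1) [LHS]pull_slice1 uvE.
  have uE : u true = u false.
    have [sa _ Ea] := su true; have [sb _ Eb] := su false.
    have e0 : pull0 (u true : pull_top k (mdmap_id X)) = pull0 (u false : pull_top k (mdmap_id X)).
      by have [_ inj _] := hk; apply: inj => //; rewrite !k0.
    apply: pull_eq => //; first by rewrite !uvE.
    by apply/funext => t; rewrite [LHS](Ea t) [RHS](Eb t) e0.
  have [m mE] := @dset_rec unit (pull k (mdmap_id X)) (fun=> u true) (fun=> su true).
  exists m; split; apply: mdmap_eq; apply/funext.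
    by case; rewrite /= mE.
  by case; rewrite /= mE uvE.
Qed.

(** Existence half of the Whitehead theorem: [x] lifts strictly along [pull_pr1], from the cofibrant
    [W], and the connecting paths of the lift form the homotopy. *)
Lemma mdstar_sur W X Y (k : mdmap Y X) (x : mdmap W X) : @qcofibrant R h W -> mdstar k ->
  exists g : mdmap W Y, homot (k \o g) x.
Proof.
move=> qW hk.
have [|w [_ wx]] := qW _ _ _ (pull_pr1_inj hk) (empty_map (pull k (mdmap_id X))) x.
  by apply: mdmap_eq; apply/funext => -[].
exists (mdmap_comp w (pull_pr0 k (mdmap_id X))).
have := pull_homot w; rewrite -wx; exact.
Qed.

End Lifting.

(** * Uniqueness of lifts up to homotopy *)

Section LiftingUniqueness.
Variables (R : realType) (h : bool).
Local Notation I := (unit_interval R).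
Implicit Types W X Y : mdspace R h.

(** Families of paths of [pull] are assembled from their two projections and their slices; the ends
    fit because connecting paths are constant at states. *)
Lemma pull_path (S : topologicalType) (Y0 Y1 X : mdspace R h) (k0 : mdmap Y0 X)
    (k1 : mdmap Y1 X) (A B : pull_top k0 k1)
    (p0 : S -> path_space (pull0 A) (pull0 B)) (p1 : S -> path_space (pull1 A) (pull1 B))
    (sl : S * I -> path_space (k0 (pull0 A)) (k0 (pull0 B))) :
  delta_generated R S -> delta_generated R (S * I)%type ->
  pull_states A -> pull_states B ->
  continuous p0 -> continuous p1 -> continuous sl ->
  (forall s t, path_fun (sl (s, i0)) t = k0 (path_fun (p0 s) t)) ->
  (forall s t, path_fun (sl (s, i1)) t = k1 (path_fun (p1 s) t)) ->
  exists2 c : S -> @path_space R h (pull k0 k1) A B, continuous c &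
    forall s t, let z : pull_top k0 k1 := path_fun (c s) t in
      [/\ pull0 z = path_fun (p0 s) t, pull1 z = path_fun (p1 s) t &
       forall u, pull_slice z u = path_fun (sl (s, u)) t].
Proof.
move=> dS dSI [_ _ sA] [_ _ sB] c0 c1 csl sl0 sl1.
have cw s t : continuous (fun u : I => path_fun (sl (s, u)) t).
  have c2 : continuous (fun u : I => sl (s, u)) by ct.
  exact: (comp_continuous c2 (@path_at_continuous R _ _ _ _ t)).
pose g s t : pull_top k0 k1 := mk_pull (cw s t) (sl0 s t) (sl1 s t).
have cg : continuous (fun z : S * I => g z.1 z.2).
  apply: pull_continuous => //.
  - exact: path_eval.
  - apply: TOP01_curry => //.
    have c2 : continuous (fun z : (S * I) * I => ((z.1.1, z.2), z.1.2)) by ct.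
    exact: (comp_continuous c2 (path_eval csl)).
  - exact: path_eval.
have g0 s : g s i0 = A.
  apply: pull_eq; [exact: path_src|exact: path_src|].
  by apply/funext => u; rewrite [LHS](path_src (sl (s, u))) -(sA u).
have g1 s : g s i1 = B.
  apply: pull_eq; [exact: path_tgt|exact: path_tgt|].
  by apply/funext => u; rewrite [LHS](path_tgt (sl (s, u))) -(sB u).
have eg s : @execution R h (pull k0 k1) (g s).
  split.
  - have c2 : continuous (fun t : I => (s, t)) by ct.
    exact: (comp_continuous c2 cg).
  - exact: (path_exec (p0 s)).
  - exact: (path_exec (p1 s)).
  - by move=> u; exact: (path_exec (sl (s, u))).
  - by move=> u; rewrite g0 g1 sA sB.
exists (fun s => mk_path (eg s) (g0 s) (g1 s)); last by [].
by apply: path_curry.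
Qed.

Definition path_cast X (a b a' b' : underlying X) (ea : a = a') (eb : b = b')
    (g : path_space a b) : path_space a' b' :=
  mk_path (path_exec g) (etrans (path_src g) ea) (etrans (path_tgt g) eb).

Lemma path_cast_continuous (S : topologicalType) X (a b a' b' : underlying X)
    (ea : a = a') (eb : b = b') (u : S -> path_space a b) : delta_generated R S ->
  continuous u -> continuous (fun s => path_cast ea eb (u s)).
Proof. by move=> dS cu; apply: path_curry => //; exact: (path_eval cu). Qed.

Section PullSquare.
Variables (Y X : mdspace R h) (k : mdmap Y X).
Let Y1 := mdmap_id Y.
Variable k2 : mdmap (pull Y1 Y1) (pull k k).
Hypothesis k2E : forall z : pull_top Y1 Y1, [/\ pull0 (k2 z : pull_top k k) = pull0 z,
  pull1 (k2 z : pull_top k k) = pull1 z &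
  forall u, pull_slice (k2 z : pull_top k k) u = k (pull_slice z u)].

Let kk z : pull_top k k := k2 z.
Let kk0 z : pull0 (kk z) = pull0 z. Proof. by have [] := k2E z. Qed.
Let kk1 z : pull1 (kk z) = pull1 z. Proof. by have [] := k2E z. Qed.
Let kks z u : pull_slice (kk z) u = k (pull_slice z u). Proof. by have [] := k2E z. Qed.

Let state1 (A : pull_top Y1 Y1) : pull_states A -> pull1 A = pull0 A.
Proof. by move=> [_ _ E]; rewrite -[RHS](E i1) [RHS]pull_slice1. Qed.

Section Star.
Variables A B : pull_top Y1 Y1.
Hypotheses (sA : pull_states A) (sB : pull_states B).
Hypothesis sk : star R (@path_map R h Y X k (pull0 A) (pull0 B)).
Local Notation PY := (path_space (pull0 A) (pull0 B)).
Local Notation PX := (path_space (k (pull0 A)) (k (pull0 B))).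
Local Notation PQ := (@path_space R h (pull Y1 Y1) A B).
Local Notation PK := (@path_space R h (pull k k) (k2 A) (k2 B)).

Let pf (g : PK) t : pull_top k k := path_fun g t.
Let qf (g : PQ) t : pull_top Y1 Y1 := path_fun g t.
Let pe g : pull_execution (pf g). Proof. exact: (path_exec g). Qed.
Let qe g : pull_execution (qf g). Proof. exact: (path_exec g). Qed.
Let e0 g : execution (fun t => pull0 (pf g t)). Proof. by case: (pe g). Qed.
Let e1 g : execution (fun t => pull1 (pf g t)). Proof. by case: (pe g). Qed.
Let es g u : execution (fun t => pull_slice (pf g t) u). Proof. by case: (pe g). Qed.
Let ea g u : execution (fun t => pull_slice (qf g t) u). Proof. by case: (qe g). Qed.
Let pfs g : pf g i0 = kk A. Proof. exact: (path_src g). Qed.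
Let pft g : pf g i1 = kk B. Proof. exact: (path_tgt g). Qed.
Let qfs g : qf g i0 = A. Proof. exact: (path_src g). Qed.
Let qft g : qf g i1 = B. Proof. exact: (path_tgt g). Qed.

Let a1 := state1 sA.
Let b1 := state1 sB.
Let slA u : pull_slice A u = pull0 A. Proof. by case: sA. Qed.
Let slB u : pull_slice B u = pull0 B. Proof. by case: sB. Qed.

Let g0 (g : PK) : PY := mk_path (e0 g) (etrans (congr1 (@pull0 _ _ _ _ _ k k) (pfs g)) (kk0 A))
  (etrans (congr1 (@pull0 _ _ _ _ _ k k) (pft g)) (kk0 B)).
Let g1 (g : PK) : PY := mk_path (e1 g)
  (etrans (congr1 (@pull1 _ _ _ _ _ k k) (pfs g)) (etrans (kk1 A) a1))
  (etrans (congr1 (@pull1 _ _ _ _ _ k k) (pft g)) (etrans (kk1 B) b1)).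
Let gs (g : PK) u : PX := mk_path (es g u)
  (etrans (congr1 ((@pull_slice _ _ _ _ _ k k)^~ u) (pfs g)) (etrans (kks A u) (congr1 k (slA u))))
  (etrans (congr1 ((@pull_slice _ _ _ _ _ k k)^~ u) (pft g)) (etrans (kks B u) (congr1 k (slB u)))).
Let as_ (g : PQ) u : PY := mk_path (ea g u)
  (etrans (congr1 ((@pull_slice _ _ _ _ _ Y1 Y1)^~ u) (qfs g)) (slA u))
  (etrans (congr1 ((@pull_slice _ _ _ _ _ Y1 Y1)^~ u) (qft g)) (slB u)).

(** A path of [pull Y1 Y1] is a homotopy between two paths of [Y]. A filling problem for [k2] in
    dimension [n] is therefore one for [k] in dimension [n + 1], over a cylinder whose two ends are
    prescribed by [be]: this is [star_shift]. *)
Lemma pull_square_star : star R (@path_map R h _ _ k2 A B).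
Proof.
have clc := @cl_continuous R.
apply: star_intro => [b|n al be cal cbe albe].
  have dS : delta_generated R 'rV[R]_0 by exact: rV_delta.
  have dSI := @rV_I_delta R 0.
  have c1 : continuous (fun _ : 'rV[R]_0 => g0 b) by move=> x; ct.
  have c2 : continuous (fun _ : 'rV[R]_0 => path_cast (esym a1) (esym b1) (g0 b)) by move=> x; ct.
  have c3 : continuous (fun _ : 'rV[R]_0 * I => g0 b) by move=> x; ct.
  have [//|//|c _ _] := @pull_path _ Y Y Y Y1 Y1 A B _ _ _ dS dSI sA sB c1 c2 c3.
  exact: (inhabits (c 0)).
have cmc := @clamp_continuous R 'rV[R]_n.
pose b0 x := g0 (be x); pose b1' x := g1 (be x).
pose bs (z : 'rV[R]_n * R) := gs (be z.1) (proj_unit z.2).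
pose a (z : 'rV[R]_n * R) := as_ (al z.1) (proj_unit z.2).
have cpf : continuous (fun z : 'rV[R]_n * I => pf (be z.1) z.2) by exact: (path_eval cbe).
have cb0 : continuous b0.
  apply: path_curry; first exact: rV_delta.
  exact: (comp_continuous cpf (pull0_continuous (k0 := k) (k1 := k))).
have cb1 : continuous b1'.
  apply: path_curry; first exact: rV_delta.
  exact: (comp_continuous cpf (pull1_continuous (k0 := k) (k1 := k))).
have cbs : continuous bs.
  apply: path_curry; first exact: rV_prod_delta.
  have c2 : continuous (fun z : ('rV[R]_n * R) * I =>
      (pullw (pf (be z.1.1) z.2), proj_unit z.1.2)).
    have c3 : continuous (fun z : ('rV[R]_n * R) * I => (z.1.1, z.2)) by ct.
    have c4 := comp_continuous (comp_continuous c3 cpf) (pullw_continuous (k0 := k) (k1 := k)).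
    by apply: pair_continuous; [exact: c4|ct].
  exact: (comp_continuous c2 (@TOP01_eval R _ _ id (fun=> cvg_id))).
have ca (z : 'rV[R]_n * R) : z.1 != 0 -> continuous_at z a.
  move=> z0; have [|rho [crho rhoO [e ee0 rhoE]]] :=
      @local_retraction R _ z [set z : 'rV[R]_n * R | z.1 != 0].
    by apply: open_nbhs_nbhs; split => //; exact: fst_neq0_open.
  have cal' : continuous (fun z => al (rho z).1).
    move=> y; apply: (@comp_cont_at _ _ _ (fun z => (rho z).1) al); first by ct.
    exact: cal (rhoO y).
  have car : continuous (fun z => a (rho z)).
    apply: path_curry; first exact: rV_prod_delta.
    have c2 : continuous (fun z : ('rV[R]_n * R) * I =>
        (pullw (qf (al (rho z.1).1) z.2), proj_unit (rho z.1).2)).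
      have c4 := comp_continuous (path_eval cal') (pullw_continuous (k0 := Y1) (k1 := Y1)).
      by apply: pair_continuous; [exact: c4|ct].
    exact: (comp_continuous c2 (@TOP01_eval R _ _ id (fun=> cvg_id))).
  apply: (eq_near_continuous _ (car z)).
  apply/nbhs_ballP; exists e => // y; rewrite -ball_normE /= distrC => /ltW /rhoE yE.
  by rewrite yE.
have pi0 : proj_unit 0 = i0 :> I by [].
have pi1 : proj_unit 1 = i1 :> I by [].
have bs01 (x : 'rV[R]_n) : `|x| <= 1 -> bs (x, 0) = path_map k (b0 x) /\ bs (x, 1) = path_map k (b1' x).
  move=> _; split; apply: path_fun_inj; apply/funext => t; first exact: pull_slice0.
  exact: pull_slice1.
have ab x t : `|x| = 1 -> kk (qf (al x) t) = pf (be x) t.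
  by move=> x1; rewrite /pf -albe.
have bsa (x : 'rV[R]_n) (u : R) : `|x| = 1 -> 0 <= u <= 1 -> bs (x, u) = path_map k (a (x, u)).
  move=> x1 _; apply: path_fun_inj; apply/funext => t.
  change (pull_slice (pf (be x) t) (proj_unit u) = k (pull_slice (qf (al x) t) (proj_unit u))).
  by rewrite -ab // kks.
have a01 (x : 'rV[R]_n) : `|x| = 1 -> a (x, 0) = b0 x /\ a (x, 1) = b1' x.
  move=> x1; split; apply: path_fun_inj; apply/funext => t.
    change (pull_slice (qf (al x) t) i0 = pull0 (pf (be x) t)).
    by rewrite pull_slice0 -ab // kk0.
  change (pull_slice (qf (al x) t) i1 = pull1 (pf (be x) t)).
  by rewrite pull_slice1 -ab // kk1.
have [C [K [cC cK [C01 Ca] K01 Kb]]] := star_shift sk cb0 cb1 ca cbs bs01 bsa a01.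
have cn (x : 'rV[R]_n) : `|clamp x| <= 1 by exact: norm_clamp_le.
have [] := @pull_path _ Y Y Y Y1 Y1 A B (fun x => C (clamp x, 0))
   (fun x => path_cast (esym a1) (esym b1) (C (clamp x, 1)))
   (fun z => C (clamp z.1, set_val z.2)) (@rV_delta R n) (@rV_I_delta R n) sA sB.
- by apply: (comp_continuous _ cC); ct.
- apply: path_cast_continuous; first exact: rV_delta.
  by apply: (comp_continuous _ cC); ct.
- by apply: (comp_continuous _ cC); ct.
- by move=> s t /=; rewrite set_val_i0.
- by move=> s t /=; rewrite set_val_i1.
move=> c cc cE.
have kA u : k (pull0 A) = k (pull0 (kk A)) by rewrite kk0.
have kB u : k (pull0 B) = k (pull0 (kk B)) by rewrite kk0.
have skA : pull_states (kk A) by exact: (md_states k2 sA).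
have skB : pull_states (kk B) by exact: (md_states k2 sB).
have [] := @pull_path _ Y Y X k k (kk A) (kk B)
   (fun z : 'rV[R]_n * R => path_cast (esym (kk0 A)) (esym (kk0 B)) (C (clamp z.1, 0)))
   (fun z => path_cast (esym (etrans (kk1 A) a1)) (esym (etrans (kk1 B) b1)) (C (clamp z.1, 1)))
   (fun z => path_cast (esym (congr1 k (kk0 A))) (esym (congr1 k (kk0 B)))
      (K ((clamp z.1.1, set_val z.2), cl z.1.2)))
   (@rV_prod_delta R n) (@rV_R_I_delta R n) skA skB.
- apply: path_cast_continuous; first exact: rV_prod_delta.
  by apply: (comp_continuous _ cC); ct.
- apply: path_cast_continuous; first exact: rV_prod_delta.
  by apply: (comp_continuous _ cC); ct.
- apply: path_cast_continuous; first exact: rV_R_I_delta.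
  by apply: (comp_continuous _ cK); ct.
- move=> [x r] t /=; change (path_fun (K ((clamp x, set_val (i0 : I)), cl r)) t = k (path_fun (C (clamp x, 0)) t)).
  rewrite set_val_i0 Kb ?lexx ?ler01 ?cl_itv //; last by constructor 2.
  by rewrite (bs01 _ (cn x)).1 -(C01 _ (cn x)).1.
- move=> [x r] t /=; change (path_fun (K ((clamp x, set_val (i1 : I)), cl r)) t = k (path_fun (C (clamp x, 1)) t)).
  rewrite set_val_i1 Kb ?lexx ?ler01 ?cl_itv //; last by constructor 3.
  by rewrite (bs01 _ (cn x)).2 -(C01 _ (cn x)).2.
move=> d cd dE.
exists c, d; split => //.
- move=> x x1; apply: path_fun_inj; apply/funext => t.
  have x1' : `|x| <= 1 by rewrite x1.
  have cx : clamp x = x by rewrite clamp_id.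
  have [E0 E1 Es] := cE x t; rewrite cx in E0 E1 Es.
  apply: pull_eq.
  + by rewrite [LHS]E0 (C01 x x1').1 -(a01 x x1).1; exact: pull_slice0.
  + rewrite [LHS]E1; change (path_fun (C (x, 1)) t = pull1 (qf (al x) t)).
    by rewrite (C01 x x1').2 -(a01 x x1).2; exact: pull_slice1.
  + apply/funext => u; rewrite [LHS]Es Ca ?itv01P //.
    change (pull_slice (qf (al x) t) (proj_unit (set_val u)) = pull_slice (qf (al x) t) u).
    by rewrite set_valK01.
- move=> x x1; have cx : clamp x = x by rewrite clamp_id.
  split; apply: path_fun_inj; apply/funext => t.
    have [E0 E1 Es] := cE x t; have [F0 F1 Fs] := dE (x, 0) t.
    rewrite /= cx in E0 E1 Es F0 F1 Fs.
    change (pf (d (x, 0)) t = kk (qf (c x) t)); apply: pull_eq.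
    + by rewrite kk0 [LHS]F0 [RHS]E0.
    + by rewrite kk1 [LHS]F1 [RHS]E1.
    + apply/funext => u; rewrite [LHS]Fs [RHS]kks [in RHS]Es cl_le0 //.
      change (path_fun (K ((x, set_val u), 0)) t = path_fun (path_map k (C (x, set_val u))) t).
      by rewrite (K01 _ _ x1 (itv01P u)).1.
  have [F0 F1 Fs] := dE (x, 1) t; rewrite /= cx in F0 F1 Fs.
  change (pf (d (x, 1)) t = pf (be x) t); apply: pull_eq.
  + by rewrite [LHS]F0; change (path_fun (C (x, 0)) t = path_fun (b0 x) t); rewrite (C01 _ x1).1.
  + by rewrite [LHS]F1; change (path_fun (C (x, 1)) t = path_fun (b1' x) t); rewrite (C01 _ x1).2.
  + apply/funext => u; rewrite [LHS]Fs cl_ge1 //.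
    change (path_fun (K ((x, set_val u), 1)) t = pull_slice (pf (be x) t) u).
    by rewrite (K01 _ _ x1 (itv01P u)).2 -[in RHS](set_valK01 u).
- move=> x r x1 r01; have x1' : `|x| <= 1 by rewrite x1.
  apply: path_fun_inj; apply/funext => t; have cx : clamp x = x by rewrite clamp_id.
  have [F0 F1 Fs] := dE (x, r) t; rewrite /= cx in F0 F1 Fs.
  change (pf (d (x, r)) t = pf (be x) t); apply: pull_eq.
  + by rewrite [LHS]F0; change (path_fun (C (x, 0)) t = path_fun (b0 x) t); rewrite (C01 _ x1').1.
  + by rewrite [LHS]F1; change (path_fun (C (x, 1)) t = path_fun (b1' x) t); rewrite (C01 _ x1').2.
  + apply/funext => u; rewrite [LHS]Fs cl_id //.
    change (path_fun (K ((x, set_val u), r)) t = pull_slice (pf (be x) t) u).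
    rewrite Kb ?itv01P //; last by constructor 1.
    by rewrite -[in RHS](set_valK01 u).
Qed.

End Star.

Lemma pull_square_mdstar : mdstar k -> mdstar k2.
Proof.
move=> [sur inj sk]; split.
- move=> b [s0 s1 sb]; have e01 : pull0 (b : pull_top k k) = pull1 (b : pull_top k k).
    by apply: inj => //; rewrite -(sb i1) [LHS]pull_slice1.
  have cw : continuous (fun _ : I => pull0 (b : pull_top k k)) by move=> t; ct.
  pose a : pull_top Y1 Y1 := @mk_pull _ _ _ _ _ Y1 Y1 _ _ _ cw (erefl _) (erefl _).
  exists a; first by split.
  apply: pull_eq; first by rewrite [LHS]kk0.
    by rewrite [LHS]kk1 -e01.
  by apply/funext => u; rewrite [LHS]kks [RHS]sb.
- move=> a a' sa sa' aa'.
  have e0 : pull0 (a : pull_top Y1 Y1) = pull0 (a' : pull_top Y1 Y1).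
    by rewrite -(kk0 a) -(kk0 a') /kk aa'.
  apply: pull_eq => //; first by rewrite (state1 sa) (state1 sa').
  have [_ _ E] := sa; have [_ _ E'] := sa'.
  by apply/funext => u; rewrite [LHS]E [RHS]E' e0.
- move=> a b sa sb; apply: (pull_square_star sa sb); apply: sk.
    by case: sa.
  by case: sb.
Qed.

End PullSquare.

(** The homotopy between [k \o g0] and [k \o g1] is a map [x] to [pull k k]. Since [k2] is again
    [mdstar], [x] lifts up to homotopy to the path object [pull Y1 Y1], whose two projections are
    homotopic. *)
Lemma mdstar_inj W X Y (k : mdmap Y X) (g0 g1 : mdmap W Y) : @qcofibrant R h W ->
  mdstar k -> homot (k \o g0) (k \o g1) -> homot g0 g1.
Proof.
move=> qW hk [K [cK K0 K1 eK sK]].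
have [x xE] := pull_map cK K0 K1 eK sK.
pose Y1 := mdmap_id Y; pose P := pull Y1 Y1.
have ck := @md_continuous _ _ _ _ k.
have [|||||k2 k2E] := @pull_map R h Y Y X k k P (pull_pr0 Y1 Y1) (pull_pr1 Y1 Y1)
  (fun u z => k (pull_slice (z : pull_top Y1 Y1) u)).
- apply: (comp_continuous _ ck).
  exact: (@TOP01_eval R _ _ (@pullw R h Y Y Y Y1 Y1) (@pullw_continuous R h Y Y Y Y1 Y1)).
- by apply/funext => z /=; rewrite pull_slice0.
- by apply/funext => z /=; rewrite pull_slice1.
- by move=> u e [_ _ _ ew _]; apply: (md_execution k (ew u)).
- by move=> u a [_ _ ->].
have [G [H [cH H0 H1 eH sH]]] := mdstar_sur x qW (pull_square_mdstar k2E hk).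
have pr_h (j : mdmap (pull k k) Y) : homot (j \o (k2 \o G)) (j \o x).
  by apply: homot_postcomp; exists H.
have h0 := pr_h (pull_pr0 k k); have h1 := pr_h (pull_pr1 k k).
have -> : md_fun g0 = pull_pr0 k k \o x by apply/funext => w /=; case: (xE w).
have -> : md_fun g1 = pull_pr1 k k \o x by apply/funext => w /=; case: (xE w).
apply: (homot_trans (homot_sym h0)); apply: homot_trans h1.
have -> : pull_pr0 k k \o (k2 \o G) = Y1 \o pull_pr0 Y1 Y1 \o G.
  by apply/funext => w /=; case: (k2E (G w)).
have -> : pull_pr1 k k \o (k2 \o G) = Y1 \o pull_pr1 Y1 Y1 \o G.
  by apply/funext => w /=; case: (k2E (G w)).
exact: pull_homot.
Qed.

End LiftingUniqueness.

(** * Labels *)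

Section Labels.
Variables (R : realType) (h : bool) (H : flow R h).

(* The execution paths of [H] with formal units and an absorbing element, so that
   composition becomes a total associative operation. *)
Inductive label := lzero | lunit of fstate H | larrow (a b : fstate H) of fpath a b.

HB.instance Definition _ := gen_eqMixin label.
HB.instance Definition _ := gen_choiceMixin label.

(** The topology of the disjoint union of all path spaces, with [lzero] and the units as isolated
    points. *)
Definition label_open (U : set label) :=
  forall a b : fstate H, open [set p : fpath a b | U (larrow p)].

Lemma label_openT : label_open setT.
Proof. by move=> a b; exact: openT. Qed.

Lemma label_openI : setI_closed label_open.
Proof. by move=> A B oA oB a b; exact: (openI (oA a b) (oB a b)). Qed.

Lemma label_open_bigU (J : Type) (g : J -> set label) :
  (forall i, label_open (g i)) -> label_open (\bigcup_i g i).
Proof.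
move=> og a b; have := @bigcup_open _ J setT (fun i => [set p : fpath a b | g i (larrow p)]).
by apply => i _; exact: og.
Qed.

HB.instance Definition _ :=
  isOpenTopological.Build label label_openT label_openI label_open_bigU.

Lemma label_openE (U : set label) : open U = label_open U.
Proof. by []. Qed.

Lemma larrow_continuous (a b : fstate H) : continuous (@larrow a b).
Proof. by apply/continuousP => A oA; exact: oA. Qed.

Definition fpath_cast (a b a' b' : fstate H) (e : a = a' /\ b = b') (p : fpath a b) : fpath a' b' :=
  let: conj ea eb := e in ecast x (fpath x b') ea (ecast y (fpath a y) eb p).

(** A total left inverse of [larrow] with default [d]; it brings families of labels near an arrow
    back to a single path space. *)
Definition lget (a b : fstate H) (d : fpath a b) (x : label) : fpath a b :=
  if x is larrow a' b' p then
    if pselect (a' = a /\ b' = b) is left e then fpath_cast e p else d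
  else d.

Lemma lgetK (a b : fstate H) (d p : fpath a b) : lget d (larrow p) = p.
Proof.
rewrite /lget; case: pselect => [e|[]//].
by rewrite (Prop_irrelevance e (conj erefl erefl)).
Qed.

Lemma larrow_inj (a b : fstate H) : injective (@larrow a b).
Proof. by move=> p q pq; rewrite -(lgetK p p) pq lgetK. Qed.

Definition is_larrow (a b : fstate H) : set label := range (@larrow a b).

Lemma larrow_open (a b : fstate H) (V : set (fpath a b)) : open V -> open (@larrow a b @` V).
Proof.
rewrite label_openE => oV a' b'; have [[ea eb]|ne] := pselect (a = a' /\ b = b').
  case: _ / ea; case: _ / eb; rewrite (_ : [set _ | _] = V) //.
  by apply/seteqP; split => p /= => [[q Vq /larrow_inj <-//]|Vp]; exists p.
rewrite (_ : [set _ | _] = set0); first exact: open0.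
by apply/seteqP; split => p // [q _ [ea eb _]]; apply: ne.
Qed.

Lemma lzero_open : open [set lzero].
Proof.
by move=> a b; rewrite (_ : [set _ | _] = set0); [exact: open0|apply/seteqP; split].
Qed.

Lemma lunit_open a : open [set lunit a].
Proof.
by move=> a' b; rewrite (_ : [set _ | _] = set0); [exact: open0|apply/seteqP; split].
Qed.

Section Plots.
Variables (T : topologicalType) (x : T) (u : T -> label).
Hypothesis cu : continuous_at x u.

Lemma label_near_zero : u x = lzero -> \forall y \near x, u y = lzero.
Proof.
by move=> ux; apply: (cu (t := [set lzero])); rewrite ux; exact: open_nbhs_nbhs (conj lzero_open _).
Qed.

Lemma label_near_unit a : u x = lunit a -> \forall y \near x, u y = lunit a.
Proof.
by move=> ux; apply: (cu (t := [set lunit a])); rewrite ux; exact: open_nbhs_nbhs (conj (lunit_open a) _).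
Qed.

Lemma label_near_arrow (a b : fstate H) (p : fpath a b) : u x = larrow p ->
  \forall y \near x, u y = larrow (lget p (u y)).
Proof.
move=> ux; have : \forall y \near x, is_larrow a b (u y).
  apply: (cu (t := is_larrow a b)); rewrite ux; apply: open_nbhs_nbhs; split; last by exists p.
  by apply: larrow_open; exact: openT.
by apply: filterS => y [q _ <-]; rewrite lgetK.
Qed.

Lemma lget_continuous (a b : fstate H) (p : fpath a b) : u x = larrow p ->
  continuous_at x (fun y => lget p (u y)).
Proof.
move=> ux A /=; rewrite ux lgetK nbhsE => -[V [oV Vp] VA].
have : \forall y \near x, (@larrow a b @` V) (u y).
  apply: (cu (t := @larrow a b @` V)); rewrite ux; apply: open_nbhs_nbhs; split.
    exact: larrow_open.
  by exists p.
change (nbhs x [set y | (@larrow a b @` V) (u y)] -> nbhs x [set y | A (lget p (u y))]).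
by apply: filterS => y [q Vq qy] /=; rewrite -qy lgetK; exact: VA.
Qed.

End Plots.

Definition lmul (x y : label) : label := match x, y with
  | lunit a, lunit b => if pselect (a = b) then lunit a else lzero
  | lunit a, larrow b c p => if pselect (a = b) then larrow p else lzero
  | larrow a b p, lunit c => if pselect (b = c) then larrow p else lzero
  | larrow a b p, larrow c d q =>
      if pselect (c = b) is left e then larrow (fcomp p (fpath_cast (conj e erefl) q)) else lzero
  | _, _ => lzero
  end.

Lemma lmul0l x : lmul lzero x = lzero. Proof. by []. Qed.
Lemma lmul0r x : lmul x lzero = lzero. Proof. by case: x. Qed.

Lemma lmulUU a : lmul (lunit a) (lunit a) = lunit a.
Proof. by rewrite /lmul; case: pselect. Qed.
Lemma lmulUA (a b : fstate H) (p : fpath a b) : lmul (lunit a) (larrow p) = larrow p.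
Proof. by rewrite /lmul; case: pselect. Qed.
Lemma lmulAU (a b : fstate H) (p : fpath a b) : lmul (larrow p) (lunit b) = larrow p.
Proof. by rewrite /lmul; case: pselect. Qed.
Lemma lmulAA (a b c : fstate H) (p : fpath a b) (q : fpath b c) :
  lmul (larrow p) (larrow q) = larrow (fcomp p q).
Proof.
rewrite /lmul; case: pselect => [e|[]//].
by rewrite (Prop_irrelevance e erefl).
Qed.
Lemma lmulUU0 a b : a <> b -> lmul (lunit a) (lunit b) = lzero.
Proof. by rewrite /lmul; case: pselect. Qed.
Lemma lmulUA0 (a b c : fstate H) (p : fpath b c) : a <> b -> lmul (lunit a) (larrow p) = lzero.
Proof. by rewrite /lmul; case: pselect. Qed.
Lemma lmulAU0 (a b c : fstate H) (p : fpath a b) : b <> c -> lmul (larrow p) (lunit c) = lzero.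
Proof. by rewrite /lmul; case: pselect. Qed.
Lemma lmulAA0 (a b c d : fstate H) (p : fpath a b) (q : fpath c d) : b <> c ->
  lmul (larrow p) (larrow q) = lzero.
Proof. by rewrite /lmul; case: pselect => // e /(_ (esym e)). Qed.

Definition lmulE := (lmul0l, lmul0r, lmulUU, lmulUA, lmulAU, lmulAA).

Inductive lmul_spec : label -> label -> label -> Prop :=
| LmulUU a : lmul_spec (lunit a) (lunit a) (lunit a)
| LmulUA (a b : fstate H) (p : fpath a b) : lmul_spec (lunit a) (larrow p) (larrow p)
| LmulAU (a b : fstate H) (p : fpath a b) : lmul_spec (larrow p) (lunit b) (larrow p)
| LmulAA (a b c : fstate H) (p : fpath a b) (q : fpath b c) :
    lmul_spec (larrow p) (larrow q) (larrow (fcomp p q)).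

Lemma lmulP x y : lmul x y <> lzero -> lmul_spec x y (lmul x y).
Proof.
case: x y => [|a|a b p] [|c|c d q] //.
- have [<-|ne] := pselect (a = c); last by rewrite lmulUU0.
  by rewrite lmulUU => _; constructor.
- have [e|ne] := pselect (a = c); last by rewrite lmulUA0.
  by case: _ / e q => q; rewrite lmulUA => _; constructor.
- have [e|ne] := pselect (b = c); last by rewrite lmulAU0.
  by case: _ / e; rewrite lmulAU => _; constructor.
- have [e|ne] := pselect (b = c); last by rewrite lmulAA0.
  by case: _ / e q => q; rewrite lmulAA => _; constructor.
Qed.

Lemma lmulA x y z : lmul (lmul x y) z = lmul x (lmul y z).
Proof.
case: x y z => [|a|a b p] [|c|c d q] [|e|e f r]; rewrite ?lmulE //.
- have [E1|n1] := pselect (a = c); have [E2|n2] := pselect (c = e); try subst c; try subst e;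
    by rewrite ?lmulE ?(lmulUU0 n1) ?(lmulUU0 n2) ?lmulE.
- have [E1|n1] := pselect (a = c); have [E2|n2] := pselect (c = e); try subst c; try subst e;
    by rewrite ?lmulE ?(lmulUU0 n1) ?(lmulUA0 _ n2) ?(lmulUA0 _ n1) ?lmulE.
- have [E1|n1] := pselect (a = c); have [E2|n2] := pselect (d = e); try subst c; try subst e;
    by rewrite ?lmulE ?(lmulUA0 _ n1) ?(lmulAU0 _ n2) ?(lmulUA0 _ n1) ?lmulE.
- have [E1|n1] := pselect (a = c); have [E2|n2] := pselect (d = e); try subst c; try subst e;
    by rewrite ?lmulE ?(lmulUA0 _ n1) ?(lmulAA0 _ _ n2) ?(lmulUA0 _ n1) ?lmulE.
- have [E1|n1] := pselect (b = c); have [E2|n2] := pselect (c = e); try subst c; try subst e;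
    by rewrite ?lmulE ?(lmulAU0 _ n1) ?(lmulUU0 n2) ?(lmulAU0 _ n1) ?(lmulAU0 _ n2) ?lmulE.
- have [E1|n1] := pselect (b = c); have [E2|n2] := pselect (c = e); try subst c; try subst e;
    by rewrite ?lmulE ?(lmulAU0 _ n1) ?(lmulUA0 _ n2) ?(lmulAA0 _ _ n1) ?(lmulAA0 _ _ n2) ?lmulE.
- have [E1|n1] := pselect (b = c); have [E2|n2] := pselect (d = e); try subst c; try subst e;
    by rewrite ?lmulE ?(lmulAA0 _ _ n1) ?(lmulAU0 _ n2) ?(lmulAA0 _ _ n1) ?lmulE.
- have [E1|n1] := pselect (b = c); have [E2|n2] := pselect (d = e); try subst c; try subst e;
    by rewrite ?lmulE ?(lmulAA0 _ _ n1) ?(lmulAA0 _ _ n2) ?(lmulAA0 _ _ n1) ?lmulE ?fcomp_assoc.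
Qed.

(** A product vanishes only through mismatched end states or a zero factor, and [lunit a] fixes both
    the end of [x] and the start of [y] to be [a]. *)
Lemma lmul_unit_ne0 x y a : lmul x (lunit a) <> lzero -> lmul (lunit a) y <> lzero ->
  lmul x y <> lzero.
Proof.
move=> /lmulP + /lmulP; case: x => [|b|b c p]; case: y => [|b'|b' c' q] => H1 H2;
  inversion H1; inversion H2; subst; by rewrite lmulE.
Qed.

(** Continuity is assumed near [x] and not just at [x] because [fcomp] is continuous on the
    Delta-product: both factors are first turned into plots by [local_retraction]. *)
Lemma lmul_cont (W : normedModType R) (u v : W -> label) (x : W) :
  delta_generated R W ->
  (\forall y \near x, continuous_at y u) -> (\forall y \near x, continuous_at y v) ->
  continuous_at x (fun y => lmul (u y) (v y)).
Proof.
move=> dW nu nv; have cu := nbhs_singleton nu; have cv := nbhs_singleton nv.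
have cst w : (\forall y \near x, lmul (u y) (v y) = w) ->
    continuous_at x (fun y => lmul (u y) (v y)).
  move=> nw; apply: (@eq_near_continuous _ _ (fun=> w)); last exact: ct_cst.
  by apply: filterS nw => y ->.
case ux: (u x) => [|a|a b p].
- by apply: (cst lzero); apply: filterS (label_near_zero cu ux) => y ->.
- have nx := label_near_unit cu ux; case vx: (v x) => [|c|c d q].
  + by apply: (cst lzero); apply: filterS (label_near_zero cv vx) => y ->; rewrite lmulE.
  + apply: (cst (lmul (lunit a) (lunit c))).
    by apply: filterS (filterI nx (label_near_unit cv vx)) => y [-> ->].
  + have ny := label_near_arrow cv vx; have [E|n] := pselect (a = c); last first.
      by apply: (cst lzero); apply: filterS (filterI nx ny) => y [-> ->]; rewrite lmulUA0.
    case: _ / E q vx ny => q vx ny; apply: (eq_near_continuous _ cv).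
    by apply: filterS (filterI nx ny) => y [-> ->]; rewrite lmulE.
- have nx := label_near_arrow cu ux; case vx: (v x) => [|c|c d q].
  + by apply: (cst lzero); apply: filterS (label_near_zero cv vx) => y ->; rewrite lmulE.
  + have ny := label_near_unit cv vx; have [E|n] := pselect (b = c); last first.
      by apply: (cst lzero); apply: filterS (filterI nx ny) => y [-> ->]; rewrite lmulAU0.
    case: _ / E vx ny => vx ny; apply: (eq_near_continuous _ cu).
    by apply: filterS (filterI nx ny) => y [-> ->]; rewrite lmulE.
  + have ny := label_near_arrow cv vx; have [E|n] := pselect (b = c); last first.
      by apply: (cst lzero); apply: filterS (filterI nx ny) => y [-> ->]; rewrite lmulAA0.
    case: _ / E q vx ny => q vx ny.
    have [rho [crho rhoO [e e0 rhoE]]] :=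
      local_retraction (filterI (filterI nx ny) (filterI nu nv)).
    have cp : continuous (fun y => lget p (u (rho y))).
      move=> y; apply: (comp_cont_at (f := rho) (g := fun y => lget p (u y))); first exact: crho.
      have [[E1 _] [c1 _]] := rhoO y.
      apply: (eq_near_continuous _ (lget_continuous c1 E1)).
      apply: filterS (label_near_arrow c1 E1) => z E2.
      by rewrite {2}E2 lgetK; move: E2; case: (u z) => // a' b' p'; rewrite /lget; case: pselect.
    have cq : continuous (fun y => lget q (v (rho y))).
      move=> y; apply: (comp_cont_at (f := rho) (g := fun y => lget q (v y))); first exact: crho.
      have [[_ E1] [_ c1]] := rhoO y.
      apply: (eq_near_continuous _ (lget_continuous c1 E1)).
      apply: filterS (label_near_arrow c1 E1) => z E2.
      by rewrite {2}E2 lgetK; move: E2; case: (v z) => // a' b' p'; rewrite /lget; case: pselect.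
    have cpq := comp_continuous (kpair_continuous dW cp cq) (@fcomp_continuous _ _ H a b d).
    have cl := comp_continuous cpq (@larrow_continuous a d).
    apply: (eq_near_continuous _ (cl x)); apply/nbhs_ballP; exists e => // y.
    rewrite -ball_normE /= distrC => /ltW /rhoE yE; have [[E1 E2] _] := rhoO y.
    by rewrite -lmulAA -E1 -E2 yE.
Qed.

Lemma lmul_near_cont (W : normedModType R) (u v : W -> label) (x : W) :
  delta_generated R W ->
  (\forall y \near x, continuous_at y u) -> (\forall y \near x, continuous_at y v) ->
  \forall y \near x, continuous_at y (fun y => lmul (u y) (v y)).
Proof.
move=> dW /nbhs_interior nu /nbhs_interior nv.
by apply: filterS (filterI nu nv) => y [yu yv]; exact: lmul_cont.
Qed.

Lemma plot_separated (T : topologicalType) n (u v : 'rV[R]_n -> T) : in_Top R h T -> h ->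
  continuous u -> continuous v -> open [set x | u x <> v x].
Proof.
move=> [_ hT] hh cu cv; have := hT hh; rewrite /delta_hausdorff => /closed_openC oD.
have c1 := kpair_continuous (@rV_delta R n) cu cv.
exact: ((continuousP _).1 c1 _ oD).
Qed.

(** Labels of different kinds, or with different end states, lie in disjoint open pieces. Two arrows
    in one path space are separated by its closed diagonal, pulled back along plots. *)
Lemma label_separated n (u v : 'rV[R]_n -> label) (x : 'rV[R]_n) : h ->
  (\forall y \near x, continuous_at y u) -> (\forall y \near x, continuous_at y v) ->
  u x <> v x -> \forall y \near x, u y <> v y.
Proof.
move=> hh nu nv; have cu := nbhs_singleton nu; have cv := nbhs_singleton nv.
case ux: (u x) => [|a|a b p]; case vx: (v x) => [|c|c d q] uv.
all: try (have nx := label_near_zero cu ux).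
all: try (have nx := label_near_unit cu ux).
all: try (have nx := label_near_arrow cu ux).
all: try (have ny := label_near_zero cv vx).
all: try (have ny := label_near_unit cv vx).
all: try (have ny := label_near_arrow cv vx).
all: try (by apply: filterS (filterI nx ny) => y [-> ->]).
have [[E1 E2]|n1] := pselect (a = c /\ b = d); last first.
  by apply: filterS (filterI nx ny) => y [-> ->] [e1 e2 _]; apply: n1.
case: _ / E1 q vx uv ny => q vx uv ny; case: _ / E2 q vx uv ny => q vx uv ny.
have [rho [crho rhoO [e e0 rhoE]]] :=
  local_retraction (filterI (filterI nx ny) (filterI nu nv)).
have cp : continuous (fun y => lget p (u (rho y))).
  move=> y; apply: (comp_cont_at (f := rho) (g := fun y => lget p (u y))); first exact: crho.
  have [[E1 _] [c1 _]] := rhoO y.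
  apply: (eq_near_continuous _ (lget_continuous c1 E1)).
  apply: filterS (label_near_arrow c1 E1) => z E2.
  by rewrite {2}E2 lgetK; move: E2; case: (u z) => // a' b' p'; rewrite /lget; case: pselect.
have cq : continuous (fun y => lget q (v (rho y))).
  move=> y; apply: (comp_cont_at (f := rho) (g := fun y => lget q (v y))); first exact: crho.
  have [[_ E1] [_ c1]] := rhoO y.
  apply: (eq_near_continuous _ (lget_continuous c1 E1)).
  apply: filterS (label_near_arrow c1 E1) => z E2.
  by rewrite {2}E2 lgetK; move: E2; case: (v z) => // a' b' p'; rewrite /lget; case: pselect.
have o := plot_separated (carrierP (fpath a b)) hh cp cq.
have rx : rho x = x by apply: rhoE; rewrite subrr normr0 ltW.
have nO : nbhs x [set x | lget p (u (rho x)) <> lget q (v (rho x))].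
  by apply: open_nbhs_nbhs; split => //=; rewrite rx ux vx !lgetK => pq; apply: uv; rewrite pq.
have nE : nbhs x [set y | rho y = y].
  by apply/nbhs_ballP; exists e => // y; rewrite -ball_normE /= distrC => /ltW /rhoE.
apply: filterS (filterI nO nE) => y [/= neq yE]; rewrite yE in neq.
have [[E1 E2] _] := rhoO y; rewrite yE in E1 E2.
by rewrite E1 E2 => /larrow_inj.
Qed.

End Labels.

(** * Points of E(H) *)

Section ReadingSpace.
Variables (R : realType) (h : bool) (H : flow R h).

Definition reading : Type := (label H * (R * R))%type.
Definition rnone : reading := (lzero H, (0, 0)).

(** Local constancy to the right provides regular levels just above any given level. The value
    [rnone] outside the range of levels makes equality of points amount to equality of genuine
    readings. *)
Definition rpoint_spec (x : R * (R -> reading)) := [/\ 0 <= x.1 <= 1,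
  forall c, ~~ (0 <= c < 1) -> x.2 c = rnone &
  forall c, exists2 e : R, 0 < e & forall c', c <= c' < c + e -> x.2 c' = x.2 c].

(* A point has a height and, for each level [c] of the interval [0, 1[, a reading: the label
   of the maximal piece of execution path around this point on which the height exceeds
   [c], with the lengths of its two halves. *)
Definition rpoint : Type := {x | rpoint_spec x}.

HB.instance Definition _ := gen_eqMixin rpoint.
HB.instance Definition _ := gen_choiceMixin rpoint.

Definition hgt (p : rpoint) : R := (sval p).1.
Definition rd (p : rpoint) : R -> reading := (sval p).2.

Lemma hgt_itv p : 0 <= hgt p <= 1. Proof. by have [] := proj2_sig p. Qed.
Lemma rd_out p c : ~~ (0 <= c < 1) -> rd p c = rnone.
Proof. by have [_ + _] := proj2_sig p; apply. Qed.
Lemma rd_right p c : exists2 e : R, 0 < e & forall c', c <= c' < c + e -> rd p c' = rd p c.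
Proof. by have [_ _] := proj2_sig p; apply. Qed.

Lemma rpoint_eq p q : hgt p = hgt q -> (forall c, 0 <= c < 1 -> rd p c = rd q c) -> p = q.
Proof.
move=> hpq rpq; have rE : rd p = rd q.
  apply/funext => c; have [c01|c01] := boolP (0 <= c < 1); first exact: rpq.
  by rewrite !rd_out.
case: p q hpq rpq rE => -[a f] ap [[b g] bq]; rewrite /hgt /rd /= => ab _ fg.
by case: _ / ab bq; case: _ / fg ap => ap bq; congr exist; exact: Prop_irrelevance.
Qed.

Definition regular (p : rpoint) (c : R) :=
  exists2 e : R, 0 < e & forall c', `|c' - c| < e -> (rd p c').2 = (rd p c).2.

(** Readings jump at the level where two excursions merge, so continuity is required at regular
    levels only. Regularity compares lengths alone: on an execution path, a stretch without clock
    time has height below 1 by [ck_go], hence a trivial label by [ck_stop]. *)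
Definition readable (T : topologicalType) (f : T -> rpoint) :=
  continuous (fun x => hgt (f x)) /\
  forall x c, 0 < c < 1 -> regular (f x) c ->
    (\forall y \near x, regular (f y) c) /\ continuous_at x (fun y => rd (f y) c).

Definition rpoint_open (A : set rpoint) :=
  forall n (u : 'rV[R]_n -> rpoint), readable u -> open (u @^-1` A).

Lemma rpoint_openT : rpoint_open setT.
Proof. by move=> n u _; exact: openT. Qed.

Lemma rpoint_openI : setI_closed rpoint_open.
Proof. by move=> A B oA oB n u ru; exact: (openI (oA n u ru) (oB n u ru)). Qed.

Lemma rpoint_open_bigU (J : Type) (g : J -> set rpoint) :
  (forall i, rpoint_open (g i)) -> rpoint_open (\bigcup_i g i).
Proof.
move=> og n u ru; rewrite preimage_bigcup.
by apply: bigcup_open => i _; exact: og.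
Qed.

HB.instance Definition _ :=
  isOpenTopological.Build rpoint rpoint_openT rpoint_openI rpoint_open_bigU.

Lemma rpoint_openE (A : set rpoint) : open A = rpoint_open A.
Proof. by []. Qed.

Lemma readable_comp (S T : topologicalType) (g : S -> T) (f : T -> rpoint) :
  continuous g -> readable f -> readable (f \o g).
Proof.
move=> cg [ch rf]; split; first exact: (comp_continuous cg ch).
move=> x c c01 rx; have [nr cr] := rf _ _ c01 rx; split; first exact: (cg x _ nr).
exact: (comp_cont_at (cg x) cr).
Qed.

(** The topology is final for readable plots, so the inverse images under [hgt] and the sets [O c U]
    are open; these test exactly the two clauses of [readable]. *)
Lemma continuous_readable (T : topologicalType) (f : T -> rpoint) :
  continuous f -> readable f.
Proof.
have oh (V : set R) : open V -> open (hgt @^-1` V).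
  by move=> oV; rewrite rpoint_openE => n u [cu _]; exact: (continuousP _).1 cu _ oV.
pose O c U := [set p | regular p c /\ U (rd p c)] : set rpoint.
have oO c (U : set reading) : 0 < c < 1 -> open (U : set (label H * (R * R))%type) -> open (O c U).
  move=> c01 oU; rewrite rpoint_openE => n u [_ ru]; rewrite openE => x [rx Ux].
  have [nr cr] := ru _ _ c01 rx.
  have nU : nbhs x [set y | U (rd (u y) c)] by apply: cr; exact: open_nbhs_nbhs.
  by apply: filterS (filterI nr nU) => y [].
move=> cf; split; first by apply/continuousP => V /oh; exact: (continuousP _).1 cf _.
move=> x c c01 rx; split.
  have : nbhs x (f @^-1` O c setT).
    by apply: cf; apply: open_nbhs_nbhs; split => //; apply: oO => //; exact: openT.
  by apply: filterS => y [].
move=> A; rewrite /= nbhsE => -[U [oU Ux] UA].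
have : nbhs x (f @^-1` O c U).
  by apply: cf; apply: open_nbhs_nbhs; split => //; exact: oO.
by apply: filterS => y [_ /UA].
Qed.

Lemma readable_continuous (T : topologicalType) (f : T -> rpoint) :
  delta_generated R T -> readable f -> continuous f.
Proof.
move=> dT rf; apply: (rV_test dT) => n u cu; apply/continuousP => A.
by rewrite rpoint_openE; apply; exact: readable_comp.
Qed.

Lemma rpoint_delta : delta_generated R rpoint.
Proof.
move=> A dA; rewrite rpoint_openE => n u ru; apply: rV_delta => m v cv.
by apply: dA; exact: (comp_continuous cv (readable_continuous (@rV_delta R n) ru)).
Qed.

Lemma hgt_continuous : continuous hgt.
Proof. exact: (continuous_readable (fun=> cvg_id)).1. Qed.

Lemma delta_hausdorff_plots (T : topologicalType) :
  (forall n (u v : 'rV[R]_n -> T), continuous u -> continuous v ->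
    open [set x | u x <> v x]) -> delta_hausdorff R T.
Proof.
move=> H1; rewrite /delta_hausdorff -openC kelley_open => n w cw.
pose u x := (w (to_simplex x)).1; pose v x := (w (to_simplex x)).2.
have cts := @to_simplex_continuous R n.
have cu : continuous u by exact: (comp_continuous (comp_continuous cts cw) (@fst_continuous _ _)).
have cv : continuous v by exact: (comp_continuous (comp_continuous cts cw) (@snd_continuous _ _)).
rewrite (_ : _ @^-1` _ = set_val @^-1` [set x | u x <> v x]).
  exact: ((continuousP _).1 (@set_val_continuous _ _) _ (H1 _ _ _ cu cv)).
by apply/seteqP; split => s /=; rewrite /u /v to_simplexK.
Qed.

(** Distinct points of equal height differ at some level, and then at a slightly higher one that is
    regular for both. There the readings are continuous along plots, and either the labels or the
    lengths separate. *)
Lemma rpoint_in_Top : in_Top R h rpoint.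
Proof.
split=> [|hh]; first exact: rpoint_delta.
apply: delta_hausdorff_plots => n u v cu cv; rewrite openE => x /= uv; rewrite /interior.
have [hu ru] := continuous_readable cu; have [hv rv] := continuous_readable cv.
have [huv|huv] := pselect (hgt (u x) = hgt (v x)); last first.
  have cd : continuous (fun y => hgt (u y) - hgt (v y) : R) by ct.
  have : nbhs x [set y | hgt (u y) - hgt (v y) != 0].
    apply: (cd x [set r | r != 0]); apply: open_nbhs_nbhs; split; first exact: (@neq0_open R R^o).
    by rewrite /= subr_eq0; apply/eqP.
  by apply: filterS => y /eqP ne uvy; apply: ne; rewrite uvy subrr.
have [c c01 rne] : exists2 c, 0 <= c < 1 & rd (u x) c <> rd (v x) c.
  apply: contrapT => N; apply: uv; apply: rpoint_eq => // c c01.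
  by apply: contrapT => ne; apply: N; exists c.
have [e e0 eE] := rd_right (u x) c; have [f f0 fE] := rd_right (v x) c.
pose d := Order.min (Order.min e f) (1 - c).
have d0 : 0 < d by rewrite !lt_min e0 f0 subr_gt0; case/andP: c01.
have [de df dc] : [/\ d <= e, d <= f & d <= 1 - c].
  by split; rewrite !ge_min lexx ?orbT.
(* The middle of an interval to the right of [c] on which both reading functions are constant. *)
pose c1 := c + d / 2.
have c1E c' : `|c' - c1| < d / 2 -> c <= c' < c + d.
  by rewrite ltr_distl /c1 => /andP[? ?]; apply/andP; split; lra.
have c11 : `|c1 - c1| < d / 2 by rewrite subrr normr0; lra.
have ue c' : `|c' - c1| < d / 2 -> rd (u x) c' = rd (u x) c.
  by move=> /c1E /andP[? ?]; apply: eE; apply/andP; split; lra.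
have ve c' : `|c' - c1| < d / 2 -> rd (v x) c' = rd (v x) c.
  by move=> /c1E /andP[? ?]; apply: fE; apply/andP; split; lra.
have c101 : 0 < c1 < 1 by rewrite /c1; case/andP: c01 => ? ?; apply/andP; split; lra.
have gu : regular (u x) c1 by exists (d / 2); [lra|move=> c' ?; rewrite !ue].
have gv : regular (v x) c1 by exists (d / 2); [lra|move=> c' ?; rewrite !ve].
have [nu _] := ru _ _ c101 gu; have [nv _] := rv _ _ c101 gv.
have cu1 : \forall y \near x, continuous_at y (fun y => rd (u y) c1).
  by apply: filterS nu => y gy; have [] := ru _ _ c101 gy.
have cv1 : \forall y \near x, continuous_at y (fun y => rd (v y) c1).
  by apply: filterS nv => y gy; have [] := rv _ _ c101 gy.
rewrite -(ue c1) // -(ve c1) // in rne.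
have [e1|n1] := pselect ((rd (u x) c1).1 = (rd (v x) c1).1); last first.
  have : \forall y \near x, (rd (u y) c1).1 <> (rd (v y) c1).1.
    apply: label_separated => //.
      by apply: filterS cu1 => y cy; apply: (@ct_fst _ _ (label H) _ _ cy).
    by apply: filterS cv1 => y cy; apply: (@ct_fst _ _ (label H) _ _ cy).
  by apply: filterS => y ne uvy; apply: ne; rewrite uvy.
have n2 : (rd (u x) c1).2 <> (rd (v x) c1).2.
  by move=> e2; apply: rne; move: e1 e2; case: (rd (u x) c1) (rd (v x) c1) => ? ? [? ?] /= -> ->.
have cu2 : continuous_at x (fun y => (rd (u y) c1).2).
  exact: (@ct_snd _ _ (label H) _ _ (nbhs_singleton cu1)).
have cv2 : continuous_at x (fun y => (rd (v y) c1).2).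
  exact: (@ct_snd _ _ (label H) _ _ (nbhs_singleton cv1)).
have cd : continuous_at x (fun y => (rd (u y) c1).2 - (rd (v y) c1).2).
  by apply: (@ct_add R _ x (R * R)%type) => //; apply: (@ct_opp R _ x (R * R)%type).
have : nbhs x [set y | (rd (u y) c1).2 - (rd (v y) c1).2 != 0].
  apply: (cd [set r | r != 0]); apply: open_nbhs_nbhs; split; first exact: (@neq0_open R (R * R)%type).
  by rewrite /= subr_eq0; apply/eqP.
by apply: filterS => y /eqP ne uvy; apply: ne; rewrite uvy subrr.
Qed.

End ReadingSpace.

(** * Execution paths of E(H) *)

Section Excursions.
Variable R : realType.
Implicit Types f : R -> R.

Lemma near_lt f (t r : R) : continuous f -> f t < r ->
  exists2 e : R, 0 < e & forall s, `|s - t| < e -> f s < r.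
Proof.
move=> cf ftr; have /nbhs_ballP[e /= e0 eE] : nbhs t [set s | f s < r].
  by apply: (cf t [set v | v < r]); exact: lt_nbhsl.
by exists e => // s se; apply: eE; rewrite /ball /= distrC.
Qed.

Lemma near_gt f (t r : R) : continuous f -> r < f t ->
  exists2 e : R, 0 < e & forall s, `|s - t| < e -> r < f s.
Proof.
move=> cf ftr; have cg : continuous (fun s => - f s) by ct.
have [|e e0 eE] := @near_lt _ t (- r) cg; first by rewrite ltrN2.
by exists e => // s /eE; rewrite ltrN2.
Qed.

(** [t1] is the last time before [t] with [f <= c], a supremum attained by continuity. Together with
    [excursion_right] it delimits the excursion above [c] around [t], which degenerates to [t] when
    [f t <= c]. *)
Lemma excursion_left f (a t c : R) : continuous f -> f a <= c -> a <= t ->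
  exists t1, [/\ a <= t1 <= t, f t1 <= c & forall s, t1 < s <= t -> c < f s].
Proof.
move=> cf fa at_; pose A := [set s | a <= s <= t /\ f s <= c].
have Aa : A a by split => //; rewrite lexx.
have supA : has_sup A by split; [exists a|exists t => s [/andP[]]].
have le s : A s -> s <= sup A by move=> As; apply: (sup_upper_bound supA).
exists (sup A); split.
- by rewrite le //= ge_sup //; [exists a|move=> s [/andP[]]].
- rewrite leNgt; apply/negP => cs; have [e e0 eE] := near_gt cf cs.
  have [s As] := sup_adherent e0 supA => es; have := le _ As => ls.
  have : c < f s by apply: eE; rewrite distrC ltr_norml; apply/andP; split; lra.
  by rewrite ltNge As.2.
- move=> s /andP[s1 s2]; rewrite ltNge; apply/negP => fs.
  have : A s by split => //; rewrite s2 andbT (le_trans (le _ Aa)) // ltW.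
  by move=> /le; lra.
Qed.

Lemma excursion_right f (t b c : R) : continuous f -> f b <= c -> t <= b ->
  exists t2, [/\ t <= t2 <= b, f t2 <= c & forall s, t <= s < t2 -> c < f s].
Proof.
move=> cf fb tb; have cg : continuous (fun s => f (- s)).
  have c1 : continuous (fun s : R => - s) by ct.
  exact: (comp_continuous c1 cf).
have [||t1 [t1b ft1 t1E]] := @excursion_left _ (- b) (- t) c cg; [by rewrite opprK|lra|].
exists (- t1); split => //; first by case/andP: t1b => ? ?; apply/andP; split; lra.
move=> s /andP[s1 s2]; have := t1E (- s); rewrite opprK; apply.
by apply/andP; split; lra.
Qed.

Lemma tube_lt (S : topologicalType) (F : S * R -> R) (s0 : S) (a b r : R) :
  continuous F -> (forall t, a <= t <= b -> F (s0, t) < r) ->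
  \forall s \near s0, forall t, a <= t <= b -> F (s, t) < r.
Proof.
move=> cF Fr; have /compact_near_coveringP cab := @segment_compact R a b.
have tb : \forall s \near s0, `[a, b]%classic `<=` (fun t => F (s, t) < r).
  apply: cab => t /=; rewrite in_itv /= => tab.
  have nU : nbhs (s0, t) [set z | F z < r].
    by apply: (cF (s0, t) [set v | v < r]); apply: lt_nbhsl; exact: Fr.
  have [[A B] /= [nA nB] AB] := nU; exists (B, A) => //= -[t' s'] /= [Bt' As'].
  exact: (AB (s', t')).
by apply: filterS tb => s ts t tab; apply: ts; rewrite /= in_itv.
Qed.

Lemma tube_gt (S : topologicalType) (F : S * R -> R) (s0 : S) (a b r : R) :
  continuous F -> (forall t, a <= t <= b -> r < F (s0, t)) ->
  \forall s \near s0, forall t, a <= t <= b -> r < F (s, t).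
Proof.
move=> cF Fr; have cG : continuous (fun z => - F z) by ct.
have := @tube_lt S _ s0 a b (- r) cG.
have H1 t : a <= t <= b -> - F (s0, t) < - r by move=> /Fr; rewrite ltrN2.
by move=> /(_ H1); apply: filterS => s Hs t /Hs; rewrite ltrN2.
Qed.

(** Continuous induction along the zeros of [f]. At the supremum [T] of the zeros up to which [P]
    holds, either another zero follows within the reach of [loc], or an excursion begins and [jump]
    crosses it. *)
Lemma zero_induction f (P : R -> Prop) : continuous f -> (forall t, 0 <= f t) ->
  f 0 = 0 -> f 1 = 0 -> P 0 ->
  (forall T, 0 <= T <= 1 -> f T = 0 -> exists2 e : R, 0 < e & forall t t',
    0 <= t <= 1 -> 0 <= t' <= 1 -> f t = 0 -> f t' = 0 ->
    `|t - T| < e -> `|t' - T| < e -> P t -> P t') ->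
  (forall t1 t2, 0 <= t1 -> t1 < t2 -> t2 <= 1 -> f t1 = 0 -> f t2 = 0 ->
    (forall t, t1 < t < t2 -> 0 < f t) -> P t1 -> P t2) ->
  forall t, 0 <= t <= 1 -> f t = 0 -> P t.
Proof.
move=> cf f0 f00 f01 P0 loc jump t t01 ft; apply: contrapT => nPt.
pose A := [set s | [/\ 0 <= s <= 1, f s = 0 & forall s', 0 <= s' <= s -> f s' = 0 -> P s']].
have A0 : A 0.
  split=> // [|s' s0 _]; first by rewrite lexx ler01.
  by have -> : s' = 0 by lra.
have supA : has_sup A by split; [exists 0|exists 1 => s [/andP[]]].
have le s : A s -> s <= sup A by move=> As; apply: (sup_upper_bound supA).
set T := sup A; have T0 : 0 <= T by exact: le.
have T1 : T <= 1 by apply: ge_sup; [exists 0|move=> s [/andP[]]].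
have T01 : 0 <= T <= 1 by rewrite T0.
have fT : f T = 0.
  apply/eqP; rewrite eq_le f0 andbT leNgt; apply/negP => cs.
  have [e e0 eE] := near_gt cf cs; have [s As es] := sup_adherent e0 supA.
  have ls := le _ As; rewrite -/T in es ls.
  have : 0 < f s by apply: eE; rewrite distrC ltr_norml; apply/andP; split; lra.
  by have [_ -> _] := As; rewrite ltxx.
have [e e0 eE] := loc T T01 fT.
have [s [s01 fs As] es] := sup_adherent e0 supA; rewrite -/T in es.
have sT : s <= T by apply: le; split.
have Ps : P s by apply: As => //; case/andP: s01 => -> _; rewrite lexx.
have PT : P T.
  apply: (eE s T) => //; last by rewrite subrr normr0.
  by rewrite distrC ltr_norml; apply/andP; split; lra.
have AT s' : 0 <= s' <= T -> f s' = 0 -> P s'.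
  move=> /andP[s'0 s'T] fs'; have [->//|ne] := eqVneq s' T.
  have lt' : 0 < T - s' by rewrite subr_gt0 lt_neqAle ne.
  have [r [r01 fr Ar] er] := sup_adherent lt' supA; rewrite -/T in er.
  by apply: Ar => //; apply/andP; split => //; lra.
have tT : T < t.
  by rewrite ltNge; apply/negP => tT; apply: nPt; apply: AT => //; case/andP: t01 => -> _.
have [[s1 [s1T s1e fs1]]|noz] := pselect (exists s1, [/\ T < s1, s1 < T + e & f s1 = 0]).
  have [s1t|ts1] := leP s1 t; last first.
    apply: nPt; apply: (eE T t) => //; first by rewrite subrr normr0.
    by rewrite ltr_norml; apply/andP; split; lra.
  suff /le : A s1 by rewrite -/T; lra.
  have s101 : 0 <= s1 <= 1 by case/andP: t01 => ? ?; apply/andP; split; lra.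
  split=> // s' /andP[s'0 s's1] fs'; have [s'T|Ts'] := leP s' T.
    by apply: AT => //; rewrite s'0.
  apply: (eE T s') => //.
  - by case/andP: s101 => ? ?; apply/andP; split; lra.
  - by rewrite subrr normr0.
  - by rewrite ltr_norml; apply/andP; split; lra.
have te : T + e <= t by rewrite leNgt; apply/negP => te; apply: noz; exists t.
pose m := T + e / 2.
have Tm : T <= m by rewrite /m; lra.
have mt : m <= t by rewrite /m; lra.
have ft0 : f t <= 0 by rewrite ft.
have [t2 [/andP[mt2 t2t] ft2 t2E]] := excursion_right cf ft0 mt.
have ft2' : f t2 = 0 by apply/eqP; rewrite eq_le ft2 f0.
have Tt2 : T < t2 by rewrite /m in mt2; lra.
have fpos s' : T < s' < t2 -> 0 < f s'.
  move=> /andP[Ts' s't2]; have [ms'|s'm] := leP m s'.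
    by apply: t2E; rewrite ms'.
  rewrite lt_neqAle f0 andbT eq_sym; apply/eqP => fs'; apply: noz; exists s'.
  by split => //; rewrite /m in s'm; lra.
have t21 : t2 <= 1 by case/andP: t01 => ? ?; lra.
have Pt2 : P t2 by exact: (jump T t2).
suff /le : A t2 by rewrite -/T; lra.
split=> //; first by apply/andP; split => //; lra.
move=> s' /andP[s'0 s't2] fs'; have [s'T|Ts'] := leP s' T.
  by apply: AT => //; rewrite s'0.
have [<-//|ne] := eqVneq t2 s'.
have : 0 < f s' by apply: fpos; rewrite Ts' lt_neqAle eq_sym ne.
by rewrite fs' ltxx.
Qed.

End Excursions.

Section Clocked.
Variables (R : realType) (h : bool) (H : flow R h).
Local Notation I := (unit_interval R).
Local Notation E := (rpoint H).
Implicit Types e : I -> E.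

Lemma proj_unit_le0 (t : R) : t <= 0 -> proj_unit t = i0 :> I.
Proof. by move=> t0; apply: unit_eq; rewrite set_val_i0 [LHS](cl_le0 t0). Qed.

Lemma proj_unit_ge1 (t : R) : 1 <= t -> proj_unit t = i1 :> I.
Proof. by move=> t1; apply: unit_eq; rewrite set_val_i1 [LHS](cl_ge1 t1). Qed.

Definition ht e (t : R) : R := hgt (e (proj_unit t)).

Definition below e (t t' : R) := forall s, t <= s <= t' -> ht e s < 1.

(* The execution path [e] carries the labels [Q t t'], between the times at which its
   height is not maximal, and a clock [run] that runs exactly when its height is maximal;
   its readings are determined by these data. *)
Record clocked e (Q : R -> R -> label H) (run : R -> R) : Prop := Clocked {
  ck_h0 : ht e 0 = 0;
  ck_h1 : ht e 1 = 0;
  ck_coc : forall t t' t'', t <= t' -> t' <= t'' -> ht e t < 1 -> ht e t' < 1 ->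
    ht e t'' < 1 -> Q t t'' = lmul (Q t t') (Q t' t'');
  ck_ne0 : forall t t', t <= t' -> ht e t < 1 -> ht e t' < 1 -> Q t t' <> lzero H;
  ck_unit : forall t, ht e t < 1 -> exists a, Q t t = lunit a;
  ck_mono : forall t t', t <= t' -> run t <= run t';
  ck_stop : forall t t', t <= t' -> below e t t' -> run t = run t' /\ Q t t' = Q t t;
  ck_go : forall t t', t <= t' -> ht e t < 1 -> ht e t' < 1 -> run t = run t' -> below e t t';
  ck_run0 : run 0 = 0;
  ck_arrow : exists (a b : fstate H) (p : fpath a b), Q 0 1 = larrow p;
  ck_rd : forall c t1 t t2, 0 <= c < 1 -> t1 <= t <= t2 -> ht e t1 <= c -> ht e t2 <= c ->
    (forall s, t1 < s <= t -> c < ht e s) -> (forall s, t <= s < t2 -> c < ht e s) ->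
    rd (e (proj_unit t)) c = (Q t1 t2, (run t - run t1, run t2 - run t))
}.

Definition rexec e := continuous e /\ exists Q run, clocked e Q run.

Section Facts.
Variables (e : I -> E) (Q : R -> R -> label H) (run : R -> R).
Hypotheses (ce : continuous e) (ck : clocked e Q run).

Lemma ht_ge0 t : 0 <= ht e t. Proof. by have /andP[] := hgt_itv (e (proj_unit t)). Qed.

Lemma ht_continuous : continuous (ht e).
Proof.
have c1 := comp_continuous (@proj_unit_continuous R) ce.
exact: (comp_continuous c1 (@hgt_continuous R h H)).
Qed.

Lemma ck_gap c t : ht e t <= c < 1 -> rd (e (proj_unit t)) c = (Q t t, (0, 0)).
Proof.
move=> /andP[tc c1]; rewrite (@ck_rd _ _ _ ck c t t t) ?subrr ?lexx //.
- by rewrite c1 (le_trans (ht_ge0 t)).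
- by move=> s /andP[s1 s2]; lra.
- by move=> s /andP[s1 s2]; lra.
Qed.

Lemma ck_stop_r t t' : t <= t' -> below e t t' -> Q t t' = Q t' t'.
Proof.
move=> tt' b; have [_ q] := ck_stop ck tt' b.
have ht1 : ht e t < 1 by apply: b; rewrite lexx.
have ht2 : ht e t' < 1 by apply: b; rewrite lexx tt'.
have [a qa] := ck_unit ck ht1; have [a' qa'] := ck_unit ck ht2.
have := ck_coc ck tt' (lexx t') ht1 ht2 ht2; rewrite qa' q qa => E1.
have : lmul (lunit a) (lunit a') <> lzero H by rewrite -E1.
by move=> /lmulP H1; inversion H1; subst.
Qed.

Lemma ck_below_l t t' t'' : t <= t' -> t' <= t'' -> below e t t' -> ht e t'' < 1 ->
  Q t t'' = Q t' t''.
Proof.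
move=> tt' tt'' b h3; have h1 : ht e t < 1 by apply: b; rewrite lexx.
have h2 : ht e t' < 1 by apply: b; rewrite lexx tt'.
rewrite (ck_coc ck tt' tt'') // (ck_stop_r tt' b).
by rewrite -(ck_coc ck (lexx t') tt'').
Qed.

Lemma ck_below_r t t' t'' : t <= t' -> t' <= t'' -> below e t' t'' -> ht e t < 1 ->
  Q t t'' = Q t t'.
Proof.
move=> tt' tt'' b h1; have h2 : ht e t' < 1 by apply: b; rewrite lexx.
have h3 : ht e t'' < 1 by apply: b; rewrite lexx tt''.
rewrite (ck_coc ck tt' tt'') //; have [_ ->] := ck_stop ck tt'' b.
by rewrite -(ck_coc ck tt' (lexx t')).
Qed.

Lemma ck_below_run t t' : t <= t' -> below e t t' -> run t = run t'.
Proof. by move=> tt' b; have [] := ck_stop ck tt' b. Qed.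

Lemma ht_near0 T : ht e T = 0 -> exists2 r : R, 0 < r & forall s, `|s - T| < r -> ht e s < 1.
Proof. by move=> hT; apply: near_lt ht_continuous _; rewrite hT. Qed.

Lemma near_below (r T t t' : R) : (forall s, `|s - T| < r -> ht e s < 1) ->
  `|t - T| < r -> `|t' - T| < r -> below e t t'.
Proof.
move=> rE; rewrite !ltr_norml => /andP[? ?] /andP[? ?] s /andP[? ?].
by apply: rE; rewrite ltr_norml; apply/andP; split; lra.
Qed.

(** If the clock did not run at all, the height would stay below 1 and the total label would be a
    unit instead of an arrow. *)
Lemma ck_len : 0 < run 1.
Proof.
rewrite -(ck_run0 ck) lt_neqAle (ck_mono ck) // andbT; apply/eqP => r01.
have b := ck_go ck ler01 _ _ r01; rewrite (ck_h0 ck) (ck_h1 ck) ltr01 in b.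
have [_ q] := ck_stop ck ler01 (b isT isT); have [x [y [p pE]]] := ck_arrow ck.
have h0 : ht e 0 < 1 by rewrite (ck_h0 ck).
by have [a qa] := ck_unit ck h0; rewrite q qa in pE.
Qed.

Lemma ck_exc c t : 0 <= c -> 0 <= t <= 1 -> exists t1 t2 : R,
  [/\ 0 <= t1 <= t, t <= t2 <= 1, ht e t1 <= c, ht e t2 <= c &
   (forall s, t1 < s <= t -> c < ht e s) /\ (forall s, t <= s < t2 -> c < ht e s)].
Proof.
move=> c0 /andP[t0 t1]; have h0 : ht e 0 <= c by rewrite (ck_h0 ck).
have h1 : ht e 1 <= c by rewrite (ck_h1 ck).
have [u [u1 u2 u3]] := excursion_left ht_continuous h0 t0.
have [v [v1 v2 v3]] := excursion_right ht_continuous h1 t1.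
by exists u, v.
Qed.

End Facts.

(** Readings at level 0 reveal the label and the clock time of each excursion between two zeros of
    the height, and near a zero neither changes; [zero_induction] accumulates them. Label and clock
    are thus determined by the points of the path. *)
Lemma ck_zero e Q run Q' run' : continuous e -> clocked e Q run -> clocked e Q' run' ->
  forall t, 0 <= t <= 1 -> ht e t = 0 -> Q 0 t = Q' 0 t /\ run t = run' t.
Proof.
move=> ce ck ck'; have ch := ht_continuous ce.
have h0 := ck_h0 ck; have h0' : ht e 0 < 1 by rewrite h0.
apply: (zero_induction ch (@ht_ge0 e) h0 (ck_h1 ck)).
- have g0 : ht e 0 <= 0 < (1 : R) by rewrite h0 lexx ltr01.
  have := ck_gap ck g0; rewrite (ck_gap ck' g0) => -[->].
  by rewrite (ck_run0 ck) (ck_run0 ck').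
- move=> T T01 hT; have [r r0 rE] := ht_near0 ce hT; exists r => //.
  move=> t t' /andP[t0 t1] /andP[t'0 t'1] ht0 ht'0 tr t'r [qt rt].
  have g1 : ht e t < 1 by rewrite ht0.
  have g2 : ht e t' < 1 by rewrite ht'0.
  have [tt'|/ltW tt'] := leP t t'.
    have b := near_below rE tr t'r.
    rewrite (ck_below_r ck t0 tt' b h0') (ck_below_r ck' t0 tt' b h0').
    by rewrite -(ck_below_run ck tt' b) -(ck_below_run ck' tt' b).
  have b := near_below rE t'r tr.
  rewrite -(ck_below_r ck t'0 tt' b h0') -(ck_below_r ck' t'0 tt' b h0').
  by rewrite (ck_below_run ck tt' b) (ck_below_run ck' tt' b).
- move=> t1 t2 t10 t12 t21 h1 h2 pos [q1 r1]; pose m := (t1 + t2) / 2.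
  have E1 Q1 run1 : clocked e Q1 run1 ->
      rd (e (proj_unit m)) 0 = (Q1 t1 t2, (run1 m - run1 t1, run1 t2 - run1 m)).
    move=> ck1; apply: (ck_rd ck1); rewrite ?h1 ?h2 ?lexx ?ltr01 //.
    - by rewrite /m; apply/andP; split; lra.
    - by move=> s /andP[s1 s2]; apply: pos; rewrite /m in s2; apply/andP; split; lra.
    - by move=> s /andP[s1 s2]; apply: pos; rewrite /m in s1; apply/andP; split; lra.
  have := E1 _ _ ck; rewrite (E1 _ _ ck') => -[q12 r2 r3].
  have g1 : ht e t1 < 1 by rewrite h1.
  have g2 : ht e t2 < 1 by rewrite h2.
  have t12' := ltW t12.
  rewrite (ck_coc ck t10 t12') // (ck_coc ck' t10 t12') // q1 q12; split => //.
  by lra.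
Qed.

Lemma ck_run_unique e Q run Q' run' : continuous e -> clocked e Q run -> clocked e Q' run' ->
  forall t, 0 <= t <= 1 -> run t = run' t.
Proof.
move=> ce ck ck' t t01; have [t1 [t2 [t1t t2t h1 h2 [p1 p2]]]] := ck_exc ce ck (lexx 0) t01.
have tt : t1 <= t <= t2 by case/andP: t1t => _ ->; case/andP: t2t.
have c01 : 0 <= (0 : R) < 1 by rewrite lexx ltr01.
have := ck_rd ck c01 tt h1 h2 p1 p2; rewrite (ck_rd ck' c01 tt h1 h2 p1 p2) => -[_ r1 _].
have t101 : 0 <= t1 <= 1 by case/andP: t1t => -> ?; case/andP: t01 => ? ?; lra.
have z1 : ht e t1 = 0 by apply/eqP; rewrite eq_le h1 ht_ge0.
by have [_ r2] := ck_zero ce ck ck' t101 z1; lra.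
Qed.

Lemma ck_label_unique e Q run Q' run' : continuous e -> clocked e Q run -> clocked e Q' run' ->
  Q 0 1 = Q' 0 1.
Proof.
move=> ce ck ck'; have t1 : 0 <= (1 : R) <= 1 by rewrite ler01 lexx.
by have [] := ck_zero ce ck ck' t1 (ck_h1 ck).
Qed.

End Clocked.

Lemma common_margin (R : realFieldType) (r1 r2 u m v : R) : 0 < r1 -> 0 < r2 ->
  u < m -> m < v -> exists del : R,
    [/\ 0 < del, del < r1, del < r2, u + del <= m - del & m + del <= v - del].
Proof.
move=> r10 r20 um mv; pose D : R := Order.min (Order.min r1 r2) (Order.min (m - u) (v - m)).
have D0 : 0 < D by rewrite !lt_min r10 r20 !subr_gt0 um mv.
have [D1 D2 D3 D4] : [/\ D <= r1, D <= r2, D <= m - u & D <= v - m].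
  by split; rewrite !ge_min lexx ?orbT.
by exists (D / 2); split; lra.
Qed.

Lemma dist_margin (R : realFieldType) (u t del r : R) : del < r ->
  u - del <= t <= u + del -> u - r < t < u + r.
Proof. by move=> ? /andP[? ?]; apply/andP; split; lra. Qed.

Lemma margin_itv (R : realFieldType) (t1 t2 u v m t del : R) : t1 <= u -> v <= t2 ->
  0 <= del -> u + del <= m - del -> m + del <= v - del -> - del <= t - m -> t - m <= del ->
  [/\ t1 <= t, t <= t2, u + del <= t & t <= v - del].
Proof. by move=> *; split; lra. Qed.

Lemma near_slice (S T : topologicalType) (x : S) (y : T) (P : set (S * T)) :
  (\forall z \near (x, y), P z) -> \forall s \near x, P (s, y).
Proof.
have cm : continuous (fun s : S => (s, y)) by move=> s; apply: cvg_pair; [exact: cvg_id|exact: cvg_cst].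
exact: (cm x P).
Qed.

Lemma nearI (T : topologicalType) (x : T) (A B : set T) :
  (\forall y \near x, A y) -> (\forall y \near x, B y) -> \forall y \near x, (A `&` B) y.
Proof. by move=> nA nB; exact: filterI. Qed.

Lemma near2 (T : topologicalType) (x : T) (A B C : set T) :
  (\forall y \near x, A y) -> (\forall y \near x, B y) ->
  (forall y, A y -> B y -> C y) -> \forall y \near x, C y.
Proof. by move=> nA nB ABC; apply: filterS (filterI nA nB) => y []; exact: ABC. Qed.

Lemma near_fst (S T : topologicalType) (x : S) (y : T) (P : set S) :
  (\forall s \near x, P s) -> \forall z \near (x, y), P z.1.
Proof. exact: (@fst_continuous S T (x, y) P). Qed.

Lemma near_cont_eq (S T : topologicalType) (u v : S -> T) (x : S) :
  (\forall y \near x, u y = v y) -> (\forall y \near x, continuous_at y u) ->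
  \forall y \near x, continuous_at y v.
Proof.
move=> /nbhs_interior uv cu.
by apply: filterS (filterI uv cu) => y [uvy cuy]; exact: eq_near_continuous uvy cuy.
Qed.

(** * Continuity of labels and clocks in families of paths *)

Section ClockedPlots.
Variables (R : realType) (h : bool) (H : flow R h) (n : nat).
Local Notation I := (unit_interval R).
Local Notation E := (rpoint H).
Variables (e : 'rV[R]_n -> I -> E) (Q : 'rV[R]_n -> R -> R -> label H).
Variable run : 'rV[R]_n -> R -> R.
Hypothesis ce : continuous (fun z : 'rV[R]_n * I => e z.1 z.2).
Hypothesis ck : forall s, clocked (e s) (Q s) (run s).
Hypothesis start : forall s s', e s i0 = e s' i0.

Let f (z : 'rV[R]_n * R) : E := e z.1 (proj_unit z.2).
Let g (z : 'rV[R]_n * R) : R := ht (e z.1) z.2.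

Let cf : continuous f.
Proof.
have c1 : continuous (fun z : 'rV[R]_n * R => (z.1, proj_unit z.2)) by ct.
exact: (comp_continuous c1 ce).
Qed.

Let cg : continuous g. Proof. exact: (comp_continuous cf (@hgt_continuous R h H)). Qed.

Let ces s : continuous (e s).
Proof.
have c1 : continuous (fun t : I => (s, t)) by ct.
exact: (comp_continuous c1 ce).
Qed.

(** For parameters near [s0] the height may be positive at [t1] and [t2], so level 0 gives no
    information about this interval. A small positive level [c] still isolates one excursion inside
    it, and the margins cut off have height below 1, hence contribute neither label nor clock
    time. *)
Lemma reading_near (s0 : 'rV[R]_n) (t1 t2 m : R) : 0 <= t1 -> t1 < m < t2 -> t2 <= 1 ->
  ht (e s0) t1 = 0 -> ht (e s0) t2 = 0 -> (forall t, t1 < t < t2 -> 0 < ht (e s0) t) ->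
  exists c, (\forall z \near (s0, m), rd (f z) c =
      (Q z.1 t1 t2, (run z.1 z.2 - run z.1 t1, run z.1 t2 - run z.1 z.2))) /\
    \forall z \near (s0, m), continuous_at z (fun z => rd (f z) c).
Proof.
move=> t10 /andP[t1m mt2] t21 z1 z2 pos; have hm : 0 < ht (e s0) m by apply: pos; rewrite t1m.
have [r r0 rE] := rd_right (f (s0, m)) 0.
(* As [c] is half of [d], the levels at distance less than [c] from [c] lie between 0 and [d], where
   the reading at [(s0, m)] is the one of level 0; so [c] is regular there. *)
pose d : R := Order.min (Order.min r 1) (ht (e s0) m); pose c : R := d / 2.
have d0 : 0 < d by rewrite !lt_min r0 ltr01.
have [dr d1 dm] : [/\ d <= r, d <= 1 & d <= ht (e s0) m].
  by split; rewrite !ge_min lexx ?orbT.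
have c0 : 0 < c by rewrite /c; lra.
have c1 : c < 1 by rewrite /c; lra.
have cm : c < ht (e s0) m by rewrite /c; lra.
have c01 : 0 <= c < 1 by rewrite (ltW c0).
have rc c' : `|c' - c| < c -> rd (f (s0, m)) c' = rd (f (s0, m)) 0.
  rewrite ltr_norml => /andP[x1 x2]; apply: rE; rewrite /c in x1 x2.
  by apply/andP; split; lra.
have cc : `|c - c| < c by rewrite subrr normr0.
exists c; have reg : regular (f (s0, m)) c by exists c => // c' c'c; rewrite !rc.
have [_ rf] := continuous_readable cf; have c01' : 0 < c < 1 by rewrite c0.
have [nr _] := rf _ _ c01' reg; split; last first.
  by apply: filterS nr => z zr; have [] := rf _ _ c01' zr.
have ch := ht_continuous (@ces s0); have ck0 := ck s0.
have h1c : ht (e s0) t1 <= c by rewrite z1 ltW.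
have h2c : ht (e s0) t2 <= c by rewrite z2 ltW.
have [u [/andP[u1 u2] hu uE]] := excursion_left ch h1c (ltW t1m).
have [v [/andP[v1 v2] hv vE]] := excursion_right ch h2c (ltW mt2).
have um : u < m.
  by rewrite lt_neqAle u2 andbT; apply/eqP => um; move: hu; rewrite um leNgt cm.
have mv : m < v.
  by rewrite lt_neqAle v1 andbT; apply/eqP => vm; move: hv; rewrite -vm leNgt cm.
have E0 : rd (f (s0, m)) 0 = (Q s0 t1 t2, (run s0 m - run s0 t1, run s0 t2 - run s0 m)).
  apply: (ck_rd ck0); rewrite ?z1 ?z2 ?lexx ?ltr01 ?(ltW t1m) ?(ltW mt2) //.
  - by move=> s /= /andP[s1 s2]; apply: pos; rewrite s1 (le_lt_trans s2).
  - by move=> s /= /andP[s1 s2]; apply: pos; rewrite s2 (lt_le_trans t1m).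
have Ec : rd (f (s0, m)) c = (Q s0 u v, (run s0 m - run s0 u, run s0 v - run s0 m)).
  by apply: (ck_rd ck0) => //; rewrite u2.
(* The readings at [(s0, m)] agree at levels 0 and [c]. Comparing lengths shows that the clock
   stands still on the two margins, and [ck_go] then bounds the height on them. *)
have [ru rv] : run s0 t1 = run s0 u /\ run s0 v = run s0 t2.
  by move: Ec; rewrite rc // E0 => -[_ /addrI/oppr_inj -> /addIr ->].
have hu1 : ht (e s0) u < 1 by exact: le_lt_trans c1.
have hv1 : ht (e s0) v < 1 by exact: le_lt_trans c1.
have h11 : ht (e s0) t1 < 1 by exact: le_lt_trans c1.
have h21 : ht (e s0) t2 < 1 by exact: le_lt_trans c1.
have bu := ck_go ck0 u1 h11 hu1 ru; have bv := ck_go ck0 v2 hv1 h21 rv.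
have [ru1 ru10 ru1E] := near_lt ch hu1; have [rv1 rv10 rv1E] := near_lt ch hv1.
have [del [del0 del1 del2 del3 del4]] := common_margin ru10 rv10 um mv.
have T1 : \forall s \near s0, forall t, t1 <= t <= u + del -> g (s, t) < 1.
  apply: tube_lt => // t /andP[ta tb]; have [tu|ut] := leP t u; first by apply: bu; rewrite ta.
  by apply: ru1E; rewrite /= ltr_distl; apply: (@dist_margin _ _ _ del) => //; rewrite tb andbT (le_trans _ (ltW ut)) // gerBl ltW.
have T2 : \forall s \near s0, forall t, v - del <= t <= t2 -> g (s, t) < 1.
  apply: tube_lt => // t /andP[ta tb]; have [vt|tv] := leP v t; first by apply: bv; rewrite vt.
  by apply: rv1E; rewrite /= ltr_distl; apply: (@dist_margin _ _ _ del) => //; rewrite ta (le_trans (ltW tv)) // lerDl ltW.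
have T3 : \forall s \near s0, forall t, u + del <= t <= v - del -> c < g (s, t).
  apply: tube_gt => // t /andP[ta tb]; have [tm|mt] := leP t m.
    by apply: uE; rewrite /= tm andbT (lt_le_trans _ ta) // ltrDl.
  by apply: vE; rewrite /= (ltW mt) (le_lt_trans tb) // gtrBl.
have T4 : \forall s \near s0, forall t, t1 <= t <= t1 -> g (s, t) < c.
  by apply: tube_lt => // t; rewrite -eq_le => /eqP <-; rewrite /g z1.
have T5 : \forall s \near s0, forall t, t2 <= t <= t2 -> g (s, t) < c.
  by apply: tube_lt => // t; rewrite -eq_le => /eqP <-; rewrite /g z2.
have N1 := near_fst m (nearI (nearI T1 T2) (nearI T3 (nearI T4 T5))).
have N2 : \forall z \near (s0, m), `|z.2 - m| < del.
  have := @snd_continuous 'rV[R]_n R (s0, m) [set t | `|t - m| < del]; apply.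
  apply/nbhs_ballP; exists del => //=.
  by move=> t; rewrite /ball /= distrC.
apply: (near2 N1 N2) => -[s t] /= [[U1 U2] [U3 [U4 U5]]] tm.
rewrite ltr_norml in tm; case/andP: tm => tm1 tm2; have cks := ck s.
have chs := ht_continuous (@ces s).
have hs1 : ht (e s) t1 < c by apply: U4; rewrite lexx.
have hs2 : ht (e s) t2 < c by apply: U5; rewrite lexx.
have [t1t tt2 tu tv] : [/\ t1 <= t, t <= t2, u + del <= t & t <= v - del].
  exact: margin_itv u1 v2 (ltW del0) del3 del4 (ltW tm1) (ltW tm2).
have [u' [/andP[u'1 u'2] hu' u'E]] := excursion_left chs (ltW hs1) t1t.
have [v' [/andP[v'1 v'2] hv' v'E]] := excursion_right chs (ltW hs2) tt2.
have u'u : u' < u + del.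
  rewrite ltNge; apply/negP => uu; have : c < g (s, u').
    by apply: U3; rewrite uu /= (le_trans u'2).
  by rewrite /g /= ltNge hu'.
have vv' : v - del < v'.
  rewrite ltNge; apply/negP => vv; have : c < g (s, v').
    by apply: U3; rewrite vv andbT (le_trans _ v'1).
  by rewrite /g /= ltNge hv'.
have b1 : below (e s) t1 u'.
  by move=> x /andP[x1 x2]; apply: U1; rewrite x1 (le_trans x2) // ltW.
have b2 : below (e s) v' t2.
  by move=> x /andP[x1 x2]; apply: U2; rewrite x2 andbT (le_trans _ x1) // ltW.
have ttv : u' <= t <= v' by rewrite u'2.
have -> : rd (f (s, t)) c = (Q s u' v', (run s t - run s u', run s v' - run s t)).
  exact: (ck_rd cks).
have u't2 : u' <= t2 by exact: le_trans tt2.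
have u'v' : u' <= v' by exact: le_trans v'1.
have g2 : ht (e s) t2 < 1 by exact: lt_trans c1.
have gu' : ht (e s) u' < 1 by exact: le_lt_trans c1.
rewrite (ck_below_l cks u'1 u't2 b1 g2) (ck_below_r cks u'v' v'2 b2 gu').
by rewrite -(ck_below_run cks u'1 b1) -(ck_below_run cks v'2 b2).
Qed.

Let good (s0 : 'rV[R]_n) (t : R) := \forall s \near s0, continuous_at s (fun s => Q s 0 t) /\
  continuous_at s (fun s => run s t).

Let near_flat (s0 : 'rV[R]_n) (T : R) : ht (e s0) T = 0 -> exists2 r : R, 0 < r &
  \forall s \near s0, forall t, `|t - T| < r -> ht (e s) t < 1.
Proof.
move=> hT; have [r r0 rE] := ht_near0 (@ces s0) hT; exists (r / 2); first lra.
have := @tube_lt R _ g s0 (T - r / 2) (T + r / 2) 1 cg.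
have Hb (t : R) : T - r / 2 <= t <= T + r / 2 -> g (s0, t) < 1.
  by move=> /andP[? ?]; apply: rE; rewrite /= ltr_distl; apply/andP; split; lra.
move=> /(_ Hb); apply: filterS => s Hs t; rewrite ltr_norml => /andP[? ?].
by apply: (Hs t); apply/andP; split; lra.
Qed.

(** [zero_induction] along the zeros of the height of [e s0]: [near_flat] carries continuity from a
    zero to the zeros close to it, and [reading_near] carries it across an excursion. [start] begins
    the induction. *)
Let good_zero (s0 : 'rV[R]_n) (t : R) : 0 <= t <= 1 -> ht (e s0) t = 0 -> good s0 t.
Proof.
have h00 s : ht (e s) 0 < 1 by rewrite (ck_h0 (ck s)).
apply: (zero_induction (ht_continuous (@ces s0)) (@ht_ge0 R h H (e s0)) (ck_h0 (ck s0)) (ck_h1 (ck s0))).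
- have c1 : continuous (fun s => Q s 0 0).
    apply: (eq_cont (g := fun=> Q s0 0 0)); last by move=> s; ct.
    move=> s; have g0 s' : ht (e s') 0 <= 0 < (1 : R) by rewrite (ck_h0 (ck s')) lexx ltr01.
    have := ck_gap (ck s) (g0 s); rewrite (start s s0 : e s (proj_unit 0) = e s0 (proj_unit 0)).
    by rewrite (ck_gap (ck s0) (g0 s0)) => -[].
  have c2 : continuous (fun s => run s 0).
    by apply: (eq_cont (g := fun=> 0)) => [s|s]; [rewrite (ck_run0 (ck s))|ct].
  by apply: (filterS _ filterT) => s _; split; [exact: c1|exact: c2].
- move=> T T01 hT; have [r r0 rE] := near_flat hT; exists r => //.
  move=> t1 t2 /andP[t10 t11] /andP[t20 t21] h1 h2 r1 r2 gt1.
  have eqs : \forall s \near s0, Q s 0 t1 = Q s 0 t2 /\ run s t1 = run s t2.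
    apply: filterS rE => s sE; have cks := ck s.
    have [t12|/ltW t12] := leP t1 t2.
      have b := near_below sE r1 r2.
      by rewrite (ck_below_r cks t10 t12 b (h00 s)) (ck_below_run cks t12 b).
    have b := near_below sE r2 r1.
    by rewrite (ck_below_r cks t20 t12 b (h00 s)) (ck_below_run cks t12 b).
  have e1 : \forall s \near s0, Q s 0 t1 = Q s 0 t2 by apply: filterS eqs => s [].
  have e2 : \forall s \near s0, run s t1 = run s t2 by apply: filterS eqs => s [].
  have g1 : \forall s \near s0, continuous_at s (fun s => Q s 0 t1) by apply: filterS gt1 => s [].
  have g2 : \forall s \near s0, continuous_at s (fun s => run s t1) by apply: filterS gt1 => s [].
  exact: filterI (near_cont_eq e1 g1) (near_cont_eq e2 g2).
- move=> t1 t2 t10 t12 t21 h1 h2 pos gt1; pose m : R := (t1 + t2) / 2.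
  have m12 : t1 < m < t2 by rewrite /m; apply/andP; split; lra.
  have [c [rE rC]] := reading_near t10 m12 t21 h1 h2 pos.
  have cm : continuous (fun s : 'rV[R]_n => (s, m)) by ct.
  have rE' := near_slice rE; have rC' := near_slice rC.
  have cr : \forall s \near s0, continuous_at s (fun s => rd (f (s, m)) c).
    by apply: filterS rC' => s cs; exact: (comp_cont_at (@cm s) cs).
  have g1 : \forall s \near s0, continuous_at s (fun s => Q s 0 t1) by apply: filterS gt1 => s [].
  have cQ : \forall s \near s0, continuous_at s (fun s => Q s t1 t2).
    apply: (@near_cont_eq _ _ (fun s => (rd (f (s, m)) c).1)).
      by apply: filterS rE' => s ->.
    by apply: filterS cr => s cs; exact: (@ct_fst _ _ (label H) _ _ cs).
  have T1 : \forall s \near s0, forall t, t1 <= t <= t1 -> g (s, t) < 1.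
    by apply: tube_lt => // x; rewrite -eq_le => /eqP <-; rewrite /g h1.
  have T2 : \forall s \near s0, forall t, t2 <= t <= t2 -> g (s, t) < 1.
    by apply: tube_lt => // x; rewrite -eq_le => /eqP <-; rewrite /g h2.
  have q1 : \forall s \near s0, continuous_at s (fun s => Q s 0 t2).
    apply: (near_cont_eq _ (lmul_near_cont (@rV_delta R n) g1 cQ)).
    apply: filterS (filterI T1 T2) => s [T1s T2s]; apply/esym/(ck_coc (ck s)) => //.
    + exact: ltW.
    + by apply: T1s; rewrite lexx.
    + by apply: T2s; rewrite lexx.
  have r1 : \forall s \near s0, continuous_at s (fun s => run s t2).
    apply: (@near_cont_eq _ _ (fun s => run s t1 + (rd (f (s, m)) c).2.1 + (rd (f (s, m)) c).2.2)).
      by apply: filterS rE' => s -> /=; lra.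
    apply: filterS (filterI gt1 cr) => s [[_ c1] c2].
    by ct.
  exact: filterI q1 r1.
Qed.

Lemma label_plot_continuous : continuous (fun s => Q s 0 1).
Proof.
move=> s0; have t1 : 0 <= (1 : R) <= 1 by rewrite ler01 lexx.
by have [] := nbhs_singleton (good_zero t1 (ck_h1 (ck s0))).
Qed.

(** Near a zero of the height the clock does not depend on the time. Inside an excursion it is its
    value at the start of the excursion plus the first length of a reading. *)
Lemma run_plot_continuous : continuous (fun z : 'rV[R]_n * I => run z.1 (set_val z.2)).
Proof.
suff cr (s0 : 'rV[R]_n) (t : R) : 0 <= t <= 1 -> continuous_at (s0, t) (fun z : 'rV[R]_n * R => run z.1 z.2).
  move=> [s0 t]; apply: (@comp_cont_at _ _ _ (fun z : 'rV[R]_n * I => (z.1, set_val z.2))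
    (fun z : 'rV[R]_n * R => run z.1 z.2)); first by ct.
  exact: cr (itv01P t).
move=> t01; have [z0|nz] := eqVneq (ht (e s0) t) 0.
  have [_ c1] := nbhs_singleton (good_zero t01 z0); have [r r0 rE] := near_flat z0.
  apply: (@eq_near_continuous _ _ (fun z : 'rV[R]_n * R => run z.1 t)).
    have N1 := near_fst t rE.
    have N2 : \forall z \near (s0, t), `|z.2 - t| < r.
      have := @snd_continuous 'rV[R]_n R (s0, t) [set t' | `|t' - t| < r]; apply.
      by apply/nbhs_ballP; exists r => //= t'; rewrite /ball /= distrC.
    apply: (near2 N1 N2) => -[s t'] /= sE t't.
    have tt : `|t - t| < r by rewrite subrr normr0.
    have [tt'|/ltW tt'] := leP t t'.
      exact: (ck_below_run (ck s) tt' (near_below sE tt t't)).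
    exact/esym/(ck_below_run (ck s) tt' (near_below sE t't tt)).
  by apply: (@comp_cont_at _ _ _ fst (fun s => run s t)) => //; exact: cvg_fst.
have hp : 0 < ht (e s0) t by rewrite lt_neqAle eq_sym nz ht_ge0.
have [t1 [t2 [/andP[t10 t1t] /andP[tt2 t21] h1 h2 [p1 p2]]]] :=
  ck_exc (@ces s0) (ck s0) (lexx 0) t01.
have z1 : ht (e s0) t1 = 0 by apply/eqP; rewrite eq_le h1 ht_ge0.
have z2 : ht (e s0) t2 = 0 by apply/eqP; rewrite eq_le h2 ht_ge0.
have lt1 : t1 < t by rewrite lt_neqAle t1t andbT; apply/eqP => tE; rewrite -tE z1 ltxx in hp.
have lt2 : t < t2 by rewrite lt_neqAle tt2 andbT; apply/eqP => tE; rewrite tE z2 ltxx in hp.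
have pos s : t1 < s < t2 -> 0 < ht (e s0) s.
  move=> /andP[s1 s2]; have [st|ts] := leP s t; first by apply: p1; rewrite s1.
  by apply: p2; rewrite s2 (ltW ts).
have m12 : t1 < t < t2 by rewrite lt1.
have [c [rE rC]] := reading_near t10 m12 t21 z1 z2 pos.
have t101 : 0 <= t1 <= 1 by rewrite t10; lra.
have [_ c1] := nbhs_singleton (good_zero t101 z1).
apply: (@eq_near_continuous _ _ (fun z : 'rV[R]_n * R => run z.1 t1 + (rd (f z) c).2.1)).
  by apply: filterS rE => z -> /=; lra.
have c2 : continuous_at (s0, t) (fun z : 'rV[R]_n * R => run z.1 t1).
  by apply: (@comp_cont_at _ _ _ fst (fun s => run s t1)) => //; exact: cvg_fst.
have c3 := nbhs_singleton rC.
by ct.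
Qed.

End ClockedPlots.

(** * The multipointed d-space E(H) *)

Section ReadingPaths.
Variables (R : realType) (h : bool) (H : flow R h).
Local Notation I := (unit_interval R).
Local Notation E := (rpoint H).

Lemma rstate_subproof (a : fstate H) :
  rpoint_spec (0 : R, fun c => if 0 <= c < 1 then (lunit a, (0, 0)) else rnone H).
Proof.
split=> /= [|c /negbTE -> //|c]; first by rewrite lexx ler01.
have [c0|c0] := ltP c 0.
  exists (- c) => [|c' /andP[? ?]]; first lra.
  by rewrite !ifF //; apply/negbTE/negP => /andP[? ?]; lra.
have [c1|c1] := ltP c 1.
  exists (1 - c) => [|c' /andP[? ?]]; first lra.
  by rewrite ifT //; apply/andP; split; lra.
exists 1 => // c' /andP[? ?].
by rewrite !ifF //; apply/negbTE/negP => /andP[? ?]; lra.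
Qed.

Definition rstate (a : fstate H) : E := exist _ _ (rstate_subproof a).

Lemma rstate_inj : injective rstate.
Proof.
move=> a b /(congr1 (fun p => rd p 0)); rewrite /rd /= lexx ltr01 /=.
by move=> -[].
Qed.

Lemma ht0_rstate (e : I -> E) t a : ht e t = 0 ->
  (forall c, 0 <= c < 1 -> rd (e (proj_unit t)) c = (lunit a, (0, 0))) ->
  e (proj_unit t) = rstate a.
Proof.
move=> h0 rE; apply: rpoint_eq; first exact: h0.
by move=> c c01; rewrite rE // /rd /= c01.
Qed.

Lemma clocked_state (e : I -> E) Q run t : clocked e Q run -> ht e t = 0 ->
  exists2 a, e (proj_unit t) = rstate a & Q t t = lunit a.
Proof.
move=> ck h0; have h1 : ht e t < 1 by rewrite h0 ltr01.
have [a qa] := ck_unit ck h1; exists a => //; apply: ht0_rstate => // c c01.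
by rewrite (ck_gap ck) ?qa // h0.
Qed.

Lemma clocked_start (e : I -> E) Q run : clocked e Q run ->
  exists2 a, e i0 = rstate a & Q 0 0 = lunit a.
Proof. by move=> ck; have := clocked_state ck (ck_h0 ck). Qed.

Lemma clocked_end (e : I -> E) Q run : clocked e Q run ->
  exists2 a, e i1 = rstate a & Q 1 1 = lunit a.
Proof. by move=> ck; have := clocked_state ck (ck_h1 ck). Qed.

Definition rtime (phi : I -> I) (t : R) : R := set_val (phi (proj_unit t)).

Lemma clmono (s t : R) : s <= t -> cl s <= cl t.
Proof.
move=> st; rewrite /cl ge_max le_max lexx /= le_max; apply/orP; right.
by rewrite le_min !ge_min lexx st !orbT.
Qed.

Lemma set_val_proj_unit (t : R) : set_val (proj_unit t : I) = cl t.
Proof. by []. Qed.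

Section RTime.
Variables (phi : I -> I) (rphi : reparametrization phi).

Lemma rtime_mono s t : s <= t -> rtime phi s <= rtime phi t.
Proof. by move=> st; apply: rphi.1; rewrite !set_val_proj_unit; exact: clmono. Qed.

Lemma rtime0 : rtime phi 0 = 0.
Proof. by rewrite /rtime reparam0 // set_val_i0. Qed.

Lemma rtime1 : rtime phi 1 = 1.
Proof. by rewrite /rtime reparam1 // set_val_i1. Qed.

Lemma rtime_sur t t' s : t <= t' -> rtime phi t <= s <= rtime phi t' ->
  exists2 s', t <= s' <= t' & rtime phi s' = s.
Proof.
move=> tt' /andP[ts st']; have s01 : 0 <= s <= 1.
  rewrite (le_trans _ ts) ?(le_trans st') //; first by have /andP[] := itv01P (phi (proj_unit t')).
  by have /andP[] := itv01P (phi (proj_unit t)).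
have [x px] := rphi.2 (proj_unit s).
have xs : rtime phi (set_val x) = s by rewrite /rtime set_valK01 px proj_unitK.
have [xt|tx] := ltP (set_val x) t.
  exists t; first by rewrite lexx.
  by apply/eqP; rewrite eq_le ts -{1}xs rtime_mono // ltW.
have [t'x|xt'] := ltP t' (set_val x).
  exists t'; first by rewrite lexx andbT.
  by apply/eqP; rewrite eq_le st' andbT -{1}xs rtime_mono // ltW.
by exists (set_val x) => //; rewrite tx.
Qed.

Lemma rtimeE T (e : I -> T) t : e (phi (proj_unit t)) = e (proj_unit (rtime phi t)).
Proof. by rewrite /rtime set_valK01. Qed.

Lemma ht_reparam (e : I -> E) t : ht (e \o phi) t = ht e (rtime phi t).
Proof. by rewrite /ht /= (rtimeE e). Qed.

Lemma clocked_reparam (e : I -> E) Q run : clocked e Q run ->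
  clocked (e \o phi) (fun t t' => Q (rtime phi t) (rtime phi t')) (fun t => run (rtime phi t)).
Proof.
move=> ck; have m := rtime_mono.
have bl t t' : t <= t' -> below (e \o phi) t t' <-> below e (rtime phi t) (rtime phi t').
  move=> tt'; split=> b s st; last first.
    rewrite ht_reparam; apply: b; case/andP: st => ts st; by rewrite !m.
  by have [s' s't <-] := rtime_sur tt' st; rewrite -ht_reparam; exact: b.
split.
- by rewrite ht_reparam rtime0 (ck_h0 ck).
- by rewrite ht_reparam rtime1 (ck_h1 ck).
- by move=> t t' t'' ? ?; rewrite !ht_reparam; apply: (ck_coc ck); exact: m.
- by move=> t t' ?; rewrite !ht_reparam; apply: (ck_ne0 ck); exact: m.
- by move=> t; rewrite ht_reparam; exact: (ck_unit ck).
- by move=> t t' ?; apply: (ck_mono ck); exact: m.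
- by move=> t t' tt' /(bl _ _ tt'); apply: (ck_stop ck); exact: m.
- move=> t t' tt'; rewrite !ht_reparam => h1 h2 r; apply/(bl _ _ tt').
  by apply: (ck_go ck) => //; exact: m.
- by rewrite rtime0 (ck_run0 ck).
- by rewrite rtime0 rtime1; exact: (ck_arrow ck).
- move=> c t1 t t2 c01 /andP[t1t tt2]; rewrite !ht_reparam => h1 h2 p1 p2.
  rewrite /= (rtimeE e); apply: (ck_rd ck) => //.
  + by rewrite !m.
  + move=> s /andP[s1 s2]; have [|s' /andP[s'1 s'2] sE] := @rtime_sur t1 t s t1t.
      by rewrite (ltW s1).
    rewrite -sE -ht_reparam; apply: p1; rewrite s'2 andbT lt_neqAle s'1 andbT.
    by apply/eqP => E1; rewrite -sE -E1 ltxx in s1.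
  + move=> s /andP[s1 s2]; have [|s' /andP[s'1 s'2] sE] := @rtime_sur t t2 s tt2.
      by rewrite s1 ltW.
    rewrite -sE -ht_reparam; apply: p2; rewrite s'1 lt_neqAle s'2 andbT.
    by apply/eqP => E1; rewrite -sE E1 ltxx in s2.
Qed.

End RTime.

Section Ncomp.
Variables (T : Type) (g1 g2 : I -> T).
Hypothesis g12 : g1 i1 = g2 i0.

Lemma ncomp_projl (t : R) : t <= 2^-1 -> ncomp g1 g2 (proj_unit t) = g1 (proj_unit (2 * t)).
Proof.
move=> t2; have [t0|t0] := leP t 0.
  by rewrite proj_unit_le0 // ncomp0 proj_unit_le0 //; lra.
have tE : set_val (proj_unit t : I) = t by rewrite proj_unitK //; apply/andP; split; lra.
by rewrite ncompl tE.
Qed.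

Lemma ncomp_projr (t : R) : 2^-1 <= t -> ncomp g1 g2 (proj_unit t) = g2 (proj_unit (2 * t - 1)).
Proof.
move=> t2; have [t1|t1] := leP 1 t.
  by rewrite proj_unit_ge1 // ncomp1 proj_unit_ge1 //; lra.
have tE : set_val (proj_unit t : I) = t by rewrite proj_unitK //; apply/andP; split; lra.
by rewrite ncompr // tE.
Qed.

End Ncomp.

Definition run_cat (run1 run2 : R -> R) (t : R) : R :=
  if t <= 2^-1 then run1 (2 * t) else run1 1 + run2 (2 * t - 1).

Definition label_cat (Q1 Q2 : R -> R -> label H) (t t' : R) : label H :=
  if t' <= 2^-1 then Q1 (2 * t) (2 * t')
  else if t <= 2^-1 then lmul (Q1 (2 * t) 1) (Q2 0 (2 * t' - 1))
  else Q2 (2 * t - 1) (2 * t' - 1).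

(** The height vanishes at the junction, so no excursion crosses time 1/2 and every reading comes
    from [e1] or from [e2]; the common state there keeps products of labels nonzero. *)
Lemma clocked_ncomp (e1 e2 : I -> E) Q1 run1 Q2 run2 : e1 i1 = e2 i0 ->
  clocked e1 Q1 run1 -> clocked e2 Q2 run2 ->
  clocked (ncomp e1 e2) (label_cat Q1 Q2) (run_cat run1 run2).
Proof.
move=> e12 c1 c2.
have [a e1a q1a] := clocked_end c1; have [a' e2a q2a'] := clocked_start c2.
have q2a : Q2 0 0 = lunit a by rewrite q2a'; congr lunit; apply: rstate_inj; rewrite -e2a -e12.
have hl t : t <= 2^-1 -> ht (ncomp e1 e2) t = ht e1 (2 * t).
  by move=> tt; rewrite /ht ncomp_projl.
have hr t : 2^-1 <= t -> ht (ncomp e1 e2) t = ht e2 (2 * t - 1).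
  by move=> tt; rewrite /ht ncomp_projr.
have h11 : ht e1 1 < 1 by rewrite (ck_h1 c1).
have h20 : ht e2 0 < 1 by rewrite (ck_h0 c2).
have bl t t' : t' <= 2^-1 -> below (ncomp e1 e2) t t' <-> below e1 (2 * t) (2 * t').
  move=> t'2; split=> b s /andP[? ?].
    have -> : s = 2 * (s / 2) by lra.
    by rewrite -hl; [apply: b; apply/andP; split; lra|lra].
  by rewrite hl; [apply: b; apply/andP; split; lra|lra].
have br t t' : 2^-1 <= t -> below (ncomp e1 e2) t t' <-> below e2 (2 * t - 1) (2 * t' - 1).
  move=> t'2; split=> b s /andP[? ?].
    have -> : s = 2 * ((s + 1) / 2) - 1 by lra.
    by rewrite -hr; [apply: b; apply/andP; split; lra|lra].
  by rewrite hr; [apply: b; apply/andP; split; lra|lra].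
have bm t t' : t <= 2^-1 -> 2^-1 <= t' -> below (ncomp e1 e2) t t' <->
    below e1 (2 * t) 1 /\ below e2 0 (2 * t' - 1).
  move=> t2 t'2; split=> [b|[b1 b2] s /andP[? ?]].
    split=> s /andP[? ?].
      have -> : s = 2 * (s / 2) by lra.
      by rewrite -hl; [apply: b; apply/andP; split; lra|lra].
    have -> : s = 2 * ((s + 1) / 2) - 1 by lra.
    by rewrite -hr; [apply: b; apply/andP; split; lra|lra].
  have [s2|s2] := leP s 2^-1.
    by rewrite hl //; apply: b1; apply/andP; split; lra.
  by rewrite hr ?(ltW s2) //; apply: b2; apply/andP; split; lra.
have u1 t : t <= 1 -> ht e1 t < 1 -> lmul (Q1 t 1) (lunit a) = Q1 t 1.
  by move=> t1 ht1; rewrite -q1a -(ck_coc c1 t1 (lexx 1)).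
have u2 t : 0 <= t -> ht e2 t < 1 -> lmul (lunit a) (Q2 0 t) = Q2 0 t.
  by move=> t0 ht0; rewrite -q2a -(ck_coc c2 (lexx 0) t0).
have hm : ht (ncomp e1 e2) 2^-1 = 0.
  by rewrite hl // mulfV ?pnatr_eq0 // (ck_h1 c1).
split.
- by rewrite hl ?mulr0 ?(ck_h0 c1) // invr_ge0.
- rewrite hr; last lra.
  have -> : (2 : R) * 1 - 1 = 1 by lra.
  exact: (ck_h1 c2).
- move=> t t' t'' tt' tt'' ht1 ht2 ht3; rewrite /label_cat.
  have [t''2|t''2] := leP t'' 2^-1.
    have t'2 : t' <= 2^-1 by lra.
    have t2 : t <= 2^-1 by lra.
    rewrite ifT //; rewrite !hl // in ht1 ht2 ht3; apply: (ck_coc c1) => //; lra.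
  have [t'2|t'2] := leP t' 2^-1.
    have t2 : t <= 2^-1 by lra.
    rewrite t2 -lmulA; rewrite !hl // in ht1 ht2.
    by rewrite -(ck_coc c1) //; lra.
  rewrite hr in ht2; last lra.
  rewrite hr in ht3; last lra.
  have [t2|t2] := leP t 2^-1.
    by rewrite lmulA -(ck_coc c2) //; lra.
  rewrite hr in ht1; last lra.
  apply: (ck_coc c2) => //; lra.
- move=> t t' tt' ht1 ht2; rewrite /label_cat.
  have [t'2|t'2] := leP t' 2^-1.
    have t2 : t <= 2^-1 by lra.
    by rewrite !hl // in ht1 ht2; apply: (ck_ne0 c1) => //; lra.
  rewrite hr in ht2; last lra.
  have [t2|t2] := leP t 2^-1.
    rewrite hl // in ht1; apply: (@lmul_unit_ne0 _ _ _ _ _ a).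
      by rewrite u1 //; [apply: (ck_ne0 c1) => //|]; lra.
    by rewrite u2 //; [apply: (ck_ne0 c2) => //|]; lra.
  by rewrite hr in ht1; [apply: (ck_ne0 c2) => //|]; lra.
- move=> t ht1; rewrite /label_cat; have [t2|t2] := leP t 2^-1.
    by rewrite hl // in ht1; exact: (ck_unit c1).
  by rewrite hr in ht1; [exact: (ck_unit c2)|lra].
- move=> t t' tt'; rewrite /run_cat; have [t'2|t'2] := leP t' 2^-1.
    by rewrite ifT; [apply: (ck_mono c1)|]; lra.
  have [t2|t2] := leP t 2^-1.
    have m1 : run1 (2 * t) <= run1 1 by apply: (ck_mono c1); lra.
    have m2 : run2 0 <= run2 (2 * t' - 1) by apply: (ck_mono c2); lra.
    by rewrite (ck_run0 c2) in m2; lra.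
  by rewrite lerD2l; apply: (ck_mono c2); lra.
- move=> t t' tt' b; rewrite /run_cat /label_cat; have [t'2|t'2] := leP t' 2^-1.
    have t2 : t <= 2^-1 by lra.
    by rewrite t2; apply: (ck_stop c1); [lra|apply/bl].
  have [t2|t2] := leP t 2^-1.
    have [b1 b2] : below e1 (2 * t) 1 /\ below e2 0 (2 * t' - 1) by apply/bm => //; lra.
    have l1 : 2 * t <= 1 by lra.
    have l2 : 0 <= 2 * t' - 1 by lra.
    have [r1 q1] := ck_stop c1 l1 b1; have [r2 q2] := ck_stop c2 l2 b2.
    rewrite r1 -r2 (ck_run0 c2) addr0 q2 q2a; split => //.
    by rewrite u1 //; apply: b1; rewrite lexx.
  by have [-> ->] : run2 (2 * t - 1) = run2 (2 * t' - 1) /\ Q2 (2 * t - 1) (2 * t' - 1) = Q2 (2 * t - 1) (2 * t - 1)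
    by apply: (ck_stop c2); [lra|apply/br => //; exact: ltW].
- move=> t t' tt' ht1 ht2; rewrite /run_cat; have [t'2|t'2] := leP t' 2^-1.
    have t2 : t <= 2^-1 by lra.
    rewrite t2 => r; apply/bl => //; rewrite !hl // in ht1 ht2.
    by apply: (ck_go c1) => //; lra.
  rewrite hr in ht2; last lra.
  have [t2|t2] := leP t 2^-1.
    rewrite hl // in ht1.
    have m1 : run1 (2 * t) <= run1 1 by apply: (ck_mono c1); lra.
    have m2 : run2 0 <= run2 (2 * t' - 1) by apply: (ck_mono c2); lra.
    have r0 := ck_run0 c2.
    move=> r; apply/bm => //; first exact: ltW.
    by split; [apply: (ck_go c1) => //; lra|apply: (ck_go c2) => //; lra].
  rewrite hr in ht1; last lra.
  move=> /addrI r; apply/br; first exact: ltW.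
  by apply: (ck_go c2) => //; lra.
- by rewrite /run_cat ifT ?mulr0 ?(ck_run0 c1) // invr_ge0.
- rewrite /label_cat ifF; last by apply/negbTE; rewrite -ltNge; lra.
  rewrite ifT ?invr_ge0 // mulr0; have -> : (2 : R) * 1 - 1 = 1 by lra.
  have ne : lmul (Q1 0 1) (Q2 0 1) <> lzero H.
    apply: (@lmul_unit_ne0 _ _ _ _ _ a).
      by rewrite u1 ?ler01 //; [apply: (ck_ne0 c1); rewrite ?ler01 //|]; rewrite (ck_h0 c1).
    by rewrite u2 ?ler01 //; [apply: (ck_ne0 c2); rewrite ?ler01 //|]; rewrite (ck_h1 c2).
  have [x [y [p pE]]] := ck_arrow c1; have [x' [y' [p' pE']]] := ck_arrow c2.
  rewrite pE pE' in ne *; have Hs := lmulP ne; move: ne Hs.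
  case: (lmul _ _) => // [c|c d q] _ Hs; first by inversion Hs.
  by exists c, d, q.
- move=> c t1 t t2 /[dup] c01 /andP[c0 _] /andP[t1t tt2] h1 h2 p1 p2.
  rewrite /label_cat /run_cat; have [t_2|t_2] := leP t 2^-1.
    have t22 : t2 <= 2^-1.
      rewrite leNgt; apply/negP => t22; have : c < ht (ncomp e1 e2) 2^-1.
        by apply: p2; rewrite t_2.
      by rewrite hm; lra.
    have t12 : t1 <= 2^-1 by lra.
    rewrite t22 t12 ncomp_projl //; apply: (ck_rd c1) => //.
    + by apply/andP; split; lra.
    + by rewrite -hl.
    + by rewrite -hl.
    + move=> s /andP[? ?]; have -> : s = 2 * (s / 2) by lra.
      by rewrite -hl; [apply: p1; apply/andP; split; lra|lra].
    + move=> s /andP[? ?]; have -> : s = 2 * (s / 2) by lra.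
      by rewrite -hl; [apply: p2; apply/andP; split; lra|lra].
  have t12 : 2^-1 <= t1.
    rewrite leNgt; apply/negP => t12; have : c < ht (ncomp e1 e2) 2^-1.
      by apply: p1; rewrite t12 ltW.
    by rewrite hm; lra.
  have t22 : 2^-1 < t2 by lra.
  rewrite [t2 <= _]leNgt t22 /= ncomp_projr //; last exact: ltW.
  have main Q' run' t1' : (Q' = Q2 (2 * t1 - 1) (2 * t2 - 1)) -> (run' = run1 1 + run2 (2 * t1 - 1)) ->
      t1' = 2 * t1 - 1 ->
      rd (e2 (proj_unit (2 * t - 1))) c =
      (Q', (run1 1 + run2 (2 * t - 1) - run', run1 1 + run2 (2 * t2 - 1) - (run1 1 + run2 (2 * t - 1)))).
    move=> -> -> _; have -> : rd (e2 (proj_unit (2 * t - 1))) c = (Q2 (2 * t1 - 1) (2 * t2 - 1),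
       (run2 (2 * t - 1) - run2 (2 * t1 - 1), run2 (2 * t2 - 1) - run2 (2 * t - 1))).
      apply: (ck_rd c2) => //.
      + by apply/andP; split; lra.
      + by rewrite -hr.
      + by rewrite -hr // ltW.
      + move=> s /andP[? ?]; have -> : s = 2 * ((s + 1) / 2) - 1 by lra.
        by rewrite -hr; [apply: p1; apply/andP; split; lra|lra].
      + move=> s /andP[? ?]; have -> : s = 2 * ((s + 1) / 2) - 1 by lra.
        by rewrite -hr; [apply: p2; apply/andP; split; lra|lra].
    by congr (_, (_, _)); lra.
  (* An excursion of [e2] may start at the junction itself, and [t1 = 2^-1] falls into the first
     branch of [label_cat] and [run_cat]. *)
  have [t12'|t12'] := leP t1 2^-1; last exact: main.
  have t1E : t1 = 2^-1 by apply/eqP; rewrite eq_le t12 t12'.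
  have e11 : 2 * t1 = 1 by rewrite t1E; lra.
  have e10 : 2 * t1 - 1 = 0 by rewrite t1E; lra.
  apply: main => //.
  + rewrite e10 e11 q1a u2 //; first lra.
    by have := h2; rewrite hr ?(ltW t22) // => h2'; case/andP: c01 => ? ?; lra.
  + by rewrite e10 e11 (ck_run0 c2) addr0.
Qed.

Definition rspace : space R h := Space (rpoint_in_Top H).

Definition emd : mdspace R h.
Proof.
refine (@MdSpace R h rspace (range rstate) (@rexec R h H) _ _ _ _ _).
- by move=> g [].
- by move=> g [_ [Q [run ck]]]; have [a -> _] := clocked_start ck; exists a.
- by move=> g [_ [Q [run ck]]]; have [a -> _] := clocked_end ck; exists a.
- move=> g phi [cg [Q [run ck]]] rphi; split.
    exact: (comp_continuous (reparam_continuous rphi) cg).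
  by exists (fun t t' => Q (rtime phi t) (rtime phi t')), (fun t => run (rtime phi t));
    exact: clocked_reparam.
- move=> g1 g2 [cg1 [Q1 [run1 c1]]] [cg2 [Q2 [run2 c2]]] g12; split.
    exact: ncomp_continuous.
  by exists (label_cat Q1 Q2), (run_cat run1 run2); exact: clocked_ncomp.
Defined.

End ReadingPaths.

(** * Deformation of the execution paths of E(H) *)

Section FullReadings.
Variables (R : realType) (h : bool) (H : flow R h) (n : nat).
Local Notation I := (unit_interval R).
Local Notation E := (rpoint H).

(** Full lengths mean that the excursion above [c1] around [t0] contains all the clock time, so that
    the height is below 1 outside it. Both facts persist nearby by compactness. This meets the
    hypothesis of [readable_rlift]. *)
Lemma full_near (e : 'rV[R]_n -> I -> E) Q run (s0 : 'rV[R]_n) (t0 c1 : R) :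
  continuous (fun z : 'rV[R]_n * I => e z.1 z.2) ->
  (forall s, clocked (e s) (Q s) (run s)) -> 0 <= t0 <= 1 -> 0 <= c1 < 1 ->
  (rd (e s0 (proj_unit t0)) c1).2 = (run s0 t0, run s0 1 - run s0 t0) ->
  \forall z \near (s0, t0), forall c, 0 <= c <= c1 ->
    rd (e z.1 (proj_unit z.2)) c = (Q z.1 0 1, (run z.1 z.2, run z.1 1 - run z.1 z.2)).
Proof.
move=> ce ck t001 c101 full; have /andP[c10 c11] := c101.
pose g (z : 'rV[R]_n * R) : R := ht (e z.1) z.2.
have cg : continuous g.
  have ch : continuous (fun z : 'rV[R]_n * R => (z.1, proj_unit z.2)) by ct.
  exact: (comp_continuous (comp_continuous ch ce) (@hgt_continuous R h H)).
have ces s : continuous (e s).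
  have ch : continuous (fun t : I => (s, t)) by ct.
  exact: (comp_continuous ch ce).
have ck0 := ck s0; have cs0 := @ces s0.
have [u [v [/andP[u0 ut] /andP[tv v1] hu hv [uE vE]]]] := ck_exc cs0 ck0 c10 t001.
have uv : u <= t0 <= v by rewrite ut.
move: full; rewrite (ck_rd ck0 c101 uv hu hv uE vE) /= => -[ru rv].
have ru0 : run s0 0 = run s0 u.
  by rewrite (ck_run0 ck0); apply/esym/eqP; rewrite -oppr_eq0 -(inj_eq (addrI (run s0 t0))) ru addr0.
have rv1 : run s0 v = run s0 1 by move/addIr: rv.
have hu1 : ht (e s0) u < 1 by exact: le_lt_trans c11.
have hv1 : ht (e s0) v < 1 by exact: le_lt_trans c11.
have h0 : ht (e s0) 0 < 1 by rewrite (ck_h0 ck0).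
have h1 : ht (e s0) 1 < 1 by rewrite (ck_h1 ck0).
have bu := ck_go ck0 u0 h0 hu1 ru0; have bv := ck_go ck0 v1 hv1 h1 rv1.
have ht0 : c1 < ht (e s0) t0.
  rewrite ltNge; apply/negP => htc.
  have ut' : u = t0.
    by apply/eqP; rewrite eq_le ut leNgt; apply/negP => lt; have := uE t0; rewrite lt lexx ltNge htc => /(_ isT).
  have vt' : v = t0.
    by apply/eqP; rewrite eq_le tv andbT leNgt; apply/negP => lt; have := vE t0; rewrite lt lexx ltNge htc => /(_ isT).
  have := ck_len ck0; rewrite -rv1 vt' -ut' -ru0 (ck_run0 ck0) ltxx.
  by [].
have ut' : u < t0.
  by rewrite lt_neqAle ut andbT; apply/eqP => um; move: hu; rewrite um leNgt ht0.
have tv' : t0 < v.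
  by rewrite lt_neqAle tv andbT; apply/eqP => um; move: hv; rewrite -um leNgt ht0.
have ch := ht_continuous cs0.
have [ru1 ru10 ru1E] := near_lt ch hu1; have [rv1' rv10 rv1E] := near_lt ch hv1.
have [del [del0 del1 del2 del3 del4]] := common_margin ru10 rv10 ut' tv'.
have T1 : \forall s \near s0, forall t, 0 <= t <= u + del -> g (s, t) < 1.
  apply: tube_lt => // t /andP[ta tb]; have [tu|u't] := leP t u; first by apply: bu; rewrite ta.
  apply: ru1E; rewrite /= ltr_distl; apply: (@dist_margin _ _ _ del) => //.
  by rewrite tb andbT (le_trans _ (ltW u't)) // gerBl ltW.
have T2 : \forall s \near s0, forall t, v - del <= t <= 1 -> g (s, t) < 1.
  apply: tube_lt => // t /andP[ta tb]; have [vt|t'v] := leP v t; first by apply: bv; rewrite vt.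
  apply: rv1E; rewrite /= ltr_distl; apply: (@dist_margin _ _ _ del) => //.
  by rewrite ta (le_trans (ltW t'v)) // lerDl ltW.
have T3 : \forall s \near s0, forall t, u + del <= t <= v - del -> c1 < g (s, t).
  apply: tube_gt => // t /andP[ta tb]; have [tm|mt] := leP t t0.
    by apply: uE; rewrite /= tm andbT (lt_le_trans _ ta) // ltrDl.
  by apply: vE; rewrite /= (ltW mt) (le_lt_trans tb) // gtrBl.
have N1 := near_fst t0 (nearI T1 (nearI T2 T3)).
have N2 : \forall z \near (s0, t0), `|z.2 - t0| < del.
  have := @snd_continuous 'rV[R]_n R (s0, t0) [set t | `|t - t0| < del]; apply.
  apply/nbhs_ballP; exists del => //=.
  by move=> t; rewrite /ball /= distrC.
apply: (near2 N1 N2) => -[s t] /= [U1 [U2 U3]] tm c /andP[c0 cc1].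
rewrite ltr_norml in tm; case/andP: tm => tm1 tm2; have cks := ck s; have css := @ces s.
have [t0t tt1 tu t_v] := margin_itv u0 v1 (ltW del0) del3 del4 (ltW tm1) (ltW tm2).
have t01 : 0 <= t <= 1 by rewrite t0t.
have [u' [v' [/andP[u'0 u't] /andP[tv'' v'1] hu' hv' [u'E v'E]]]] := ck_exc css cks c0 t01.
have u'u : u' < u + del.
  rewrite ltNge; apply/negP => uu; have : c1 < g (s, u').
    by apply: U3; rewrite uu /= (le_trans u't).
  by rewrite /g /= ltNge (le_trans hu').
have vv' : v - del < v'.
  rewrite ltNge; apply/negP => vv; have : c1 < g (s, v').
    by apply: U3; rewrite vv andbT (le_trans _ tv'').
  by rewrite /g /= ltNge (le_trans hv').
have b1 : below (e s) 0 u'.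
  by move=> x /andP[x1 x2]; apply: U1; rewrite x1 (le_trans x2) // ltW.
have b2 : below (e s) v' 1.
  by move=> x /andP[x1 x2]; apply: U2; rewrite x2 andbT (le_trans _ x1) // ltW.
have ttv : u' <= t <= v' by rewrite u't.
have c01 : 0 <= c < 1 by rewrite c0 (le_lt_trans cc1).
rewrite (ck_rd cks c01 ttv hu' hv' u'E v'E).
have u'1 : u' <= 1 by exact: le_trans tt1.
have u'v' : u' <= v' by exact: le_trans tv''.
have g2 : ht (e s) 1 < 1 by rewrite (ck_h1 cks).
have gu' : ht (e s) u' < 1 by case/andP: c01 => _; exact: le_lt_trans.
rewrite (ck_below_l cks u'0 u'1 b1 g2) (ck_below_r cks u'v' v'1 b2 gu').
by rewrite -(ck_below_run cks u'0 b1) (ck_run0 cks) subr0 (ck_below_run cks v'1 b2).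
Qed.

End FullReadings.

(** * The standard height profile and its clock *)

Section Profile.
Variable R : realType.

(** A trapezoid with its plateau on the middle third; the clock [tau] runs exactly there, as [ck_go]
    and [ck_stop] demand. *)
Definition hstd (t : R) : R := cl (Order.min (3 * t) (3 - 3 * t)).
Definition tau (t : R) : R := cl (3 * t - 1).

Lemma hstd_itv t : 0 <= hstd t <= 1. Proof. exact: cl_itv. Qed.

Lemma hstd_continuous : continuous hstd.
Proof. by have c := @cl_continuous R; rewrite /hstd; ct. Qed.

Lemma tau_continuous : continuous tau.
Proof. by have c := @cl_continuous R; rewrite /tau; ct. Qed.

Lemma hstd_mono s t : s <= t -> t <= 2^-1 -> hstd s <= hstd t.
Proof.
move=> st t2; apply: clmono; rewrite le_min !ge_min.
by apply/andP; split; apply/orP; left; lra.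
Qed.

Lemma hstd_anti s t : s <= t -> 2^-1 <= s -> hstd t <= hstd s.
Proof.
move=> st t2; apply: clmono; rewrite le_min !ge_min.
by apply/andP; split; apply/orP; right; lra.
Qed.

Lemma hstd_mid t : 3^-1 <= t <= 2 / 3 -> hstd t = 1.
Proof.
by move=> /andP[? ?]; apply: cl_ge1; rewrite le_min; apply/andP; split; lra.
Qed.

Lemma hstd_le0 t : t <= 0 -> hstd t = 0.
Proof. by move=> t0; apply: cl_le0; rewrite ge_min; apply/orP; left; lra. Qed.

Lemma hstd_ge1 t : 1 <= t -> hstd t = 0.
Proof. by move=> t0; apply: cl_le0; rewrite ge_min; apply/orP; right; lra. Qed.

Lemma hstd_lt1 t : hstd t < 1 -> t < 3^-1 \/ 2 / 3 < t.
Proof.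
move=> t1; have [?|?] := ltP t 3^-1; first by left.
by right; rewrite ltNge; apply/negP => ?; rewrite hstd_mid ?ltxx // in t1; apply/andP.
Qed.

Lemma hstd_small t : t < 3^-1 \/ 2 / 3 < t -> hstd t < 1.
Proof.
move=> t1; rewrite /hstd /cl gt_max ltr01 /= gt_min; apply/orP; right; rewrite gt_min.
by apply/orP; case: t1 => ?; [left|right]; lra.
Qed.

Lemma hstd_pos t : 0 < hstd t -> 0 < t < 1.
Proof.
move=> t0; rewrite !ltNge -negb_or; apply/negP => /orP[?|?].
  by rewrite hstd_le0 // ltxx in t0.
by rewrite hstd_ge1 // ltxx in t0.
Qed.

Lemma hstd_cl t : hstd (cl t) = hstd t.
Proof.
have [t0|t0] := leP t 0; first by rewrite (cl_le0 t0) !hstd_le0.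
have [t1|t1] := leP 1 t; first by rewrite (cl_ge1 t1) !hstd_ge1.
by rewrite cl_id // (ltW t0) ltW.
Qed.

Lemma hstd_left s t : s <= t -> hstd s < hstd t -> s < 3^-1.
Proof.
move=> st; apply: contraPT; rewrite -leNgt => s3; apply/negP; rewrite -leNgt.
have [s2|s2] := leP s (2 / 3).
  by rewrite (@hstd_mid s) ?s3 //; case/andP: (hstd_itv t).
by apply: hstd_anti => //; lra.
Qed.

Lemma hstd_right s t : t <= s -> hstd s < hstd t -> 2 / 3 < s.
Proof.
move=> st; apply: contraPT; rewrite -leNgt => s3; apply/negP; rewrite -leNgt.
have [s2|s2] := leP 3^-1 s.
  by rewrite (@hstd_mid s) ?s2 //; case/andP: (hstd_itv t).
by apply: hstd_mono => //; lra.
Qed.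

Lemma tau_l t : t <= 3^-1 -> tau t = 0. Proof. by move=> ?; apply: cl_le0; lra. Qed.
Lemma tau_r t : 2 / 3 <= t -> tau t = 1. Proof. by move=> ?; apply: cl_ge1; lra. Qed.
Lemma tau_mono s t : s <= t -> tau s <= tau t. Proof. by move=> ?; apply: clmono; lra. Qed.

End Profile.

Section Lift.
Variables (R : realType) (h : bool) (H : flow R h).
Local Notation I := (unit_interval R).
Local Notation E := (rpoint H).

Lemma rlift_subproof (p : E) (b : R) (r : reading H) :
  rpoint_spec (Order.max (hgt p) (cl b), fun c => if 0 <= c < cl b then r else rd p c).
Proof.
have /andP[b0 b1] := cl_itv b; have /andP[p0 p1] := hgt_itv p; split=> /=.
- by rewrite le_max p0 ge_max p1 b1.
- move=> c nc; rewrite ifF ?rd_out //; apply: contraNF nc => /andP[-> /lt_le_trans]; exact.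
- move=> c; have [e e0 eE] := rd_right p c; have [c0|c0] := ltP c 0.
    exists (Order.min e (- c)) => [|c' /andP[c1 c2]]; first by rewrite lt_min e0 oppr_gt0.
    have [? ?] : c' < c + e /\ c' < 0.
      by move: c2; rewrite -ltrBlDl lt_min => /andP[? ?]; split; lra.
    have n1 : (0 <= c' < cl b) = false by apply/negbTE/negP => /andP[? ?]; lra.
    have n2 : (0 <= c < cl b) = false by apply/negbTE/negP => /andP[? ?]; lra.
    by rewrite n1 ?n2 /=; apply: eE; rewrite c1.
  have [cb|bc] := ltP c (cl b).
    exists (cl b - c) => [|c' /andP[c1 c2]]; first by rewrite subr_gt0.
    by rewrite ifT //; apply/andP; split; lra.
  exists e => // c' /andP[c1 c2]; rewrite ifF; first by apply: eE; rewrite c1.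
  by apply/negbTE; rewrite negb_and -!leNgt (le_trans bc) // orbT.
Qed.

(** Floods [p] up to height [b]: the levels below [b] receive [r], in applications the reading of
    the whole path. *)
Definition rlift (p : E) (b : R) (r : reading H) : E := exist _ _ (rlift_subproof p b r).

Lemma hgt_rlift p b r : hgt (rlift p b r) = Order.max (hgt p) (cl b).
Proof. by []. Qed.
Lemma rd_rlift p b r c : rd (rlift p b r) c = if 0 <= c < cl b then r else rd p c.
Proof. by []. Qed.

Lemma rlift0 p b r : b <= 0 -> rlift p b r = p.
Proof.
move=> b0; apply: rpoint_eq => [|c /andP[c0 _]].
  by rewrite hgt_rlift (cl_le0 b0) max_l //; case/andP: (hgt_itv p).
by rewrite rd_rlift (cl_le0 b0) [c < 0]ltNge c0.
Qed.

(** Only the level [cl (b z0)] itself is delicate. If it is regular, the lengths of [p z0] and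
    [r z0] agree at it, and the last hypothesis says that [p] then reads [r] nearby up to a higher
    level, so that the two sides match. *)
Lemma readable_rlift (T : topologicalType) (p : T -> E) (b : T -> R) (r : T -> reading H) :
  continuous p -> continuous b ->
  continuous (r : T -> (label H * (R * R))%type) ->
  (forall z0, 0 < cl (b z0) < 1 -> (rd (p z0) (cl (b z0))).2 = (r z0).2 ->
    exists2 c1 : R, cl (b z0) < c1 &
      \forall z \near z0, forall c, 0 <= c <= c1 -> rd (p z) c = r z) ->
  readable (fun z => rlift (p z) (b z) (r z)).
Proof.
move=> cp cb cr full; have ccl := @cl_continuous R; have [chp rp] := continuous_readable cp.
have cB : continuous (fun z => cl (b z)) by ct.
split; first by rewrite /hgt /=; ct.
move=> z0 c /andP[c0 c1] [e e0 eE]; set B := fun z => cl (b z).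
have [cb0|bc|cE] := ltgtP c (B z0).
- pose m := (c + B z0) / 2; have cm : c < m by rewrite /m; lra.
  have mB : \forall z \near z0, m < B z.
    by apply: (cB z0 [set v | m < v]); apply: open_nbhs_nbhs; split; [exact: open_gt|change (m < B z0); rewrite /m; lra].
  have rE z c' : m < B z -> `|c' - c| < Order.min c (m - c) -> rd (rlift (p z) (b z) (r z)) c' = r z.
    rewrite lt_min ltr_distl => mz /andP[/andP[x1 x2]]; rewrite ltr_distl => /andP[x3 x4].
    by rewrite rd_rlift ifT //; apply/andP; split; [lra|apply: lt_trans mz; lra].
  have cc : `|c - c| < Order.min c (m - c) by rewrite subrr normr0 lt_min c0 subr_gt0.
  split.
    apply: filterS mB => z mz; exists (Order.min c (m - c)); first by rewrite lt_min c0 subr_gt0.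
    by move=> c' c'c; rewrite !(rE z).
  apply: (@eq_near_continuous _ _ (r : T -> (label H * (R * R))%type)); last exact: cr.
  by apply: filterS mB => z mz; rewrite (rE z).
- pose m := (c + B z0) / 2; have mc : m < c by rewrite /m; lra.
  have mB : \forall z \near z0, B z < m.
    by apply: (cB z0 [set v | v < m]); apply: lt_nbhsl; change (B z0 < m); rewrite /m; lra.
  have rE z c' : B z < m -> `|c' - c| < c - m -> rd (rlift (p z) (b z) (r z)) c' = rd (p z) c'.
    move=> mz; rewrite ltr_distl => /andP[x1 x2].
    rewrite rd_rlift ifF //; apply/negbTE; rewrite negb_and -!leNgt; apply/orP; right.
    by apply: ltW; apply: lt_trans mz _; lra.
  have cc : `|c - c| < c - m by rewrite subrr normr0 subr_gt0.
  have reg : regular (p z0) c.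
    exists (Order.min e (c - m)); first by rewrite lt_min e0 subr_gt0.
    move=> c'; rewrite lt_min => /andP[c'e c'm]; have := eE _ c'e.
    by rewrite !rE // (nbhs_singleton mB).
  have c01 : 0 < c < 1 by rewrite c0.
  have [nr crd] := rp _ _ c01 reg; split.
    apply: filterS (filterI mB nr) => z [mz [e' e'0 e'E]].
    exists (Order.min e' (c - m)); first by rewrite lt_min e'0 subr_gt0.
    by move=> c'; rewrite lt_min => /andP[c'e c'm]; rewrite !(rE z) // e'E.
  apply: (@eq_near_continuous _ _ (fun z => rd (p z) c : (label H * (R * R))%type)); last exact: crd.
  by apply: filterS mB => z mz; rewrite (rE z).
- have B01 : 0 < B z0 < 1 by rewrite -cE c0.
  (* A level just below [c] reads [r] and the level [c] reads [p]; regularity equates their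
     lengths. *)
  have [c' c'0 c'c] : exists2 c' : R, `|c' - c| < e & 0 <= c' < c.
    exists (c - Order.min e c / 2).
      rewrite addrAC subrr sub0r normrN gtr0_norm ?divr_gt0 ?lt_min ?e0 //.
      by rewrite ltr_pdivrMr // gt_min; apply/orP; left; lra.
    have m0 : 0 < Order.min e c by rewrite lt_min e0.
    have mc : Order.min e c <= c by rewrite ge_min lexx orbT.
    by apply/andP; split; lra.
  have := eE _ c'0; rewrite !rd_rlift -/(B z0) -cE c'c ltxx andbF => rE.
  have [|d cd dE] := full z0 B01; first by rewrite -/(B z0) -cE rE.
  rewrite -/(B z0) -cE in cd.
  have gE z c'' : (forall c, 0 <= c <= d -> rd (p z) c = r z) -> `|c'' - c| < Order.min c (d - c) ->
      rd (rlift (p z) (b z) (r z)) c'' = r z.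
    rewrite lt_min ltr_distl => H1 /andP[/andP[x1 x2]]; rewrite ltr_distl => /andP[x3 x4].
    by rewrite rd_rlift; case: ifP => // _; apply: H1; apply/andP; split; lra.
  have cc : `|c - c| < Order.min c (d - c) by rewrite subrr normr0 lt_min c0 subr_gt0.
  split.
    apply: filterS dE => z zE; exists (Order.min c (d - c)); first by rewrite lt_min c0 subr_gt0.
    by move=> c'' c''c; rewrite !(gE z).
  apply: (@eq_near_continuous _ _ (r : T -> (label H * (R * R))%type)); last exact: cr.
  by apply: filterS dE => z zE; rewrite (gE z).
Qed.

End Lift.

Section ClockedLift.
Variables (R : realType) (h : bool) (H : flow R h).
Local Notation I := (unit_interval R).
Local Notation E := (rpoint H).
Variables (e : I -> E) (Q : R -> R -> label H) (run : R -> R) (sg u : R).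
Hypotheses (ce : continuous e) (ck : clocked e Q run).
Hypotheses (sg01 : 0 <= sg <= 1) (u01 : 0 <= u <= 1) (usg : u = 0 \/ sg = 1).
Hypothesis flat : sg = 0 \/ forall t, t <= 3^-1 \/ 2 / 3 <= t -> ht e t = 0.

Definition mixrun (t : R) : R := (1 - u) * run t + u * tau t.

Definition raised (t : I) : E :=
  rlift (e t) (sg * hstd (set_val t)) (Q 0 1, (mixrun (set_val t), mixrun 1 - mixrun (set_val t))).

Let b (t : R) : R := sg * hstd t.

Let b_itv t : 0 <= b t <= 1.
Proof.
have /andP[s0 s1] := sg01; have /andP[t0 t1] := hstd_itv t.
by rewrite mulr_ge0 //= mulr_ile1.
Qed.

Let htE t : ht raised t = Order.max (ht e t) (b t).
Proof. by rewrite /ht hgt_rlift set_val_proj_unit hstd_cl cl_id // b_itv. Qed.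

Let gap t : ht raised t < 1 -> ht e t < 1 /\ b t < 1.
Proof. by rewrite htE gt_max => /andP[]. Qed.

Let below_raised t t' : below raised t t' -> below e t t'.
Proof. by move=> bl s /bl /gap[]. Qed.

Let runl t : sg <> 0 -> t <= 3^-1 -> run t = 0.
Proof.
case: flat => // fl _ t3; rewrite -(ck_run0 ck).
have bl s s' : s' <= 3^-1 -> below e s s'.
  by move=> s'3 x /andP[_ xs']; rewrite fl ?ltr01 //; left; exact: le_trans s'3.
have [t0|/ltW t0] := leP t 0; first by apply: (ck_below_run ck t0); apply: bl; rewrite invr_ge0.
by apply/esym/(ck_below_run ck t0); exact: bl.
Qed.

Let runr t : sg <> 0 -> 2 / 3 <= t -> run t = run 1.
Proof.
case: flat => // fl _ t3.
have bl s s' : 2 / 3 <= s -> below e s s'.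
  by move=> s3 x /andP[xs _]; rewrite fl ?ltr01 //; right; exact: le_trans xs.
have [t1|/ltW t1] := leP t 1; first by apply: (ck_below_run ck t1); exact: bl.
by apply/esym/(ck_below_run ck t1); apply: bl; lra.
Qed.

Lemma mixrun_len : 0 < mixrun 1.
Proof.
rewrite /mixrun tau_r; last lra.
have L := ck_len ck; have /andP[u0 u1] := u01; rewrite mulr1.
have [->|un] := eqVneq u 0; first by rewrite subr0 mul1r addr0.
by rewrite ltr_wpDl ?lt_neqAle ?u0 ?andbT 1?eq_sym // mulr_ge0 ?subr_ge0 // ltW.
Qed.

Let sides t : sg = 1 -> ht raised t < 1 -> t < 3^-1 \/ 2 / 3 < t.
Proof. by move=> s1 /gap[_]; rewrite /b s1 mul1r => /hstd_lt1. Qed.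

Let mixl t : sg <> 0 -> t <= 3^-1 -> mixrun t = 0.
Proof. by move=> s0 t3; rewrite /mixrun runl // tau_l // !mulr0 addr0. Qed.

Let mixr t : sg <> 0 -> 2 / 3 <= t -> mixrun t = mixrun 1.
Proof. by move=> s0 t3; rewrite /mixrun runr // !tau_r //; lra. Qed.

Let third : (3^-1 : R) <= 2 / 3. Proof. lra. Qed.

(** If the profile exceeds [c] at [t], the excursion covers the middle third, outside of which [e]
    has height 0 by [flat], so the reading is that of the whole path. Otherwise the excursion is one
    of [e] or is reduced to a point. By [usg] the clock is modified only once the profile is
    complete. *)
Lemma clocked_raised : clocked raised Q mixrun.
Proof.
have /andP[s0 s1] := sg01; have /andP[u0 u1] := u01.
have one0 : (1 : R) <> 0 by apply/eqP; rewrite oner_eq0.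
split.
- by rewrite htE (ck_h0 ck) /b hstd_le0 // mulr0 maxxx.
- by rewrite htE (ck_h1 ck) /b hstd_ge1 // mulr0 maxxx.
- by move=> t t' t'' tt' tt'' /gap[? _] /gap[? _] /gap[? _]; exact: (ck_coc ck).
- by move=> t t' tt' /gap[? _] /gap[? _]; exact: (ck_ne0 ck).
- by move=> t /gap[? _]; exact: (ck_unit ck).
- move=> t t' tt'; rewrite /mixrun lerD //; apply: ler_wpM2l; rewrite ?subr_ge0 //.
    exact: (ck_mono ck).
  exact: tau_mono.
- move=> t t' tt' bl; have [r q] := ck_stop ck tt' (below_raised bl); split => //.
  rewrite /mixrun r; case: usg => [->|sg1]; first by rewrite !mul0r.
  have gt : ht raised t < 1 by apply: bl; rewrite lexx.
  have [t3|t3] := sides sg1 gt; last first.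
    by rewrite !tau_r ?(le_trans _ tt') ?(ltW t3).
  have t'3 : t' < 3^-1.
    rewrite ltNge; apply/negP => t'3; have g3 : ht raised 3^-1 < 1.
      by apply: bl; rewrite (ltW t3).
    by have [] := sides sg1 g3; rewrite ?ltxx // ltNge third.
  by rewrite !tau_l // ltW.
- move=> t t' tt' g1 g2; have [sg1|sg1] := eqVneq sg 1.
    have sn0 : sg <> 0 by rewrite sg1.
    have fl : forall t, t <= 3^-1 \/ 2 / 3 <= t -> ht e t = 0 by case: flat.
    have flt s : s < 3^-1 \/ 2 / 3 < s -> ht raised s < 1.
      move=> s3; rewrite htE gt_max fl ?ltr01 /b ?sg1 ?mul1r ?hstd_small //.
      by case: s3 => /ltW ?; [left|right].
    have [t3|t3] := sides sg1 g1; last first.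
      by move=> _ s /andP[ts _]; apply: flt; right; exact: lt_le_trans ts.
    have [t'3|t'3] := sides sg1 g2.
      by move=> _ s /andP[_ ts]; apply: flt; left; exact: le_lt_trans t'3.
    rewrite (mixl sn0 (ltW t3)) (mixr sn0 (ltW t'3)) => L0.
    by have := mixrun_len; rewrite -L0 ltxx.
  case: usg sg1 => [u_0 sg1|->]; last by rewrite eqxx.
  rewrite /mixrun u_0 subr0 !mul1r !mul0r !addr0 => r s st.
  have [g1' _] := gap g1; have [g2' _] := gap g2.
  rewrite htE gt_max (ck_go ck tt' g1' g2' r) //= /b.
  have : sg * hstd s <= sg by rewrite ler_piMr //; case/andP: (hstd_itv s).
  by move=> /le_lt_trans; apply; rewrite lt_neqAle sg1.
- by rewrite /mixrun (ck_run0 ck) tau_l ?mulr0 ?addr0 // invr_ge0.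
- exact: (ck_arrow ck).
- move=> c t1 t t2 /andP[c0 c1] /andP[t1t tt2] h1 h2 p1 p2.
  have le_b s : b s <= ht raised s by rewrite htE le_max lexx orbT.
  have le_e s : ht e s <= ht raised s by rewrite htE le_max lexx.
  rewrite /raised rd_rlift set_val_proj_unit hstd_cl cl_id ?b_itv // c0 /=.
  case: ifPn => [cb|]; last first.
    rewrite -leNgt => bc.
    (* A positive height of [e] at [t] forces [t] into the middle third when [sg] is nonzero. The
       profile has its maximum [sg] there, so [b t <= c] keeps it below [c] everywhere. *)
    have inner : c < ht raised t -> forall s, c < ht raised s -> c < ht e s.
      move=> ct s; rewrite !htE !lt_max => /orP[//|cs].
      have [s00|s00] := eqVneq sg 0; first by move: cs; rewrite /b s00 mul0r ltNge c0.
      have fl : forall t, t <= 3^-1 \/ 2 / 3 <= t -> ht e t = 0 by case: flat s00 => [->|//]; rewrite eqxx.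
      have ct' : c < ht e t by move: ct; rewrite htE lt_max => /orP[//|]; rewrite ltNge bc.
      have tm : 3^-1 <= t <= 2 / 3.
        rewrite !leNgt -negb_or; apply/negP => /orP[] /ltW t3; move: ct'; rewrite fl ?ltNge ?c0 //.
          by left.
        by right.
      have : sg <= c by move: bc; rewrite /b hstd_mid // mulr1.
      have : b s <= sg by rewrite /b ler_piMr //; case/andP: (hstd_itv s).
      by move=> x1 x2; move: cs; rewrite ltNge (le_trans x1).
    have E1 : rd (e (proj_unit t)) c = (Q t1 t2, (run t - run t1, run t2 - run t)).
      apply: (ck_rd ck); rewrite ?c0 ?t1t ?(le_trans (le_e _)) //.
      + move=> s st; have ct : c < ht raised t.
          by apply: p1; rewrite lexx andbT; case/andP: st => /lt_le_trans; apply.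
        by apply: (inner ct); exact: p1.
      + move=> s st; have ct : c < ht raised t.
          by apply: p2; rewrite lexx /=; case/andP: st; exact: le_lt_trans.
        by apply: (inner ct); exact: p2.
    rewrite E1 /mixrun; case: usg => [->|sg1]; first by rewrite subr0 !mul1r !mul0r !addr0.
    have ht3 : hstd t < 1 by move: bc; rewrite /b sg1 mul1r => /le_lt_trans; apply.
    have htc : ht raised t <= c.
      rewrite htE ge_max bc andbT; have sn0 : sg <> 0 by rewrite sg1.
      case: flat => // -> //; by case: (hstd_lt1 ht3) => /ltW ?; [left|right].
    have t1E : t1 = t.
      apply/eqP; rewrite eq_le t1t leNgt; apply/negP => lt; have := p1 t.
      by rewrite lt lexx ltNge htc => /(_ isT).
    have t2E : t2 = t.
      apply/eqP; rewrite eq_le tt2 andbT leNgt; apply/negP => lt; have := p2 t.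
      by rewrite lt lexx ltNge htc => /(_ isT).
    by rewrite t1E t2E !subrr.
  have sgp : 0 < sg.
    by rewrite lt_neqAle s0 andbT eq_sym; apply/eqP => sgE; move: cb; rewrite /b sgE mul0r ltNge c0.
  have sn0 : sg <> 0 by apply/eqP; rewrite gt_eqF.
  have ht_0 : 0 < hstd t by move: cb => /(le_lt_trans c0); rewrite /b pmulr_rgt0.
  have /andP[t0 t_1] := hstd_pos ht_0; rewrite (@cl_id _ t) ?(ltW t0) ?(ltW t_1) //.
  have h1b : hstd t1 < hstd t by rewrite -(ltr_pM2l sgp) (le_lt_trans (le_trans (le_b t1) h1)).
  have h2b : hstd t2 < hstd t by rewrite -(ltr_pM2l sgp) (le_lt_trans (le_trans (le_b t2) h2)).
  have t13 := hstd_left t1t h1b; have t23 := hstd_right tt2 h2b.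
  have t10 : 0 <= t1.
    rewrite leNgt; apply/negP => lt; have := p1 0; rewrite lt (ltW t0) htE (ck_h0 ck).
    by rewrite /b hstd_le0 // mulr0 maxxx ltNge c0 => /(_ isT).
  have t21 : t2 <= 1.
    rewrite leNgt; apply/negP => lt; have := p2 1; rewrite lt (ltW t_1) htE (ck_h1 ck).
    by rewrite /b hstd_ge1 // mulr0 maxxx ltNge c0 => /(_ isT).
  have fl : forall t, t <= 3^-1 \/ 2 / 3 <= t -> ht e t = 0 by case: flat.
  have b1 : below e 0 t1.
    by move=> s /andP[_ st]; rewrite fl ?ltr01 //; left; rewrite (le_trans st) // ltW.
  have b2 : below e t2 1.
    by move=> s /andP[st _]; rewrite fl ?ltr01 //; right; rewrite (le_trans _ st) // ltW.
  have t1t2 : t1 <= t2 by exact: le_trans tt2.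
  have g1 : ht e 1 < 1 by rewrite (ck_h1 ck).
  have g2 : ht e t1 < 1 by rewrite fl ?ltr01 //; left; exact: ltW.
  rewrite (ck_below_l ck t10 (le_trans t1t2 t21) b1 g1) (ck_below_r ck t1t2 t21 b2 g2).
  by rewrite (mixl sn0 (ltW t13)) subr0 (mixr sn0 (ltW t23)).
Qed.

End ClockedLift.

Section Edges.
Variables (R : realType) (h : bool) (H : flow R h).
Local Notation I := (unit_interval R).
Local Notation E := (rpoint H).
Variables a b : fstate H.

(** The base state is switched at time 1/2, at height 1, where every level reads [r] and the switch
    is invisible. *)
Definition edge (p : fpath a b) (t : I) : E :=
  let r := (larrow p, (tau (set_val t), 1 - tau (set_val t))) in
  if set_val t <= 2^-1 then rlift (rstate a) (hstd (set_val t)) r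
  else rlift (rstate b) (hstd (set_val t)) r.

Lemma edge_cat (p : fpath a b) t : edge p t =
  rlift (rstate (if set_val t <= 2^-1 then a else b)) (hstd (set_val t))
    (larrow p, (tau (set_val t), 1 - tau (set_val t))).
Proof. by rewrite /edge; case: ifP. Qed.

Lemma rd_rstate (x : fstate H) c : 0 <= c < 1 -> rd (rstate x) c = (lunit x, (0, 0)).
Proof. by move=> c01; rewrite /rd /= c01. Qed.

Lemma edge_plot_continuous (S : topologicalType) (p : S -> fpath a b) :
  delta_generated R (S * I)%type -> continuous p ->
  continuous (fun z : S * I => edge (p z.1) z.2).
Proof.
move=> dS cp; have ct1 := @tau_continuous R; have ch := @hstd_continuous R.
have cl1 := comp_continuous (comp_continuous (@fst_continuous S I) cp) (@larrow_continuous R h H a b).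
have cr : continuous (fun z : S * I => (larrow (p z.1), (tau (set_val z.2), 1 - tau (set_val z.2)))).
  by apply: pair_continuous; [exact: cl1|ct].
have main x : continuous (fun z : S * I => rlift (rstate x) (hstd (set_val z.2))
    (larrow (p z.1), (tau (set_val z.2), 1 - tau (set_val z.2)))).
  apply: readable_continuous => //; apply: readable_rlift => //.
  - by move=> z; ct.
  - by ct.
  - move=> z /andP[c0 c1]; rewrite rd_rstate ?(ltW c0) //= => -[x1 x2].
    by exfalso; lra.
apply: (@paste R _ _ (fun z : S * I => set_val z.2) 2^-1).
- by ct.
- by move=> z _; exact: main.
- by move=> z _; exact: main.
- move=> z z2; have hm : hstd (set_val z.2) = 1 by rewrite z2 hstd_mid //; apply/andP; split; lra.
  apply: rpoint_eq => [|c c01].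
    by rewrite !hgt_rlift.
  by rewrite !rd_rlift hm cl_ge1 // c01.
Qed.

Lemma edge_start (p : fpath a b) : edge p i0 = rstate a.
Proof. by rewrite /edge set_val_i0 ifT ?invr_ge0 // rlift0 // hstd_le0. Qed.

Lemma edge_end (p : fpath a b) : edge p i1 = rstate b.
Proof.
rewrite /edge set_val_i1 ifF; last by apply/negbTE; rewrite -ltNge; lra.
by rewrite rlift0 // hstd_ge1.
Qed.

Definition edge_label (p : fpath a b) (t t' : R) : label H :=
  if t' <= 2^-1 then lunit a else if t <= 2^-1 then larrow p else lunit b.

Lemma clocked_edge (p : fpath a b) : clocked (edge p) (edge_label p) (@tau R).
Proof.
have hE t : ht (edge p) t = hstd t.
  rewrite /ht edge_cat hgt_rlift set_val_proj_unit hstd_cl /hgt /= cl_id ?hstd_itv //.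
  by rewrite max_r //; case/andP: (hstd_itv t).
have sideE t t' : t <= t' -> below (edge p) t t' -> t' < 3^-1 \/ 2 / 3 < t.
  move=> tt' bl; have gt : hstd t < 1 by rewrite -hE; apply: bl; rewrite lexx.
  have [t3|t3] := hstd_lt1 gt; last by right.
  left; rewrite ltNge; apply/negP => t'3; have : ht (edge p) 3^-1 < 1.
    by apply: bl; rewrite (ltW t3).
  by rewrite hE hstd_mid ?ltxx // lexx /=; lra.
have q2 : (2^-1 : R) < 2 / 3 by lra.
have q3 : (3^-1 : R) < 2^-1 by lra.
split.
- by rewrite hE hstd_le0.
- by rewrite hE hstd_ge1.
- move=> t t' t'' tt' tt'' _ _ _; rewrite /edge_label.
  have [t''2|t''2] := leP t'' 2^-1.
    by rewrite (le_trans tt'') // lmulE.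
  have [t'2|t'2] := leP t' 2^-1; first by rewrite (le_trans tt') // lmulE.
  by case: ifP => _; rewrite lmulE.
- by move=> t t' _ _ _; rewrite /edge_label; do 2!case: ifP => // _.
- by move=> t _; rewrite /edge_label; have [t2|t2] := leP t 2^-1; [exists a|exists b].
- exact: tau_mono.
- move=> t t' tt' bl; rewrite /edge_label; have [t'3|t3] := sideE _ _ tt' bl.
    have t3 := le_lt_trans tt' t'3.
    by rewrite !tau_l ?(ltW t'3) ?(ltW t3) // !ifT // ltW // (lt_trans _ q3).
  have t'3 := lt_le_trans t3 tt'.
  rewrite !tau_r ?(ltW t'3) ?(ltW t3) // ![_ <= 2^-1]leNgt (lt_trans q2 t3).
  by rewrite (lt_trans q2 t'3).
- move=> t t' tt'; rewrite !hE => /hstd_lt1 h1 /hstd_lt1 h2 r s /andP[ts st]; rewrite hE.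
  apply: hstd_small; case: h1 => t3; last by right; exact: lt_le_trans ts.
  case: h2 => t'3; first by left; exact: le_lt_trans t'3.
  by move: r; rewrite tau_l ?(ltW t3) // tau_r ?(ltW t'3) // => /esym/eqP; rewrite oner_eq0.
- by rewrite tau_l // invr_ge0.
- exists a, b, p; rewrite /edge_label ifF ?ifT ?invr_ge0 //.
  by apply/negbTE; rewrite -ltNge; lra.
- move=> c t1 t t2 /andP[c0 c1] /andP[t1t tt2]; rewrite !hE => h1 h2 p1 p2.
  rewrite edge_cat rd_rlift set_val_proj_unit hstd_cl cl_id ?hstd_itv // c0 /=.
  case: ifPn => [ct|]; last first.
    rewrite -leNgt => tc; have t1E : t1 = t.
      apply/eqP; rewrite eq_le t1t leNgt; apply/negP => lt; have := p1 t.
      by rewrite lt lexx hE ltNge tc => /(_ isT).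
    have t2E : t2 = t.
      apply/eqP; rewrite eq_le tt2 andbT leNgt; apply/negP => lt; have := p2 t.
      by rewrite lt lexx hE ltNge tc => /(_ isT).
    rewrite t1E t2E !subrr rd_rstate ?c0 // /edge_label.
    have clt : (cl t <= 2^-1) = (t <= 2^-1).
      have [t0|t0] := leP t 0; first by rewrite (cl_le0 t0) invr_ge0 ler0n; apply/esym; lra.
      have [t_1|t_1] := leP 1 t; last by rewrite cl_id // (ltW t0) ltW.
      by rewrite (cl_ge1 t_1); apply/idP/idP => ?; exfalso; lra.
    by rewrite clt; case: ifP.
  have /andP[t0 t_1] := hstd_pos (le_lt_trans c0 ct).
  have t13 := hstd_left t1t (le_lt_trans h1 ct); have t23 := hstd_right tt2 (le_lt_trans h2 ct).
  rewrite (@cl_id _ t) ?(ltW t0) ?(ltW t_1) // (tau_l (ltW t13)) (tau_r (ltW t23)) subr0.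
  rewrite /edge_label ifF ?ifT //; first by rewrite ltW // (lt_trans t13).
  by apply/negbTE; rewrite -ltNge (lt_trans q2).
Qed.

End Edges.

(** * Straightening of execution paths *)

Section Straighten.
Variables (R : realType) (h : bool) (H : flow R h).
Local Notation I := (unit_interval R).
Local Notation E := (rpoint H).

(** Chosen by [xget] among all clocked data; [ck_label_unique] makes the choice irrelevant, and
    [ck_run_unique] does the same for [rclock] on the unit interval. *)
Definition rlabel (e : I -> E) : label H :=
  xget (lzero H) [set q | exists Q run, clocked e Q run /\ q = Q 0 1].

Definition rclock (e : I -> E) (t : R) : R :=
  xget 0 [set r | exists Q run, clocked e Q run /\ r = run t].

Lemma rlabelE e Q run : continuous e -> clocked e Q run -> rlabel e = Q 0 1.
Proof.
move=> ce ck; rewrite /rlabel; have [|Q' [run' [ck' ->]]] := @xgetPex _ (lzero H)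
    [set q | exists Q run, clocked e Q run /\ q = Q 0 1].
  by exists (Q 0 1), Q, run.
exact: (ck_label_unique ce ck' ck).
Qed.

Lemma rclockE e Q run t : continuous e -> clocked e Q run -> 0 <= t <= 1 -> rclock e t = run t.
Proof.
move=> ce ck t01; rewrite /rclock; have [|Q' [run' [ck' ->]]] := @xgetPex _ (0 : R)
    [set r | exists Q run, clocked e Q run /\ r = run t].
  by exists (run t), Q, run.
exact: (ck_run_unique ce ck' ck).
Qed.

(** A pause of length [v / (1 + 2 * v)] at each end; for [v = 1] the motion takes place in the
    middle third, under the plateau of [hstd]. *)
Definition slow (v : R) (t : I) : I := proj_unit ((1 + 2 * v) * set_val t - v).

Lemma slow_reparam v : 0 <= v <= 1 -> reparametrization (slow v).
Proof.
move=> /andP[v0 v1]; have v2 : 0 < 1 + 2 * v by lra.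
split=> [s t st|t].
  by rewrite !set_val_proj_unit; apply: clmono; rewrite lerD2r ler_pM2l.
have [t0 t1] := unit_le t.
have s01 : 0 <= (set_val t + v) / (1 + 2 * v) <= 1.
  rewrite divr_ge0 ?(ltW v2) ?addr_ge0 //= ler_pdivrMr // mul1r; lra.
exists (proj_unit ((set_val t + v) / (1 + 2 * v))).
rewrite /slow proj_unitK // mulrC divfK ?gt_eqF // addrK; exact: set_valK01.
Qed.

Lemma slow_eq v t : (1 + 2 * v) * set_val t - v = set_val t -> slow v t = t.
Proof. by rewrite /slow => ->; exact: set_valK01. Qed.

Lemma slow0 t : slow 0 t = t. Proof. by apply: slow_eq; lra. Qed.

Lemma slow_i0 v : 0 <= v -> slow v i0 = i0.
Proof. by move=> v0; rewrite /slow set_val_i0 proj_unit_le0 //; lra. Qed.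

Lemma slow_i1 v : 0 <= v -> slow v i1 = i1.
Proof. by move=> v0; rewrite /slow set_val_i1 proj_unit_ge1 //; lra. Qed.

Lemma slow1_l t : set_val t <= 3^-1 -> slow 1 t = i0.
Proof. by move=> t3; rewrite /slow proj_unit_le0 //; lra. Qed.

Lemma slow1_r t : 2 / 3 <= set_val t -> slow 1 t = i1.
Proof. by move=> t3; rewrite /slow proj_unit_ge1 //; lra. Qed.

Lemma set_val_slow1 t : set_val (slow 1 t) = tau (set_val t).
Proof. by rewrite set_val_proj_unit; congr cl; lra. Qed.

(* For [0 <= w <= 1] the path is made to wait at both ends, for [1 <= w <= 2] the
   heights are raised to the standard profile, for [2 <= w <= 3] the clock is made linear. *)
Definition straight (w : R) (e : I -> E) : I -> E :=
  raised (e \o slow (cl w)) (fun _ _ => rlabel e)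
    (fun t => rclock e (rtime (slow (cl w)) t)) (cl (w - 1)) (cl (w - 2)).

Lemma rtime_itv (phi : I -> I) t : 0 <= rtime phi t <= 1.
Proof. exact: itv01P. Qed.

Lemma straightE w e Q run : continuous e -> clocked e Q run ->
  straight w e = raised (e \o slow (cl w))
    (fun t t' => Q (rtime (slow (cl w)) t) (rtime (slow (cl w)) t'))
    (fun t => run (rtime (slow (cl w)) t)) (cl (w - 1)) (cl (w - 2)).
Proof.
move=> ce ck; have rs := slow_reparam (cl_itv w).
rewrite /straight /raised (rlabelE ce ck) rtime0 // rtime1 //; apply/funext => t.
by rewrite /mixrun !(rclockE ce ck) ?rtime_itv.
Qed.

Lemma clocked_straight w e Q run : continuous e -> clocked e Q run ->
  clocked (straight w e)
    (fun t t' => Q (rtime (slow (cl w)) t) (rtime (slow (cl w)) t'))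
    (mixrun (fun t => run (rtime (slow (cl w)) t)) (cl (w - 2))).
Proof.
move=> ce ck; have rs := slow_reparam (cl_itv w).
rewrite (straightE w ce ck); apply: clocked_raised.
- exact: clocked_reparam.
- exact: cl_itv.
- exact: cl_itv.
- by have [w2|w2] := leP w 2; [left; apply: cl_le0|right; apply: cl_ge1]; lra.
have [w1|w1] := leP w 1; first by left; apply: cl_le0; lra.
right=> t t3; rewrite ht_reparam //.
have cw : cl w = 1 by apply: cl_ge1; lra.
have [->|->] : rtime (slow (cl w)) t = 0 \/ rtime (slow (cl w)) t = 1.
- rewrite cw /rtime; case: t3 => t3; [left|right].
    by rewrite slow1_l ?set_val_i0 // set_val_proj_unit -(cl_id (t := 3^-1)) ?clmono //; apply/andP; split; lra.
  by rewrite slow1_r ?set_val_i1 // set_val_proj_unit -(cl_id (t := 2 / 3)) ?clmono //; apply/andP; split; lra.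
- exact: (ck_h0 ck).
- exact: (ck_h1 ck).
Qed.

Lemma straight_start w (e : I -> E) : straight w e i0 = e i0.
Proof.
rewrite /straight /raised /= slow_i0 ?rlift0 //; last by case/andP: (cl_itv w).
by rewrite set_val_i0 hstd_le0 // mulr0.
Qed.

Lemma straight_end w (e : I -> E) : straight w e i1 = e i1.
Proof.
rewrite /straight /raised /= slow_i1 ?rlift0 //; last by case/andP: (cl_itv w).
by rewrite set_val_i1 hstd_ge1 // mulr0.
Qed.

Lemma straight0 (e : I -> E) : straight 0 e = e.
Proof.
apply/funext => t; rewrite /straight /raised /= (cl_le0 (lexx 0)) slow0 rlift0 //.
by rewrite cl_le0 ?mul0r //; lra.
Qed.

Lemma straight3 (e : I -> E) Q run a b (p : fpath a b) : continuous e -> clocked e Q run ->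
  e i0 = rstate a -> e i1 = rstate b -> rlabel e = larrow p -> straight 3 e = edge p.
Proof.
move=> ce ck ea eb ep; apply/funext => t; rewrite edge_cat /straight /raised ep /=.
have [c3 c31 c32] : [/\ cl 3 = 1 :> R, cl (3 - 1) = 1 :> R & cl (3 - 2) = 1 :> R].
  by split; apply: cl_ge1; lra.
rewrite c3 c31 c32 mul1r /mixrun subrr !mul0r !add0r !mul1r (@tau_r _ 1); last lra.
apply: rpoint_eq => [|c c01]; rewrite ?hgt_rlift ?rd_rlift !(cl_id (hstd_itv _)).
  have [t3|t3] := leP (set_val t) 3^-1.
    by rewrite slow1_l // ea ifT //; lra.
  have [t3'|t3'] := leP (2 / 3) (set_val t).
    by rewrite slow1_r // eb ifF //; apply/negbTE; rewrite -ltNge; lra.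
  have hm x : Order.max (@hgt R h H x) 1 = 1 by apply/max_r; case/andP: (hgt_itv x).
  by rewrite hstd_mid ?(ltW t3) ?(ltW t3') // !hm.
case: ifPn => // nc; have t1 : hstd (set_val t) < 1.
  by case/andP: c01 nc => -> c1; rewrite -leNgt => /le_lt_trans; apply.
case: (hstd_lt1 t1) => t3.
  by rewrite slow1_l ?(ltW t3) // ea ifT //; lra.
by rewrite slow1_r ?(ltW t3) // eb ifF //; apply/negbTE; rewrite -ltNge; lra.
Qed.

(** By [readable_rlift] only points flooded to a level strictly between 0 and 1 where the reading is
    already full need care. They occur only for [1 < v < 2], when the clock is still that of the
    slowed path, so that [full_near] applies. *)
Lemma straight_plot_continuous n (e : 'rV[R]_n -> I -> E) (v : 'rV[R]_n -> R) :
  continuous (fun z : 'rV[R]_n * I => e z.1 z.2) -> (forall s, rexec (e s)) ->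
  (forall s s', e s i0 = e s' i0) -> continuous v ->
  continuous (fun z : 'rV[R]_n * I => straight (v z.1) (e z.1) z.2).
Proof.
move=> ce ee es cv.
have /choice[qr ck] : forall s, exists qr, clocked (e s) qr.1 qr.2.
  by move=> s; have [_ [Q [run ck]]] := ee s; exists (Q, run).
pose Q s := (qr s).1; pose run s := (qr s).2.
have ces s : continuous (e s) by have [] := ee s.
have cQ := label_plot_continuous ce ck es; have cr := run_plot_continuous ce ck es.
have ccl := @cl_continuous R; have ctau := @tau_continuous R; have ch := @hstd_continuous R.
pose sg z := cl (v z - 1); pose u z := cl (v z - 2).
have cph : continuous (fun z : 'rV[R]_n * I => (z.1, slow (cl (v z.1)) z.2)) by rewrite /slow; ct.
have cp : continuous (fun z : 'rV[R]_n * I => e z.1 (slow (cl (v z.1)) z.2)).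
  exact: (comp_continuous cph ce).
pose rn (z : 'rV[R]_n * I) := run z.1 (set_val (slow (cl (v z.1)) z.2)).
have crn : continuous rn by exact: (comp_continuous cph cr).
have cl1 : continuous (fun s => run s 1).
  have c1 : continuous (fun s : 'rV[R]_n => (s, i1 : I)) by ct.
  by apply: eq_cont (comp_continuous c1 cr) => s /=; rewrite set_val_i1.
pose mx z := (1 - u z.1) * rn z + u z.1 * tau (set_val z.2).
pose L s := (1 - u s) * run s 1 + u s.
have Lpos s : 0 < L s.
  have := mixrun_len (ck s) (cl_itv (v s - 2)); rewrite /mixrun (@tau_r _ 1) ?mulr1 //; lra.
pose r (z : 'rV[R]_n * I) : reading H := (Q z.1 0 1, (mx z, L z.1 - mx z)).
have E z : straight (v z.1) (e z.1) z.2 =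
    rlift (e z.1 (slow (cl (v z.1)) z.2)) (sg z.1 * hstd (set_val z.2)) (r z).
  have rs := slow_reparam (cl_itv (v z.1)).
  rewrite (straightE (v z.1) (@ces z.1) (ck z.1)) /raised rtime0 // rtime1 //.
  rewrite /mixrun rtime1 // (@tau_r _ 1) ?mulr1; last lra.
  by rewrite /r /mx /L /rn /rtime set_valK01.
apply: (eq_cont E); apply: readable_continuous; first exact: rV_I_delta.
apply: readable_rlift => //.
- by rewrite /sg; ct.
- have c1 := comp_continuous (@fst_continuous 'rV[R]_n I) cQ.
  have cL : continuous L by rewrite /L /u; ct.
  by apply: pair_continuous; [exact: c1|rewrite /mx /u; ct].
move=> [x0 t0] /=; set c := cl _; move=> /andP[c0 c1] rc.
have sgh : 0 <= sg x0 * hstd (set_val t0) <= 1.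
  have /andP[? ?] := cl_itv (v x0 - 1); have /andP[? ?] := hstd_itv (set_val t0).
  by rewrite mulr_ge0 //= mulr_ile1.
have cE : c = sg x0 * hstd (set_val t0) by rewrite /c cl_id.
have c01 : 0 <= c < 1 by rewrite (ltW c0).
(* Once the profile is complete, a point where it is below 1 lies outside the plateau and is a
   state, whose lengths 0 contradict the positive total [L]. *)
have sg1 : sg x0 < 1.
  rewrite ltNge; apply/negP => sg1; have sgE : sg x0 = 1.
    by apply/eqP; rewrite eq_le sg1; case/andP: (cl_itv (v x0 - 1)) => _ ->.
  have cvE : cl (v x0) = 1.
    apply: cl_ge1; rewrite leNgt; apply/negP => v1.
    by move: sgE; rewrite /sg cl_le0 => [/esym/eqP|]; [rewrite oner_eq0|lra].
  rewrite sgE mul1r in cE; rewrite cE in c1.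
  have rst t : set_val t = 0 \/ set_val t = 1 :> R ->
      exists a, e x0 t = rstate a.
    case=> tE; have -> : t = (if set_val t == 0 then i0 else i1).
    - by apply: unit_eq; rewrite tE eqxx set_val_i0.
    - by rewrite tE eqxx; have [a -> _] := clocked_start (ck x0); exists a.
    - by apply: unit_eq; rewrite tE oner_eq0 set_val_i1.
    - by rewrite tE oner_eq0; have [a -> _] := clocked_end (ck x0); exists a.
  have [|a ea] := rst (slow (cl (v x0)) t0).
    rewrite cvE set_val_slow1; case: (hstd_lt1 c1) => t3; [left; apply: tau_l|right; apply: tau_r];
      exact: ltW.
  move: rc; rewrite ea rd_rstate // /r /= => -[x1 x2].
  by have := Lpos x0; rewrite -[L x0](subrK (mx (x0, t0))) -x2 -x1 addr0 ltxx.
have v1 : 1 < v x0.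
  rewrite ltNge; apply/negP => v1; move: cE; rewrite /sg cl_le0 ?mul0r; last lra.
  by move=> c00; rewrite c00 ltxx in c0.
have v2 : v x0 < 2.
  by rewrite ltNge; apply/negP => v2; move: sg1; rewrite /sg cl_ge1 ?ltxx //; lra.
have u0 x : v x < 2 -> u x = 0 by move=> vx; apply: cl_le0; lra.
have mE x t : v x < 2 -> mx (x, t) = rn (x, t).
  by move=> vx; rewrite /mx /= u0 // subr0 mul1r mul0r addr0.
have LE x : v x < 2 -> L x = run x 1.
  by move=> vx; rewrite /L u0 // subr0 mul1r addr0.
pose s0 := set_val (slow (cl (v x0)) t0).
have [d d0 dE] := rd_right (e x0 (slow (cl (v x0)) t0)) c.
pose c' := c + Order.min d (1 - c) / 2.
have m0 : 0 < Order.min d (1 - c) by rewrite lt_min d0 subr_gt0.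
have [m1 m2] : Order.min d (1 - c) <= d /\ Order.min d (1 - c) <= 1 - c.
  by rewrite !ge_min !lexx orbT.
have c'1 : 0 <= c' < 1 by rewrite /c'; apply/andP; split; lra.
have rc' : (rd (e x0 (proj_unit s0)) c').2 = (run x0 s0, run x0 1 - run x0 s0).
  rewrite /s0 set_valK01 dE; last by rewrite /c'; apply/andP; split; lra.
  by rewrite rc /r /= mE // LE.
exists c'; first by rewrite /c'; lra.
have fn := full_near ce ck (itv01P (slow (cl (v x0)) t0)) c'1 rc'.
have cmap : continuous (fun z : 'rV[R]_n * I => (z.1, set_val (slow (cl (v z.1)) z.2))).
  by rewrite /slow; ct.
have N1 : \forall z \near (x0, t0), forall c, 0 <= c <= c' ->
    rd (e z.1 (slow (cl (v z.1)) z.2)) c = (Q z.1 0 1, (rn z, run z.1 1 - rn z)).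
  have := @cmap (x0, t0) _ fn; rewrite /=.
  change (nbhs (x0, t0) [set z : 'rV[R]_n * I | forall c, 0 <= c <= c' ->
    rd (e z.1 (proj_unit (set_val (slow (cl (v z.1)) z.2)))) c =
    (Q z.1 0 1, (rn z, run z.1 1 - rn z))] -> nbhs (x0, t0) [set z : 'rV[R]_n * I |
      forall c, 0 <= c <= c' -> rd (e z.1 (slow (cl (v z.1)) z.2)) c =
      (Q z.1 0 1, (rn z, run z.1 1 - rn z))]).
  by apply: filterS => z zE c2 c2c; rewrite -(zE c2) // set_valK01.
have N2 : \forall z \near (x0, t0), v z.1 < 2.
  apply: (@near_fst _ _ x0 t0 [set x | v x < 2]).
  by apply: (cv x0 [set y | y < 2]); exact: lt_nbhsl.
by apply: (near2 N1 N2) => -[x t] /= zE vx c2 c2c; rewrite zE // /r /= mE // LE.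
Qed.

(** Continuity of a single path is the case of a plot on the vector space of dimension 0. *)
Lemma straight_rexec w e : rexec e -> rexec (straight w e).
Proof.
move=> ee; have [ce [Q [run ck]]] := ee; split; last first.
  by do 2!eexists; exact: (clocked_straight w ce ck).
have c1 : continuous (fun z : 'rV[R]_0 * I => e z.2) by exact: (comp_continuous (@snd_continuous _ _) ce).
have c2 : continuous (fun _ : 'rV[R]_0 => w) by move=> x; ct.
have c3 := @straight_plot_continuous 0 (fun=> e) (fun=> w) c1 (fun=> ee) (fun _ _ => erefl) c2.
have c4 : continuous (fun t : I => (0 : 'rV[R]_0, t)) by ct.
exact: (comp_continuous c4 c3).
Qed.

Lemma rexec_label (e : I -> E) a b (p : fpath a b) : rexec e -> rlabel e = larrow p ->
  e i0 = rstate a /\ e i1 = rstate b.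
Proof.
move=> ee; have [ce [Q [run ck]]] := ee; rewrite (rlabelE ce ck) => pE.
have [a' ea qa] := clocked_start ck; have [b' eb qb] := clocked_end ck.
have h0 : ht e 0 < 1 by rewrite (ck_h0 ck).
have h1 : ht e 1 < 1 by rewrite (ck_h1 ck).
have l0 := ck_coc ck (lexx 0) ler01 h0 h0 h1; have l1 := ck_coc ck ler01 (lexx 1) h0 h1 h1.
rewrite qa pE in l0; rewrite qb pE in l1.
have n0 : lmul (lunit a') (larrow p) <> lzero H by rewrite -l0.
have n1 : lmul (larrow p) (lunit b') <> lzero H by rewrite -l1.
have -> : a = a' by apply: contrapT => ne; apply: n0; apply: lmulUA0; exact: nesym.
have -> : b = b' by apply: contrapT => ne; apply: n1; exact: lmulAU0.
by [].
Qed.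

End Straighten.

(** * Functoriality of E *)

Section StraightPaths.
Variables (R : realType) (h : bool) (H : flow R h).
Local Notation I := (unit_interval R).
Variables (al be : underlying (emd H)) (a b : fstate H).
Hypotheses (ala : al = rstate a) (beb : be = rstate b).
Local Notation PE := (@path_space R h (emd H) al be).

Lemma path_label (g : PE) : exists p : fpath a b, rlabel (path_fun g) = larrow p.
Proof.
have ee := path_exec g; have [ce [Q [run ck]]] := ee; have [x [y [p pE]]] := ck_arrow ck.
have lp : rlabel (path_fun g) = larrow p by rewrite (rlabelE ce ck).
have [gx gy] := rexec_label ee lp.
have xa : x = a by apply: rstate_inj; rewrite -ala -gx; exact: (path_src g).
have yb : y = b by apply: rstate_inj; rewrite -beb -gy; exact: (path_tgt g).
by case: _ / xa in p lp pE gx *; case: _ / yb in p lp pE gy *; exists p.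
Qed.

Definition plabel (g : PE) : fpath a b := sval (cid (path_label g)).

Lemma plabelE (g : PE) : rlabel (path_fun g) = larrow (plabel g).
Proof. by rewrite /plabel; case: cid. Qed.

Lemma rlabel_plot_continuous n (e : 'rV[R]_n -> I -> rpoint H) :
  continuous (fun z : 'rV[R]_n * I => e z.1 z.2) -> (forall s, rexec (e s)) ->
  (forall s s', e s i0 = e s' i0) -> continuous (fun s => rlabel (e s)).
Proof.
move=> ce ee es; have /choice[qr ck] : forall s, exists qr, clocked (e s) qr.1 qr.2.
  by move=> s; have [_ [Q [run ck]]] := ee s; exists (Q, run).
apply: eq_cont (label_plot_continuous ce ck es) => s.
by have [ces _] := ee s; rewrite (rlabelE ces (ck s)).
Qed.

Lemma path_start_const (S : Type) (u : S -> PE) s s' : path_fun (u s) i0 = path_fun (u s') i0.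
Proof. by rewrite !path_src. Qed.

Lemma plabel_continuous : continuous plabel.
Proof.
have [dP _] := path_space_in_Top al be; apply: (rV_test dP) => n u cu x.
have c1 : continuous (fun s => larrow (plabel (u s))).
  have := @rlabel_plot_continuous n (fun s => path_fun (u s)) (path_eval cu)
    (fun s => path_exec (u s)) (path_start_const u).
  by apply: eq_cont => s; rewrite plabelE.
have := lget_continuous (c1 x) (erefl (larrow (plabel (u x)))).
by apply: eq_near_continuous; apply: filterE => y; rewrite lgetK.
Qed.

Definition straight_path (w : R) (g : PE) : PE :=
  mk_path (straight_rexec w (path_exec g) : execution (straight w (path_fun g) : I -> underlying (emd H)))
    (etrans (straight_start w (path_fun g)) (path_src g))
    (etrans (straight_end w (path_fun g)) (path_tgt g)).

Lemma straight_path_hcont : hcont (fun t => straight_path (3 * t)).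
Proof.
move=> n g v cg cv; apply: path_curry; first exact: rV_delta.
have cv3 : continuous (fun x => 3 * v x) by ct.
exact: (straight_plot_continuous (path_eval cg) (fun s => path_exec (g s)) (path_start_const g) cv3).
Qed.

Lemma edge_rexec (p : fpath a b) : rexec (edge p).
Proof.
split; last by exists (edge_label p), (@tau R); exact: clocked_edge.
have cp : continuous (fun _ : 'rV[R]_0 => p) by move=> x; ct.
have c4 : continuous (fun t : I => (0 : 'rV[R]_0, t)) by ct.
exact: (comp_continuous c4 (edge_plot_continuous (@rV_I_delta R 0) cp)).
Qed.

Definition edge_path (p : fpath a b) : PE :=
  mk_path (edge_rexec p : execution (edge p : I -> underlying (emd H)))
    (etrans (edge_start p) (esym ala)) (etrans (edge_end p) (esym beb)).

Lemma edge_path_continuous : continuous edge_path.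
Proof.
have [dP _] := carrierP (fpath a b); apply: (rV_test dP) => n u cu.
apply: path_curry; first exact: rV_delta.
exact: (edge_plot_continuous (@rV_I_delta R n) cu).
Qed.

Lemma straight_path0 (g : PE) : straight_path (3 * 0) g = g.
Proof. by apply: path_fun_inj; rewrite mulr0; exact: straight0. Qed.

Lemma straight_path1 (g : PE) : straight_path (3 * 1) g = edge_path (plabel g).
Proof.
apply: path_fun_inj; rewrite mulr1; have [ce [Q [run ck]]] := path_exec g.
apply: (straight3 ce ck (etrans (path_src g) ala) (etrans (path_tgt g) beb)).
exact: plabelE.
Qed.

Lemma rlabel_edge (p : fpath a b) : rlabel (edge p) = larrow p.
Proof.
have [ce _] := edge_rexec p; rewrite (rlabelE ce (clocked_edge p)) /edge_label ifF.
  by rewrite ifT // invr_ge0.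
by apply/negbTE; rewrite -ltNge; lra.
Qed.

End StraightPaths.

Section EMap.
Variables (R : realType) (h : bool) (F G : flow R h) (f : flowmap F G).
Local Notation I := (unit_interval R).

Definition lmap (x : label F) : label G := match x with
  | lzero => lzero G
  | lunit a => lunit (fm_state f a)
  | larrow a b p => larrow (fm_path f p)
  end.

Lemma lmap_mul x y : lmul x y <> lzero F -> lmap (lmul x y) = lmul (lmap x) (lmap y).
Proof. by case/lmulP => *; rewrite /lmap ?fm_comp lmulE. Qed.

Lemma lmap_ne0 x : x <> lzero F -> lmap x <> lzero G. Proof. by case: x. Qed.

Lemma lmap_continuous : continuous lmap.
Proof.
apply/continuousP => A oA; rewrite label_openE => a b.
exact: (continuousP _).1 (@fm_continuous _ _ _ _ f a b) _ (oA _ _).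
Qed.

Lemma rmap_subproof (p : rpoint F) :
  rpoint_spec (hgt p, fun c => (lmap (rd p c).1, (rd p c).2)).
Proof.
split=> [|c nc|c] /=; first exact: hgt_itv.
  by rewrite rd_out.
by have [e e0 eE] := rd_right p c; exists e => // c' /eE ->.
Qed.

Definition rmap (p : rpoint F) : rpoint G := exist _ _ (rmap_subproof p).

Lemma rd_rmap p c : rd (rmap p) c = (lmap (rd p c).1, (rd p c).2). Proof. by []. Qed.

Lemma rmap_continuous : continuous rmap.
Proof.
apply: readable_continuous; first exact: rpoint_delta.
have [ch rf] := continuous_readable (fun x => cvg_id : continuous_at x (id : rpoint F -> rpoint F)).
split=> // x c c01 [e e0 eE]; have reg : regular x c by exists e.
have [nr cr] := rf _ _ c01 reg; split; first by [].
have cl1 := @ct_fst _ _ (label F) _ _ cr; have cl2 := @ct_snd _ _ (label F) _ _ cr.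
have cl3 := comp_cont_at cl1 (@lmap_continuous _).
exact: (@ct_pair _ _ (label G) (R * R)%type _ _ cl3 cl2).
Qed.

Lemma rmap_rstate a : rmap (rstate a) = rstate (fm_state f a).
Proof. by apply: rpoint_eq => // c c01; rewrite rd_rmap !rd_rstate. Qed.

Lemma rmap_rlift p b r : rmap (rlift p b r) = rlift (rmap p) b (lmap r.1, r.2).
Proof. by apply: rpoint_eq => // c c01; rewrite rd_rmap !rd_rlift; case: ifP. Qed.

Lemma rmap_edge a b (p : fpath a b) t : rmap (edge p t) = edge (fm_path f p) t.
Proof. by rewrite !edge_cat rmap_rlift rmap_rstate; case: ifP. Qed.

Lemma clocked_rmap e Q run : clocked e Q run ->
  clocked (rmap \o e) (fun t t' => lmap (Q t t')) run.
Proof.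
move=> ck; split; rewrite /ht /=.
- exact: (ck_h0 ck).
- exact: (ck_h1 ck).
- move=> t t' t'' tt' tt'' h1 h2 h3; rewrite -lmap_mul -?(ck_coc ck tt' tt'') //.
  by apply: (ck_ne0 ck) => //; exact: le_trans tt''.
- by move=> t t' tt' h1 h2; apply: lmap_ne0; exact: (ck_ne0 ck).
- by move=> t h1; have [a ->] := ck_unit ck h1; exists (fm_state f a).
- exact: (ck_mono ck).
- by move=> t t' tt' bl; have [-> ->] := ck_stop ck tt' bl.
- exact: (ck_go ck).
- exact: (ck_run0 ck).
- by have [a [b [p ->]]] := ck_arrow ck; do 3!eexists.
- by move=> c t1 t t2 c01 tt h1 h2 p1 p2; rewrite rd_rmap (ck_rd ck c01 tt h1 h2 p1 p2).
Qed.

Lemma rmap_rexec e : rexec e -> rexec (rmap \o e).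
Proof.
move=> [ce [Q [run ck]]]; split; first exact: (comp_continuous ce rmap_continuous).
by exists (fun t t' => lmap (Q t t')), run; exact: clocked_rmap.
Qed.

Lemma rlabel_rmap e : rexec e -> rlabel (rmap \o e) = lmap (rlabel e).
Proof.
move=> ee; have [ce [Q [run ck]]] := ee; have [ce' _] := rmap_rexec ee.
by rewrite (rlabelE ce ck) (rlabelE ce' (clocked_rmap ck)).
Qed.

Lemma rclock_rmap e t : rexec e -> 0 <= t <= 1 -> rclock (rmap \o e) t = rclock e t.
Proof.
move=> ee t01; have [ce [Q [run ck]]] := ee; have [ce' _] := rmap_rexec ee.
by rewrite (rclockE ce ck) // (rclockE ce' (clocked_rmap ck)).
Qed.

Lemma rmap_straight w e t : rexec e -> rmap (straight w e t) = straight w (rmap \o e) t.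
Proof.
move=> ee; rewrite /straight /raised rmap_rlift /= rlabel_rmap // /mixrun.
by rewrite !rclock_rmap ?rtime_itv.
Qed.

Definition emap : mdmap (emd F) (emd G).
Proof.
refine (@MdMap R h (emd F) (emd G) rmap rmap_continuous _ _).
- by move=> _ [a _ <-]; exists (fm_state f a) => //; rewrite rmap_rstate.
- exact: rmap_rexec.
Defined.

(** Straightening depends only on labels and clocks, which [emap] respects. It deforms both path
    spaces compatibly onto standard edges, and [star_deformation] reduces the claim to
    [fm_path f]. *)
Lemma emap_mdstar : flow_weak_equivalence f -> mdstar emap.
Proof.
move=> [[g fK gK] wf]; split.
- by move=> _ [b _ <-]; exists (rstate (g b)); [exists (g b)|rewrite /= rmap_rstate gK].
- move=> _ _ [a _ <-] [a' _ <-] /=; rewrite !rmap_rstate => /rstate_inj /(can_inj fK) ->.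
  by [].
- move=> _ _ [a _ <-] [b _ <-]; pose ea := erefl (rstate a); pose eb := erefl (rstate b).
  have ea' : emap (rstate a) = rstate (fm_state f a) by exact: rmap_rstate.
  have eb' : emap (rstate b) = rstate (fm_state f b) by exact: rmap_rstate.
  apply: (@star_deformation R _ _ _ _ _ (@fm_path _ _ _ _ f a b) (plabel ea eb) (plabel ea' eb')
    (edge_path ea eb) (edge_path ea' eb') (fun t => straight_path (3 * t))
    (fun t => straight_path (3 * t))).
  + exact: plabel_continuous.
  + exact: plabel_continuous.
  + exact: edge_path_continuous.
  + exact: edge_path_continuous.
  + exact: straight_path_hcont.
  + exact: straight_path_hcont.
  + exact: straight_path0.
  + exact: straight_path1.
  + exact: straight_path0.
  + exact: straight_path1.
  + by move=> p; apply: path_fun_inj; apply/funext => t; exact: rmap_edge.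
  + move=> x; apply: larrow_inj; rewrite -plabelE.
    by rewrite [LHS](rlabel_rmap (path_exec x)) (plabelE ea eb).
  + move=> t x; apply: path_fun_inj; apply/funext => s.
    exact: (rmap_straight (3 * t) s (path_exec x)).
  + exact: star_weak_homotopy_equivalence.
Qed.

End EMap.

Lemma rmap_id (R : realType) (h : bool) (F : flow R h) (p : rpoint F) : rmap (flowmap_id F) p = p.
Proof.
apply: rpoint_eq => // c _; rewrite rd_rmap; case: (rd p c) => l r /=.
by congr pair; case: l.
Qed.

Lemma rmap_comp (R : realType) (h : bool) (F G K : flow R h) (f : flowmap F G) (g : flowmap G K)
    (p : rpoint F) : rmap (flowmap_comp f g) p = rmap g (rmap f p).
Proof.
apply: rpoint_eq => // c _; rewrite !rd_rmap; case: (rd p c) => l r /=.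
by congr pair; case: l.
Qed.

(** * Natural parametrizations *)

Section NaturalClock.
Variables (R : realType) (h : bool) (H : flow R h).
Local Notation I := (unit_interval R).
Local Notation E := (rpoint H).

Lemma continuous_reparam (phi : I -> I) : continuous phi ->
  (forall s t, set_val s <= set_val t -> set_val (phi s) <= set_val (phi t)) ->
  phi i0 = i0 -> phi i1 = i1 -> reparametrization phi.
Proof.
move=> cphi mphi p0 p1; split=> // t.
pose f (x : R) : R := set_val (phi (proj_unit x)).
have cf : continuous f by rewrite /f; ct.
have f0 : f 0 = 0 by rewrite /f -/i0 p0 set_val_i0.
have f1 : f 1 = 1 by rewrite /f -/i1 p1 set_val_i1.
have [||c _ fc] := @IVT R f 0 1 (set_val t) ler01.
- exact: continuous_subspaceT.
- by rewrite f0 f1 (min_idPl ler01) (max_idPr ler01); exact: itv01P.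
- by exists (proj_unit c); apply: unit_eq.
Qed.

Lemma rclock_mono (e : I -> E) (s t : R) : rexec e -> 0 <= s <= 1 -> 0 <= t <= 1 -> s <= t ->
  rclock e s <= rclock e t.
Proof.
by move=> [ce [Q [run ck]]] s01 t01 st; rewrite !(rclockE ce ck) //; exact: (ck_mono ck).
Qed.

Lemma rclock0 (e : I -> E) : rexec e -> rclock e 0 = 0.
Proof.
by move=> [ce [Q [run ck]]]; rewrite (rclockE ce ck) ?lexx ?ler01 //; exact: (ck_run0 ck).
Qed.

Lemma rclock_len (e : I -> E) : rexec e -> 0 < rclock e 1.
Proof.
by move=> [ce [Q [run ck]]]; rewrite (rclockE ce ck) ?lexx ?ler01 //; exact: (ck_len ck).
Qed.

(** The clock is read off the points of [e], so [nclock (e \o phi)] is [nclock e \o phi] by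
    [nclock_comp]. Dividing a path by this clock therefore selects a representative that does not
    depend on the parametrization. *)
Definition nclock (e : I -> E) (t : I) : I := proj_unit (rclock e (set_val t) / rclock e 1).

Lemma rclock_div_itv (e : I -> E) (t : I) : rexec e -> 0 <= rclock e (set_val t) / rclock e 1 <= 1.
Proof.
move=> ee; have /andP[t0 t1] := itv01P t; have L := rclock_len ee.
have u0 : 0 <= (0 : R) <= 1 by rewrite lexx ler01.
have u1 : 0 <= (1 : R) <= 1 by rewrite lexx ler01.
rewrite ler_pdivrMr // mul1r (rclock_mono ee (itv01P t) u1 t1) andbT.
have := rclock_mono ee u0 (itv01P t) t0; rewrite (rclock0 ee) => r0.
by rewrite divr_ge0 ?(ltW L).
Qed.

Lemma set_val_nclock (e : I -> E) (t : I) : rexec e ->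
  set_val (nclock e t) = rclock e (set_val t) / rclock e 1.
Proof. by move=> ee; rewrite proj_unitK // rclock_div_itv. Qed.

Lemma nclock_plot_continuous n (e : 'rV[R]_n -> I -> E) :
  continuous (fun z : 'rV[R]_n * I => e z.1 z.2) -> (forall s, rexec (e s)) ->
  (forall s s', e s i0 = e s' i0) ->
  continuous (fun z : 'rV[R]_n * I => nclock (e z.1) z.2).
Proof.
move=> ce ee es; have /choice[qr ck] : forall s, exists qr, clocked (e s) qr.1 qr.2.
  by move=> s; have [_ [Q [run ck]]] := ee s; exists (Q, run).
have cr : continuous (fun z : 'rV[R]_n * I => rclock (e z.1) (set_val z.2)).
  apply: eq_cont (run_plot_continuous ce ck es) => z.
  by have [ces _] := ee z.1; rewrite (rclockE ces (ck z.1)) //; exact: itv01P.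
have cL : continuous (fun z : 'rV[R]_n * I => rclock (e z.1) 1).
  have c1 : continuous (fun z : 'rV[R]_n * I => (z.1, i1 : I)) by ct.
  by apply: eq_cont (comp_continuous c1 cr) => z; rewrite /= set_val_i1.
by move=> z; rewrite /nclock; ct; rewrite gt_eqF // rclock_len.
Qed.

Lemma nclock_reparam (e : I -> E) : rexec e -> reparametrization (nclock e).
Proof.
move=> ee; have L := rclock_len ee; apply: continuous_reparam.
- have c1 : continuous (fun z : 'rV[R]_0 * I => e z.2).
    by have ce := ee.1; ct.
  have c2 := @nclock_plot_continuous 0 (fun=> e) c1 (fun=> ee) (fun _ _ => erefl).
  have c3 : continuous (fun t : I => (0 : 'rV[R]_0, t)) by ct.
  exact: (comp_continuous c3 c2).
- move=> s t st; rewrite !set_val_nclock // ler_pM2r ?invr_gt0 //.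
  by apply: rclock_mono => //; exact: itv01P.
- by apply: unit_eq; rewrite set_val_nclock // set_val_i0 rclock0 // mul0r.
- by apply: unit_eq; rewrite set_val_nclock // set_val_i1 divff // gt_eqF.
Qed.

Lemma set_val_rtime (phi : I -> I) (t : I) : rtime phi (set_val t) = set_val (phi t).
Proof. by rewrite /rtime set_valK01. Qed.

Lemma nclock_comp (e : I -> E) (phi : I -> I) t : rexec e -> reparametrization phi ->
  nclock (e \o phi) t = nclock e (phi t).
Proof.
move=> ee rphi; have [ce [Q [run ck]]] := ee; have ck' := clocked_reparam rphi ck.
have ce' : continuous (e \o phi) := comp_continuous (reparam_continuous rphi) ce.
have u1 : 0 <= (1 : R) <= 1 by rewrite lexx ler01.
rewrite /nclock (rclockE ce' ck') ?itv01P // (rclockE ce' ck') // (rclockE ce ck) ?itv01P //.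
by rewrite (rclockE ce ck) // rtime1 // set_val_rtime.
Qed.

Lemma rlabel_comp (e : I -> E) (phi : I -> I) : rexec e -> reparametrization phi ->
  rlabel (e \o phi) = rlabel e.
Proof.
move=> ee rphi; have [ce [Q [run ck]]] := ee; have ck' := clocked_reparam rphi ck.
have ce' : continuous (e \o phi) := comp_continuous (reparam_continuous rphi) ce.
by rewrite (rlabelE ce' ck') (rlabelE ce ck) rtime0 // rtime1.
Qed.

Lemma reparam_inverse (phi : I -> I) : reparametrization phi -> injective phi ->
  exists psi, reparametrization psi /\ cancel phi psi.
Proof.
move=> [mphi sphi] iphi; have [psi psiK] := choice sphi.
have phiK : cancel phi psi by move=> t; apply: iphi; rewrite psiK.
exists psi; split=> //; split=> [s t st|t]; last by exists (phi t).
have [//|ts] := leP (set_val (psi s)) (set_val (psi t)).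
have := mphi _ _ (ltW ts); rewrite !psiK => ts'.
have E : s = t by apply: unit_eq; apply/eqP; rewrite eq_le st.
by move: ts; rewrite E ltxx.
Qed.

Section Ncomp.
Variables e1 e2 : I -> E.
Hypotheses (ee1 : rexec e1) (ee2 : rexec e2) (e12 : e1 i1 = e2 i0).

Lemma rlabel_ncomp : rlabel (ncomp e1 e2) = lmul (rlabel e1) (rlabel e2).
Proof.
have [c1 [Q1 [run1 k1]]] := ee1; have [c2 [Q2 [run2 k2]]] := ee2.
rewrite (rlabelE (ncomp_continuous c1 c2 e12) (clocked_ncomp e12 k1 k2)).
rewrite (rlabelE c1 k1) (rlabelE c2 k2) /label_cat mulr0 mulr1 invr_ge0 ler0n ifF.
  by congr (lmul _ (Q2 0 _)); lra.
by apply/negbTE; rewrite -ltNge; lra.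
Qed.

Lemma rclock_ncomp t : 0 <= t <= 1 -> rclock (ncomp e1 e2) t =
  if t <= 2^-1 then rclock e1 (2 * t) else rclock e1 1 + rclock e2 (2 * t - 1).
Proof.
have [c1 [Q1 [run1 k1]]] := ee1; have [c2 [Q2 [run2 k2]]] := ee2; move=> t01.
rewrite (rclockE (ncomp_continuous c1 c2 e12) (clocked_ncomp e12 k1 k2)) // /run_cat.
have u1 : 0 <= (1 : R) <= 1 by rewrite lexx ler01.
case/andP: t01 => t0 t1; case: ifPn => [t2|]; first by rewrite (rclockE c1 k1) //; lra.
by rewrite -ltNge => t2; rewrite (rclockE c1 k1) // (rclockE c2 k2) //; lra.
Qed.

Let a1 := rclock e1 1.
Let a2 := rclock e2 1.

Definition cutf (s : R) : R := Order.min (s * (a1 + a2) / (2 * a1)) 2^-1 +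
  Order.max 0 ((s * (a1 + a2) - a1) / (2 * a2)).

(* Sends [a1 / (a1 + a2)] to [1 / 2]. *)
Definition cut (s : I) : I := proj_unit (cutf (set_val s)).

Let a10 : 0 < a1. Proof. exact: rclock_len. Qed.
Let a20 : 0 < a2. Proof. exact: rclock_len. Qed.

Let cutf_l s : s * (a1 + a2) <= a1 -> cutf s = s * (a1 + a2) / (2 * a1).
Proof.
move=> sl; rewrite /cutf min_l ?max_l ?addr0 //.
  by rewrite pmulr_lle0 ?invr_gt0 ?mulr_gt0 // subr_le0.
by rewrite ler_pdivrMr ?mulr_gt0 // mulrA mulVf ?pnatr_eq0 // mul1r.
Qed.

Let cutf_r s : a1 <= s * (a1 + a2) -> cutf s = 2^-1 + (s * (a1 + a2) - a1) / (2 * a2).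
Proof.
move=> sl; rewrite /cutf min_r ?max_r //.
  by rewrite divr_ge0 ?subr_ge0 // mulr_ge0 ?ler0n // ltW.
by rewrite ler_pdivlMr ?mulr_gt0 // mulrA mulVf ?pnatr_eq0 // mul1r.
Qed.

Lemma cut_reparam : reparametrization cut.
Proof.
have a12 : 0 < a1 + a2 by rewrite addr_gt0.
split=> [s t st|t].
  rewrite !set_val_proj_unit; apply: clmono; apply: lerD.
    by rewrite le_min !ge_min lexx orbT andbT ler_pM2r ?invr_gt0 ?mulr_gt0 // ler_pM2r ?st.
  rewrite ge_max !le_max lexx /= ler_pM2r ?invr_gt0 ?mulr_gt0 //.
  by rewrite lerD2r ler_pM2r ?st // orbT.
have /andP[t0 t1] := itv01P t; have [t2|t2] := leP (set_val t) 2^-1.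
  pose s := 2 * set_val t * a1 / (a1 + a2).
  have sE : s * (a1 + a2) = 2 * set_val t * a1 by rewrite /s divfK ?gt_eqF.
  have l1 : 2 * set_val t * a1 <= 1 * a1 by rewrite ler_pM2r //; lra.
  have s1 : s <= 1 by rewrite /s ler_pdivrMr // mul1r; have := a20; lra.
  have s0 : 0 <= s by rewrite /s divr_ge0 ?(ltW a12) ?mulr_ge0 ?(ltW a10).
  exists (proj_unit s); rewrite /cut proj_unitK ?s0 //; apply: unit_eq.
  rewrite cutf_l sE; last lra.
  have -> : 2 * set_val t * a1 / (2 * a1) = set_val t.
    by rewrite (mulrAC 2) mulrC mulKf // gt_eqF // mulr_gt0.
  by rewrite proj_unitK ?itv01P.
pose s := (a1 + (2 * set_val t - 1) * a2) / (a1 + a2).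
have sE : s * (a1 + a2) = a1 + (2 * set_val t - 1) * a2 by rewrite /s divfK ?gt_eqF.
have l1 : (2 * set_val t - 1) * a2 <= 1 * a2 by rewrite ler_pM2r //; lra.
have l2 : 0 <= (2 * set_val t - 1) * a2 by apply: mulr_ge0; [lra|exact: ltW].
have s1 : s <= 1 by rewrite /s ler_pdivrMr // mul1r; lra.
have s0 : 0 <= s by rewrite /s divr_ge0 ?(ltW a12) //; have := ltW a10; lra.
exists (proj_unit s); rewrite /cut proj_unitK ?s0 //; apply: unit_eq.
rewrite cutf_r sE; last lra.
have -> : a1 + (2 * set_val t - 1) * a2 - a1 = (2 * set_val t - 1) * a2 by lra.
have -> : (2 * set_val t - 1) * a2 / (2 * a2) = set_val t - 2^-1.
  by rewrite invfM (mulrC 2^-1) mulrA mulfK ?gt_eqF // mulrBl mul1r mulrAC mulfV ?mul1r ?pnatr_eq0.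
by rewrite addrC subrK proj_unitK ?itv01P.
Qed.

(** The clock of the composite gives the fraction [a1 / (a1 + a2)] of its range to the first path,
    whereas [ncomp d1 d2] gives it one half; [cut] absorbs the discrepancy, so divisibility is
    stable under composition. *)
Lemma nclock_ncomp T (d1 d2 : I -> T) t : d1 i1 = d2 i0 ->
  ncomp (d1 \o nclock e1) (d2 \o nclock e2) t = (ncomp d1 d2 \o cut) (nclock (ncomp e1 e2) t).
Proof.
move=> d12; have /andP[t0 t1] := itv01P t; have a12 : 0 < a1 + a2 by rewrite addr_gt0.
have u1 : 0 <= (1 : R) <= 1 by rewrite lexx ler01.
have LE : rclock (ncomp e1 e2) 1 = a1 + a2.
  rewrite rclock_ncomp // ifF; first by congr (_ + rclock e2 _); lra.
  by apply/negbTE; rewrite -ltNge; lra.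
have nE : nclock (ncomp e1 e2) t = proj_unit ((if set_val t <= 2^-1 then
    rclock e1 (2 * set_val t) else a1 + rclock e2 (2 * set_val t - 1)) / (a1 + a2)).
  by rewrite /nclock LE rclock_ncomp ?itv01P.
rewrite /= /cut nE; have [t2|t2] := leP (set_val t) 2^-1.
  have t02 : 0 <= 2 * set_val t <= 1 by lra.
  have rE : rclock e1 (2 * set_val t) / (a1 + a2) * (a1 + a2) = rclock e1 (2 * set_val t).
    by rewrite divfK ?gt_eqF.
  have r1 : rclock e1 (2 * set_val t) <= a1 by apply: rclock_mono => //; lra.
  have r0 : 0 <= rclock e1 (2 * set_val t).
    by rewrite -[leLHS](rclock0 ee1); apply: rclock_mono => //; lra.
  have p01 : 0 <= rclock e1 (2 * set_val t) / (a1 + a2) <= 1.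
    by rewrite divr_ge0 ?(ltW a12) //= ler_pdivrMr // mul1r (le_trans r1) // lerDl ltW.
  rewrite [LHS]ncompl // (proj_unitK p01) cutf_l rE //.
  have q01 : 0 <= rclock e1 (2 * set_val t) / (2 * a1) <= 1 / 2.
    rewrite divr_ge0 //= ?mulr_ge0 ?(ltW a10) //.
    by rewrite ler_pdivrMr ?mulr_gt0 // mulrA mulfVK ?pnatr_eq0 // mul1r.
  rewrite ncompl /= proj_unitK; [|lra|lra|lra].
  congr (d1 _); rewrite /nclock proj_unitK //; congr proj_unit.
  by rewrite -/a1 invfM; lra.
have t02 : 0 <= 2 * set_val t - 1 <= 1 by lra.
set r := rclock e2 (2 * set_val t - 1).
have rE : (a1 + r) / (a1 + a2) * (a1 + a2) = a1 + r by rewrite divfK ?gt_eqF.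
have r1 : r <= a2 by apply: rclock_mono => //; lra.
have r0 : 0 <= r by rewrite -[leLHS](rclock0 ee2); apply: rclock_mono => //; lra.
have p01 : 0 <= (a1 + r) / (a1 + a2) <= 1.
  by rewrite divr_ge0 ?(ltW a12) ?addr_ge0 ?(ltW a10) //= ler_pdivrMr // mul1r lerD2l.
have n1 : nclock e1 i1 = i1 by exact: reparam1 (nclock_reparam ee1).
have n0 : nclock e2 i0 = i0 by exact: reparam0 (nclock_reparam ee2).
rewrite [LHS]ncompr ?(ltW t2) /= ?n1 ?n0 // (proj_unitK p01) cutf_r rE ?lerDl //.
have -> : a1 + r - a1 = r by lra.
have q01 : 0 <= r / (2 * a2) <= 1 / 2.
  rewrite divr_ge0 //= ?mulr_ge0 ?(ltW a20) //.
  by rewrite ler_pdivrMr ?mulr_gt0 // mulrA mulfVK ?pnatr_eq0 // mul1r.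
rewrite ncompr //= proj_unitK; [|lra|lra|lra].
congr (d2 _); rewrite /nclock proj_unitK //; congr proj_unit.
by rewrite -/r -/a2 invfM; lra.
Qed.

End Ncomp.
End NaturalClock.

(** * The space A(Z) *)

Lemma path_map_continuous (R : realType) (h : bool) (X Y : mdspace R h) (k : mdmap Y X)
    (a b : underlying Y) : continuous (@path_map R h Y X k a b).
Proof.
have [dP _] := path_space_in_Top a b; apply: (rV_test dP) => n u cu.
apply: path_curry; first exact: rV_delta.
exact: (comp_continuous (path_eval cu) (@md_continuous _ _ _ _ k)).
Qed.

Lemma star_id (R : realType) (A : topologicalType) : star R (@id A).
Proof.
split=> [b|n a b ca cb ab]; first by exists b, (fun=> b); split => // t; ct.
exists b, (fun z => b z.1); split => //.
- by move=> x /ab <-.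
- exact: (comp_continuous (@fst_continuous _ _) cb).
Qed.

Section Atlas.
Variables (R : realType) (h : bool) (Z : mdspace R h).
Local Notation I := (unit_interval R).
Local Notation H := (cat_flow Z).
Local Notation PZ a b := (@path_space R h Z (set_val (a : fstate H)) (set_val (b : fstate H))).

Definition aspace : space R h :=
  Space (kprod_in_Top (carrierP (underlying Z)) (carrierP (rspace H))).

Definition amk (x : underlying Z) (p : rpoint H) : aspace := (x, p).

(* [e] supplies a parametrization of [g], hence a representative [d] of its class modulo
   reparametrization. *)
Definition adiv (g : I -> underlying Z) (e : I -> rpoint H) :=
  exists2 d : I -> underlying Z, execution d & g = d \o nclock e.

Definition alabel (g : I -> underlying Z) (e : I -> rpoint H) :=
  exists (a b : fstate H) (p : PZ a b), path_fun p = g /\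
    rlabel e = @larrow R h H a b (cat_pi p).

Definition aexec : set (I -> aspace) := [set w |
  [/\ rexec (snd \o w), adiv (fst \o w) (snd \o w) & alabel (fst \o w) (snd \o w)]].

Definition astate (a : fstate H) : aspace := amk (set_val a) (rstate a).

Lemma cat_pi_comp (a b : underlying Z) (p q : @path_space R h Z a b) phi :
  reparametrization phi -> path_fun q = path_fun p \o phi -> cat_pi q = cat_pi p.
Proof. by move=> rphi qE; apply/esym/topquot_pi_eq; exists phi. Qed.

Lemma alabel_comp g e phi : rexec e -> alabel g e -> reparametrization phi ->
  alabel (g \o phi) (e \o phi).
Proof.
move=> ee [a [b [p [pE lE]]]] rphi.
have s0 : (path_fun p \o phi) i0 = set_val a by rewrite /= reparam0 // path_src.
have s1 : (path_fun p \o phi) i1 = set_val b by rewrite /= reparam1 // path_tgt.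
exists a, b, (mk_path (execution_reparam (path_exec p) rphi) s0 s1).
split; first by rewrite mk_pathK pE.
by rewrite rlabel_comp // lE (@cat_pi_comp _ _ p _ phi).
Qed.

Lemma aexec_ends w : aexec w -> exists a b, w i0 = astate a /\ w i1 = astate b.
Proof.
move=> [ee _ [a [b [p [pE lE]]]]]; have [e0 e1] := rexec_label ee lE; exists a, b.
have g0 : (w i0).1 = set_val a by rewrite -(path_src p) pE.
have g1 : (w i1).1 = set_val b by rewrite -(path_tgt p) pE.
by split; rewrite [LHS]surjective_pairing /astate; [rewrite -g0 -e0|rewrite -g1 -e1].
Qed.

Lemma aexec_fst w : aexec w -> execution (fst \o w).
Proof. by move=> [_ _ [a [b [p [<- _]]]]]; exact: path_exec. Qed.

Definition atlas : mdspace R h.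
Proof.
refine (@MdSpace R h aspace (range astate) aexec _ _ _ _ _).
- move=> w ew; have cw := execution_continuous (aexec_fst ew); have [[ce _] _ _] := ew.
  have cp := @kpair_continuous R _ _ _ _ _ (@unit_interval_delta R) cw ce.
  by apply: eq_cont cp => t; rewrite /= -surjective_pairing.
- by move=> w /aexec_ends[a [b [-> _]]]; exists a.
- by move=> w /aexec_ends[a [b [_ ->]]]; exists b.
- move=> w phi [ee [d ed dE] al] rphi; split.
  + have [ce [Q [run ck]]] := ee; split; first exact: (comp_continuous (reparam_continuous rphi) ce).
    by do 2!eexists; exact: clocked_reparam ck.
  + exists d => //; apply/funext => t; rewrite [RHS]/= (nclock_comp _ ee rphi).
    exact: (congr1 (@^~ (phi t)) dE).
  + exact: (alabel_comp ee al rphi).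
- move=> w1 w2 [ee1 [d1 ed1 dE1] al1] [ee2 [d2 ed2 dE2] al2] w12.
  have e12 : (snd \o w1) i1 = (snd \o w2) i0 by rewrite /= w12.
  have n1 := reparam1 (nclock_reparam ee1); have n2 := reparam0 (nclock_reparam ee2).
  have d12 : d1 i1 = d2 i0.
    have := congr1 (@^~ i1) dE1; have := congr1 (@^~ i0) dE2; rewrite /= n1 n2 => <- <-.
    by rewrite w12.
  split; rewrite !ncomp_comp.
  + have [c1 [Q1 [run1 k1]]] := ee1; have [c2 [Q2 [run2 k2]]] := ee2.
    split; first exact: ncomp_continuous.
    by exists (label_cat Q1 Q2), (run_cat run1 run2); exact: clocked_ncomp e12 k1 k2.
  + exists (ncomp d1 d2 \o cut (snd \o w1) (snd \o w2)).
      by apply: execution_reparam; [exact: execution_ncomp|exact: cut_reparam].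
    by rewrite dE1 dE2; apply/funext => t; exact: nclock_ncomp.
  + have [a1 [b1 [p1 [pE1 l1]]]] := al1; have [a2 [b2 [p2 [pE2 l2]]]] := al2.
    have [_ s1] := rexec_label ee1 l1; have [s2 _] := rexec_label ee2 l2.
    have ba : a2 = b1 by apply: (@rstate_inj _ _ H); rewrite -s1 -s2 e12.
    case: _ / ba in p1 pE1 l1 s1 *; exists a1, b2, (path_comp p1 p2); split.
      by rewrite path_compE pE1 pE2.
    by rewrite rlabel_ncomp // l1 l2 lmulAA /= cat_compE.
Defined.

Definition atlas_space : mdmap atlas Z.
Proof.
refine (@MdMap R h atlas Z fst _ _ _).
- exact: (@kfst_continuous R (underlying Z) (rspace H)).
- by move=> _ [a _ <-]; exact: set_valP.
- exact: aexec_fst.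
Defined.

Definition atlas_flow : mdmap atlas (emd H).
Proof.
refine (@MdMap R h atlas (emd H) snd _ _ _).
- exact: (@ksnd_continuous R (underlying Z) (rspace H)).
- by move=> _ [a _ <-]; exists a.
- by move=> w [].
Defined.

(** For [w <= 2] the normalized clock is merely slowed and the same [d] works. Afterwards it is
    [nu \o slow 1] with [nu] strictly increasing, hence invertible, and every slowed path is
    divisible by it. *)
Lemma adiv_straight w (g : I -> underlying Z) (e : I -> rpoint H) : execution g -> rexec e ->
  adiv g e -> adiv (g \o slow (cl w)) (straight w e).
Proof.
move=> eg ee [d ed dE]; have [ce [Q [run ck]]] := ee; have rs := slow_reparam (cl_itv w).
have ck' := clocked_straight w ce ck; have [ce' _] := straight_rexec w ee.
have u1 : 0 <= (1 : R) <= 1 by rewrite lexx ler01.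
have run0 t : 0 <= t <= 1 -> rclock e t = run t by exact: (rclockE ce ck).
have L0 := rclock_len ee; have L1 := rclock_len (straight_rexec w ee).
have r1 : rtime (slow (cl w)) 1 = 1 by exact: rtime1.
have nE t : set_val (nclock (straight w e) t) =
    ((1 - cl (w - 2)) * run (set_val (slow (cl w) t)) + cl (w - 2) * tau (set_val t)) /
    ((1 - cl (w - 2)) * run 1 + cl (w - 2)).
  rewrite set_val_nclock; last exact: straight_rexec.
  rewrite !(rclockE ce' ck') ?itv01P // /mixrun r1 set_val_rtime (@tau_r _ 1) ?mulr1 //; lra.
have [w2|w2] := leP w 2.
  exists d => //; rewrite dE; apply/funext => t /=; congr d; apply: unit_eq; rewrite nE.
  have -> : cl (w - 2) = 0 by apply: cl_le0; lra.
  by rewrite subr0 !mul1r !mul0r !addr0 set_val_nclock // !run0 ?itv01P.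
have cw : cl w = 1 by apply: cl_ge1; lra.
have [u0 u01] : 0 < cl (w - 2) /\ cl (w - 2) <= 1.
  split; last by case/andP: (cl_itv (w - 2)).
  by rewrite /cl lt_max; apply/orP; right; rewrite lt_min ltr01; lra.
set u := cl (w - 2) in nE u0 u01; set L := _ + u in nE.
(* The summand [u * set_val s] makes [nu] strictly increasing although [run] may stand still. *)
pose nu (s : I) : I := proj_unit (((1 - u) * run (set_val s) + u * set_val s) / L).
have u01' : 0 <= (1 : R) <= 1 by rewrite lexx ler01.
have Lrun : 0 < run 1 by rewrite -run0.
have L2 : 0 < L by rewrite /L ltr_wpDl // mulr_ge0 ?subr_ge0 // ltW.
have nslow t : nclock (straight w e) t = nu (slow 1 t).
  apply: unit_eq; rewrite nE cw /nu -set_val_slow1 proj_unitK //.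
  by have := itv01P (nclock (straight w e) t); rewrite nE cw -set_val_slow1.
have vnu s : set_val (nu s) = ((1 - u) * run (set_val s) + u * set_val s) / L.
  have [_ /(_ s)[t <-]] := @slow_reparam R 1 u01'.
  by rewrite -nslow nE cw -set_val_slow1.
have snu s t : set_val s < set_val t -> set_val (nu s) < set_val (nu t).
  move=> st; rewrite !vnu ltr_pM2r ?invr_gt0 // ler_ltD //.
    by rewrite ler_wpM2l ?subr_ge0 //; apply: (ck_mono ck); exact: ltW.
  by rewrite ltr_pM2l.
have rnu : reparametrization nu.
  split=> [s t|t].
    by rewrite le_eqVlt => /orP[/eqP/unit_eq ->//|/snu/ltW].
  have [_ /(_ t)[s <-]] := nclock_reparam (straight_rexec w ee).
  by exists (slow 1 s); rewrite nslow.
have inu : injective nu.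
  move=> s t st; apply: unit_eq; apply/eqP; rewrite eq_le !leNgt.
  by apply/andP; split; apply/negP => /snu; rewrite st ltxx.
have [mu [rmu muK]] := reparam_inverse rnu inu.
exists (g \o mu); first exact: execution_reparam.
by apply/funext => t /=; rewrite cw nslow muK.
Qed.

Section Paths.
Variables a b : fstate H.
Local Notation PA := (@path_space R h atlas (astate a) (astate b)).
Local Notation PE := (@path_space R h (emd H) (rstate a) (rstate b)).
Local Notation pspace := (@path_map R h atlas Z atlas_space (astate a) (astate b)).
Local Notation pflow := (@path_map R h atlas (emd H) atlas_flow (astate a) (astate b)).

Lemma atlas_plabel (w : PA) : plabel (erefl (rstate a)) (erefl (rstate b)) (pflow w) =
  cat_pi (pspace w).
Proof.
apply: larrow_inj; rewrite -plabelE; have [ee _ [a' [b' [p [pE lE]]]]] := path_exec w.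
rewrite [LHS]lE; have [e0 e1] := rexec_label ee lE.
have ea : a = a' by apply: (@rstate_inj _ _ H); rewrite -e0 /= (path_src w).
have eb : b = b' by apply: (@rstate_inj _ _ H); rewrite -e1 /= (path_tgt w).
case: _ / ea in p pE lE e0 *; case: _ / eb in p pE lE e1 *.
by have -> : p = pspace w by exact: path_fun_inj.
Qed.

Lemma aexec_mk (g : PZ a b) (e : PE) : adiv (path_fun g) (path_fun e) ->
  rlabel (path_fun e) = @larrow R h H a b (cat_pi g) ->
  aexec (fun t => amk (path_fun g t) (path_fun e t)).
Proof. by move=> ad al; split => //; [exact: (path_exec e)|exists a, b, g]. Qed.

Lemma amk_end (g : PZ a b) (e : PE) :
  amk (path_fun g i0) (path_fun e i0) = astate a /\ amk (path_fun g i1) (path_fun e i1) = astate b.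
Proof. by rewrite !path_src !path_tgt. Qed.

Definition apath (g : PZ a b) (e : PE) (ad : adiv (path_fun g) (path_fun e))
    (al : rlabel (path_fun e) = @larrow R h H a b (cat_pi g)) : PA :=
  mk_path (aexec_mk ad al : execution ((fun t => amk (path_fun g t) (path_fun e t)) : I -> underlying atlas))
    (amk_end g e).1 (amk_end g e).2.

Lemma pspace_apath g e ad al : pspace (@apath g e ad al) = g.
Proof. exact: path_fun_inj. Qed.

Lemma pflow_apath g e ad al : pflow (@apath g e ad al) = e.
Proof. exact: path_fun_inj. Qed.

Lemma apath_eq (w w' : PA) : pspace w = pspace w' -> pflow w = pflow w' -> w = w'.
Proof.
move=> ws wf; apply: path_fun_inj; apply/funext => t.
have e1 : (path_fun w t).1 = (path_fun w' t).1 := congr1 (fun p => path_fun p t) ws.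
have e2 : (path_fun w t).2 = (path_fun w' t).2 := congr1 (fun p => path_fun p t) wf.
by rewrite [LHS]surjective_pairing [RHS]surjective_pairing e1 e2.
Qed.

Lemma apath_continuous n (f : 'rV[R]_n -> PA) : continuous (pspace \o f) -> continuous (pflow \o f) ->
  continuous f.
Proof.
move=> c1 c2; apply: path_curry; first exact: rV_delta.
have cp := @kpair_continuous R _ _ _ _ _ (@rV_I_delta R n) (path_eval c1) (path_eval c2).
by apply: eq_cont cp => z; rewrite [LHS]surjective_pairing.
Qed.

Definition slow_path (v : R) (g : PZ a b) : PZ a b :=
  let rs := slow_reparam (cl_itv v) in
  mk_path (execution_reparam (path_exec g) rs)
    (etrans (congr1 (path_fun g) (reparam0 rs)) (path_src g))
    (etrans (congr1 (path_fun g) (reparam1 rs)) (path_tgt g)).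

Lemma slow_pathE v g : path_fun (slow_path v g) = path_fun g \o slow (cl v).
Proof. by []. Qed.

Lemma cat_pi_slow v g : cat_pi (slow_path v g) = cat_pi g.
Proof. by apply: cat_pi_comp (slow_pathE v g); exact: slow_reparam (cl_itv v). Qed.

Lemma slow_path_hcont : hcont (fun t => slow_path (3 * t)).
Proof.
move=> n g v cg cv; apply: path_curry; first exact: rV_delta.
have c1 := path_eval cg; have ccl := @cl_continuous R.
have c2 : continuous (fun z : 'rV[R]_n * I => (z.1, slow (cl (3 * v z.1)) z.2)).
  by rewrite /slow => z; ct.
exact: (comp_continuous c2 c1).
Qed.

Lemma slow_path0 g : slow_path (3 * 0) g = g.
Proof.
apply: path_fun_inj; rewrite slow_pathE mulr0 cl_le0 //.
by apply/funext => t /=; rewrite slow0.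
Qed.

Lemma slow_path1 g : slow_path (3 * 1) g = slow_path 1 g.
Proof. by apply: path_fun_inj; rewrite !slow_pathE !cl_ge1 //; lra. Qed.

Lemma edge_adiv (g : PZ a b) : adiv (path_fun (slow_path 1 g)) (edge (cat_pi g : fpath a b)).
Proof.
exists (path_fun g); first exact: path_exec.
apply/funext => t; rewrite slow_pathE cl_ge1 //=; congr path_fun; apply: unit_eq.
have [ce _] := edge_rexec (cat_pi g : fpath a b).
have ck := clocked_edge (cat_pi g : fpath a b).
have u1 : 0 <= (1 : R) <= 1 by rewrite lexx ler01.
rewrite set_val_slow1 set_val_nclock; last exact: edge_rexec.
by rewrite !(rclockE ce ck) ?itv01P // (@tau_r _ 1) ?divr1 //; lra.
Qed.

(** The clock of a standard edge is [tau], that is [slow 1]; so the slowed path is divisible by it,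
    with [g] itself as quotient. *)
Definition alift (g : PZ a b) : PA :=
  @apath (slow_path 1 g) (edge_path (erefl (rstate a)) (erefl (rstate b)) (cat_pi g))
    (edge_adiv g) (etrans (rlabel_edge (cat_pi g : fpath a b))
      (congr1 (@larrow R h H a b) (esym (cat_pi_slow 1 g)))).

Lemma alift_continuous : continuous alift.
Proof.
have [dP _] := @path_space_in_Top R h Z (set_val a) (set_val b).
apply: (rV_test dP) => n u cu; apply: apath_continuous.
  have c1 : continuous (fun _ : 'rV[R]_n => 1 : R) by move=> x; ct.
  have := slow_path_hcont cu c1; apply: eq_cont => x.
  by rewrite [LHS]pspace_apath slow_path1.
have c1 := @topquot_pi_continuous R h _ (@reparam_rel R h Z (set_val a) (set_val b)).
have c2 := @edge_path_continuous R h H _ _ _ _ (erefl (rstate a)) (erefl (rstate b)).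
apply: eq_cont (comp_continuous cu (comp_continuous c1 c2)) => x.
by rewrite [LHS]pflow_apath.
Qed.

Lemma astraight_adiv v (w : PA) :
  adiv (path_fun (slow_path v (pspace w))) (path_fun (straight_path v (pflow w))).
Proof.
have [ee ad _] := path_exec w; apply: adiv_straight => //; exact: (path_exec (pspace w)).
Qed.

Lemma astraight_label v (w : PA) :
  rlabel (path_fun (straight_path v (pflow w))) =
  @larrow R h H a b (cat_pi (slow_path v (pspace w))).
Proof.
rewrite cat_pi_slow -atlas_plabel -plabelE.
have ee := path_exec (pflow w); have [ce [Q [run ck]]] := ee.
have [ce' _] := straight_rexec v ee.
by rewrite (rlabelE ce' (clocked_straight v ce ck)) rtime0 ?rtime1 ?(rlabelE ce ck) //;
  exact: slow_reparam (cl_itv v).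
Qed.

Definition astraight v (w : PA) : PA := apath (astraight_adiv v w) (astraight_label v w).

Lemma astraight_hcont : hcont (fun t => astraight (3 * t)).
Proof.
move=> n w v cw cv; apply: apath_continuous.
  have := slow_path_hcont (comp_continuous cw (@path_map_continuous _ _ _ _ atlas_space _ _)) cv.
  by apply: eq_cont => x; rewrite [LHS]pspace_apath.
have := straight_path_hcont (comp_continuous cw (@path_map_continuous _ _ _ _ atlas_flow _ _)) cv.
by apply: eq_cont => x; rewrite [LHS]pflow_apath.
Qed.

Lemma astraight0 w : astraight (3 * 0) w = w.
Proof.
by apply: apath_eq; rewrite ?pspace_apath ?pflow_apath ?slow_path0 ?straight_path0.
Qed.

Lemma astraight1 w : astraight (3 * 1) w = alift (pspace w).
Proof.
apply: apath_eq; rewrite ?pspace_apath ?pflow_apath ?slow_path1 //.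
by rewrite (straight_path1 (erefl _) (erefl _)) atlas_plabel.
Qed.

End Paths.

(** [astraight] deforms every path of [atlas] to the [alift] of its projection to [Z], so the
    projection on path spaces is compared by [star_deformation] with an identity map. *)
Lemma atlas_space_mdstar : mdstar atlas_space.
Proof.
split.
- by move=> x sx; exists (astate (SigSub (mem_set sx))); [exists (SigSub (mem_set sx))|].
- move=> _ _ [a _ <-] [a' _ <-] /= aa'; have -> // : a = a'; exact: val_inj.
- move=> _ _ [a _ <-] [b _ <-].
  have cid' (T : topologicalType) : continuous (@id T) by move=> x; exact: cvg_id.
  apply: (@star_deformation R _ _ _ _ _ id (@path_map R h atlas Z atlas_space (astate a) (astate b))
    id (@alift a b) (slow_path 1) (fun t => astraight (3 * t)) (fun t => slow_path (3 * t))).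
  + exact: path_map_continuous.
  + exact: cid'.
  + exact: alift_continuous.
  + have [dP _] := @path_space_in_Top R h Z (set_val a) (set_val b).
    apply: (rV_test dP) => n u cu.
    have c1 : continuous (fun _ : 'rV[R]_n => 1 : R) by move=> x; ct.
    by have := slow_path_hcont cu c1; apply: eq_cont => x /=; rewrite slow_path1.
  + exact: astraight_hcont.
  + exact: slow_path_hcont.
  + exact: astraight0.
  + exact: astraight1.
  + exact: slow_path0.
  + exact: slow_path1.
  + by move=> g; rewrite [LHS]pspace_apath.
  + by [].
  + by move=> t w; rewrite [LHS]pspace_apath.
  + exact: star_id.
Qed.

(** The same deformation compares the projection to [emd] with the quotient map [cat_pi], whence the
    hypothesis on the latter. *)
Lemma atlas_flow_mdstar : (forall a b : fstate H, star R (@cat_pi R h Z (set_val a) (set_val b))) ->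
  mdstar atlas_flow.
Proof.
move=> cs; split.
- by move=> _ [a _ <-]; exists (astate a); [exists a|].
- by move=> _ _ [a _ <-] [a' _ <-] /= /(@rstate_inj _ _ H) ->.
- move=> _ _ [a _ <-] [b _ <-]; pose ea := erefl (rstate a); pose eb := erefl (rstate b).
  apply: (@star_deformation R _ _ _ _ _ (@cat_pi R h Z (set_val a) (set_val b))
    (@path_map R h atlas Z atlas_space (astate a) (astate b)) (plabel ea eb) (@alift a b)
    (edge_path ea eb) (fun t => astraight (3 * t)) (fun t => straight_path (3 * t))).
  + exact: (@path_map_continuous R h Z atlas atlas_space (astate a) (astate b)).
  + exact: plabel_continuous.
  + exact: alift_continuous.
  + exact: (@edge_path_continuous R h H _ _ a b ea eb).
  + exact: astraight_hcont.
  + exact: straight_path_hcont.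
  + exact: astraight0.
  + exact: astraight1.
  + exact: straight_path0.
  + exact: straight_path1.
  + by move=> g; rewrite [LHS]pflow_apath.
  + exact: atlas_plabel.
  + by move=> t w; rewrite [LHS]pflow_apath.
  + exact: cs.
Qed.

End Atlas.

(** * Deformation of execution paths onto their classes modulo reparametrization *)

Section CatPi.
Variables (R : realType) (h : bool) (Z : mdspace R h).
Local Notation I := (unit_interval R).
Local Notation H := (cat_flow Z).
Variables (g : mdmap Z (atlas Z)) (K : I -> underlying Z -> underlying Z).
Hypotheses (cK : continuous (fun z : underlying Z * I => K z.2 z.1)).
Hypotheses (K0 : K i0 = id) (K1 : K i1 = atlas_space Z \o g).
Hypotheses (eK : forall u e, execution e -> execution (K u \o e)).
Hypotheses (sK : forall u a, states a -> K u a = a).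
Variables a b : fstate H.
Local Notation P := (@path_space R h Z (set_val a) (set_val b)).
Implicit Types p q : P.

Definition pflow p : I -> rpoint H := atlas_flow Z \o g \o path_fun p.

Lemma pflow_rexec p : rexec (pflow p).
Proof. exact: (md_execution (atlas_flow Z) (md_execution g (path_exec p))). Qed.

Lemma pflow_start p q : pflow p i0 = pflow q i0.
Proof. by rewrite /pflow /= !path_src. Qed.

Lemma dpath_subproof p : exists d : P,
  forall t, path_fun d (nclock (pflow p) t) = atlas_space Z (g (path_fun p t)).
Proof.
have [_ [d ed dE] _] := md_execution g (path_exec p).
have dE' t : d (nclock (pflow p) t) = atlas_space Z (g (path_fun p t)).
  exact: (esym (congr1 (@^~ t) dE)).
have rn := nclock_reparam (pflow_rexec p).
have gE x : states x -> atlas_space Z (g x) = x by move=> sx; rewrite -[RHS](sK i1) // K1.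
have d0 : d i0 = set_val a.
  by rewrite -(reparam0 rn) dE' path_src gE //; exact: set_valP.
have d1 : d i1 = set_val b.
  by rewrite -(reparam1 rn) dE' path_tgt gE //; exact: set_valP.
by exists (mk_path ed d0 d1).
Qed.

(** The quotient of the path, moved by [g], by its natural clock. It is unique because the clock is
    surjective, and by [dpath_comp] it depends only on the class of [p] modulo reparametrization. *)
Definition dpath p : P := sval (cid (dpath_subproof p)).

Lemma dpathE p t : path_fun (dpath p) (nclock (pflow p) t) = atlas_space Z (g (path_fun p t)).
Proof. by rewrite /dpath; case: cid => d dE; exact: dE. Qed.

Lemma dpath_comp p q phi : reparametrization phi -> path_fun q = path_fun p \o phi ->
  dpath q = dpath p.
Proof.
move=> rphi qE; apply: path_fun_inj; apply/funext => s.
have [_ /(_ s)[t <-]] := nclock_reparam (pflow_rexec q); rewrite dpathE.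
have -> : pflow q = pflow p \o phi by rewrite /pflow qE.
by rewrite nclock_comp //; [rewrite dpathE qE|exact: pflow_rexec].
Qed.

(** The clock may stand still, so it has no continuous inverse to compose with. Compactness of [I]
    replaces it: each [t] either has clock value different from [r0], which persists nearby, or is
    sent to [r0], and then [dpathE] controls the image near [(s0, t)]. *)
Lemma dpath_continuous : continuous dpath.
Proof.
have [dP _] := @path_space_in_Top R h Z (set_val a) (set_val b).
apply: (rV_test dP) => n u cu; apply: path_curry; first exact: rV_delta.
have cp := path_eval cu; have cg := @md_continuous _ _ _ _ g.
have cf := @md_continuous _ _ _ _ (atlas_flow Z); have cs := @md_continuous _ _ _ _ (atlas_space Z).
have cG := comp_continuous cp (comp_continuous cg cs).
have cn := @nclock_plot_continuous R h H n (fun s => pflow (u s))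
  (comp_continuous cp (comp_continuous cg cf)) (fun s => pflow_rexec (u s))
  (fun s s' => pflow_start (u s) (u s')).
move=> [s0 r0] W nW.
have /compact_near_coveringP cov := @unit_interval_compact R.
pose Q (z : 'rV[R]_n * I) (t : I) : Prop := nclock (pflow (u z.1)) t = z.2 ->
  W (atlas_space Z (g (path_fun (u z.1) t))).
have H0 : \forall z \near (s0, r0), [set: I] `<=` Q z.
  apply: (cov ('rV[R]_n * I)%type (nbhs (s0, r0)) Q (nbhs_filter _)) => t _; have [E|ne] := pselect (nclock (pflow (u s0)) t = r0).
    have nW' : nbhs (s0, t) [set z : 'rV[R]_n * I | W (atlas_space Z (g (path_fun (u z.1) z.2)))].
      apply: (cG (s0, t)); change (nbhs (atlas_space Z (g (path_fun (u s0) t))) W).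
      by rewrite -dpathE E.
    have [[A B] [/= nA nB] AB] := nW'.
    exists (B, (A `*` setT)) => /=.
      by split=> //; exists (A, setT); [split => //; exact: filterT|].
    by move=> [t' [s r]] [/= Bt [As _]] _; exact: (AB (s, t')).
  pose D (z : I * ('rV[R]_n * I)) : R := set_val (nclock (pflow (u z.2.1)) z.1) - set_val z.2.2.
  have cD : continuous D.
    have c1 : continuous (fun z : I * ('rV[R]_n * I) => (z.2.1, z.1)) by ct.
    by have c2 := comp_continuous c1 cn; rewrite /D; ct.
  have D0 : D (t, (s0, r0)) != 0.
    by rewrite subr_eq0; apply/eqP => /unit_eq.
  have nD : \forall z \near (t, (s0, r0)), D z != 0.
    have := cD (t, (s0, r0)) [set x : R | x != 0]; apply.
    by apply: open_nbhs_nbhs; split; [exact: neq0_open|].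
  have [AB nAB sAB] := nD; exists AB => // z /sAB /= + E; rewrite /D E subrr eqxx.
  by [].
change (nbhs (s0, r0) [set z : 'rV[R]_n * I | W (path_fun (dpath (u z.1)) z.2)]).
apply: filterS H0 => -[s r] /= sub.
have [_ /(_ r)[t tr]] := nclock_reparam (pflow_rexec (u s)).
by rewrite -tr dpathE; exact: sub.
Qed.

Definition cmix (w : R) p (t : I) : I :=
  proj_unit ((1 - w) * set_val (nclock (pflow p) t) + w * set_val t).

Lemma cmix_reparam w p : 0 <= w <= 1 -> reparametrization (cmix w p).
Proof.
move=> /andP[w0 w1]; have rn := nclock_reparam (pflow_rexec p); apply: continuous_reparam.
- by have cn := reparam_continuous rn; rewrite /cmix; ct.
- move=> s t st; rewrite !set_val_proj_unit; apply: clmono; apply: lerD; apply: ler_wpM2l => //.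
    by rewrite subr_ge0.
  exact: rn.1.
- by rewrite /cmix reparam0 // set_val_i0 !mulr0 addr0.
- by rewrite /cmix reparam1 // set_val_i1 !mulr1 subrK.
Qed.

(** The first half uses [K] to reach [dpath p] composed with its clock; the second deforms the clock
    linearly to the identity. *)
Definition cdef (v : R) p (t : I) : underlying Z :=
  if v <= 2^-1 then K (proj_unit (2 * v)) (path_fun p t)
  else path_fun (dpath p) (cmix (cl (2 * v - 1)) p t).

Lemma cdef_exec v p : [/\ execution (cdef v p), cdef v p i0 = set_val a & cdef v p i1 = set_val b].
Proof.
rewrite /cdef; case: ifP => _.
  rewrite path_src path_tgt !sK; try exact: set_valP.
  by split => //; exact: eK (path_exec p).
have rm := cmix_reparam p (cl_itv (2 * v - 1)).
rewrite reparam0 // reparam1 // path_src path_tgt; split => //.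
exact: execution_reparam (path_exec (dpath p)) rm.
Qed.

Definition cdeform (v : R) p : P := let: And3 e1 e2 e3 := cdef_exec v p in mk_path e1 e2 e3.

Lemma cdeformE v p : path_fun (cdeform v p) = cdef v p.
Proof. by rewrite /cdeform; case: cdef_exec. Qed.

Lemma cdeform_hcont : hcont cdeform.
Proof.
move=> n u v cu cv; apply: path_curry; first exact: rV_delta.
have cp := path_eval cu; have cg := @md_continuous _ _ _ _ g.
have cf := @md_continuous _ _ _ _ (atlas_flow Z).
have cd := path_eval (comp_continuous cu dpath_continuous).
have cn := @nclock_plot_continuous R h H n (fun s => pflow (u s))
  (comp_continuous cp (comp_continuous cg cf)) (fun s => pflow_rexec (u s))
  (fun s s' => pflow_start (u s) (u s')).
apply: (eq_cont (g := fun z : 'rV[R]_n * I => if v z.1 <= 2^-1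
    then K (proj_unit (2 * v z.1)) (path_fun (u z.1) z.2)
    else path_fun (dpath (u z.1)) (cmix (cl (2 * v z.1 - 1)) (u z.1) z.2))).
  by move=> z; rewrite cdeformE.
have ccl := @cl_continuous R.
apply: (@paste R _ _ (fun z : 'rV[R]_n * I => v z.1)).
- by ct.
- move=> z _; move: z.
  have c1 : continuous (fun z : 'rV[R]_n * I => (path_fun (u z.1) z.2, proj_unit (2 * v z.1))).
    by move=> z; ct.
  exact: (comp_continuous c1 cK).
- move=> z _; move: z.
  have c1 : continuous (fun z : 'rV[R]_n * I => (z.1, cmix (cl (2 * v z.1 - 1)) (u z.1) z.2)).
    by move=> z; rewrite /cmix; ct.
  exact: (comp_continuous c1 cd).
- move=> z ->; rewrite mulfV ?pnatr_eq0 // subrr cl_le0 //.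
  rewrite -/i1 K1 /cmix subr0 mul1r mul0r addr0 set_valK01 dpathE //.
Qed.

Lemma cdeform0 p : cdeform 0 p = p.
Proof.
by apply: path_fun_inj; rewrite cdeformE /cdef invr_ge0 ler0n mulr0 -/i0 K0.
Qed.

Lemma cdeform1 p : cdeform 1 p = dpath p.
Proof.
apply: path_fun_inj; rewrite cdeformE; apply/funext => t; rewrite /cdef ifF; last by apply/negbTE; rewrite -ltNge; lra.
congr path_fun; rewrite cl_ge1; last by lra.
by rewrite /cmix subrr mul0r add0r mul1r set_valK01.
Qed.

Let cpi : continuous (@cat_pi R h Z (set_val a) (set_val b)).
Proof. exact: topquot_pi_continuous. Qed.

Let fixed_continuous v : continuous (cdeform v).
Proof.
have [dP _] := @path_space_in_Top R h Z (set_val a) (set_val b).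
apply: (rV_test dP) => n u cu; apply: cdeform_hcont => //.
by move=> x; ct.
Qed.

(** In the first half the deformation commutes with reparametrization. In the second every stage is
    a reparametrization of [dpath p], which depends only on the class of [p]. *)
Lemma cat_pi_cdeform v p q : cat_pi p = cat_pi q -> cat_pi (cdeform v p) = cat_pi (cdeform v q).
Proof.
apply: (@topquot_factor R h _ _ _ (fun p => cat_pi (cdeform v p))).
- exact: cat_path_in_Top.
- exact: (comp_continuous (@fixed_continuous v) cpi).
move=> {}p {}q [phi rphi qE]; have [v2|v2] := leP v 2^-1.
  apply/esym/(cat_pi_comp rphi); rewrite !cdeformE /cdef v2 qE //.
have dE r : cat_pi (cdeform v r) = cat_pi (dpath r).
  apply: (cat_pi_comp (cmix_reparam r (cl_itv (2 * v - 1)))).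
  by rewrite cdeformE /cdef leNgt v2.
by rewrite !dE (dpath_comp rphi qE).
Qed.

Lemma dpath_cat_pi p q : cat_pi p = cat_pi q -> dpath p = dpath q.
Proof.
apply: (@topquot_factor R h _ _ _ dpath).
- exact: path_space_in_Top.
- exact: dpath_continuous.
- by move=> {}p {}q [phi rphi qE]; exact/esym/(dpath_comp rphi).
Qed.

Let kb (v : R) (x : cat_path (set_val a) (set_val b)) := cat_pi (cdeform v (cat_repr x)).

Let kb_pi v p : kb v (cat_pi p) = cat_pi (cdeform v p).
Proof. by apply: cat_pi_cdeform; rewrite cat_reprK. Qed.

Let kb_hcont : hcont kb.
Proof.
(* [cat_pi] stays a quotient map after multiplication by the real line, so continuity may be checked
   before passing to classes. *)
have ck : continuous (fun z : kprod R (cat_path (set_val a) (set_val b)) R => kb z.2 z.1).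
  apply: (@quotient_prod_continuous R _ _ R _ (@cat_pi R h Z (set_val a) (set_val b)) (fun x v => kb v x)).
  - exact: kelley_delta.
  - by move=> x; exists (cat_repr x); rewrite cat_reprK.
  - by move=> A; exact: topquot_open.
  apply: (eq_cont (g := fun z : kprod R P R => cat_pi (cdeform z.2 z.1))).
    by move=> z; rewrite kb_pi.
  apply: (rV_test (@kelley_delta R _)) => n u cu.
  have c1 := comp_continuous cu (@kfst_continuous R _ _).
  have c2 := comp_continuous cu (@ksnd_continuous R _ _).
  exact: (comp_continuous (cdeform_hcont c1 c2) cpi).
move=> n x v cx cv.
have cp := @kpair_continuous R _ _ _ _ _ (@rV_delta R n) cx cv.
exact: (comp_continuous cp ck).
Qed.

(** [dpath] descends to classes and is a homotopy inverse of [cat_pi]; [cdeform] and the homotopy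
    [kb] induced on classes compare [cat_pi] with an identity map. *)
Lemma cat_pi_star : star R (@cat_pi R h Z (set_val a) (set_val b)).
Proof.
pose C := cat_path (set_val a) (set_val b).
have cs : continuous ((fun x => dpath (cat_repr x)) : C -> P).
  apply: (@topquot_continuous R h _ (@reparam_rel R h Z _ _)).
  by apply: eq_cont dpath_continuous => p /=; apply: dpath_cat_pi; exact: cat_reprK.
apply: (@star_deformation R _ _ C C _ id (@cat_pi R h Z _ _) id
  (fun x => dpath (cat_repr x)) (fun x => cat_pi (dpath (cat_repr x))) cdeform kb) => //.
- by move=> x; exact: cvg_id.
- exact: (comp_continuous cs cpi).
- exact: cdeform_hcont.
- exact: cdeform0.
- by move=> p; rewrite cdeform1 /=; apply: dpath_cat_pi; rewrite cat_reprK.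
- by move=> x; rewrite /kb cdeform0 cat_reprK.
- by move=> x; rewrite /kb cdeform1.
- exact: star_id.
Qed.

End CatPi.

Lemma qcofibrant_atlas_flow_mdstar (R : realType) (h : bool) (Z : mdspace R h) :
  @qcofibrant R h Z -> mdstar (atlas_flow Z).
Proof.
move=> qZ; have [g /homot_sym[K [cK K0 K1 eK sK]]] := mdstar_sur (mdmap_id Z) qZ (atlas_space_mdstar Z).
have sK' u x : states x -> K u x = x by move=> sx; rewrite sK // K0.
by apply: atlas_flow_mdstar => a b; exact: cat_pi_star cK K0 K1 eK sK' a b.
Qed.

(** * Action of zigzags *)

Section Zigzags.
Variables (R : realType) (h : bool).
Local Notation fcat := (FlowCat R h).
Local Notation weq := (@flow_weak_equivalence R h).
Local Notation I := (unit_interval R).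
Implicit Types (F G : flow R h) (W : mdspace R h).

(* The action of a zigzag of flows on homotopy classes of maps to [emd]: backward weak
   equivalences act through the bijections that they induce. *)
Fixpoint zact W F G (z : zigzag weq F G) : mdmap W (emd F) -> mdmap W (emd G) -> Prop :=
  match z in zigzag _ F G return mdmap W (emd F) -> mdmap W (emd G) -> Prop with
  | zz_nil _ => fun x y => homot x y
  | zz_fwd _ _ _ f z => fun x y => zact z (mdmap_comp x (emap f)) y
  | zz_bwd A B _ w _ z => fun x y => exists2 x' : mdmap W (emd B), homot (emap w \o x') x & zact z x' y
  end.

Lemma zact_homot W F G (z : zigzag weq F G) (x x' : mdmap W (emd F)) (y y' : mdmap W (emd G)) :
  homot x' x -> homot y y' -> zact z x y -> zact z x' y'.
Proof.
elim: z x x' y y' => [A|A B D f z IH|A B D w Ww z IH] x x' y y' xx yy /=.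
- by move=> xy; apply: homot_trans yy; exact: homot_trans xy.
- by apply: IH => //; exact: homot_postcomp.
- by move=> [x1 e1 zy]; exists x1; [exact: homot_trans (homot_sym xx)|exact: IH (homot_refl x1) yy zy].
Qed.

Lemma zact_total W F G (z : zigzag weq F G) (x : mdmap W (emd F)) : @qcofibrant R h W ->
  exists y, zact z x y.
Proof.
move=> qW; elim: z x => [A|A B D f z IH|A B D w Ww z IH] x /=.
- by exists x; exact: homot_refl.
- exact: IH.
- by have [x' e] := mdstar_sur x qW (emap_mdstar Ww); have [y zy] := IH x'; exists y, x'.
Qed.

Lemma zact_cat W F G K (z : zigzag weq F G) (z' : zigzag weq G K) (x : mdmap W (emd F)) y y' :
  zact z x y -> zact z' y y' -> zact (zz_cat z z') x y'.
Proof.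
elim: z z' x y => [A|A B D f z IH|A B D w Ww z IH] z' x y /=.
- by move=> xy; apply: zact_homot => //; exact: homot_refl.
- exact: IH.
- by move=> [x' e zy] zy'; exists x' => //; exact: IH zy zy'.
Qed.

Lemma zact_precomp W W' F G (z : zigzag weq F G) (k : mdmap W' W) (x : mdmap W (emd F)) y :
  zact z x y -> zact z (mdmap_comp k x) (mdmap_comp k y).
Proof.
elim: z x y => [A|A B D f z IH|A B D w Ww z IH] x y /=.
- exact: homot_precomp.
- by move/IH; apply: zact_homot; exact: homot_refl.
- by move=> [x' e zy]; exists (mdmap_comp k x'); [exact: (homot_precomp k e)|exact: IH].
Qed.

(** The relations [zz_fwd_bwd] and [zz_bwd_fwd] hold by the uniqueness and the existence of lifts up
    to homotopy along [emap]; the relations on forward maps hold by functoriality. *)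
Lemma zact_eq W F G (z z' : zigzag weq F G) : @qcofibrant R h W -> zz_eq z z' ->
  forall (x : mdmap W (emd F)) y, zact z x y <-> zact z' x y.
Proof.
move=> qW; elim=> {F G z z'}.
- by [].
- by move=> A B z z' _ IH x y; split => /IH.
- by move=> A B z1 z2 z3 _ IH1 _ IH2 x y; rewrite IH1.
- by move=> A B D f z z' _ IH x y; exact: IH.
- by move=> A B D w Ww z z' _ IH x y; split => /= -[x' e /IH]; exists x'.
- move=> A B z x y /=; have e : mdmap_comp x (emap (flowmap_id A)) = x.
    by apply: mdmap_eq; apply/funext => t; exact: rmap_id.
  by rewrite e.
- move=> A B D K f k z x y /=.
  suff -> : mdmap_comp (mdmap_comp x (emap f)) (emap k) =
      mdmap_comp x (emap (flowmap_comp f k)) by [].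
  by apply: mdmap_eq; apply/funext => t; exact/esym/rmap_comp.
- move=> A B D w Ww z x y /=; split=> [[x' e zy]|zy]; last by exists x => //; exact: (homot_refl (mdmap_comp x (emap w))).
  by apply: zact_homot (homot_refl y) zy; apply: homot_sym; exact: (mdstar_inj qW (emap_mdstar Ww)).
- move=> A B D w Ww z x y /=; split=> [[x' e zy]|zy].
    by apply: zact_homot (homot_refl y) zy; exact: homot_sym.
  have [x' e] := mdstar_sur x qW (emap_mdstar Ww); exists x' => //.
  by apply: zact_homot zy; [exact: e|exact: homot_refl].
Qed.

(** The correspondence of homotopy classes through [atlas Z], kept as a relation. The lemmas
    [chart_total], [chart_surj], [chart_flow] and [chart_space] make it bijective for q-cofibrant
    [W] and [Z]. *)
Definition chart W Z (g : mdmap W Z) (x : mdmap W (emd (cat_flow Z))) :=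
  exists a : mdmap W (atlas Z), homot (atlas_space Z \o a) g /\ homot (atlas_flow Z \o a) x.

Lemma chart_total W Z (g : mdmap W Z) : @qcofibrant R h W -> exists x, chart g x.
Proof.
move=> qW; have [a ag] := mdstar_sur g qW (atlas_space_mdstar Z).
exists (mdmap_comp a (atlas_flow Z)), a; split => //.
exact: (homot_refl (mdmap_comp a (atlas_flow Z))).
Qed.

Lemma chart_surj W Z (x : mdmap W (emd (cat_flow Z))) : @qcofibrant R h W ->
  @qcofibrant R h Z -> exists g : mdmap W Z, chart g x.
Proof.
move=> qW qZ; have [a ax] := mdstar_sur x qW (qcofibrant_atlas_flow_mdstar qZ).
exists (mdmap_comp a (atlas_space Z)), a; split => //.
exact: (homot_refl (mdmap_comp a (atlas_space Z))).
Qed.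

Lemma chart_flow W Z (g : mdmap W Z) x x' : @qcofibrant R h W -> chart g x -> chart g x' ->
  homot x x'.
Proof.
move=> qW [a [ag ax]] [a' [ag' ax']].
have aa : homot a a'.
  by apply: (mdstar_inj qW (atlas_space_mdstar Z)); exact: homot_trans (homot_sym ag').
apply: homot_trans (homot_sym ax) _; apply: homot_trans ax'.
exact: (homot_postcomp (atlas_flow Z) aa).
Qed.

Lemma chart_space W Z (g g' : mdmap W Z) x x' : @qcofibrant R h W -> @qcofibrant R h Z ->
  chart g x -> chart g' x' -> homot x x' -> homot g g'.
Proof.
move=> qW qZ [a [ag ax]] [a' [ag' ax']] xx.
have aa : homot a a'.
  apply: (mdstar_inj qW (qcofibrant_atlas_flow_mdstar qZ)).
  by apply: homot_trans ax _; apply: homot_trans xx _; exact: homot_sym.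
apply: homot_trans (homot_sym ag) _; apply: homot_trans ag'.
exact: (homot_postcomp (atlas_space Z) aa).
Qed.

Lemma chart_precomp W W' Z (k : mdmap W' W) (g : mdmap W Z) x : chart g x ->
  chart (mdmap_comp k g) (mdmap_comp k x).
Proof.
move=> [a [ag ax]]; exists (mdmap_comp k a).
by split; [exact: (homot_precomp k ag)|exact: (homot_precomp k ax)].
Qed.

(** The Yoneda device: [f] corresponds to the image of the identity of [Z] under the action of
    [z]. *)
Definition transport Z Z' (z : zigzag weq (cat_flow Z) (cat_flow Z')) (f : mdmap Z Z') :=
  exists x y, [/\ chart (mdmap_id Z) x, zact z x y & chart f y].

Lemma transport_total Z Z' (z : zigzag weq (cat_flow Z) (cat_flow Z')) :
  @qcofibrant R h Z -> @qcofibrant R h Z' -> exists f, transport z f.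
Proof.
move=> qZ qZ'; have [x cx] := chart_total (mdmap_id Z) qZ.
have [y zy] := zact_total z x qZ; have [f cf] := chart_surj y qZ qZ'.
by exists f, x, y.
Qed.

(** By naturality in the source, [zact_precomp] and [chart_precomp], the composite corresponds to
    the identity acted upon by [zz_cat z z']; this zigzag acts trivially by [zact_eq], and
    [chart_space] concludes. *)
Lemma transport_inverse Z Z' (z : zigzag weq (cat_flow Z) (cat_flow Z'))
    (z' : zigzag weq (cat_flow Z') (cat_flow Z)) f f' : @qcofibrant R h Z ->
  zz_eq (zz_cat z z') (zz_nil weq (cat_flow Z)) -> transport z f -> transport z' f' ->
  homot (f' \o f) id.
Proof.
move=> qZ zzE [x [y [cx zy cf]]] [x' [y' [cx' zy' cf']]].
have cx1 := chart_precomp f cx'; have cf1 := chart_precomp f cf'.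
have ef : mdmap_comp f (mdmap_id Z') = f by exact: mdmap_eq.
rewrite ef in cx1.
have yx := chart_flow qZ cf cx1.
have zy1 := zact_precomp f zy'.
have zy2 := zact_homot yx (homot_refl _) zy1.
have /(zact_eq qZ zzE)/= xy := zact_cat zy zy2.
exact: (chart_space qZ qZ cf1 cx (homot_sym xy)).
Qed.

Lemma homot_homotopic (X Y : mdspace R h) (f g : underlying X -> underlying Y) :
  @homot R h X Y f g -> homotopic R f g.
Proof.
move=> [K [cK <- <- _ _]]; exists (fun z => K z.2 z.1); split => //.
have ck := @kelley_id_continuous R (underlying X * I)%type.
exact: (comp_continuous ck cK).
Qed.

Lemma ho_isomorphic_homotopy_equivalent (Z Z' : mdspace R h) : @qcofibrant R h Z ->
  @qcofibrant R h Z' -> ho_isomorphic (cat_flow Z) (cat_flow Z') ->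
  homotopy_equivalent R (underlying Z) (underlying Z').
Proof.
move=> qZ qZ' [z [z' [zz zz']]].
have [f tf] := transport_total z qZ qZ'; have [f' tf'] := transport_total z' qZ' qZ.
exists f, f'; split; try exact: md_continuous.
  by apply: homot_homotopic; exact: (transport_inverse qZ zz tf tf').
by apply: homot_homotopic; exact: (transport_inverse qZ' zz' tf' tf).
Qed.

End Zigzags.

(** * Homotopy equivalences of spaces *)

Section HomotopyEquivalences.
Variable R : realType.
Local Notation I := (unit_interval R).
Implicit Types A B C : topologicalType.

Lemma homotopic_precomp A B C (k : A -> B) (f g : B -> C) : continuous k ->
  homotopic R f g -> homotopic R (f \o k) (g \o k).
Proof.
move=> ck [K [cK K0 K1]]; exists (fun z => K (k z.1, z.2)); split => //.
have cp : continuous (fun z : kprod R A I => (k z.1, z.2) : kprod R B I).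
  apply: kpair_continuous; first exact: kelley_delta.
    exact: (comp_continuous (@kfst_continuous R _ _) ck).
  exact: ksnd_continuous.
exact: (comp_continuous cp cK).
Qed.

Lemma homotopic_postcomp A B C (k : B -> C) (f g : A -> B) : continuous k ->
  homotopic R f g -> homotopic R (k \o f) (k \o g).
Proof.
move=> ck [K [cK K0 K1]]; exists (k \o K); split; first exact: (comp_continuous cK ck).
- by move=> a /=; rewrite K0.
- by move=> a /=; rewrite K1.
Qed.

Lemma homotopic_trans A B (f g k : A -> B) :
  homotopic R f g -> homotopic R g k -> homotopic R f k.
Proof.
move=> [K [cK K0 K1]] [K' [cK' K0' K1']].
have ct1 := @ksnd_continuous R A I; have ct0 := @kfst_continuous R A I.
exists (fun z => if set_val z.2 <= 2^-1 then K (z.1, proj_unit (2 * set_val z.2))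
  else K' (z.1, proj_unit (2 * set_val z.2 - 1))); split.
- apply: (@paste R _ _ (fun z : kprod R A I => set_val z.2)).
  + by move=> z; apply: ct_val; exact: ct1.
  + move=> z _; move: z; have c1 : continuous (fun z : kprod R A I => proj_unit (2 * set_val z.2) : I).
      by have c2 : continuous (fun t : I => proj_unit (2 * set_val t) : I);
        [move=> t; ct|exact: (comp_continuous ct1 c2)].
    have cp := @kpair_continuous R _ _ _ _ _ (@kelley_delta R _) ct0 c1.
    exact: (comp_continuous cp cK).
  + move=> z _; move: z; have c1 : continuous (fun z : kprod R A I => proj_unit (2 * set_val z.2 - 1) : I).
      by have c2 : continuous (fun t : I => proj_unit (2 * set_val t - 1) : I);
        [move=> t; ct|exact: (comp_continuous ct1 c2)].
    have cp := @kpair_continuous R _ _ _ _ _ (@kelley_delta R _) ct0 c1.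
    exact: (comp_continuous cp cK').
  + by move=> [a t] /= ->; rewrite mulfV ?pnatr_eq0 // subrr -/i0 -/i1 K1 K0'.
- by move=> a; rewrite /= set_val_i0 invr_ge0 ler0n mulr0 -/i0.
- move=> a; rewrite /= set_val_i1 ifF.
    by rewrite (_ : 2 * 1 - 1 = 1) -/i1 //; lra.
  by apply/negbTE; rewrite -ltNge; lra.
Qed.

Lemma homotopy_equivalent_trans A B C : homotopy_equivalent R A B ->
  homotopy_equivalent R B C -> homotopy_equivalent R A C.
Proof.
move=> [f [g [cf cg gf fg]]] [f' [g' [cf' cg' gf' fg']]]; exists (f' \o f), (g \o g').
split; [exact: (comp_continuous cf cf')|exact: (comp_continuous cg' cg)| |].
  apply: homotopic_trans gf; have := homotopic_postcomp cg (homotopic_precomp cf gf').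
  exact.
apply: homotopic_trans fg'; have := homotopic_postcomp cf' (homotopic_precomp cg' fg).
exact.
Qed.

Lemma homotopy_equivalent_sym A B : homotopy_equivalent R A B -> homotopy_equivalent R B A.
Proof. by move=> [f [g [cf cg gf fg]]]; exists g, f. Qed.

Lemma homeomorphic_equivalent A B (f : A -> B) (g : B -> A) : continuous f -> continuous g ->
  cancel f g -> cancel g f -> homotopy_equivalent R A B.
Proof.
move=> cf cg fK gK; exists f, g; split => //.
  exists fst; split=> [|a|a]; [exact: kfst_continuous|by rewrite /= fK|by []].
exists fst; split=> [|a|a]; [exact: kfst_continuous|by rewrite /= gK|by []].
Qed.

End HomotopyEquivalences.

(** * Cellular objects are cofibrant *)

Section WellOrder.
Variables (L : Type) (le : rel L).
Hypothesis wo : wochoice.well_order le.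

Lemma wo_min (P : L -> Prop) : (exists x, P x) ->
  exists2 x, P x & (forall y, P y -> le x y) /\
    forall x', P x' -> (forall y, P y -> le x' y) -> x = x'.
Proof.
move=> [x0 Px0]; have [|x [[Px xm] xu]] := wo (A := [pred x | `[< P x >]]).
  by exists x0; exact/asboolP.
exists x; first exact/asboolP.
split=> [y Py|x' Px' xm']; first by apply: xm; exact/asboolP.
apply: xu; split; first exact/asboolP.
by move=> y /asboolP; exact: xm'.
Qed.

Lemma wo_refl i : le i i.
Proof. by have [|x -> [xm _]] := @wo_min (eq^~ i); [exists i|exact: xm]. Qed.

Lemma wo_total i j : le i j \/ le j i.
Proof.
have [|x [->|->] [xm _]] := @wo_min (fun k => k = i \/ k = j); first by exists i; left.
- by left; apply: xm; right.
- by right; apply: xm; left.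
Qed.

Lemma wo_anti i j : le i j -> le j i -> i = j.
Proof.
move=> ij ji; have [|x _ [_ xu]] := @wo_min (fun k => k = i \/ k = j); first by exists i; left.
have <- : x = i by apply: xu; [left|move=> y [->|->] //; exact: wo_refl].
by apply: xu; [right|move=> y [->|->] //; exact: wo_refl].
Qed.

Lemma strictly_wf : well_founded (strictly le).
Proof.
move=> i; apply: contrapT => ni.
have [|x nx [xm _]] := @wo_min (fun k => ~ Acc (strictly le) k); first by exists i.
apply: nx; split=> y [yx ne]; apply: contrapT => ny; apply: ne.
by apply: wo_anti => //; exact: xm.
Qed.

End WellOrder.

Section CellCof.
Variables (C : category) (K : mor_class C).
Arguments compm {c A B D}.

Section Recursion.
Variables (L : Type) (le : rel L) (bot : L) (D : L -> C).
Variables (d : forall i j, le i j -> hom (D i) (D j)).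
Hypotheses (wo : wochoice.well_order le) (botP : forall i, le bot i).
Hypotheses (df : is_functor d).
Hypothesis dsucc : forall i j (lij : le i j), is_successor le i j -> pushout_of K (d lij).
Hypothesis dlim : forall j, j <> bot -> (forall i, ~ is_successor le i j) ->
  is_colimit d (fun i (lij : strictly le i j) => d (strictlyW lij)).
Variables (Y X0 Y0 : C) (c : forall i, True -> hom (D i) Y) (p : hom X0 Y0).
Hypotheses (cc : is_cocone d c) (pK : inj K p).
Variables (u : hom (D bot) X0) (v : hom Y Y0).
Hypothesis uv : compm u p = compm (c bot I) v.

Definition extends j (w : forall i, strictly le i j -> option (hom (D i) X0)) (a : hom (D j) X0) :=
  [/\ forall i (lij : strictly le i j), w i lij = Some (compm (d (strictlyW lij)) a),
      compm a p = compm (c j I) v & compm (d (botP j)) a = u].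

(** [Fix] carries no invariant along the recursion, so a step may fail with [None]; [lift_at_exists]
    shows afterwards that this never happens. *)
Definition lift_step j (w : forall i, strictly le i j -> option (hom (D i) X0)) :
    option (hom (D j) X0) :=
  if pselect (exists a, extends w a) is left e then Some (sval (cid e)) else None.

Definition lift_at : forall j, option (hom (D j) X0) := Fix (strictly_wf wo) _ lift_step.

Lemma lift_atE j : lift_at j = lift_step (fun i (_ : strictly le i j) => lift_at i).
Proof.
apply: (Fix_eq (strictly_wf wo) (fun j => option (hom (D j) X0))) => x f g fg.
by congr lift_step; apply: functional_extensionality_dep => i;
  apply: functional_extensionality_dep => l.
Qed.

Let isval j (a : hom (D j) X0) := lift_at j = Some a /\ extends (fun i (_ : strictly le i j) => lift_at i) a.

Let d_id i (l : le i i) : d l = idm (D i). Proof. exact: df.1. Qed.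
Let d_comp i j k (lij : le i j) (ljk : le j k) (lik : le i k) : compm (d lij) (d ljk) = d lik.
Proof. exact: df.2. Qed.
Let le_irr i j (l l' : le i j) : l = l'. Proof. exact: Prop_irrelevance. Qed.

Let isval_compat i j (l : le i j) (a : hom (D i) X0) (b : hom (D j) X0) : isval a -> isval b -> compm (d l) b = a.
Proof.
move=> [ia _] [jb [H1 _ _]]; have [E|ne] := pselect (i = j).
  move: l a ia; rewrite E => l a; rewrite jb => -[->]; by rewrite d_id comp_idl.
have := H1 i (conj l ne); rewrite ia => -[->]; congr (compm (d _) b); exact: le_irr.
Qed.

(** Transfinite induction: at a successor the lifting property of [p] against an element of [K]
    passes through the pushout, at a limit the earlier lifts form a cocone. In both cases uniqueness
    in the universal property gives the compatibility with [v]. *)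
Lemma lift_at_exists j : exists a : hom (D j) X0, isval a.
Proof.
elim/(well_founded_ind (strictly_wf wo)): j => j IH.
suff [a ea] : exists a, extends (fun i (_ : strictly le i j) => lift_at i) a.
  rewrite /isval lift_atE /lift_step; case: pselect => [e|[]]; last by exists a.
  by case: cid => b eb /=; exists b.
pose a i (l : strictly le i j) := sval (cid (IH i l)).
have aP i l : isval (a i l) by rewrite /a; case: cid.
have acc : is_cocone d a.
  by move=> i i' l Pi Pi'; exact: isval_compat.
have [jb|jb] := pselect (j = bot).
  move: (botP j); rewrite /extends; rewrite jb => lb; exists u; split => //.
  - by move=> i [l ne]; case: ne; exact: wo_anti (botP i).
  - by rewrite d_id comp_idl.
have [[i sij]|ns] := pselect (exists i, is_successor le i j); last first.
  have [_ colim] := dlim jb (fun i si => ns (ex_intro _ i si)).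
  have [w [wE _]] := colim X0 a acc; exists w; split.
  - by move=> i l; rewrite (aP i l).1 wE.
  - have ccv : is_cocone d (fun i (l : strictly le i j) => compm (c i I) v).
      by move=> i i' l _ _; rewrite -comp_assoc (cc l I I).
    have [w' [_ w'u]] := colim Y0 _ ccv.
    rewrite -(w'u (compm w p)); last first.
      by move=> i l; rewrite -comp_assoc wE; have [_ []] := aP i l.
    by apply: w'u => i l; rewrite -comp_assoc cc.
  - have lb : strictly le bot j by split=> // E; apply: jb.
    have [_ [_ _ <-]] := aP bot lb; rewrite d_id comp_idl -wE; congr (compm (d _) w).
    exact: le_irr.
have [lij smin] := sij; set l := strictlyW lij.
have [A [B [k [f [g [Kk [sq po]]]]]]] := dsucc l sij.
have [iv [ai1 ai2 ai3]] := aP i lij; set ai := a i lij in iv ai1 ai2 ai3.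
have H1 : compm (compm f ai) p = compm k (compm g (compm (c j I) v)).
  by rewrite comp_assoc ai2 -(cc l I I) comp_assoc -(comp_assoc f) sq comp_assoc.
have [m [km mp]] := pK Kk H1.
have [w [[gw lw] _]] := po X0 m ai (esym km).
exists w; split.
- move=> i' l'; have li'i : le i' i.
    have [//|ii'] := wo_total wo i' i; have [->|ne] := pselect (i = i'); first exact: wo_refl.
    have [l1 n1] := l'; case: n1; apply: (wo_anti wo) => //.
    exact: smin (conj ii' ne).
  rewrite (aP i' l').1 -(isval_compat li'i (aP i' l') (aP i lij)) -/ai -lw -comp_assoc.
  by rewrite (d_comp _ _ (strictlyW l')).
- have H2 : compm f (compm (d l) (compm (c j I) v)) = compm k (compm g (compm (c j I) v)).
    by rewrite -comp_assoc sq comp_assoc.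
  have [w' [_ w'u]] := po Y0 _ _ H2.
  rewrite -(w'u (compm w p)); first by apply: w'u.
  by rewrite -!comp_assoc gw lw mp ai2 comp_assoc (cc l I I).
- by rewrite -ai3 -lw -comp_assoc (d_comp _ _ (botP j)).
Qed.

Lemma lift_colimit : is_colimit d c -> exists w, compm (c bot I) w = u /\ compm w p = v.
Proof.
move=> [_ colim]; pose a i (_ : True) := sval (cid (lift_at_exists i)).
have aP i t : isval (a i t) by rewrite /a; case: cid.
have acc : is_cocone d a by move=> i j l t t'; exact: isval_compat.
have [w [wE _]] := colim X0 a acc; exists w; split.
  by rewrite wE; have [_ [_ _ <-]] := aP bot I; rewrite d_id comp_idl.
have ccv : is_cocone d (fun i (t : True) => compm (c i t) v).
  by move=> i j l t t'; rewrite -comp_assoc (cc l t t').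
have [w' [_ w'u]] := colim Y0 _ ccv.
rewrite -(w'u (compm w p)); first exact: w'u.
by move=> i []; rewrite -comp_assoc wE; have [_ []] := aP i I.
Qed.

End Recursion.

Lemma cell_cof X Y (f : hom X Y) : cell K f -> cof K f.
Proof.
move=> [L [le [bot [D [d [c [e [[wo botP] df ds dl [cY [[e' [ee' e'e]] <-]]]]]]]]]] X0 Y0 p pK u v uv.
have uv' : compm (compm e' u) p = compm (c bot I) v.
  by rewrite comp_assoc uv !comp_assoc -comp_assoc e'e comp_idl.
have [w [cw wp]] := lift_colimit wo botP df ds dl cY.1 pK uv' cY.
by exists w; rewrite comp_assoc cw -comp_assoc ee' comp_idl.
Qed.

End CellCof.

Lemma ho_isomorphic_refl (R : realType) (h : bool) (F : flow R h) : ho_isomorphic F F.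
Proof. by exists (@zz_nil (FlowCat R h) _ F), (@zz_nil (FlowCat R h) _ F); split; exact: zz_refl. Qed.

(** A cellular [X] is q-cofibrant, so it may itself serve as [Z]; any other choice has a homotopy
    equivalent underlying space. *)
Lemma cellular_underlying_homotopy_type (R : realType) (h : bool) (X : mdspace R h) (T : space R h) :
  @cellular R h X ->
  underlying_homotopy_type (cat_flow X) T <-> homotopy_equivalent R (underlying X) T.
Proof.
move=> /cell_cof qX; split=> [[Z [qZ ZX ZT]]|XT]; last first.
  by exists X; split => //; exact: ho_isomorphic_refl.
apply: homotopy_equivalent_trans ZT; apply: homotopy_equivalent_sym.
exact: ho_isomorphic_homotopy_equivalent.
Qed.

Theorem corollary9p7 (R : realType) (h : bool) (X Y : mdspace R h)
    (f : mdmap X Y) (f_subdivision : globular_subdivision f) :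
  underlying_homotopy_type (cat_flow X) = underlying_homotopy_type (cat_flow Y).
Proof.
have [cX cY [g [cg fK gK]]] := f_subdivision; apply/funext => T; apply/propext.
have XY := @homeomorphic_equivalent R _ _ _ _ (@md_continuous _ _ _ _ f) cg fK gK.
rewrite !cellular_underlying_homotopy_type //; split; apply: homotopy_equivalent_trans => //.
exact: homotopy_equivalent_sym.
Qed.
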